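(* Let $q\in AM$, let $L=L(\varepsilon)$ be the operator in $L_2(-1,1)$ associated with the model problem $i\varepsilon^2z''+q(x)z=\lambda z$, $z(-1)=z(1)=0$, and let $\Omega$ be the domain bounded by the curves $\gamma_+$, $\gamma_-$ and the segment $[a,b]$. Then for every compact set $K\subset\Omega$ there are numbers $\tau>0$ and $\varepsilon_0>0$ such that $$\|(L-\lambda)^{-1}\|\ge e^{\tau/\varepsilon}\qquad\text{for all }\lambda\in K\text{ and }0<\varepsilon<\varepsilon_0 .$$ In particular, the Riesz constant $C(\varepsilon)$ of the system of normed eigenfunctions of $L(\varepsilon)$ grows exponentially: there is a number $\eta>0$ such that $C(\varepsilon)\ge e^{\eta/\varepsilon}$ (for all sufficiently small $\varepsilon$).
   Context: Class $AM$: a real-valued function $q$ on $[-1,1]$ belongs to $AM$ if $q$ is analytic on $[-1,1]$ and admits an analytic continuation to a domain $G\subset\mathbb C$ (containing $[-1,1]$) such that $q(G)$ contains the semistrip $\Pi=\{\lambda\in\mathbb C: a<\operatorname{Re}\lambda<b,\ \operatorname{Im}\lambda<0\}$, where $a=q(-1)$, $b=q(1)$; moreover, with $D=q^{-1}(\Pi)\subset G$, $q$ is continuous on the closure $\overline D$ and the map $q:\overline D\to\overline\Pi$ is one-to-one (and onto). For $\lambda\in\overline\Pi$ let $\xi_\lambda\in\overline D$ be the root of $q(\xi)-\lambda=0$, and put $Q^\pm(\lambda)=\int_{\xi_\lambda}^{\pm1}\sqrt{i(q(\xi)-\lambda)}\,d\xi$, where for $\lambda\in\Pi$ the root with positive imaginary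 part is taken and the path lies in $\overline D$ and meets $q^{-1}(\{\lambda-it:t\ge0\})$ only at $\xi_\lambda$; values on the boundary of $\Pi$ are obtained by continuity. $Q^\pm$ are analytic in $\Pi$ and continuous in $\overline\Pi$. For $q\in AM$ the curves $\tilde\gamma_\pm=\{\lambda\in\Pi:\operatorname{Re}Q^\pm(\lambda)=0\}$ have a unique intersection point $\lambda_0\in\Pi$; $\gamma_+$ is the part of $\tilde\gamma_+$ connecting $\lambda_0$ with $b$, and $\gamma_-$ is the part of $\tilde\gamma_-$ connecting $\lambda_0$ with $a$. $L(\varepsilon)$ acts by $Lz=i\varepsilon^2z''+qz$ on the domain $\{z\in W_2^2[-1,1]: z(\pm1)=0\}$, $\varepsilon>0$; we set $\|(L-\lambda)^{-1}\|=\infty$ if $\lambda$ is in the spectrum. Riesz constant: let $z_k=z_k(x,\varepsilon)$, $k\ge1$, be the eigenfunctions of $L(\varepsilon)$ normed to have norm $1$ in $L_2(-1,1)$ (it is assumed for simplicity that there are no associated functions for the values of $\varepsilon$ considered; they appear only for some discrete values $\varepsilon_j\to0$). The system $\{z_k\}_{k=1}^\infty$ is a Riesz basis of $L_2(-1,1)$, so the Gram matrix $\{(z_k,z_j)\}_{k,j=1}^\infty$ generates a bounded and boundedly invertible operator $T$ in $\ell_2$, and $C(\varepsilon)=\|T\|\cdot\|T^{-1}\|$. *)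

(* Defs.v *)
From HB Require Import structures.
From mathcomp Require Import all_boot all_order all_algebra.
From mathcomp Require Import complex.
From mathcomp Require Import all_classical all_reals all_analysis.

Set Implicit Arguments.
Unset Strict Implicit.
Unset Printing Implicit Defensive.

Import Order.TTheory GRing.Theory Num.Theory.
Import numFieldNormedType.Exports.
Local Open Scope classical_set_scope.
Local Open Scope ring_scope.

(* R[i] is given its usual topology and norm, as
   a one-dimensional normed space over itself; hence [derivable f z 1] is
   complex differentiability of f : R[i] -> R[i] at z. *)
HB.instance Definition _ (R : realType) := NormedModule.copy R[i] (R[i]^o).

Local Notation mu := (@lebesgue_measure _).

Definition cintegrable {R : realType} (A : set R) (f : R -> R[i]) : Prop :=
  mu.-integrable A (EFin \o (fun x => complex.Re (f x))) /\
  mu.-integrable A (EFin \o (fun x => complex.Im (f x))).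

Definition cintegral {R : realType} (A : set R) (f : R -> R[i]) : R[i] :=
  Complex (Rintegral mu A (fun x => complex.Re (f x)))
          (Rintegral mu A (fun x => complex.Im (f x))).

Definition normsq {R : realType} (w : R[i]) : R :=
  complex.Re w ^+ 2 + complex.Im w ^+ 2.

Section ClassAM.
Context {R : realType}.
Implicit Types (q : R -> R) (G : set R[i]) (f : R[i] -> R[i]).

Definition semistrip q : set R[i] :=
  [set l | q (- 1) < complex.Re l < q 1 /\ complex.Im l < 0].

Definition preim_strip q G f : set R[i] := G `&` f @^-1` semistrip q.

(* q belongs to the class AM iff [AM_ext q G f] for some G and f. The map f
   stands for the analytic continuation of q to G; its values at the points of
   the closure of [preim_strip q G f] that are outside G are the extension of q
   by continuity. Analyticity of q on [-1, 1] follows from [AM_holo]. *)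
Record AM_ext q G f : Prop := MkAMExt {
  AM_open : open G;
  AM_connected : connected G;
  AM_interval : forall x : R, -1 <= x <= 1 -> G (x%:C)%C;
  AM_extends : forall x : R, -1 <= x <= 1 -> f (x%:C)%C = ((q x)%:C)%C;
  AM_holo : forall z, G z -> derivable f z 1;
  AM_nondegenerate : q (- 1) < q 1;
  AM_covers : semistrip q `<=` f @` G;
  AM_continuous : {within closure (preim_strip q G f), continuous f};
  AM_bijective :
    set_bij (closure (preim_strip q G f)) (closure (semistrip q)) f }.

Definition xi q G f (l : R[i]) : R[i] :=
  xget 0 [set x | closure (preim_strip q G f) x /\ f x = l].

(* p is an absolutely continuous path on [0, 1] with velocity p' (every
   rectifiable curve has such a parametrization). *)
Definition ac_path (p p' : R -> R[i]) : Prop :=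
  cintegrable `[0, 1] p' /\
  forall t : R, 0 <= t <= 1 -> p t = p 0 + cintegral `[0, t] p'.

Definition down_ray (l : R[i]) : set R[i] :=
  [set m | exists2 t : R, 0 <= t & m = l - 'i%C * (t%:C)%C].

Definition admissible_path q G f (l e : R[i]) (p p' : R -> R[i]) : Prop :=
  [/\ ac_path p p', p 0 = xi q G f l, p 1 = e,
      forall t : R, 0 <= t <= 1 -> closure (preim_strip q G f) (p t) &
      forall t : R, 0 <= t <= 1 -> down_ray l (f (p t)) -> p t = xi q G f l].

(* [phase q G f e l] is the integral of sqrt (i (q - l)) from xi_l to e: it is
   Q^+(l) for e = 1 and Q^-(l) for e = -1, where l lies in the semistrip. The
   value of [sqrtC] has nonnegative imaginary part, and positive imaginary part
   when its argument is not in [0, +oo[, which is the case here exactly when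
   the path is off the preimage of [down_ray l]. The integral does not depend
   on the path. *)
Definition phase q G f (e l : R[i]) : R[i] :=
  xget 0 [set v | exists p p', admissible_path q G f l e p p' /\
    v = cintegral `[0, 1] (fun t => sqrtC ('i%C * (f (p t) - l)) * p' t)].

Definition critical_curve q G f (e : R[i]) : set R[i] :=
  [set l | semistrip q l /\ complex.Re (phase q G f e l) = 0].

(* A is the part of the curve S that connects x to y, both endpoints being
   included in A; y need not be a point of S itself. *)
Definition connecting_part (S : set R[i]) (x y : R[i]) (A : set R[i]) : Prop :=
  exists p : R -> R[i],
    [/\ {within `[0, 1], continuous p}, set_inj `[0, 1] p,
        p 0 = x /\ p 1 = y, p @` `[0, 1[ `<=` S & A = p @` `[0, 1]].

(* The union of the bounded components of the complement of J; when J is a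
   Jordan curve, this is the domain bounded by J. *)
Definition domain_bounded_by (J : set R[i]) : set R[i] :=
  [set z | ~ J z /\ bounded_set (connected_component (~` J) z)].

Definition real_segment (a b : R) : set R[i] :=
  [set (t%:C)%C | t in (`[a, b] : set R)].

End ClassAM.

Section Operator.
Context {R : realType}.
Implicit Types (q : R -> R) (eps : R) (lam : R[i]).

Definition L2fun (u : R -> R[i]) : Prop :=
  [/\ measurable_fun (`[-1, 1] : set R) (fun x => complex.Re (u x)),
      measurable_fun (`[-1, 1] : set R) (fun x => complex.Im (u x)) &
      mu.-integrable `[-1, 1] (EFin \o (fun x => normsq (u x)))].

Definition L2norm (u : R -> R[i]) : R :=
  Num.sqrt (Rintegral mu `[-1, 1] (fun x => normsq (u x))).

Definition L2dot (u v : R -> R[i]) : R[i] :=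
  cintegral `[-1, 1] (fun x => u x * (v x)^*%C).

Definition vanishes (u : R -> R[i]) : Prop :=
  forall x : R, -1 <= x <= 1 -> u x = 0.

(* z is in W_2^2[-1, 1] with second derivative z2: z has on [-1, 1] an
   absolutely continuous derivative z1, whose derivative z2 is in L_2. *)
Definition W22 (z z2 : R -> R[i]) : Prop :=
  L2fun z2 /\ exists z1 : R -> R[i], forall x : R, -1 <= x <= 1 ->
    z1 x = z1 (-1) + cintegral `[-1, x] z2 /\
    z x = z (-1) + cintegral `[-1, x] z1.

(* z is in the domain of L(eps) and L(eps) z = g in L_2(-1, 1). *)
Definition op_graph q eps (z g : R -> R[i]) : Prop :=
  [/\ z (-1) = 0, z 1 = 0, L2fun g &
      exists2 z2, W22 z z2 &
        {ae mu, forall x : R, -1 <= x <= 1 ->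
          g x = 'i%C * ((eps ^+ 2)%:C)%C * z2 x + ((q x)%:C)%C * z x}].

(* (L(eps) - lam) z = g *)
Definition op_shift q eps lam (z g : R -> R[i]) : Prop :=
  op_graph q eps z (fun x => g x + lam * z x).

(* The norm, possibly infinite, of the operator with graph A. *)
Definition opnorm (V W : Type) (nV : V -> R) (nW : W -> R)
    (A : V -> W -> Prop) : \bar R :=
  ereal_sup [set y | exists v w, [/\ A v w, nV v <= 1 & y = (nW w)%:E]].

Definition in_resolvent_set q eps lam : Prop :=
  [/\ forall g, L2fun g -> exists z, op_shift q eps lam z g,
      forall z, op_shift q eps lam z (fun=> 0) -> vanishes z &
      exists M : R, forall z g, L2fun g -> op_shift q eps lam z g ->
        L2norm z <= M * L2norm g].

Definition resolvent_norm q eps lam : \bar R :=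
  if `[< in_resolvent_set q eps lam >] then
    opnorm L2norm L2norm (fun g z => L2fun g /\ op_shift q eps lam z g)
  else +oo%E.

(* There is no w with (L - lam) w = z for an eigenfunction z at lam. *)
Definition no_associated q eps : Prop :=
  forall lam (z w : R -> R[i]),
    op_shift q eps lam z (fun=> 0) -> op_shift q eps lam w z -> vanishes z.

(* All normed eigenfunctions, one for each eigenvalue: the eigenspaces of a
   second order operator with Dirichlet conditions are one-dimensional. *)
Definition normed_eigensystem q eps (z : nat -> R -> R[i]) : Prop :=
  exists l : nat -> R[i],
    [/\ injective l,
        forall k, op_shift q eps (l k) (z k) (fun=> 0) /\ L2norm (z k) = 1 &
        forall lam u, op_shift q eps lam u (fun=> 0) -> ~ vanishes u ->
          exists k, lam = l k].

Definition in_l2 (c : nat -> R[i]) : Prop :=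
  cvgn (series (fun k => normsq (c k))).

Definition l2norm (c : nat -> R[i]) : R :=
  Num.sqrt (limn (series (fun k => normsq (c k)))).

(* d = T c, where T is the operator in l_2 generated by the Gram matrix
   ((z_k, z_j))_{k,j}. *)
Definition gram_graph (z : nat -> R -> R[i]) (c d : nat -> R[i]) : Prop :=
  [/\ in_l2 c, in_l2 d &
      forall k, series (fun j => L2dot (z k) (z j) * c j) @ \oo --> d k].

(* ||T|| * ||T^-1|| *)
Definition riesz_constant (z : nat -> R -> R[i]) : \bar R :=
  (opnorm l2norm l2norm (gram_graph z) *
   opnorm l2norm l2norm (fun d c => gram_graph z c d))%E.

End Operator.

(* Main.v *)
(** Both parts rest on one construction. On a complex neighbourhood of [-1, 1]
    the potential V = i (q - lam) has a holomorphic square root, and about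
    1 / eps steps of the iteration P -> sqrt (V + eps P') produce P such that
    P^2 - eps P' = V up to an exponentially small error. Then
    u = exp (- (1 / eps) \int P) nearly solves (L - lam) u = 0, and since Re P
    changes sign from -1 to 1 as q - Re lam does, u is exponentially small at
    both ends compared with its maximum: corrected by a linear function, it is
    an exponentially good quasi-mode with Dirichlet conditions. This works
    locally uniformly for lam in the whole semistrip, which contains Omega
    because a vertical or horizontal ray leads from every point outside it to
    infinity.

    If the Riesz constant is C, then the norm of (L - lam)^-1 is at most
    C / dist (lam, spectrum). By Schur's inequality for (L - i)^-1 the sum of
    1 / |l_k - i|^2 is O(eps^-2), so that some lam on a fixed segment of the
    semistrip has distance at least const * eps^2 to the spectrum, and the
    quasi-mode at this lam bounds C from below. The upper bound for the
    resolvent needs the completeness of the eigenfunctions: on the functions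
    orthogonal to the conjugates of the first n of them, the resolvent extends
    holomorphically to a large rectangle containing i, on whose boundary it is
    small, by energy estimates on three sides and by comparison with
    w'' + k^2 w, |sin 2k| = 1, on the lower one; the maximum principle makes it
    small at i. *)

Require Import Defs.
From HB Require Import structures.
From mathcomp Require Import all_boot all_order all_algebra.
From mathcomp Require Import complex.
From mathcomp Require Import all_classical all_reals all_analysis.
From mathcomp Require Import ring lra measurable_realfun.
Import Order.TTheory GRing.Theory Num.Theory.
Import numFieldNormedType.Exports.
Local Open Scope classical_set_scope.
Local Open Scope ring_scope.
Set Implicit Arguments.
Unset Strict Implicit.
Unset Printing Implicit Defensive.

(** Each step of the iteration takes a derivative, and Cauchy's estimate pays for it with a part of
    the complex neighbourhood. A width [h] of order eps per step is enough to halve the difference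
    of consecutive iterates; a fixed neighbourhood then allows about 1 / eps steps, and the error
    decays like 2 to the power - c / eps. Analyticity of q enters here, and for this Cauchy's theory
    is built up from rectangles. In the second part little is known in advance about the
    eigenfunctions. L is symmetric for the bilinear form without conjugation, so the eigenfunctions
    are, up to conjugation, also those of the adjoint operator, and the duality arguments use this
    form. The norms of the Gram operator and of its inverse give inequalities for finite
    combinations only, so that completeness has to be proved before they say anything about the
    resolvent. The exponent [eta = tau / 2] leaves a factor exp (eta / eps) to beat the eps^2 in the
    distance to the spectrum. *)

Local Notation re := complex.Re.
Local Notation im := complex.Im.
(* The modulus with values in R; [`|z|] is in R[i]. *)
Local Notation nc := ComplexField.Normc.normc.
Local Notation ofr := (real_complex _).
Local Notation mu := (@lebesgue_measure _).

Tactic Notation "lra_on" ne_hyp_list(H) := revert H; clear; intros; lra.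
Tactic Notation "nra_on" ne_hyp_list(H) := revert H; clear; intros; nra.

(** * Complex numbers, continuity and derivatives *)

Section ComplexModulus.
Context {R : realType}.
Implicit Types (x y z w : R[i]) (a b e : R).

Lemma reD x y : re (x + y) = re x + re y. Proof. by case: x; case: y. Qed.
Lemma imD x y : im (x + y) = im x + im y. Proof. by case: x; case: y. Qed.
Lemma reN x : re (- x) = - re x. Proof. by case: x. Qed.
Lemma imN x : im (- x) = - im x. Proof. by case: x. Qed.
Lemma reM x y : re (x * y) = re x * re y - im x * im y.
Proof. by case: x; case: y. Qed.
Lemma imM x y : im (x * y) = re x * im y + im x * re y.
Proof. by case: x; case: y. Qed.
Lemma re_ofr a : re (ofr a) = a. Proof. by []. Qed.
Lemma im_ofr a : im (ofr a) = 0. Proof. by []. Qed.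
Lemma re_conj x : re (x^*)%C = re x. Proof. by case: x. Qed.
Lemma im_conj x : im (x^*)%C = - im x. Proof. by case: x. Qed.
Lemma re_i : re ('i%C : R[i]) = 0. Proof. by []. Qed.
Lemma im_i : im ('i%C : R[i]) = 1. Proof. by []. Qed.
Lemma reC a b : re (Complex a b) = a. Proof. by []. Qed.
Lemma imC a b : im (Complex a b) = b. Proof. by []. Qed.
Lemma re0 : re (0 : R[i]) = 0. Proof. by []. Qed.
Lemma im0 : im (0 : R[i]) = 0. Proof. by []. Qed.
Lemma re1 : re (1 : R[i]) = 1. Proof. by []. Qed.
Lemma im1 : im (1 : R[i]) = 0. Proof. by []. Qed.
Definition reimE := (reD, imD, reN, imN, reM, imM, re_conj, im_conj,
  re_i, im_i, re1, im1, re0, im0).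
Definition reimCE := (reimE, re_ofr, im_ofr, reC, imC).

Lemma complex_ext x y : re x = re y -> im x = im y -> x = y.
Proof. by case: x => ? ?; case: y => ? ? /= -> ->. Qed.

Lemma ncE x : nc x = Num.sqrt (re x ^+ 2 + im x ^+ 2).
Proof. by case: x. Qed.
Lemma sqr_nc x : nc x ^+ 2 = re x ^+ 2 + im x ^+ 2.
Proof. by rewrite ncE sqr_sqrtr // addr_ge0 ?sqr_ge0. Qed.
Lemma normsq_nc x : normsq x = nc x ^+ 2. Proof. by rewrite sqr_nc. Qed.
Lemma nc_ge0 x : 0 <= nc x. Proof. by rewrite ncE sqrtr_ge0. Qed.
Lemma nc0 : nc (0 : R[i]) = 0. Proof. exact: ComplexField.Normc.normc0. Qed.
Lemma nc1 : nc (1 : R[i]) = 1. Proof. exact: ComplexField.Normc.normc1. Qed.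
Lemma ncM x y : nc (x * y) = nc x * nc y.
Proof. exact: ComplexField.Normc.normcM. Qed.
Lemma ncV x : nc x^-1 = (nc x)^-1.
Proof. exact: ComplexField.Normc.normcV. Qed.
Lemma ncX x n : nc (x ^+ n) = nc x ^+ n.
Proof. by elim: n => [|n IH]; rewrite ?expr0 ?nc1 // !exprS ncM IH. Qed.
Lemma ncN x : nc (- x) = nc x. Proof. exact: normcN. Qed.
Lemma ncD x y : nc (x + y) <= nc x + nc y. Proof. exact: le_normcD. Qed.
Lemma ncB x y : nc (x - y) <= nc x + nc y.
Proof. by rewrite -(ncN y) ncD. Qed.
Lemma ncBC x y : nc (x - y) = nc (y - x). Proof. by rewrite -ncN opprB. Qed.
Lemma nc_tri x y z : nc (x - z) <= nc (x - y) + nc (y - z).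
Proof. by apply: le_trans (ncD _ _); rewrite addrA subrK. Qed.
Lemma nc_eq0 x : (nc x == 0) = (x == 0).
Proof.
by apply/eqP/eqP => [|->]; [exact: ComplexField.Normc.eq0_normc|exact: nc0].
Qed.
Lemma nc_gt0 x : (0 < nc x) = (x != 0).
Proof. by rewrite lt_def nc_ge0 andbT nc_eq0. Qed.
Lemma nc_conj x : nc (x^*)%C = nc x.
Proof. by rewrite !ncE re_conj im_conj sqrrN. Qed.
Lemma nc_ofr a : nc (ofr a) = `|a|.
Proof. by rewrite ncE re_ofr im_ofr expr0n addr0 sqrtr_sqr. Qed.
Lemma nc_i : nc ('i%C : R[i]) = 1.
Proof. by rewrite ncE re_i im_i expr0n expr1n add0r sqrtr1. Qed.
Lemma re_le_nc x : `|re x| <= nc x.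
Proof. by rewrite ncE -sqrtr_sqr ler_sqrt ?lerDl ?sqr_ge0 // addr_ge0 ?sqr_ge0. Qed.
Lemma im_le_nc x : `|im x| <= nc x.
Proof. by rewrite ncE -sqrtr_sqr ler_sqrt ?lerDr ?sqr_ge0 // addr_ge0 ?sqr_ge0. Qed.
Lemma nc_le_reim x : nc x <= `|re x| + `|im x|.
Proof.
rewrite -ler_sqr ?nnegrE ?nc_ge0 ?addr_ge0 //.
rewrite sqr_nc. rewrite sqrrD !real_normK ?num_real // addrAC lerDl.
by rewrite mulrn_wge0 // mulr_ge0.
Qed.
Lemma nc_sub_le x y : nc x - nc y <= nc (x - y).
Proof. by rewrite lerBlDr; have := ncD (x - y) y; rewrite subrK. Qed.
Lemma nc_norm_sub x y : `|nc x - nc y| <= nc (x - y).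
Proof. by rewrite ler_norml nc_sub_le andbT lerNl opprB ncBC nc_sub_le. Qed.
Lemma normr_nc x : `|x| = ofr (nc x). Proof. by rewrite normc_def ncE. Qed.
Lemma mul_conj x : x * (x^*)%C = ofr (nc x ^+ 2).
Proof.
by apply: complex_ext; rewrite !reimE ?re_ofr ?im_ofr ?sqr_nc; ring.
Qed.
Lemma ofr_eq0 a : (ofr a == 0 :> R[i]) = (a == 0).
Proof. by rewrite eq_complex /= eqxx andbT. Qed.
Lemma neq0i : ('i%C : R[i]) != 0.
Proof. by rewrite eq_complex /= oner_eq0 andbF. Qed.
Lemma mulii : 'i%C * 'i%C = -1 :> R[i]. Proof. by rewrite -expr2 sqr_i. Qed.
End ComplexModulus.

Section Derivatives.
Context {R : realType}.
Implicit Types (e d : R).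

(* [j] embeds the domain in the plane: it is [id] for functions of a complex
   variable and [real_complex] for functions of a real variable. *)
Definition ccont (T : Type) (j : T -> R[i]) (f : T -> R[i]) (x : T) : Prop :=
  forall e, 0 < e -> exists2 d, 0 < d &
    forall y, nc (j y - j x) < d -> nc (f y - f x) <= e.

(** The error is compared with the increment instead of being divided by it: [y = x] is no
    exception, and one product rule and one chain rule serve real and complex variables alike. *)
Definition hasd (T : Type) (j : T -> R[i]) (f : T -> R[i]) (x : T) (D : R[i])
    : Prop :=
  forall e, 0 < e -> exists2 d, 0 < d &
    forall y, nc (j y - j x) < d ->
      nc (f y - f x - D * (j y - j x)) <= e * nc (j y - j x).

Section Generic.
Variables (T : Type) (j : T -> R[i]).
Implicit Types (f g : T -> R[i]) (x y : T).

Lemma hasd_cont f x D : hasd j f x D -> ccont j f x.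
Proof.
move=> h e e0; have [d d0 H] := h 1 ltr01.
have M0 : 0 < nc D + 1 by rewrite ltr_wpDl ?nc_ge0.
exists (Num.min d (e / (nc D + 1))); first by rewrite lt_min d0 divr_gt0.
move=> y; rewrite lt_min => /andP[yd ye].
have := H y yd; rewrite mul1r => H1.
have -> : f y - f x = (f y - f x - D * (j y - j x)) + D * (j y - j x) by rewrite subrK.
apply: le_trans (ncD _ _) _; rewrite ncM.
move: ye; rewrite ltr_pdivlMr // => ye.
apply: le_trans (ltW ye); set r := nc (j y - j x) in H1 *.
by rewrite [leRHS](_ : _ = r + nc D * r) ?lerD2r //; ring.
Qed.

Lemma ccont_bnd f x : ccont j f x ->
  exists2 d, 0 < d & forall y, nc (j y - j x) < d -> nc (f y) <= nc (f x) + 1.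
Proof.
move=> /(_ 1 ltr01)[d d0 H]; exists d => // y /H h.
by rewrite -lerBlDl; apply: le_trans h; exact: nc_sub_le.
Qed.

Lemma ccont_cst c x : ccont j (fun=> c) x.
Proof. by move=> e e0; exists 1 => // y _; rewrite subrr nc0 ltW. Qed.

Lemma ccont_j x : ccont j j x.
Proof. by move=> e e0; exists e => // y /ltW. Qed.

Lemma ccontD f g x : ccont j f x -> ccont j g x -> ccont j (fun y => f y + g y) x.
Proof.
move=> hf hg e e0; have e2 : 0 < e / 2 by rewrite divr_gt0.
have [d1 d10 H1] := hf _ e2; have [d2 d20 H2] := hg _ e2.
exists (Num.min d1 d2); first by rewrite lt_min d10.
move=> y; rewrite lt_min => /andP[/H1 h1 /H2 h2].
rewrite opprD addrACA; apply: le_trans (ncD _ _) _.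
by rewrite [leRHS]splitr lerD.
Qed.

Lemma ccontN f x : ccont j f x -> ccont j (fun y => - f y) x.
Proof.
move=> hf e e0; have [d d0 H] := hf _ e0.
by exists d => // y /H; rewrite -opprD ncN.
Qed.

Lemma ccontB f g x : ccont j f x -> ccont j g x -> ccont j (fun y => f y - g y) x.
Proof. by move=> hf hg; apply: ccontD => //; exact: ccontN. Qed.

Lemma ccontM f g x : ccont j f x -> ccont j g x -> ccont j (fun y => f y * g y) x.
Proof.
move=> hf hg e e0; have [d0 d00 H0] := ccont_bnd hg.
set M := nc (g x) + 1 + nc (f x) + 1.
have M0 : 0 < M by rewrite /M ltr_wpDl // !addr_ge0 ?nc_ge0.
have e2 : 0 < e / 2 / M by rewrite !divr_gt0.
have [d1 d10 H1] := hf _ e2; have [d2 d20 H2] := hg _ e2.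
exists (Num.min d0 (Num.min d1 d2)); first by rewrite !lt_min d00 d10.
move=> y; rewrite !lt_min => /andP[/H0 h0 /andP[/H1 h1 /H2 h2]].
have -> : f y * g y - f x * g x = (f y - f x) * g y + f x * (g y - g x) by ring.
apply: le_trans (ncD _ _) _; rewrite !ncM [leRHS]splitr.
have -> : e / 2 = e / 2 / M * M by rewrite divfK ?gt_eqF.
have m1 : nc (g x) + 1 <= M by rewrite /M -addrA lerDl addr_ge0 ?nc_ge0.
have m2 : nc (f x) <= M.
  by rewrite /M -[X in X <= _]add0r -addrA lerD ?lerDl // addr_ge0 ?nc_ge0.
apply: lerD; first by apply: ler_pM; rewrite ?nc_ge0 //; apply: le_trans m1.
by rewrite mulrC; apply: ler_pM; rewrite ?nc_ge0.
Qed.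

Lemma ccont_conj f x : ccont j f x -> ccont j (fun y => (f y)^*%C) x.
Proof.
move=> hf e e0; have [d d0 H] := hf _ e0.
by exists d => // y /H; rewrite -rmorphB nc_conj.
Qed.

Lemma ccont_near f g x d : 0 < d -> (forall y, nc (j y - j x) < d -> f y = g y) ->
  ccont j f x -> ccont j g x.
Proof.
move=> d0 fg hf e e0; have [d1 d10 H] := hf _ e0.
exists (Num.min d d1); first by rewrite lt_min d0.
move=> y; rewrite lt_min => /andP[yd /H]; rewrite !fg //.
by rewrite subrr nc0.
Qed.

Lemma hasd_near f g x D d : 0 < d -> (forall y, nc (j y - j x) < d -> f y = g y) ->
  hasd j f x D -> hasd j g x D.
Proof.
move=> d0 fg hf e e0; have [d1 d10 H] := hf _ e0.
exists (Num.min d d1); first by rewrite lt_min d0.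
move=> y; rewrite lt_min => /andP[yd /H]; rewrite !fg //.
by rewrite subrr nc0.
Qed.

Lemma hasd_cst c x : hasd j (fun=> c) x 0.
Proof.
move=> e e0; exists 1 => // y _; rewrite subrr mul0r subrr nc0.
by rewrite mulr_ge0 ?nc_ge0 // ltW.
Qed.

Lemma hasd_j x : hasd j j x 1.
Proof.
move=> e e0; exists 1 => // y _; rewrite mul1r subrr nc0.
by rewrite mulr_ge0 ?nc_ge0 // ltW.
Qed.

Lemma hasdD f g x D E : hasd j f x D -> hasd j g x E ->
  hasd j (fun y => f y + g y) x (D + E).
Proof.
move=> hf hg e e0; have e2 : 0 < e / 2 by rewrite divr_gt0.
have [d1 d10 H1] := hf _ e2; have [d2 d20 H2] := hg _ e2.
exists (Num.min d1 d2); first by rewrite lt_min d10.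
move=> y; rewrite lt_min => /andP[/H1 h1 /H2 h2].
have -> : f y + g y - (f x + g x) - (D + E) * (j y - j x) =
  (f y - f x - D * (j y - j x)) + (g y - g x - E * (j y - j x)) by ring.
apply: le_trans (ncD _ _) _.
by rewrite [e in leRHS]splitr mulrDl lerD.
Qed.

Lemma hasdM f g x D E : hasd j f x D -> hasd j g x E ->
  hasd j (fun y => f y * g y) x (D * g x + f x * E).
Proof.
move=> hf hg e e0; have [d0 d00 H0] := ccont_bnd (hasd_cont hg).
have e3 : 0 < e / 3 by rewrite divr_gt0.
set M := nc (g x) + 1 + nc (f x) + nc D + 1.
have M1 : 1 <= M by rewrite /M lerDr !addr_ge0 ?nc_ge0.
have M0 : 0 < M by exact: lt_le_trans M1.
have e2 : 0 < e / 3 / M by rewrite divr_gt0.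
have [d1 d10 H1] := hf _ e2; have [d2 d20 H2] := hg _ e2.
have [d3 d30 H3] := hasd_cont hg e2.
exists (Num.min (Num.min d0 d3) (Num.min d1 d2)); first by rewrite !lt_min d00 d10 d30.
move=> y; rewrite !lt_min => /andP[/andP[/H0 h0 /H3 h3] /andP[/H1 h1 /H2 h2]].
have -> : f y * g y - f x * g x - (D * g x + f x * E) * (j y - j x) =
  (f y - f x - D * (j y - j x)) * g y + f x * (g y - g x - E * (j y - j x))
  + D * (j y - j x) * (g y - g x) by ring.
set r := nc (j y - j x) in h1 h2 *.
have r0 : 0 <= r by exact: nc_ge0.
apply: le_trans (ncD _ _) _; apply: le_trans (lerD (ncD _ _) (lexx _)) _.
rewrite !ncM -/r.
have -> : e * r = e / 3 / M * r * M + M * (e / 3 / M * r) + M * r * (e / 3 / M).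
  by field; rewrite gt_eqF.
have [n1 n2 n3] := And3 (nc_ge0 (f x)) (nc_ge0 (g x)) (nc_ge0 D).
have [m1 m2 m3] : [/\ nc (g x) + 1 <= M, nc (f x) <= M & nc D <= M].
  by split; rewrite /M; lra.
apply: lerD; [apply: lerD|].
- by apply: ler_pM; rewrite ?nc_ge0 //; apply: le_trans m1.
- by apply: ler_pM; rewrite ?nc_ge0.
- by apply: ler_pM; rewrite ?mulr_ge0 ?nc_ge0 // ler_wpM2r.
Qed.

Lemma hasdZ c f x D : hasd j f x D -> hasd j (fun y => c * f y) x (c * D).
Proof.
move=> h; have := hasdM (hasd_cst c x) h.
by rewrite mul0r add0r.
Qed.

Lemma hasdN f x D : hasd j f x D -> hasd j (fun y => - f y) x (- D).
Proof.
move=> hf e e0; have [d d0 H] := hf _ e0; exists d => // y /H.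
by rewrite mulNr -!opprD ncN.
Qed.

Lemma hasdB f g x D E : hasd j f x D -> hasd j g x E ->
  hasd j (fun y => f y - g y) x (D - E).
Proof. by move=> hf hg; apply: hasdD => //; exact: hasdN. Qed.

Lemma ccont_comp f (g : R[i] -> R[i]) x : ccont j f x -> ccont id g (f x) ->
  ccont j (fun y => g (f y)) x.
Proof.
move=> hf hg e e0; have [d d0 H] := hg _ e0.
have d2 : 0 < d / 2 by rewrite divr_gt0.
have [d1 d10 H1] := hf _ d2; exists d1 => // y /H1 h1; apply: H => /=.
by apply: le_lt_trans h1 _; rewrite ltr_pdivrMr // ltr_pMr // ltr1n.
Qed.

Lemma hasd_comp f (g : R[i] -> R[i]) x D E : hasd j f x D -> hasd id g (f x) E ->
  hasd j (fun y => g (f y)) x (E * D).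
Proof.
move=> hf hg e e0.
set M := nc D + 1 + nc E + 1.
have M1 : 1 <= M by rewrite /M lerDr !addr_ge0 ?nc_ge0.
have M0 : 0 < M by exact: lt_le_trans M1.
have e2 : 0 < e / 2 / M by rewrite !divr_gt0.
have [d1 d10 H1] := hg _ e2; have d12 : 0 < d1 / 2 by rewrite divr_gt0.
have [d2 d20 H2] := hasd_cont hf d12.
have [d3 d30 H3] := hf _ e2; have [d4 d40 H4] := hf _ ltr01.
exists (Num.min d2 (Num.min d3 d4)); first by rewrite !lt_min d20 d30.
move=> y; rewrite !lt_min => /andP[/H2 h2 /andP[/H3 h3 /H4 h4]].
have h2' : nc (f y - f x) < d1.
  by apply: le_lt_trans h2 _; rewrite ltr_pdivrMr // ltr_pMr // ltr1n.
have := H1 _ h2' => /=; set r := nc (j y - j x) in h3 h4 *.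
have r0 : 0 <= r by exact: nc_ge0.
move=> h1.
have -> : g (f y) - g (f x) - E * D * (j y - j x) =
  (g (f y) - g (f x) - E * (f y - f x)) + E * (f y - f x - D * (j y - j x)) by ring.
have h5 : nc (f y - f x) <= M * r.
  have -> : f y - f x = (f y - f x - D * (j y - j x)) + D * (j y - j x) by rewrite subrK.
  apply: le_trans (ncD _ _) _; rewrite ncM -/r.
  apply: le_trans (lerD h4 (lexx _)) _; rewrite -mulrDl ler_wpM2r //.
  by rewrite /M; have := nc_ge0 E; lra.
apply: le_trans (ncD _ _) _; rewrite ncM [e in leRHS]splitr mulrDl.
have -> : e / 2 * r = e / 2 / M * (M * r) by rewrite mulrA divfK ?gt_eqF.
apply: lerD; first by apply: le_trans h1 _; rewrite ler_wpM2l // ltW.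
apply: le_trans (ler_wpM2l (nc_ge0 _) h3) _.
rewrite mulrCA ler_wpM2l ?(ltW e2) // ler_wpM2r // /M.
by have := nc_ge0 D; lra.
Qed.

Lemma ccont_inv f x : f x != 0 -> ccont j f x -> ccont j (fun y => (f y)^-1) x.
Proof.
move=> fx0 hf; apply: (ccont_comp hf).
move=> e e0; set r := nc (f x); have r0 : 0 < r by rewrite nc_gt0.
exists (Num.min (r / 2) (e * r * r / 2)).
  by rewrite lt_min !divr_gt0 // !mulr_gt0.
move=> w; rewrite lt_min => /andP[/= w1 w2].
have wr : r / 2 <= nc w.
  by have := nc_sub_le (f x) w; rewrite ncBC -/r; lra.
have w0 : w != 0 by rewrite -nc_gt0; apply: lt_le_trans wr; rewrite divr_gt0.
have -> : w^-1 - (f x)^-1 = (f x - w) * (w * f x)^-1 by field; apply/andP.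
rewrite ncM ncV ncM ler_pdivrMr ?mulr_gt0 ?nc_gt0 // ncBC -/r.
apply: le_trans (ltW w2) _.
have -> : e * r * r / 2 = e * (r / 2 * r) by field.
by rewrite ler_wpM2l ?(ltW e0) // ler_wpM2r // ltW.
Qed.
End Generic.

Lemma hasd_inv (w : R[i]) : w != 0 -> hasd id GRing.inv w (- (w * w)^-1).
Proof.
move=> w0 e e0.
have c : ccont id (fun y : R[i] => - (y^-1 * w^-1)) w.
  apply: ccontN; apply: ccontM; last exact: ccont_cst.
  by apply: ccont_inv => //; exact: ccont_j.
have [d d0 H] := c _ e0.
exists (Num.min d (nc w)); first by rewrite lt_min d0 nc_gt0.
move=> y; rewrite lt_min => /andP[/H h yw].
have y0 : y != 0.
  by apply: contraTneq yw => ->; rewrite sub0r ncN ltxx.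
have -> : y^-1 - w^-1 - - (w * w)^-1 * (y - w) =
   (- (y^-1 * w^-1) - - (w^-1 * w^-1)) * (y - w) by field; apply/andP.
by rewrite ncM ler_wpM2r ?nc_ge0.
Qed.
End Derivatives.

(** * Integrals of complex-valued functions *)

Section RealBridge.
Context {R : realType}.
Implicit Types (g : R -> R) (x D : R) (u : R -> R[i]).

Lemma is_deriveP g x D :
  (forall e, 0 < e -> exists2 d, 0 < d & forall y, `|y - x| < d ->
     `|g y - g x - D * (y - x)| <= e * `|y - x|) <-> is_derive x 1 g D.
Proof.
split=> [H | [dg gE] e e0].
- have cv : h^-1 *: ((g \o shift x) (h *: 1) - g x) @[h --> 0^'] --> D.
    apply/cvgrPdist_le => e e0; have [d d0 Hd] := H e e0.
    near=> h.
    have h0 : h != 0 by near: h; exact: nbhs_dnbhs_neq.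
    have hd : `|h| < d by near: h; apply: dnbhs0_lt.
    have := Hd (h + x); rewrite addrK => /(_ hd) Hh.
    rewrite /= /GRing.scale /= mulr1 distrC.
    have -> : h^-1 * (g (h + x) - g x) - D = h^-1 * (g (h + x) - g x - D * h) by field.
    by rewrite normrM normfV ler_pdivrMl ?normr_gt0 // [leRHS]mulrC.
  apply: DeriveDef; first by apply/cvg_ex; exists D.
  exact: cvg_lim.
- have := dg; rewrite /derivable => /cvg_ex[l hl].
  have lE : l = D by rewrite -gE; apply/esym/cvg_lim.
  move: hl; rewrite lE => /cvgrPdist_le /(_ e e0).
  move=> [d /= d0 Hd]; exists d => // y yd.
  have [->|yx] := eqVneq y x; first by rewrite !subrr mulr0 subrr !normr0 mulr0.
  have h0 : y - x != 0 by rewrite subr_eq0.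
  have := Hd (y - x); rewrite /ball /= sub0r normrN => /(_ yd h0).
  rewrite /GRing.scale /= mulr1 subrK distrC => Hy.
  have -> : g y - g x - D * (y - x) = ((y - x)^-1 * (g y - g x) - D) * (y - x).
    by rewrite mulrBl mulrAC mulVf // mul1r.
  by rewrite normrM ler_wpM2r.
Unshelve. all: by end_near.
Qed.

Lemma contP g x : (forall e, 0 < e -> exists2 d, 0 < d & forall y, `|y - x| < d ->
     `|g y - g x| <= e) <-> {for x, continuous g}.
Proof.
split=> [H | /cvgrPdist_le H e /H].
- apply/cvgrPdist_le => e /H[d d0 Hd]; near=> y.
  rewrite distrC; apply: Hd; rewrite distrC; near: y.
  by apply: cvgr_dist_lt d0.
- move=> [d /= d0 Hd]; exists d => // y yd.
  by rewrite distrC; apply: Hd; rewrite /ball /= distrC.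
Unshelve. all: by end_near.
Qed.

Lemma ofrB (a b : R) : ofr a - ofr b = ofr (a - b) :> R[i].
Proof. by rewrite -rmorphB. Qed.

Lemma nc_ofrB (a b : R) : nc (ofr a - ofr b : R[i]) = `|a - b|.
Proof. by rewrite ofrB nc_ofr. Qed.

Lemma re_ofrM (a : R) (z : R[i]) : re (z * ofr a) = re z * a.
Proof. by rewrite reM im_ofr mulr0 subr0. Qed.
Lemma im_ofrM (a : R) (z : R[i]) : im (z * ofr a) = im z * a.
Proof. by rewrite imM im_ofr mulr0 add0r. Qed.

Lemma ccontP u x : ccont ofr u x <->
  {for x, continuous (fun y => re (u y))} /\ {for x, continuous (fun y => im (u y))}.
Proof.
split=> [H | [/contP H1 /contP H2] e e0].
  split; apply/contP => e /H[d d0 Hd]; exists d => // y yd.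
    by apply: le_trans (Hd y _); rewrite ?nc_ofrB // -reN -reD re_le_nc.
  by apply: le_trans (Hd y _); rewrite ?nc_ofrB // -imN -imD im_le_nc.
have e2 : 0 < e / 2 by rewrite divr_gt0.
have [d1 d10 {}H1] := H1 _ e2; have [d2 d20 {}H2] := H2 _ e2.
exists (Num.min d1 d2); first by rewrite lt_min d10.
move=> y; rewrite nc_ofrB lt_min => /andP[/H1 h1 /H2 h2].
by apply: le_trans (nc_le_reim _) _; rewrite [e]splitr !reimE lerD.
Qed.

(** Through this equivalence the real fundamental theorem of calculus and the real mean value
    theorem become available for complex-valued functions. *)
Lemma hasdP u x (D : R[i]) : hasd ofr u x D <->
  is_derive x 1 (fun y => re (u y)) (re D) /\ is_derive x 1 (fun y => im (u y)) (im D).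
Proof.
split=> [H | [/is_deriveP H1 /is_deriveP H2] e e0].
  split; apply/is_deriveP => e /H[d d0 Hd]; exists d => // y yd.
    have := Hd y; rewrite nc_ofrB => /(_ yd); apply: le_trans.
    by rewrite ofrB -re_ofrM -!reN -!reD re_le_nc.
  have := Hd y; rewrite nc_ofrB => /(_ yd); apply: le_trans.
  by rewrite ofrB -im_ofrM -!imN -!imD im_le_nc.
have e2 : 0 < e / 2 by rewrite divr_gt0.
have [d1 d10 {}H1] := H1 _ e2; have [d2 d20 {}H2] := H2 _ e2.
exists (Num.min d1 d2); first by rewrite lt_min d10.
move=> y; rewrite nc_ofrB lt_min => /andP[/H1 h1 /H2 h2].
apply: le_trans (nc_le_reim _) _.
by rewrite ofrB !(reD, imD, reN, imN) re_ofrM im_ofrM [e]splitr mulrDl lerD.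
Qed.

Lemma ccont_within (a b : R) u : (forall x, a <= x <= b -> ccont ofr u x) ->
  {within `[a, b], continuous (fun y => re (u y))} /\
  {within `[a, b], continuous (fun y => im (u y))}.
Proof.
move=> H; split; apply: continuous_in_subspaceT => x; rewrite inE /= in_itv /= => /H /ccontP[] //.
Qed.
End RealBridge.

Section Integral.
Context {R : realType}.
Implicit Types (u v : R -> R[i]) (a b c x : R).

Definition icont a b u := forall x, a <= x <= b -> ccont ofr u x.
Definition cI a b u : R[i] := cintegral `[a, b] u.

Lemma icont_integrable a b u : icont a b u ->
  mu.-integrable `[a, b] (EFin \o (fun x => re (u x))) /\
  mu.-integrable `[a, b] (EFin \o (fun x => im (u x))).
Proof.
move=> /ccont_within[h1 h2]; split; apply: continuous_compact_integrable => //;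
  exact: segment_compact.
Qed.

Lemma eq_cI a b u v : (forall x, a <= x <= b -> u x = v x) -> cI a b u = cI a b v.
Proof.
move=> H; rewrite /cI /cintegral; congr Complex; apply: eq_Rintegral => x;
  by rewrite inE /= in_itv /= => /H ->.
Qed.

Lemma re_cI a b u : re (cI a b u) = Rintegral mu `[a, b] (fun x => re (u x)).
Proof. by []. Qed.
Lemma im_cI a b u : im (cI a b u) = Rintegral mu `[a, b] (fun x => im (u x)).
Proof. by []. Qed.

Lemma cID a b u v : icont a b u -> icont a b v ->
  cI a b (fun x => u x + v x) = cI a b u + cI a b v.
Proof.
move=> /icont_integrable[u1 u2] /icont_integrable[v1 v2].
apply: complex_ext; rewrite !reimE ?re_cI ?im_cI -RintegralD //;
  by apply: eq_Rintegral => x _; rewrite reimE.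
Qed.

Lemma cIZ a b (c : R[i]) u : icont a b u -> cI a b (fun x => c * u x) = c * cI a b u.
Proof.
move=> /icont_integrable[u1 u2].
have i1 k : mu.-integrable `[a, b] (EFin \o (fun x => k * re (u x))).
  rewrite (_ : _ \o _ = (fun x => k%:E * (EFin \o (fun x => re (u x))) x)%E).
    by apply: integrableZl.
  by apply/funext => x /=; rewrite EFinM.
have i2 k : mu.-integrable `[a, b] (EFin \o (fun x => k * im (u x))).
  rewrite (_ : _ \o _ = (fun x => k%:E * (EFin \o (fun x => im (u x))) x)%E).
    by apply: integrableZl.
  by apply/funext => x /=; rewrite EFinM.
apply: complex_ext; rewrite !reimE ?re_cI ?im_cI -!RintegralZl //.
  rewrite -RintegralB //.
  by apply: eq_Rintegral => x _; rewrite reimE.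
rewrite -RintegralD //.
by apply: eq_Rintegral => x _; rewrite reimE.
Qed.

Lemma icont_cst a b (c : R[i]) : icont a b (fun=> c). Proof. by move=> x _; exact: ccont_cst. Qed.
Lemma icontD a b u v : icont a b u -> icont a b v -> icont a b (fun x => u x + v x).
Proof. by move=> hu hv x hx; apply: ccontD; [exact: hu|exact: hv]. Qed.
Lemma icontM a b u v : icont a b u -> icont a b v -> icont a b (fun x => u x * v x).
Proof. by move=> hu hv x hx; apply: ccontM; [exact: hu|exact: hv]. Qed.
Lemma icontN a b u : icont a b u -> icont a b (fun x => - u x).
Proof. by move=> hu x hx; apply: ccontN; exact: hu. Qed.
Lemma icontB a b u v : icont a b u -> icont a b v -> icont a b (fun x => u x - v x).
Proof. by move=> hu hv; apply: icontD => //; exact: icontN. Qed.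
Lemma icontZ a b (c : R[i]) u : icont a b u -> icont a b (fun x => c * u x).
Proof. by move=> hu; apply: icontM => //; exact: icont_cst. Qed.
Lemma icont_conj a b u : icont a b u -> icont a b (fun x => (u x)^*%C).
Proof. by move=> hu x hx; apply: ccont_conj; exact: hu. Qed.

Lemma cIN a b u : icont a b u -> cI a b (fun x => - u x) = - cI a b u.
Proof.
move=> hu; rewrite -mulN1r -cIZ //; apply: eq_cI => x _; by rewrite mulN1r.
Qed.
Lemma cIB a b u v : icont a b u -> icont a b v ->
  cI a b (fun x => u x - v x) = cI a b u - cI a b v.
Proof. by move=> hu hv; rewrite cID ?cIN //; exact: icontN. Qed.

Lemma cI_conj a b u : icont a b u -> cI a b (fun x => (u x)^*%C) = (cI a b u)^*%C.
Proof.
move=> /icont_integrable[_ i2].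
apply: complex_ext; rewrite !reimE ?re_cI ?im_cI.
  by apply: eq_Rintegral => x _; rewrite re_conj.
rewrite -mulN1r -RintegralZl //.
by apply: eq_Rintegral => x _; rewrite im_conj mulN1r.
Qed.

Lemma le_re_cI a b u v : icont a b u -> icont a b v ->
  (forall x, a <= x <= b -> re (u x) <= re (v x)) -> re (cI a b u) <= re (cI a b v).
Proof.
move=> /icont_integrable[u1 u2] /icont_integrable[v1 v2] H.
by rewrite !re_cI; apply: le_Rintegral => // x /=; rewrite in_itv /=; exact: H.
Qed.

Lemma cI_cst a b (c : R[i]) : a <= b -> cI a b (fun=> c) = c * ofr (b - a).
Proof.
move=> ab; have E (k : R) : Rintegral mu `[a, b] (fun=> k) = k * (b - a).
  rewrite Rintegral_cst //= lebesgue_measure_itv /= lte_fin.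
  move: ab; rewrite le_eqVlt => /predU1P[->|->]; last by rewrite EFinN.
  by rewrite ltxx subrr /= mulr0.
by apply: complex_ext; rewrite ?re_ofrM ?im_ofrM ?re_cI ?im_cI E.
Qed.

Lemma icont_nc a b u : icont a b u -> icont a b (fun x => ofr (nc (u x))).
Proof.
move=> hu x /hu H e /H[d d0 Hd]; exists d => // y /Hd h.
by rewrite nc_ofrB; apply: le_trans h; exact: nc_norm_sub.
Qed.

(* The phase of the integral is rotated away, which reduces the triangle
   inequality to monotonicity of the real integral. *)
Lemma nc_cI_le a b u : icont a b u ->
  nc (cI a b u) <= re (cI a b (fun x => ofr (nc (u x)))).
Proof.
move=> hu; set I := cI a b u.
have [I0|I0] := eqVneq I 0.
  rewrite I0 nc0.
  have -> : 0 = re (cI a b (fun=> 0)).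
    by rewrite re_cI /= Rintegral_cst //= mul0r.
  apply: le_re_cI; [exact: icont_cst|exact: icont_nc|move=> x _ /=; exact: nc_ge0].
have n0 : nc I != 0 by rewrite nc_eq0.
pose c := (I^*)%C / ofr (nc I).
have cI1 : c * I = ofr (nc I).
  rewrite /c mulrAC [_ * I]mulrC mul_conj expr2 rmorphM mulfK //.
  by rewrite ofr_eq0.
have c1 : nc c = 1 by rewrite /c ncM ncV nc_conj nc_ofr ger0_norm ?nc_ge0 // divff.
rewrite -[leLHS]/(re (ofr (nc I))) -cI1 -cIZ //.
apply: le_re_cI; [exact: icontZ|exact: icont_nc|move=> x _ /=].
by apply: le_trans (ler_norm _) _; apply: le_trans (re_le_nc _) _; rewrite ncM c1 mul1r.
Qed.

Lemma nc_cI_bound a b u M : a <= b -> icont a b u ->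
  (forall x, a <= x <= b -> nc (u x) <= M) -> nc (cI a b u) <= M * (b - a).
Proof.
move=> ab hu H; apply: le_trans (nc_cI_le hu) _.
have -> : M * (b - a) = re (cI a b (fun=> ofr M)) by rewrite cI_cst // re_ofrM.
apply: le_re_cI; [exact: icont_nc|exact: icont_cst|exact: H].
Qed.

Lemma cI_FTC a b u v : a <= b -> (forall x, a <= x <= b -> hasd ofr u x (v x)) ->
  icont a b v -> cI a b v = u b - u a.
Proof.
rewrite le_eqVlt => /predU1P[<-|ab] hu hv.
  rewrite subrr; apply: complex_ext; rewrite ?re_cI ?im_cI set_itv1 Rintegral_set1 //.
have [v1 v2] := ccont_within hv.
have aux (F f : R -> R) : (forall x, a <= x <= b -> is_derive x 1 F (f x)) ->
    {within `[a, b], continuous f} -> Rintegral mu `[a, b] f = F b - F a.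
  move=> hF hf; rewrite /Rintegral (@continuous_FTC2 _ f F) //.
    have cF x : a <= x <= b -> {for x, continuous F}.
      move=> /hF[hd _]; apply: differentiable_continuous; exact/derivable1_diffP.
    split.
    - by move=> x; rewrite in_itv /= => /andP[ax xb]; have /hF[] // : a <= x <= b by rewrite (ltW ax) ltW.
    - by apply: cvg_at_right_filter; apply: cF; rewrite lexx ltW.
    - by apply: cvg_at_left_filter; apply: cF; rewrite lexx ltW.
  move=> x; rewrite in_itv /= => /andP[ax xb]; have /hF[_ <-] : a <= x <= b by rewrite (ltW ax) ltW.
  by rewrite derive1E.
apply: complex_ext; rewrite !reimE ?re_cI ?im_cI.
  by apply: (aux (fun x => re (u x))) => // x /hu /hasdP[].
by apply: (aux (fun x => im (u x))) => // x /hu /hasdP[].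
Qed.

(** The integral starts at [a - 1], so that [a] is an interior point and the derivative there is
    two-sided. *)
Lemma primitive a u : (forall x, ccont ofr u x) ->
  exists2 P : R -> R[i], P a = 0 & forall x, a - 1 < x -> hasd ofr P x (u x).
Proof.
move=> hu.
pose F x := cI (a - 1) x u - cI (a - 1) a u.
exists F; first by rewrite /F subrr.
move=> x ax; rewrite -[u x]subr0.
apply: hasdB; last exact: hasd_cst.
have hi : icont (a - 1) (x + 1) u by [].
have [i1 i2] := icont_integrable hi.
have [c1 c2] := (ccontP u x).1 (hu x).
have xx : x < x + 1 by rewrite ltrDl.
apply/hasdP; split.
  have [d1 d2] := continuous_FTC1_closed xx i1 ax c1.
  by apply: DeriveDef; [exact: d1|rewrite -derive1E; exact: d2].
have [d1 d2] := continuous_FTC1_closed xx i2 ax c2.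
by apply: DeriveDef; [exact: d1|rewrite -derive1E; exact: d2].
Qed.

(** Composition with this projection onto [a, b] turns a function continuous at the points of [a, b]
    into one continuous on the whole line, as [primitive] requires. *)
Definition clamp a b x := Num.max a (Num.min b x).
Lemma clamp_in a b x : a <= b -> a <= clamp a b x <= b.
Proof. by move=> ab; rewrite /clamp le_max lexx /= ge_max ab ge_min lexx. Qed.
Lemma clamp_id a b x : a <= x <= b -> clamp a b x = x.
Proof. by move=> /andP[h1 h2]; rewrite /clamp min_r // max_r. Qed.
Lemma clamp_lip a b x y : `|clamp a b x - clamp a b y| <= `|x - y|.
Proof.
have hM c s t : `|Num.max c s - Num.max c t| <= `|s - t|.
  have := ler_norm (s - t); have := ler_norm (t - s); rewrite distrC.
  by rewrite ler_norml; case: (leP c s) => h1; case: (leP c t) => h2 h3 h4;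
    apply/andP; split; lra.
have hm c s t : `|Num.min c s - Num.min c t| <= `|s - t|.
  have := ler_norm (s - t); have := ler_norm (t - s); rewrite distrC.
  by rewrite ler_norml; case: (leP c s) => h1; case: (leP c t) => h2 h3 h4;
    apply/andP; split; lra.
by apply: le_trans (hM _ _ _) (hm _ _ _).
Qed.

Lemma clamp_cont a b u x : a <= b -> icont a b u ->
  ccont ofr (fun y => u (clamp a b y)) x.
Proof.
move=> ab hu e e0; have [d d0 H] := hu _ (clamp_in x ab) _ e0.
exists d => // y; rewrite nc_ofrB => yd; apply: H.
by rewrite nc_ofrB; apply: le_lt_trans (clamp_lip _ _ _ _) yd.
Qed.

(** All three integrals are differences of values of one primitive. *)
Lemma cI_split a b c u : a <= c -> c <= b -> icont a b u ->
  cI a b u = cI a c u + cI c b u.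
Proof.
move=> ac cb hu; have ab := le_trans ac cb.
have [P _ HP] := @primitive a (fun y => u (clamp a b y)) (fun x => clamp_cont x ab hu).
have K s t : a <= s -> s <= t -> t <= b -> cI s t u = P t - P s.
  move=> as_ st tb; rewrite -(@cI_FTC s t P (fun y => u (clamp a b y))) //.
  - apply: eq_cI => x /andP[x1 x2]; rewrite clamp_id //.
    by rewrite (le_trans as_ x1) (le_trans x2 tb).
  - by move=> x /andP[x1 _]; apply: HP; lra.
  - by move=> x _; apply: clamp_cont.
by rewrite !K //; ring.
Qed.
End Integral.

(** * Cauchy's theorem and Cauchy's estimate *)

Section Goursat.
Context {R : realType}.
Implicit Types (g : R[i] -> R[i]) (x y w h s : R).

Lemma ccont_horizontal g x y : ccont id g (Complex x y) ->
  ccont ofr (fun t => g (Complex t y)) x.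
Proof.
move=> H e /H[d d0 Hd]; exists d => // t td; apply: Hd.
rewrite (_ : id _ - id _ = ofr t - ofr x) //.
by apply: complex_ext; rewrite /id !reimCE; ring.
Qed.

Lemma ccont_vertical g x y : ccont id g (Complex x y) ->
  ccont ofr (fun t => g (Complex x t)) y.
Proof.
move=> H e /H[d d0 Hd]; exists d => // t td; apply: Hd.
rewrite (_ : id _ - id _ = 'i%C * (ofr t - ofr y)) ?ncM ?nc_i ?mul1r //.
by apply: complex_ext; rewrite /id !reimCE; ring.
Qed.

Definition rect_in x1 x2 y1 y2 (z : R[i]) := (x1 <= re z <= x2) /\ (y1 <= im z <= y2).

(** The contour integral along the boundary, anticlockwise. *)
Definition rect_int g x1 x2 y1 y2 : R[i] :=
  cI x1 x2 (fun t => g (Complex t y1)) - cI x1 x2 (fun t => g (Complex t y2))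
  + 'i%C * (cI y1 y2 (fun t => g (Complex x2 t)) - cI y1 y2 (fun t => g (Complex x1 t))).

Definition rect_cont g x1 x2 y1 y2 := forall z, rect_in x1 x2 y1 y2 z -> ccont id g z.

Section Rect.
Variables (x1 x2 y1 y2 : R) (hx : x1 <= x2) (hy : y1 <= y2).

Lemma icont_hor g y : rect_cont g x1 x2 y1 y2 -> y1 <= y <= y2 ->
  icont x1 x2 (fun t => g (Complex t y)).
Proof. by move=> H hy' x hx'; apply: ccont_horizontal; apply: H; split. Qed.
Lemma icont_ver g x : rect_cont g x1 x2 y1 y2 -> x1 <= x <= x2 ->
  icont y1 y2 (fun t => g (Complex x t)).
Proof. by move=> H hx' y hy'; apply: ccont_vertical; apply: H; split. Qed.

Let hx1 : x1 <= x1 <= x2. Proof. by rewrite lexx. Qed.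
Let hx2 : x1 <= x2 <= x2. Proof. by rewrite lexx andbT. Qed.
Let hy1 : y1 <= y1 <= y2. Proof. by rewrite lexx. Qed.
Let hy2 : y1 <= y2 <= y2. Proof. by rewrite lexx andbT. Qed.

Lemma rect_int_splitx g x : rect_cont g x1 x2 y1 y2 -> x1 <= x <= x2 ->
  rect_int g x1 x2 y1 y2 = rect_int g x1 x y1 y2 + rect_int g x x2 y1 y2.
Proof.
move=> H /andP[xa xb]; rewrite /rect_int.
rewrite (@cI_split _ x1 x2 x (fun t => g (Complex t y1))) //; last exact: icont_hor.
rewrite (@cI_split _ x1 x2 x (fun t => g (Complex t y2))) //; last exact: icont_hor.
ring.
Qed.

Lemma rect_int_splity g y : rect_cont g x1 x2 y1 y2 -> y1 <= y <= y2 ->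
  rect_int g x1 x2 y1 y2 = rect_int g x1 x2 y1 y + rect_int g x1 x2 y y2.
Proof.
move=> H /andP[ya yb]; rewrite /rect_int.
rewrite (@cI_split _ y1 y2 y (fun t => g (Complex x1 t))) //; last exact: icont_ver.
rewrite (@cI_split _ y1 y2 y (fun t => g (Complex x2 t))) //; last exact: icont_ver.
ring.
Qed.

Lemma rect_int_bound g M : rect_cont g x1 x2 y1 y2 ->
  (forall z, rect_in x1 x2 y1 y2 z -> nc (g z) <= M) ->
  nc (rect_int g x1 x2 y1 y2) <= 2 * M * ((x2 - x1) + (y2 - y1)).
Proof.
move=> H HM; rewrite /rect_int.
have b1 : nc (cI x1 x2 (fun t => g (Complex t y1))) <= M * (x2 - x1).
  by apply: nc_cI_bound => //; [exact: icont_hor|move=> x hx'; apply: HM].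
have b2 : nc (cI x1 x2 (fun t => g (Complex t y2))) <= M * (x2 - x1).
  by apply: nc_cI_bound => //; [exact: icont_hor|move=> x hx'; apply: HM].
have b3 : nc (cI y1 y2 (fun t => g (Complex x1 t))) <= M * (y2 - y1).
  by apply: nc_cI_bound => //; [exact: icont_ver|move=> x hx'; apply: HM].
have b4 : nc (cI y1 y2 (fun t => g (Complex x2 t))) <= M * (y2 - y1).
  by apply: nc_cI_bound => //; [exact: icont_ver|move=> x hx'; apply: HM].
apply: le_trans (ncD _ _) _; apply: le_trans (lerD (ncB _ _) (lexx _)) _.
rewrite ncM nc_i mul1r; apply: le_trans (lerD (lexx _) (ncB _ _)) _.
apply: le_trans (lerD (lerD b1 b2) (lerD b4 b3)) _.
by rewrite le_eqVlt; apply/orP; left; apply/eqP; ring.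
Qed.

Lemma rect_intB g k : rect_cont g x1 x2 y1 y2 -> rect_cont k x1 x2 y1 y2 ->
  rect_int (fun z => g z - k z) x1 x2 y1 y2 =
  rect_int g x1 x2 y1 y2 - rect_int k x1 x2 y1 y2.
Proof.
move=> hg hk; rewrite /rect_int !cIB; try exact: icont_hor; try exact: icont_ver.
ring.
Qed.

(** The integrand has the explicit primitive [F], so each side contributes a difference of values of
    [F] at two corners, and these cancel around the rectangle. *)
Lemma rect_int_affine (c D z0 : R[i]) :
  rect_int (fun z => c + D * (z - z0)) x1 x2 y1 y2 = 0.
Proof.
pose F (z : R[i]) := c * z + D * ((z - z0) * (z - z0)) * (2%:R)^-1.
have dF z : hasd id F z (c + D * (z - z0)).
  have hz : hasd id (fun z => z - z0) z 1.
    by rewrite -[1]subr0; apply: hasdB; [exact: hasd_j|exact: hasd_cst].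
  have -> : c + D * (z - z0) = c * 1 + 2%:R^-1 * (D * (1 * (z - z0) + (z - z0) * 1)).
    have n2 : (2%:R : R[i]) != 0 by rewrite pnatr_eq0.
    by field.
  apply: (@hasd_near _ _ _ (fun z => c * z + 2%:R^-1 * (D * ((z - z0) * (z - z0))))) ltr01 _ _.
    by move=> y _; rewrite /F; ring.
  apply: hasdD; first by apply: hasdZ; exact: hasd_j.
  by do 2! apply: hasdZ; apply: hasdM.
have cD : rect_cont (fun z => c + D * (z - z0)) x1 x2 y1 y2.
  move=> z _; apply: ccontD; first exact: ccont_cst.
  apply: ccontM; first exact: ccont_cst.
  by apply: ccontB; [exact: ccont_j|exact: ccont_cst].
have hh y : y1 <= y <= y2 ->
    cI x1 x2 (fun t => c + D * (Complex t y - z0)) = F (Complex x2 y) - F (Complex x1 y).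
  move=> hy'; apply: (@cI_FTC _ x1 x2 (fun t => F (Complex t y))) => //.
    move=> x _; rewrite -[_ + _]mulr1.
    apply: (hasd_comp (f := fun t => Complex t y)) (dF _).
    move=> e e0; exists 1 => // t _.
    have -> : Complex t y - Complex x y - 1 * (ofr t - ofr x) = 0.
      by apply: complex_ext; rewrite /id !reimCE; ring.
    by rewrite nc0 mulr_ge0 ?nc_ge0 ?ltW.
  exact: (icont_hor cD).
have hv x : x1 <= x <= x2 ->
    cI y1 y2 (fun t => c + D * (Complex x t - z0)) = - 'i%C * (F (Complex x y2) - F (Complex x y1)).
  move=> hx'; rewrite mulrBr; apply: (@cI_FTC _ y1 y2 (fun t => - 'i%C * F (Complex x t))) => //.
    move=> y _; have -> : c + D * (Complex x y - z0) = - 'i%C * ((c + D * (Complex x y - z0)) * 'i%C).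
      by rewrite mulrCA mulNr mulii mulrN mulrN1 opprK.
    apply: hasdZ; apply: (hasd_comp (f := fun t => Complex x t)) (dF _).
    move=> e e0; exists 1 => // t _.
    have -> : Complex x t - Complex x y - 'i%C * (ofr t - ofr y) = 0.
      by apply: complex_ext; rewrite /id !reimCE; ring.
    by rewrite nc0 mulr_ge0 ?nc_ge0 ?ltW.
  exact: (icont_ver cD).
rewrite /rect_int !hh // !hv //.
rewrite -mulrBr mulrA mulrN mulii opprK mul1r; ring.
Qed.
End Rect.

(** Nested intervals in both coordinates, with an invariant [P] carried along. It serves the
    bisection of rectangles and, with [h = 0], limits of sequences. *)
Lemma nested_rect (P : R -> R -> nat -> Prop) x0 y0 w h : 0 <= w -> 0 <= h ->
  P x0 y0 0%N ->
  (forall n x y, P x y n -> exists x' y',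
     [/\ P x' y' n.+1, x <= x' <= x + w / 2 ^+ n.+1 & y <= y' <= y + h / 2 ^+ n.+1]) ->
  exists X Y, forall n, exists x y,
    [/\ P x y n, x <= X <= x + w / 2 ^+ n & y <= Y <= y + h / 2 ^+ n].
Proof.
move=> w0 h0 P0 step.
(* The choice is made total for the recursion: where [P] fails, the old corner is returned. *)
have step' (n : nat) (p : R * R) : {p' : R * R | P p.1 p.2 n ->
     [/\ P p'.1 p'.2 n.+1, p.1 <= p'.1 <= p.1 + w / 2 ^+ n.+1
       & p.2 <= p'.2 <= p.2 + h / 2 ^+ n.+1]}.
  apply: cid; case: (pselect (P p.1 p.2 n)) => [/step[x' [y' H]]|nP]; last by exists p.
  by exists (x', y').
pose fix s n := if n is m.+1 then sval (step' m (s m)) else (x0, y0).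
have sP n : P (s n).1 (s n).2 n.
  by elim: n => //= n IH; case: (svalP (step' n (s n)) IH).
have sS n : (s n).1 <= (s n.+1).1 <= (s n).1 + w / 2 ^+ n.+1 /\
            (s n).2 <= (s n.+1).2 <= (s n).2 + h / 2 ^+ n.+1.
  by rewrite /=; case: (svalP (step' n (s n)) (sP n)).
have half k (n : nat) : k / 2 ^+ n = k / 2 ^+ n.+1 + k / 2 ^+ n.+1 :> R.
  by rewrite exprS; field; rewrite expf_neq0 // pnatr_eq0.
have lim (k : R) (t : nat -> R) : 0 <= k ->
    (forall n, t n <= t n.+1 <= t n + k / 2 ^+ n.+1) ->
    exists X, forall n, t n <= X <= t n + k / 2 ^+ n.
  move=> k0 ht.
  have mon n m : t n <= t (n + m)%N.
    elim: m => [|m IH]; first by rewrite addn0.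
    by rewrite addnS; apply: le_trans IH _; case/andP: (ht (n + m)%N).
  have up n m : t (n + m)%N + k / 2 ^+ (n + m) <= t n + k / 2 ^+ n.
    elim: m => [|m IH]; first by rewrite addn0.
    rewrite addnS; apply: le_trans IH; have /andP[_ h1] := ht (n + m)%N.
    by rewrite [X in _ <= _ + X]half addrA lerD2r.
  have pos n : 0 <= k / 2 ^+ n by rewrite divr_ge0 // exprn_ge0.
  have ub n m : t m <= t n + k / 2 ^+ n.
    have [nm|mn] := leqP n m.
      by rewrite -(subnKC nm); apply: le_trans (up n (m - n)%N); rewrite lerDl.
    rewrite -(subnKC (ltnW mn)); apply: le_trans (mon m (n - m)%N) _.
    by rewrite lerDl.
  pose A := [set x | exists n, x = t n].
  have hA : has_sup A.
    split; first by exists (t 0%N); exists 0%N.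
    by exists (t 0%N + k / 2 ^+ 0) => _ [n ->].
  exists (sup A) => n; apply/andP; split.
    by apply: ub_le_sup; [case: hA|exists n].
  by apply: ge_sup; [case: hA|move=> _ [m ->]].
have [X HX] := lim w (fun n => (s n).1) w0 (fun n => (sS n).1).
have [Y HY] := lim h (fun n => (s n).2) h0 (fun n => (sS n).2).
by exists X, Y => n; exists (s n).1, (s n).2.
Qed.

Lemma half_pow_small (k e : R) : 0 < e -> exists n : nat, k / 2 ^+ n < e.
Proof.
move=> e0.
exists (Num.bound (`|k| / e)).
set N := Num.bound _.
have h : `|k| / e < 2 ^+ N.
  apply: lt_trans (archi_boundP _) _; first by rewrite divr_ge0 // ltW.
  by rewrite -natrX ltr_nat ltn_expl.
rewrite ltr_pdivrMr ?exprn_gt0 //; apply: le_lt_trans (ler_norm _) _.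
by move: h; rewrite ltr_pdivrMr // mulrC.
Qed.

(** Bisection: some quarter of a rectangle carries at least a quarter of the integral. At the common
    point of the nested rectangles the affine approximation, whose integral vanishes, makes the
    integral too small. *)
Theorem goursat g x1 x2 y1 y2 : x1 <= x2 -> y1 <= y2 ->
  (forall z, rect_in x1 x2 y1 y2 z -> exists D, hasd id g z D) ->
  rect_int g x1 x2 y1 y2 = 0.
Proof.
move=> hx hy hg.
have gc a b c d : x1 <= a -> b <= x2 -> y1 <= c -> d <= y2 -> rect_cont g a b c d.
  move=> ha hb hc hd z [/andP[z1 z2] /andP[z3 z4]].
  have [|D hD] := hg z; last exact: hasd_cont hD.
  by split; apply/andP; split; [exact: le_trans z1|exact: le_trans hb
    |exact: le_trans z3|exact: le_trans hd].
apply/eqP; rewrite -nc_eq0; apply/negP => /negP m0.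
set m := nc _ in m0; have {}m0 : 0 < m by rewrite lt_def m0 nc_ge0.
pose w := x2 - x1; pose h := y2 - y1.
have w0 : 0 <= w by rewrite subr_ge0.
have h0 : 0 <= h by rewrite subr_ge0.
have pw n : 0 <= w / 2 ^+ n by rewrite divr_ge0 // exprn_ge0.
have ph n : 0 <= h / 2 ^+ n by rewrite divr_ge0 // exprn_ge0.
have half k (n : nat) : k / 2 ^+ n = k / 2 ^+ n.+1 + k / 2 ^+ n.+1 :> R.
  by rewrite exprS; field; rewrite expf_neq0 // pnatr_eq0.
pose P x y (n : nat) := [/\ x1 <= x, x + w / 2 ^+ n <= x2, y1 <= y, y + h / 2 ^+ n <= y2
  & m / 4 ^+ n <= nc (rect_int g x (x + w / 2 ^+ n) y (y + h / 2 ^+ n))].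
have [X [Y HXY]] : exists X Y, forall n, exists x y,
    [/\ P x y n, x <= X <= x + w / 2 ^+ n & y <= Y <= y + h / 2 ^+ n].
  apply: (@nested_rect P x1 y1) => //.
    by rewrite /P !expr0 !divr1 /w /h !(addrC _ (_ - _)) !subrK; split.
  move=> n x y [p1 p2 p3 p4 p5].
  set w' := w / 2 ^+ n.+1; set h' := h / 2 ^+ n.+1.
  have w'0 : 0 <= w' by exact: pw.
  have h'0 : 0 <= h' by exact: ph.
  have xE : x + w / 2 ^+ n = x + w' + w' by rewrite half -addrA.
  have yE : y + h / 2 ^+ n = y + h' + h' by rewrite half -addrA.
  rewrite xE yE in p2 p4 p5.
  have c1 : rect_cont g x (x + w' + w') y (y + h' + h') by exact: gc.
  have c2 : rect_cont g x (x + w') y (y + h' + h') by apply: gc => //; lra.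
  have c3 : rect_cont g (x + w') (x + w' + w') y (y + h' + h') by apply: gc => //; lra.
  have E1 : rect_int g x (x + w' + w') y (y + h' + h') =
      rect_int g x (x + w') y (y + h' + h') + rect_int g (x + w') (x + w' + w') y (y + h' + h').
    by apply: rect_int_splitx => //; try lra; apply/andP; split; lra.
  have E2 : rect_int g x (x + w') y (y + h' + h') =
      rect_int g x (x + w') y (y + h') + rect_int g x (x + w') (y + h') (y + h' + h').
    by apply: rect_int_splity => //; try lra; apply/andP; split; lra.
  have E3 : rect_int g (x + w') (x + w' + w') y (y + h' + h') =
      rect_int g (x + w') (x + w' + w') y (y + h') + rect_int g (x + w') (x + w' + w') (y + h') (y + h' + h').
    by apply: rect_int_splity => //; try lra; apply/andP; split; lra.
  rewrite E1 E2 E3 in p5.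
  set r := m / 4 ^+ n.+1.
  have rE : m / 4 ^+ n = 4 * r.
    by rewrite /r exprS; field; rewrite expf_neq0 // pnatr_eq0.
  rewrite rE in p5.
  have q1 : x1 <= x + w' by rewrite (le_trans p1) ?lerDl.
  have q2 : x + w' <= x2 by rewrite (le_trans _ p2) ?lerDl.
  have q3 : y1 <= y + h' by rewrite (le_trans p3) ?lerDl.
  have q4 : y + h' <= y2 by rewrite (le_trans _ p4) ?lerDl.
  have q5 : x <= x <= x + w' by rewrite lexx lerDl.
  have q6 : x <= x + w' <= x + w' by rewrite lexx lerDl w'0.
  have q7 : y <= y <= y + h' by rewrite lexx lerDl.
  have q8 : y <= y + h' <= y + h' by rewrite lexx lerDl h'0.
  have [l1|l1] := leP r (nc (rect_int g x (x + w') y (y + h'))).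
    exists x, y; by split=> //; split.
  have [l2|l2] := leP r (nc (rect_int g x (x + w') (y + h') (y + h' + h'))).
    exists x, (y + h'); by split=> //; split.
  have [l3|l3] := leP r (nc (rect_int g (x + w') (x + w' + w') y (y + h'))).
    exists (x + w'), y; by split=> //; split.
  have [l4|l4] := leP r (nc (rect_int g (x + w') (x + w' + w') (y + h') (y + h' + h'))).
    exists (x + w'), (y + h'); by split=> //; split.
  exfalso.
  have := ncD (rect_int g x (x + w') y (y + h') + rect_int g x (x + w') (y + h') (y + h' + h'))
    (rect_int g (x + w') (x + w' + w') y (y + h') + rect_int g (x + w') (x + w' + w') (y + h') (y + h' + h')).
  have := ncD (rect_int g x (x + w') y (y + h')) (rect_int g x (x + w') (y + h') (y + h' + h')).
  have := ncD (rect_int g (x + w') (x + w' + w') y (y + h')) (rect_int g (x + w') (x + w' + w') (y + h') (y + h' + h')).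
  by lra.
pose z0 := Complex X Y.
have [D hD] : exists D, hasd id g z0 D.
  have [x [y [[p1 p2 p3 p4 _] /andP[q1 q2] /andP[q3 q4]]]] := HXY 0%N.
  by apply: hg; split; apply/andP; split=> /=; lra.
pose s := w + h; have s0 : 0 <= s by rewrite addr_ge0.
(* On the n-th rectangle the integral is at most 2 e s^2 / 4^n; with this [e] that is less than m /
   4^n. The summand 1 takes care of [s = 0]. *)
pose e := m / (4 * (s * s) + 1).
have den : 0 < 4 * (s * s) + 1 by rewrite ltr_wpDl // !mulr_ge0.
have e0 : 0 < e by rewrite divr_gt0.
have [d d0 Hd] := hD e e0.
have [n Hn] := half_pow_small s d0.
have [x [y [[p1 p2 p3 p4 p5] /andP[q1 q2] /andP[q3 q4]]]] := HXY n.
set w' := w / 2 ^+ n in p2 p5 q2; set h' := h / 2 ^+ n in p4 p5 q4.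
have sE : s / 2 ^+ n = w' + h' by rewrite /s mulrDl.
have w'0 : 0 <= w' by exact: pw.
have h'0 : 0 <= h' by exact: ph.
pose k z := g z0 + D * (z - z0).
have cg : rect_cont g x (x + w') y (y + h') by exact: gc.
have ck : rect_cont k x (x + w') y (y + h').
  move=> z _; apply: ccontD; first exact: ccont_cst.
  apply: ccontM; first exact: ccont_cst.
  by apply: ccontB; [exact: ccont_j|exact: ccont_cst].
have xw : x <= x + w' by rewrite lerDl.
have yh : y <= y + h' by rewrite lerDl.
have := rect_intB xw yh cg ck; rewrite rect_int_affine // subr0 => E.
have cgk : rect_cont (fun z => g z - k z) x (x + w') y (y + h').
  by move=> z hz; apply: ccontB; [exact: cg|exact: ck].
have bnd z : rect_in x (x + w') y (y + h') z -> nc (g z - k z) <= e * (w' + h').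
  move=> [/andP[z1 z2] /andP[z3 z4]].
  have dz : nc (z - z0) <= w' + h'.
    apply: le_trans (nc_le_reim _) _; rewrite !reimCE.
    have near1 (t T l v : R) : t <= T -> T <= t + l -> t <= v -> v <= t + l -> `|v - T| <= l.
      by move=> *; rewrite ler_norml; apply/andP; split; lra.
    by apply: lerD; [exact: near1 z1 z2|exact: near1 z3 z4].
  have := Hd z; rewrite -sE in dz; move=> /(_ (le_lt_trans dz Hn)) /= H.
  have -> : g z - k z = g z - g z0 - D * (z - z0) by rewrite /k; ring.
  by apply: le_trans H _; rewrite -sE ler_wpM2l ?(ltW e0).
have := rect_int_bound xw yh cgk bnd; rewrite E => B.
have := le_trans p5 B.
have -> : x + w' - x + (y + h' - y) = w' + h' by ring.
rewrite -sE => H.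
have H2 : m <= 2 * e * (s * s).
  have e4 : (4 : R) ^+ n = 2 ^+ n * 2 ^+ n by rewrite -exprMn -natrM.
  have p40 : (0 : R) < 4 ^+ n by rewrite exprn_gt0.
  move: H; rewrite ler_pdivrMr // e4.
  rewrite [X in _ <= X](_ : _ = 2 * e * (s * s)) //.
  by field; rewrite expf_neq0 // pnatr_eq0.
move: H2; rewrite /e.
have -> : 2 * (m / (4 * (s * s) + 1)) * (s * s) = m * (2 * (s * s)) / (4 * (s * s) + 1).
  by field; rewrite gt_eqF.
rewrite ler_pdivlMr //.
have ss : 0 <= s * s by rewrite mulr_ge0.
have := mulr_ge0 (ltW m0) ss; nra.
Qed.
End Goursat.

(** * The complex exponential *)

Section ComplexExp.
Context {R : realType}.
Implicit Types (s z w h : R[i]) (e d : R).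

Definition cis (t : R) : R[i] := Complex (cos t) (sin t).
Definition cexp s : R[i] := ofr (expR (re s)) * cis (im s).

Lemma nc_cis t : nc (cis t) = 1.
Proof. by rewrite ncE /= cos2Dsin2 sqrtr1. Qed.
Lemma nc_cexp s : nc (cexp s) = expR (re s).
Proof. by rewrite ncM nc_cis mulr1 nc_ofr ger0_norm ?expR_ge0. Qed.
Lemma cexp_neq0 s : cexp s != 0.
Proof. by rewrite -nc_gt0 nc_cexp expR_gt0. Qed.
Lemma cisD (a b : R) : cis (a + b) = cis a * cis b.
Proof. by apply: complex_ext; rewrite reimE /= ?cosD ?sinD //; ring. Qed.
Lemma cexpD s z : cexp (s + z) = cexp s * cexp z.
Proof. by rewrite /cexp reD imD expRD cisD rmorphM /=; ring. Qed.
Lemma cis0 : cis 0 = 1. Proof. by rewrite /cis cos0 sin0. Qed.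
Lemma cexp0 : cexp 0 = 1. Proof. by rewrite /cexp expR0 cis0 mulr1. Qed.
Lemma cexp_2pi (t : R) : cexp (Complex t (2 * pi)) = cexp (Complex t 0).
Proof.
rewrite /cexp /= (_ : cis (2 * pi) = cis 0) //.
by rewrite /cis mulr_natl cos2pi sin2pi cos0 sin0.
Qed.

Lemma hasd_cexp0 : hasd id cexp 0 1.
Proof.
have dcis : hasd ofr cis 0 'i%C.
  apply/hasdP; split.
    have -> : re ('i%C : R[i]) = - sin 0 by rewrite sin0 oppr0.
    exact: is_derive_cos.
  have -> : im ('i%C : R[i]) = cos 0 by rewrite cos0 im_i.
  exact: is_derive_sin.
have dexp : hasd ofr (fun t : R => ofr (expR t)) 0 1.
  apply/hasdP; split.
    have -> : re (1 : R[i]) = expR 0 by rewrite expR0 re1.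
    exact: is_derive_expR.
  exact: is_derive_cst.
(* The three terms of the decomposition of the remainder below are at most [e3], [2 * e3] and [e3]
   times [nc h]. *)
move=> e e0; pose e3 := Num.min 1 (e / 4).
have e30 : 0 < e3 by rewrite lt_min ltr01 divr_gt0.
have e31 : e3 <= 1 by rewrite ge_min lexx.
have e34 : 4 * e3 <= e by rewrite -ler_pdivlMl // mulrC ge_min lexx orbT.
have [d1 d10 H1] := dexp _ e30; have [d2 d20 H2] := dcis _ e30.
exists (Num.min (Num.min d1 d2) e3); first by rewrite lt_min e30 andbT lt_min d10.
move=> h; rewrite /id subr0 lt_min => /andP[+ h3]; rewrite lt_min => /andP[h1 h2].
set r := nc h in h1 h2 h3 *; have r0 : 0 <= r := nc_ge0 _.
have := H1 (re h); rewrite nc_ofrB subr0 => /(_ (le_lt_trans (re_le_nc h) h1)).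
rewrite expR0; set X := _ - _ - _ => HX.
have := H2 (im h); rewrite nc_ofrB subr0 => /(_ (le_lt_trans (im_le_nc h) h2)).
rewrite cis0; set Y := _ - _ - _ => HY.
have hE : h = ofr (re h) + 'i%C * ofr (im h) by exact: complexE.
have -> : cexp h - cexp 0 - 1 * h =
   X * cis (im h) + (1 + ofr (re h)) * Y + ofr (re h) * ('i%C * ofr (im h)).
  by rewrite cexp0 {2}hE /cexp /X /Y rmorph1 rmorph0; ring.
have a1 : nc (ofr (re h)) <= r by rewrite nc_ofr re_le_nc.
have b1 : nc ('i%C * ofr (im h)) <= r by rewrite ncM nc_i mul1r nc_ofr im_le_nc.
have HX' : nc X <= e3 * r by apply: le_trans HX _; rewrite ler_wpM2l ?(ltW e30) ?re_le_nc.
have HY' : nc Y <= e3 * r by apply: le_trans HY _; rewrite ler_wpM2l ?(ltW e30) ?im_le_nc.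
have c1 : nc (1 + ofr (re h)) <= 2.
  apply: le_trans (ncD _ _) _; rewrite nc1 [2](_ : _ = 1 + 1) // lerD2l.
  by apply: le_trans a1 _; apply: ltW; apply: lt_le_trans h3 e31.
apply: le_trans (ncD _ _) _; apply: le_trans (lerD (ncD _ _) (lexx _)) _.
rewrite (ncM X) nc_cis mulr1 (ncM (1 + _)) (ncM (ofr _)).
have m1 : nc (1 + ofr (re h)) * nc Y <= 2 * (e3 * r) by apply: ler_pM; rewrite ?nc_ge0.
have m2 : nc (ofr (re h)) * nc ('i%C * ofr (im h)) <= e3 * r.
  by apply: ler_pM; rewrite ?nc_ge0 //; apply: le_trans a1 (ltW h3).
have m3 : 4 * e3 * r <= e * r by rewrite ler_wpM2r.
by clear -HX' m1 m2 m3; lra.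
Qed.

Lemma hasd_cexp s : hasd id cexp s (cexp s).
Proof.
move=> e e0; have M0 : 0 < nc (cexp s) by rewrite nc_cexp expR_gt0.
have [|d d0 H] := hasd_cexp0 (e := e / nc (cexp s)); first by rewrite divr_gt0.
exists d => // y yd; rewrite /id in yd *.
have := H (y - s); rewrite /id subr0 => /(_ yd) {}H.
have -> : cexp y - cexp s - cexp s * (y - s) =
    cexp s * (cexp (y - s) - cexp 0 - 1 * (y - s)).
  have -> : cexp y = cexp (y - s) * cexp s by rewrite -cexpD subrK.
  by rewrite cexp0; ring.
rewrite ncM mulrC.
by move: H; rewrite mulrAC ler_pdivlMr.
Qed.

Lemma hasd_line (x y : R) : hasd ofr (fun t => Complex x t) y 'i%C.
Proof.
move=> e e0; exists 1 => // t _.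
have -> : Complex x t - Complex x y - 'i%C * (ofr t - ofr y) = 0.
  by apply: complex_ext; rewrite !reimCE; ring.
by rewrite nc0 mulr_ge0 ?nc_ge0 ?ltW.
Qed.
End ComplexExp.

(** * Cauchy's formula for the derivative at the centre of a disc *)

Section Cauchy.
Context {R : realType}.
Implicit Types (f df : R[i] -> R[i]) (s z w h : R[i]) (e d r : R).
Local Notation twopi := (2 * pi : R).

Lemma twopi_gt0 : 0 < twopi. Proof. by rewrite mulr_gt0 ?pi_gt0. Qed.

(** The circle of radius exp t about 0, with x as the angle; the logarithm of the radius is the
    parameter because Cauchy's theorem is applied in the logarithmic coordinate. *)
Definition circ (t x : R) : R[i] := cexp (Complex t x).

Lemma nc_circ t x : nc (circ t x) = expR t. Proof. by rewrite nc_cexp. Qed.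
Lemma circ_neq0 t x : circ t x != 0. Proof. exact: cexp_neq0. Qed.

Lemma hasd_circ t x : hasd ofr (circ t) x (circ t x * 'i%C).
Proof. exact: (hasd_comp (hasd_line t x) (hasd_cexp _)). Qed.

Lemma ccont_circ t x : ccont ofr (circ t) x.
Proof. exact: hasd_cont (hasd_circ _ _). Qed.

Lemma ccont_circV t x : ccont ofr (fun y => (circ t y)^-1) x.
Proof. by apply: ccont_inv; [exact: circ_neq0|exact: ccont_circ]. Qed.

Lemma cI_circV t : cI 0 twopi (fun x => (circ t x)^-1) = 0.
Proof.
have dV x : hasd ofr (fun y => 'i%C * (circ t y)^-1) x (circ t x)^-1.
  have -> : (circ t x)^-1 = 'i%C * (- (circ t x * circ t x)^-1 * (circ t x * 'i%C)).
    have -> : 'i%C * (- (circ t x * circ t x)^-1 * (circ t x * 'i%C)) =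
        - ('i%C * 'i%C) * (circ t x)^-1 by field; exact: circ_neq0.
    by rewrite mulii opprK mul1r.
  apply: hasdZ; apply: (hasd_comp (hasd_circ t x)).
  exact: hasd_inv (circ_neq0 t x).
rewrite (@cI_FTC _ 0 twopi (fun y => 'i%C * (circ t y)^-1)) //.
- by rewrite /circ cexp_2pi subrr.
- exact: ltW twopi_gt0.
- by move=> x _; exact: ccont_circV.
Qed.

Variables (f : R[i] -> R[i]).
Definition hol (A : set R[i]) := forall z, A z -> exists D, hasd id f z D.
Definition cball z0 r : set R[i] := [set z | nc (z - z0) < r].

Lemma cballD z0 w r : nc w < r -> cball z0 r (z0 + w).
Proof. by rewrite -[X in nc X](addKr z0) addrC. Qed.
Lemma cball0 z0 r : 0 < r -> cball z0 r z0.
Proof. by move=> r0; rewrite -[X in cball _ _ X]addr0; apply: cballD; rewrite nc0. Qed.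

Lemma icont_circ z0 r t a b : hol (cball z0 r) -> expR t < r ->
  icont a b (fun x => f (z0 + circ t x) * (circ t x)^-1).
Proof.
move=> hf tr x _; apply: ccontM; last exact: ccont_circV.
have [|D hD] := hf (z0 + circ t x).
  by apply: cballD; rewrite nc_circ.
apply: (ccont_comp (f := fun x => z0 + circ t x)); last exact: hasd_cont hD.
by apply: ccontD; [exact: ccont_cst|exact: ccont_circ].
Qed.

(* In the coordinate s, with z = z0 + exp s, circles become vertical segments
   and the two horizontal sides of a rectangle of height 2 pi cancel. *)
Lemma circle_indep z0 r (t1 t2 : R) : hol (cball z0 r) -> t1 <= t2 -> expR t2 < r ->
  cI 0 twopi (fun x => f (z0 + circ t1 x) * (circ t1 x)^-1) =
  cI 0 twopi (fun x => f (z0 + circ t2 x) * (circ t2 x)^-1).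
Proof.
move=> hf t12 tr.
pose g s := f (z0 + cexp s) * (cexp s)^-1.
have hg z : rect_in t1 t2 0 twopi z -> exists D, hasd id g z D.
  move=> [/andP[_ z2] _].
  have [|D hD] := hf (z0 + cexp z).
    by apply: cballD; rewrite nc_cexp; apply: le_lt_trans tr; rewrite ler_expR.
  have h1 : hasd id (fun s => f (z0 + cexp s)) z (D * (0 + cexp z)).
    apply: (hasd_comp (f := fun s => z0 + cexp s)) hD.
    by apply: hasdD; [exact: hasd_cst|exact: hasd_cexp].
  have h2 := hasd_comp (hasd_cexp z) (hasd_inv (cexp_neq0 z)).
  by eexists; exact: (hasdM h1 h2).
have := goursat t12 (ltW twopi_gt0) hg.
rewrite /rect_int (@eq_cI _ t1 t2 (fun t => g (Complex t twopi)) (fun t => g (Complex t 0))).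
  rewrite subrr add0r => /eqP; rewrite mulf_eq0 (negbTE neq0i) /= subr_eq0.
  by move=> /eqP <-.
by move=> x _; rewrite /g cexp_2pi.
Qed.

(** The radius does not matter, so it may tend to 0: in the first-order expansion at [z0] the
    constant term integrates to 0, the linear one to 2 pi D, and the remainder is arbitrarily
    small. *)
Lemma cauchy_deriv z0 r D t : hol (cball z0 r) -> hasd id f z0 D -> expR t < r ->
  cI 0 twopi (fun x => f (z0 + circ t x) * (circ t x)^-1) = ofr twopi * D.
Proof.
move=> hf hD tr; set I := cI _ _ _.
apply/eqP; rewrite -subr_eq0 -nc_eq0; apply/eqP/le_anti; rewrite nc_ge0 andbT.
apply/ler_addgt0Pl => e e0; rewrite addr0.
pose e1 := e / twopi; have e10 : 0 < e1 by rewrite divr_gt0 ?twopi_gt0.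
have [d d0 Hd] := hD e1 e10.
have [t1 [t1t t1d]] : exists t1, t1 <= t /\ expR t1 < d.
  have d2 : 0 < d / 2 by rewrite divr_gt0.
  exists (Num.min t (ln (d / 2))); split; first by rewrite ge_min lexx.
  apply: (@le_lt_trans _ _ (d / 2)); last by rewrite ltr_pdivrMr // ltr_pMr // ltr1n.
  by rewrite -[leRHS]lnK ?posrE // ler_expR ge_min lexx orbT.
have t1r : expR t1 < r by apply: le_lt_trans tr; rewrite ler_expR.
rewrite /I -(circle_indep hf t1t tr).
pose E (x : R) : R[i] := (f (z0 + circ t1 x) - f z0 - D * circ t1 x) * (circ t1 x)^-1.
have ic1 : icont 0 twopi (fun x => f (z0 + circ t1 x) * (circ t1 x)^-1) by exact: icont_circ hf _.
have ic2 : icont 0 twopi (fun x : R => (circ t1 x)^-1) by move=> x _; exact: ccont_circV.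
have EE x : f (z0 + circ t1 x) * (circ t1 x)^-1 = E x + (f z0 * (circ t1 x)^-1 + D).
  by rewrite /E; field; exact: circ_neq0.
have icE : icont 0 twopi E.
  have -> : E = (fun x => f (z0 + circ t1 x) * (circ t1 x)^-1 - (f z0 * (circ t1 x)^-1 + D)).
    by apply/funext => x; rewrite EE addrK.
  by apply: icontB => //; apply: icontD; [exact: icontZ|exact: icont_cst].
rewrite (@eq_cI _ _ _ _ (fun x => E x + (f z0 * (circ t1 x)^-1 + D))) //.
rewrite cID //; last by apply: icontD; [exact: icontZ|exact: icont_cst].
rewrite cID; [|exact: icontZ|exact: icont_cst].
rewrite cIZ // cI_circV mulr0 add0r cI_cst ?(ltW twopi_gt0) // subr0.
rewrite [D * _]mulrC addrK.
have -> : e = e1 * (twopi - 0) by rewrite subr0 /e1 divfK // gt_eqF ?twopi_gt0.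
apply: nc_cI_bound => //; first exact: ltW twopi_gt0.
move=> x _; rewrite /E ncM ncV ler_pdivrMr ?nc_gt0 ?circ_neq0 //.
have E1 : z0 + circ t1 x - z0 = circ t1 x by rewrite addrAC subrr add0r.
by have := Hd (z0 + circ t1 x); rewrite /id E1 nc_circ; apply.
Qed.

Lemma cauchy_est z0 r D M : 0 < r -> hol (cball z0 r) -> hasd id f z0 D ->
  (forall z, cball z0 r z -> nc (f z) <= M) -> nc D * r <= M.
Proof.
move=> r0 hf hD hM.
have M0 : 0 <= M.
  by apply: le_trans (hM z0 _); [exact: nc_ge0|exact: cball0].
rewrite leNgt; apply/negP => MD.
have D0 : 0 < nc D.
  by rewrite lt_def nc_ge0 andbT; apply: contraTneq MD => ->; rewrite mul0r -leNgt.
have q0 : M / nc D < r by rewrite ltr_pdivrMr // mulrC.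
(* [MD] puts M / nc D below r. On a circle of radius [k] between them the formula gives nc D <= M /
   k, against the choice of [k]. *)
pose k := (M / nc D + r) / 2.
have k1 : M / nc D < k by rewrite midf_lt.
have k2 : k < r by rewrite midf_lt.
have k0 : 0 < k by apply: le_lt_trans k1; rewrite divr_ge0 ?nc_ge0.
have kE : expR (ln k) = k by rewrite lnK.
have := @cauchy_deriv z0 r D (ln k) hf hD; rewrite kE => /(_ k2) C.
have := @nc_cI_bound _ 0 twopi (fun x => f (z0 + circ (ln k) x) * (circ (ln k) x)^-1) (M / k).
rewrite C => /(_ (ltW twopi_gt0)) H.
have : nc (ofr twopi * D) <= M / k * (twopi - 0).
  apply: H; first by apply: icont_circ hf _; rewrite kE.
  move=> x _; rewrite ncM ncV nc_circ kE ler_wpM2r ?invr_ge0 ?(ltW k0) //.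
  by apply: hM; apply: cballD; rewrite nc_circ kE.
rewrite subr0 ncM nc_ofr ger0_norm ?(ltW twopi_gt0) // mulrC ler_pM2r ?twopi_gt0 //.
rewrite ler_pdivlMr // leNgt => /negP; apply.
by move: k1; rewrite ltr_pdivrMr // mulrC.
Qed.
End Cauchy.

(** * The derivative of a holomorphic function is holomorphic *)

Section DerivativeHolomorphic.
Context {R : realType}.
Implicit Types (f df : R[i] -> R[i]) (s z w h : R[i]) (e d r : R).
Local Notation twopi := (2 * pi : R).

(** Multiplication by the conjugate of the error [D] reduces the claim to the real mean value
    theorem, and one factor [nc D] cancels. *)
Lemma mvt_seg (p dp : R -> R[i]) (a b K : R) (c : R[i]) : a <= b ->
  (forall t, a <= t <= b -> hasd ofr p t (dp t)) ->
  (forall t, a <= t <= b -> nc (dp t - c) <= K) ->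
  nc (p b - p a - c * ofr (b - a)) <= K * (b - a).
Proof.
move=> ab hp hK; set D := p b - p a - _.
have [D0|D0] := eqVneq D 0.
  rewrite D0 nc0 mulr_ge0 ?subr_ge0 //.
  by apply: le_trans (hK a _); rewrite ?nc_ge0 ?lexx.
pose u (t : R) := (D^*)%C * (p t - c * ofr t).
have hu t : a <= t <= b -> hasd ofr u t ((D^*)%C * (dp t - c * 1)).
  move=> ht; apply: hasdZ; apply: hasdB; first exact: hp.
  by apply: hasdZ; exact: hasd_j.
have [||t ht] := @MVT_segment R (fun t => re (u t)) (fun t => re ((D^*)%C * (dp t - c * 1))) a b ab.
- by move=> t; rewrite in_itv /= => /andP[t1 t2]; have /hu/hasdP[] : a <= t <= b by rewrite !ltW.
- by have [] := @ccont_within R a b u (fun t ht => hasd_cont (hu t ht)).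
rewrite in_itv /= in ht.
have -> : re (u b) - re (u a) = nc D ^+ 2.
  have -> : nc D ^+ 2 = re (D * (D^*)%C) by rewrite mul_conj.
  rewrite -reN -reD; congr re; rewrite /u [X in _ = X * _](_ : D = p b - p a - c * (ofr b - ofr a)); last by rewrite ofrB.
  ring.
move=> E; have : nc D ^+ 2 <= nc D * K * (b - a).
  rewrite E ler_wpM2r ?subr_ge0 //.
  apply: le_trans (ler_norm _) _; apply: le_trans (re_le_nc _) _.
  by rewrite ncM nc_conj mulr1 ler_wpM2l ?nc_ge0 // hK.
by rewrite expr2 -mulrA ler_pM2l // nc_gt0.
Qed.

Lemma mvt_cball f df z0 r K (c : R[i]) z w :
  (forall z, cball z0 r z -> hasd id f z (df z)) ->
  (forall t : R, 0 <= t <= 1 -> cball z0 r (z + w * ofr t)) ->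
  (forall t : R, 0 <= t <= 1 -> nc (df (z + w * ofr t) - c) <= K) ->
  nc (f (z + w) - f z - c * w) <= K * nc w.
Proof.
move=> hf hz hK.
have := @mvt_seg (fun t => f (z + w * ofr t)) (fun t => df (z + w * ofr t) * (0 + w * 1)) 0 1
  (K * nc w) (c * w) ler01.
rewrite subr0 !mulr1 rmorph0 mulr0 addr0; apply.
  move=> t ht; apply: (hasd_comp (j := ofr) (f := fun t => z + w * ofr t)) (hf _ (hz t ht)).
  by rewrite -[w in 0 + w]mulr1; apply: hasdD; [exact: hasd_cst|apply: hasdZ; exact: hasd_j].
move=> t ht; rewrite add0r -mulrBl ncM ler_wpM2r ?nc_ge0 //; exact: hK.
Qed.

Lemma cball_seg z0 r z w (t : R) : cball z0 r z -> cball z0 r (z + w) -> 0 <= t <= 1 ->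
  cball z0 r (z + w * ofr t).
Proof.
rewrite /cball => h1 h2 /andP[t0 t1].
change (is_true (nc (z - z0) < r)) in h1; change (is_true (nc (z + w - z0) < r)) in h2.
change (is_true (nc (z + w * ofr t - z0) < r)).
have -> : z + w * ofr t - z0 = (z - z0) * ofr (1 - t) + (z + w - z0) * ofr t.
  by rewrite -ofrB rmorph1; ring.
apply: le_lt_trans (ncD _ _) _; rewrite !ncM !nc_ofr !ger0_norm ?subr_ge0 //.
apply: (@le_lt_trans _ _ (Num.max (nc (z - z0)) (nc (z + w - z0)))); last by rewrite gt_max h1.
set m := Num.max _ _; have -> : m = m * (1 - t) + m * t by ring.
by apply: lerD; rewrite ler_wpM2r ?subr_ge0 // le_max lexx ?orbT.
Qed.

(* The Cauchy formula with a fixed radius makes the derivative Lipschitz, and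
   then differentiable under the integral sign. *)
Lemma deriv_derivable f df z0 r : 0 < r ->
  (forall z, cball z0 r z -> hasd id f z (df z)) -> exists E, hasd id df z0 E.
Proof.
move=> r0 hf0.
have [d d0 hd] := ccont_bnd (hasd_cont (hf0 z0 (cball0 z0 r0))).
set M := nc (f z0) + 1 in hd.
pose r4 := Num.min d r; have r40 : 0 < r4 by rewrite lt_min d0.
have sub z : cball z0 r4 z -> cball z0 r z.
  by move=> h; apply: lt_le_trans h _; rewrite ge_min lexx orbT.
have hf z : cball z0 r4 z -> hasd id f z (df z) by move=> /sub; exact: hf0.
have hM z : cball z0 r4 z -> nc (f z) <= M.
  by move=> h; apply: hd; apply: lt_le_trans h _; rewrite ge_min lexx.
clearbody r4 M; clear hf0 sub hd.
(* Each use of a circle costs [q]: [df] is bounded on the ball of radius 3 q and Lipschitz on that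
   of radius 2 q, and the points [z0] and [z0 + h] of the final expansion lie in that of radius
   q. *)
pose q := r4 / 4; have q0 : 0 < q by rewrite divr_gt0.
have q4 : r4 = 4 * q by rewrite /q mulrC divfK // pnatr_eq0.
have tri a b z : cball z0 a z -> forall w, nc (w - z) < b -> cball z0 (a + b) w.
  move=> h w hw; apply: le_lt_trans (nc_tri _ z _) _.
  by rewrite addrC ltrD.
have hol_in k z : cball z0 k z -> k <= 2 * q -> hol f (cball z (2 * q)).
  move=> hz kq w hw; exists (df w); apply: hf.
  apply: lt_le_trans (tri _ _ _ hz w hw) _; rewrite q4.
  by clear -kq; lra.
have M0 : 0 <= M by apply: le_trans (hM z0 (cball0 _ r40)); exact: nc_ge0.
pose M1 := M / q.
have M10 : 0 <= M1 by rewrite divr_ge0 // ltW.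
have b1 z : cball z0 (3 * q) z -> nc (df z) <= M1.
  move=> hz; rewrite ler_pdivlMr //.
  have sub w : cball z q w -> cball z0 r4 w.
    move=> hw; apply: lt_le_trans (tri _ _ _ hz w hw) _; rewrite q4; lra.
  apply: (cauchy_est q0 _ (hf z _)).
  - by move=> w /sub/hf; exists (df w).
  - by apply: sub; exact: cball0.
  - by move=> w /sub/hM.
have lipf z w : cball z0 (3 * q) z -> cball z0 (3 * q) (z + w) ->
    nc (f (z + w) - f z) <= M1 * nc w.
  move=> hz hw; have := @mvt_cball f df z0 r4 M1 0 z w hf.
  rewrite mul0r subr0; apply.
    move=> t ht; apply: lt_le_trans (cball_seg hz hw ht) _; rewrite q4; lra.
  by move=> t ht; rewrite subr0; apply: b1; exact: cball_seg.
pose t := ln q; have tq : expR t = q by rewrite lnK.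
have q2 : expR t < 2 * q by rewrite tq; lra.
have form k z : cball z0 k z -> k <= 2 * q ->
    cI 0 twopi (fun x => f (z + circ t x) * (circ t x)^-1) = ofr twopi * df z.
  move=> hz kq; apply: (cauchy_deriv (hol_in k z hz kq)) => //.
  apply: hf; apply: lt_le_trans hz _; rewrite q4; lra.
pose M2 := M1 / q.
have M20 : 0 <= M2 by rewrite divr_ge0 // ltW.
have nc2 : nc (ofr twopi : R[i]) = twopi by rewrite nc_ofr ger0_norm ?(ltW twopi_gt0).
have circ_in k z x : cball z0 k z -> cball z0 (k + q) (z + circ t x).
  move=> hz; rewrite -tq.
  have := nc_circ t x; rewrite -[X in nc X](addKr z) [- z + _]addrC => hc.
  apply: le_lt_trans (nc_tri _ z _) _.
  by rewrite hc addrC ltrD2r.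
have lipd z w : cball z0 (2 * q) z -> cball z0 (2 * q) (z + w) ->
    nc (df (z + w) - df z) <= M2 * nc w.
  move=> hz hw; have F1 := form _ _ hz (lexx _); have F2 := form _ _ hw (lexx _).
  rewrite -(ler_pM2l twopi_gt0) -nc2 -ncM mulrBr -F1 -F2.
  have i1 := @icont_circ _ f _ _ t 0 twopi (hol_in _ _ hw (lexx _)) q2.
  have i2 := @icont_circ _ f _ _ t 0 twopi (hol_in _ _ hz (lexx _)) q2.
  rewrite -cIB // nc2 [leRHS](_ : _ = M2 * nc w * (twopi - 0)); last by rewrite subr0 mulrC.
  apply: nc_cI_bound; [exact: ltW twopi_gt0|exact: icontB|move=> x _].
  rewrite -mulrBl ncM ncV nc_circ tq ler_pdivrMr // mulrAC divfK ?gt_eqF //.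
  have := lipf (z + circ t x) w; rewrite addrAC; apply.
    by apply: lt_le_trans (circ_in _ _ x hz) _; lra.
  by apply: lt_le_trans (circ_in _ _ x hw) _; lra.
have taylor z w : cball z0 (2 * q) z -> cball z0 (2 * q) (z + w) ->
    nc (f (z + w) - f z - df z * w) <= M2 * nc w * nc w.
  move=> hz hw; apply: (mvt_cball hf) => s hs.
    by apply: lt_le_trans (cball_seg hz hw hs) _; rewrite q4; lra.
  apply: le_trans (lipd _ _ hz _) _; first exact: cball_seg.
  rewrite ncM ler_wpM2l // ler_piMr ?nc_ge0 // nc_ofr ger0_norm; by case/andP: hs.
have cdf x : ccont ofr (fun x => df (z0 + circ t x)) x.
  have in0 y : cball z0 (2 * q) (z0 + circ t y).
    by apply: cballD; rewrite nc_circ.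
  move=> e e0; have e1 : 0 < e / (M2 + 1) by rewrite divr_gt0 // ltr_wpDl.
  have [k k0 hk] := ccont_circ t x e1.
  exists k => // y /hk hy.
  have := lipd (z0 + circ t x) (circ t y - circ t x) (in0 x).
  rewrite (_ : z0 + circ t x + (circ t y - circ t x) = z0 + circ t y); last by ring.
  move=> /(_ (in0 y)) h; apply: le_trans h _.
  apply: le_trans (ler_wpM2l M20 hy) _.
  by rewrite mulrCA ger_pMr // ler_pdivrMr ?ltr_wpDl // mul1r lerDl.
pose E := (ofr twopi)^-1 * cI 0 twopi (fun x => df (z0 + circ t x) * (circ t x)^-1).
exists E => e e0.
pose k := Num.min q (e / (M2 / q + 1)).
have den : 0 < M2 / q + 1 by rewrite ltr_wpDl // divr_ge0 // ltW.
have k0 : 0 < k by rewrite lt_min q0 divr_gt0.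
exists k => // y hy.
pose h := y - z0; have yE : y = z0 + h by rewrite /h addrC subrK.
have hh : nc h < k by exact: hy.
have hq : nc h < q by apply: lt_le_trans hh _; rewrite ge_min lexx.
have he : nc h * (M2 / q + 1) < e.
  by rewrite -ltr_pdivlMr //; apply: lt_le_trans hh _; rewrite ge_min lexx orbT.
rewrite /id -/h yE; clearbody h.
have hz0 : cball z0 q z0 by exact: cball0.
have hz1 : cball z0 q (z0 + h) by exact: cballD.
have qq : q <= 2 * q by lra.
have F1 := form _ _ hz0 qq; have F2 := form _ _ hz1 qq.
have n2 : (ofr twopi : R[i]) != 0 by rewrite ofr_eq0 gt_eqF ?twopi_gt0.
rewrite -(ler_pM2l twopi_gt0) -[X in X * nc (_ - _)]nc2 -ncM.
have i0 := @icont_circ _ f _ _ t 0 twopi (hol_in _ _ hz0 qq) q2.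
have i1 := @icont_circ _ f _ _ t 0 twopi (hol_in _ _ hz1 qq) q2.
have i2 : icont 0 twopi (fun x => df (z0 + circ t x) * (circ t x)^-1).
  by move=> x _; apply: ccontM; [exact: cdf|exact: ccont_circV].
have -> : ofr twopi * (df (z0 + h) - df z0 - E * h) =
    cI 0 twopi (fun x => (f (z0 + h + circ t x) * (circ t x)^-1 -
      f (z0 + circ t x) * (circ t x)^-1) - h * (df (z0 + circ t x) * (circ t x)^-1)).
  rewrite cIB ?cIB ?cIZ //; [|exact: icontB|exact: icontZ].
  rewrite F1 F2 !mulrBr /E; congr (_ - _).
  set I := cI _ _ _; set c := ofr _ in n2 *.
  clearbody c; by field.
apply: le_trans (nc_cI_bound (M := M2 * nc h * nc h / q) _ _ _) _.
- exact: ltW twopi_gt0.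
- by apply: icontB; [exact: icontB|exact: icontZ].
- move=> x _.
  have -> : f (z0 + h + circ t x) * (circ t x)^-1 - f (z0 + circ t x) * (circ t x)^-1
     - h * (df (z0 + circ t x) * (circ t x)^-1) =
     (f (z0 + circ t x + h) - f (z0 + circ t x) - df (z0 + circ t x) * h) * (circ t x)^-1.
    by rewrite [z0 + _ + h]addrAC; ring.
  rewrite ncM ncV nc_circ tq ler_wpM2r ?invr_ge0 ?(ltW q0) //.
  have ci := circ_in _ _ x hz0; have ci1 := circ_in _ _ x hz1.
  apply: taylor; first by rewrite [2 * q]mulr_natl mulr2n.
  by rewrite addrAC [2 * q]mulr_natl mulr2n.
rewrite subr0 mulrC ler_pM2l ?twopi_gt0 //.
have -> : M2 * nc h * nc h / q = nc h * (M2 / q) * nc h by ring.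
rewrite ler_wpM2r ?nc_ge0 //; apply: le_trans (ltW he).
by rewrite ler_wpM2l ?nc_ge0 // lerDl.
Qed.
End DerivativeHolomorphic.

(** * The iterated WKB approximation *)

Section SquareRoot.
Context {R : realType}.
Implicit Types (w v : R[i]) (d e : R).

(* The square root with positive imaginary part, away from [0, +oo[. *)
Definition csq w : R[i] :=
  let y := Num.sqrt ((nc w - re w) / 2) in Complex (im w / (2 * y)) y.

Lemma csq_spec d w : 0 < d -> re w <= - d ->
  [/\ csq w * csq w = w, Num.sqrt d <= im (csq w), 0 < im (csq w)
    & re (csq w) * (2 * im (csq w)) = im w].
Proof.
move=> d0 wd.
have n1 : d <= nc w by apply: le_trans (re_le_nc w); rewrite -normrN; apply: le_trans (ler_norm _); lra.
have q0 : d <= (nc w - re w) / 2 by lra.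
have y2 : Num.sqrt ((nc w - re w) / 2) ^+ 2 = (nc w - re w) / 2.
  by rewrite sqr_sqrtr // (le_trans (ltW d0)).
have yd : Num.sqrt d <= Num.sqrt ((nc w - re w) / 2) by rewrite ler_sqrt // (le_trans (ltW d0)).
have y0 : 0 < Num.sqrt ((nc w - re w) / 2).
  by apply: lt_le_trans yd; rewrite sqrtr_gt0.
rewrite /csq; set y := Num.sqrt _ in y2 yd y0 *.
have yn : y != 0 by rewrite gt_eqF.
split; rewrite ?reC ?imC //; last by rewrite divfK // mulf_neq0 // pnatr_eq0.
apply: complex_ext; rewrite !reimE !reC !imC.
  have E : im w ^+ 2 = (nc w - re w) * (nc w + re w) by rewrite -subr_sqr sqr_nc; ring.
  have y20 : y ^+ 2 != 0 by rewrite expf_neq0.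
  apply: (mulfI (x := 4 * y ^+ 2)); first by rewrite mulf_neq0 // pnatr_eq0.
  have -> : 4 * y ^+ 2 * (im w / (2 * y) * (im w / (2 * y)) - y * y) =
      im w ^+ 2 - 4 * y ^+ 2 * y ^+ 2 by field.
  by rewrite E !y2; field.
by field.
Qed.

(** w - v is the product of the difference and the sum of the roots, and the sum stays away from 0
    because both imaginary parts are at least sqrt d. *)
Lemma csq_lip d w v : 0 < d -> re w <= - d -> re v <= - d ->
  nc (csq w - csq v) * (2 * Num.sqrt d) <= nc (w - v).
Proof.
move=> d0 /(csq_spec d0)[w1 w2 w3 _] /(csq_spec d0)[v1 v2 v3 _].
have -> : w - v = (csq w - csq v) * (csq w + csq v) by rewrite -{1}w1 -{1}v1; ring.
rewrite ncM ler_wpM2l ?nc_ge0 //.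
apply: le_trans (im_le_nc _); apply: le_trans (ler_norm _); rewrite imD.
by rewrite mulr_natl mulr2n lerD.
Qed.

Lemma csq_bound d w K : 0 < d -> re w <= - d -> nc w <= K -> nc (csq w) <= K + 1.
Proof.
move=> d0 /(csq_spec d0)[w1 _ _ _] wK.
have n0 := nc_ge0 (csq w).
have : nc (csq w) * nc (csq w) <= K by rewrite -ncM w1.
nra.
Qed.

Lemma hasd_csq d w : 0 < d -> re w <= - (2 * d) ->
  hasd id csq w (2%:R * csq w)^-1.
Proof.
move=> d0 wd e e0.
have wd1 : re w <= - d by lra.
have k0 : 0 < Num.sqrt d by rewrite sqrtr_gt0.
set k := Num.sqrt d in k0.
(* [d] keeps [v] in the half-plane where [csq_lip] applies. The remainder is (v - w)(t - s) / ((t +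
   s) 2 s) up to sign, with t and s the two roots, hence at most nc (v - w)^2 / (8 k^3). *)
pose r := Num.min d (e * (8 * k ^+ 3)).
exists r; first by rewrite lt_min d0 !mulr_gt0 ?exprn_gt0.
move=> v; rewrite /id => vr.
have vd : nc (v - w) < d by apply: lt_le_trans vr _; rewrite ge_min lexx.
have ve : nc (v - w) < e * (8 * k ^+ 3) by apply: lt_le_trans vr _; rewrite ge_min lexx orbT.
have vd1 : re v <= - d.
  have := le_lt_trans (re_le_nc _) vd; rewrite reD reN ltr_norml => /andP[_]; lra.
have L := csq_lip d0 vd1 wd1; rewrite -/k in L.
have [w1 w2 w3 _] := csq_spec d0 wd1; have [v1 v2 v3 _] := csq_spec d0 vd1.
rewrite -/k in w2 v2.
set s := csq w in L w1 w2 w3 *; set t := csq v in L v1 v2 v3 *.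
have sn : k <= nc s by apply: le_trans w2 _; apply: le_trans (ler_norm _) (im_le_nc _).
have stn : 2 * k <= nc (t + s).
  apply: le_trans (le_trans (ler_norm _) (im_le_nc _)); rewrite imD; lra.
have s0 : s != 0 by rewrite -nc_gt0 (lt_le_trans k0).
have st0 : t + s != 0 by rewrite -nc_gt0; apply: lt_le_trans stn; rewrite mulr_gt0.
have -> : t - s - (2%:R * s)^-1 * (v - w) = - ((v - w) * (t - s) * ((t + s) * (2%:R * s))^-1).
  rewrite -w1 -v1; have n2 : (2%:R : R[i]) != 0 by rewrite pnatr_eq0.
  by field; apply/andP.
rewrite ncN !ncM ncV !ncM -mulrA [leRHS]mulrC ler_wpM2l ?nc_ge0 //.
have n2 : nc (2%:R : R[i]) = 2.
  by rewrite -[X in nc X](rmorph_nat (real_complex R)) nc_ofr ger0_norm.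
have den : 0 < nc (t + s) * (nc 2%:R * nc s) by rewrite !mulr_gt0 ?nc_gt0 // pnatr_eq0.
rewrite ler_pdivrMr // n2.
have P1 : 2 * k * (2 * k) <= nc (t + s) * (2 * nc s).
  apply: ler_pM => //; [by rewrite mulr_ge0 ?ltW|by rewrite mulr_ge0 ?ltW|by rewrite ler_wpM2l].
apply: le_trans (ler_wpM2l (ltW e0) P1).
have : nc (t - s) * (2 * k) <= e * (2 * k * (2 * k)) * (2 * k).
  apply: le_trans L _; apply: le_trans (ltW ve) _.
  by rewrite le_eqVlt; apply/orP; left; apply/eqP; ring.
by rewrite ler_pM2r // mulr_gt0.
Qed.
End SquareRoot.

(** * The analytic continuation on a neighbourhood of the interval *)

Section Bridge.
Context {R : realType}.
Implicit Types (f : R[i] -> R[i]) (G : set R[i]).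

Lemma ltc_ofr (e : R[i]) : 0 < e -> exists2 e' : R, 0 < e' & e = ofr e'.
Proof.
by case: e => a b; rewrite ltcE /= => /andP[/eqP -> a0]; exists a.
Qed.

Lemma nbhs_cball G (z : R[i]) : nbhs z G -> exists2 e : R, 0 < e & cball z e `<=` G.
Proof.
move=> [e0 /= /ltc_ofr[e e1 ->] H]; exists e => // w hw; apply: H.
by rewrite /ball /= distrC normr_nc ltcR.
Qed.

Lemma open_cball G (z : R[i]) : open G -> G z -> exists2 e : R, 0 < e & cball z e `<=` G.
Proof. by move=> oG Gz; apply: nbhs_cball; exact: open_nbhs_nbhs. Qed.

Lemma derivable_hasd f (z : R[i]) : derivable f z 1 -> exists D, hasd id f z D.
Proof.
move=> /cvg_ex[D /cvgrPdist_le hD]; exists D => e e0.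
have e0' : 0 < (ofr e : R[i]) by rewrite ltcE /= eqxx.
have [d0 /= /ltc_ofr[d dp ->] H] := hD _ e0'.
exists d => // y yd; rewrite /id in yd *.
have [->|yz] := eqVneq y z; first by rewrite !subrr mulr0 subrr nc0 mulr0.
have h0 : y - z != 0 by rewrite subr_eq0.
have := H (y - z); rewrite /ball /= sub0r normrN normr_nc ltcR => /(_ yd h0).
rewrite normr_nc lecR /GRing.scale /= mulr1 subrK => Hy.
have -> : f y - f z - D * (y - z) = - ((D - (y - z)^-1 * (f y - f z)) * (y - z)).
  by field.
by rewrite ncN ncM ler_wpM2r ?nc_ge0.
Qed.

(** Compactness of the segment in its covering form, taken along the filter of radii tending to 0
    from above. *)
Lemma uniform_radius (a b : R) (Q : R -> R -> Prop) :
  (forall x r s, 0 < s -> s <= r -> Q x r -> Q x s) ->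
  (forall x, a <= x <= b -> exists2 r, 0 < r & forall y, `|y - x| < r -> Q y r) ->
  exists2 r, 0 < r & forall x, a <= x <= b -> Q x r.
Proof.
move=> mono loc.
have := @segment_compact R a b; rewrite compact_near_coveringP.
move=> /(_ R (0^'+) (fun r x => 0 < r -> Q x r) _) H.
have /H : forall x, [set` `[a, b]] x -> \forall x' \near x & i \near 0^'+, 0 < i -> Q x' i.
  move=> x; rewrite /= in_itv /= => /loc[r r0 hr].
  exists ([set y | `|y - x| < r], [set i : R | i < r]) => /=.
    split; first by exists r => // y /=; rewrite /ball /= distrC.
    exists r => // i /=; rewrite sub0r normrN => ir i0.
    by apply: le_lt_trans ir; exact: ler_norm.
  move=> [y i] /= [yr ir] i0.
  by apply: mono i0 (ltW ir) _; exact: hr.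
move=> [e /= e0 He].
exists (e / 2); first by rewrite divr_gt0.
move=> x hx; apply: (He (e / 2)); rewrite /= ?in_itv ?divr_gt0 //.
by rewrite sub0r normrN ger0_norm ?ltr_pdivrMr ?ltr_pMr ?ltr1n // divr_ge0 // ltW.
Qed.

(** A neighbourhood of [-1, 1] with the width as its only parameter: Cauchy's estimate on a narrower
    tube costs exactly the difference of the widths. *)
Definition tube (s : R) : set R[i] := [set z | exists2 x : R, -1 <= x <= 1 & nc (z - ofr x) < s].

Lemma tube_cball s r z : tube s z -> cball z r `<=` tube (s + r).
Proof.
move=> [x hx zx] w hw; exists x => //.
by apply: le_lt_trans (nc_tri _ z _) _; rewrite addrC ltrD.
Qed.

Lemma sub_tube s r : s <= r -> tube s `<=` tube r.
Proof. by move=> sr z [x hx zx]; exists x => //; exact: lt_le_trans zx sr. Qed.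

Lemma tube_real s (x : R) : 0 < s -> -1 <= x <= 1 -> tube s (ofr x).
Proof. by move=> s0 hx; exists x => //; rewrite subrr nc0. Qed.

(** On the interval [f] is real, so on a thin tube its imaginary part is at most [k]. This is what
    keeps the values of [f] away from a [lam] well below the real axis. *)
Lemma AM_tube q G f (k : R) : AM_ext q G f -> 0 < k ->
  exists rho M, [/\ 0 < rho, forall z, tube rho z -> exists D, hasd id f z D,
    forall z, tube rho z -> nc (f z) <= M & forall z, tube rho z -> `|im (f z)| <= k].
Proof.
move=> hq k0.
have cf x : -1 <= x <= 1 -> ccont id f (ofr x).
  by move=> hx; have [D hD] := derivable_hasd (AM_holo hq (AM_interval hq hx)); exact: hasd_cont hD.
have cq x : -1 <= x <= 1 -> ccont ofr (fun x => f (ofr x)) x.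
  move=> hx; exact: (ccont_comp (f := ofr) (ccont_j _ _) (cf x hx)).
have [M hM] : exists M, forall x, -1 <= x <= 1 -> nc (f (ofr x)) <= M.
  have [c1 _] := @ccont_within R (-1) 1 _ (@icont_nc _ _ _ (fun x => f (ofr x)) cq).
  have [|c _ Hc] := EVT_max _ c1; first by lra.
  by exists (nc (f (ofr c))) => x hx; apply: Hc; rewrite in_itv.
have [|x hx|r r0 Hr] := @uniform_radius (-1) 1 (fun x r => -1 <= x <= 1 -> forall z, cball (ofr x) r z ->
    [/\ exists D, hasd id f z D, nc (f z) <= M + 1 & `|im (f z)| <= k]).
- by move=> x r s s0 sr H hx z hz; apply: H => //; exact: lt_le_trans hz sr.
- have [r1 r10 H1] := open_cball (AM_open hq) (AM_interval hq hx).
  have m0 : 0 < Num.min 1 k by rewrite lt_min ltr01.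
  have [r2 r20 H2] := cf x hx _ m0.
  pose r := Num.min r1 r2; have r0 : 0 < r by rewrite lt_min r10.
  exists (r / 2); first by rewrite divr_gt0.
  move=> y yx hy z zy.
  have zx : nc (z - ofr x) < r.
    apply: le_lt_trans (nc_tri _ (ofr y) _) _.
    by rewrite nc_ofrB [r]splitr ltrD.
  have Gz : G z by apply: H1; apply: lt_le_trans zx _; rewrite ge_min lexx.
  have fz : nc (f z - f (ofr x)) <= Num.min 1 k.
    by apply: H2; apply: lt_le_trans zx _; rewrite ge_min lexx orbT.
  split.
  + exact: derivable_hasd (AM_holo hq Gz).
  + have -> : f z = f (ofr x) + (f z - f (ofr x)) by ring.
    apply: le_trans (ncD _ _) _; apply: lerD; first exact: hM.
    by apply: le_trans fz _; rewrite ge_min lexx.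
  + have -> : im (f z) = im (f z - f (ofr x)).
      by rewrite imD imN (AM_extends hq hx) im_ofr subr0.
    by apply: le_trans (im_le_nc _) _; apply: le_trans fz _; rewrite ge_min lexx orbT.
exists r, (M + 1); split=> // z [x hx zx]; by have [] := Hr x hx hx z zx.
Qed.
End Bridge.

(** * The iteration on shrinking tubes *)

Section WKB.
Context {R : realType}.
Implicit Types (g : R[i] -> R[i]) (z : R[i]) (e s : R).

Definition cder g z : R[i] := xget 0 [set D | hasd id g z D].

Lemma cderP g z : (exists D, hasd id g z D) -> hasd id g z (cder g z).
Proof. by move=> [D hD]; exact: (@xgetI _ 0 [set D | hasd id g z D] D hD). Qed.

Lemma cder_est g s r M z : 0 < r -> hol g (tube (s + r)) ->
  (forall w, tube (s + r) w -> nc (g w) <= M) -> tube s z -> nc (cder g z) * r <= M.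
Proof.
move=> r0 hg hM hz; have sub := tube_cball hz.
apply: (cauchy_est r0 (f := g) (z0 := z)).
- by move=> w /sub/hg.
- by apply: cderP; apply: hg; apply: sub; exact: cball0.
- by move=> w /sub/hM.
Qed.

Lemma cder_hol g s r z : 0 < r -> hol g (tube (s + r)) -> tube s z ->
  exists E, hasd id (cder g) z E.
Proof.
move=> r0 hg hz; apply: (@deriv_derivable _ g (cder g) z r r0) => w /(tube_cball hz) hw.
by apply: cderP; exact: hg.
Qed.

Variables (f : R[i] -> R[i]) (rho M d B : R) (lam : R[i]) (eps : R) (N : nat).
Hypotheses (rho0 : 0 < rho) (d0 : 0 < d) (B0 : 0 <= B) (eps0 : 0 < eps) (N0 : (0 < N)%N).
Hypotheses (hf : hol f (tube rho)) (hM : forall z, tube rho z -> nc (f z) <= M).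
Hypotheses (hd : forall z, tube rho z -> `|im (f z)| <= d / 4).
Hypotheses (lamd : im lam <= - d) (lamB : nc lam <= B).

Definition pot z : R[i] := 'i%C * (f z - lam).
(** Iterates for the Riccati equation P^2 - eps P' = V, which P = - eps u' / u satisfies if eps^2
    u'' = V u. *)
Fixpoint wkb_P (n : nat) : R[i] -> R[i] :=
  fun z => csq (pot z + if n is m.+1 then ofr eps * cder (wkb_P m) z else 0).
Definition wkb_W (n : nat) z : R[i] :=
  pot z + if n is m.+1 then ofr eps * cder (wkb_P m) z else 0.

Lemma wkb_PE n z : wkb_P n z = csq (wkb_W n z). Proof. by case: n. Qed.

(** [K] bounds the radicands, [B1] their roots, and [kap] the imaginary parts of the roots from
    below. The n-th iterate is controlled on the tube of width [s n]: each step gives up [h], and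
    rho / 4 is left after N steps. [E0] bounds the first correction. *)
Let K := M + B + d / 4.
Let B1 := K + 1.
Let kap := Num.sqrt (d / 4).
Let h := rho / (4 * N%:R).
Let s (n : nat) := rho / 2 - n%:R * h.
Let E0 := eps * (2 * B1 / rho) / (2 * kap).

(** [small1] keeps the correction eps P' below d / 4; [small2] makes each step halve the difference
    of consecutive iterates. Both limit N to a constant divided by eps. *)
Hypothesis small1 : eps * B1 <= d / 4 * h.
Hypothesis small2 : eps <= kap * h.

Let NR : (0 : R) < N%:R. Proof. by rewrite ltr0n. Qed.
Let h0 : 0 < h. Proof. by rewrite divr_gt0 // mulr_gt0. Qed.
Let Nh : N%:R * h = rho / 4. Proof. by rewrite /h; field; rewrite gt_eqF. Qed.
Let sS n : s n = s n.+1 + h. Proof. by rewrite /s -natr1; ring. Qed.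
Let s_rho n : s n <= rho / 2.
Proof. by rewrite /s gerBl mulr_ge0 // ltW. Qed.
Let sN : s N = rho / 4. Proof. by rewrite /s Nh; field. Qed.
Let s_mono n m : (n <= m)%N -> s m <= s n.
Proof. by move=> nm; rewrite /s lerB // ler_wpM2r ?(ltW h0) // ler_nat. Qed.
Let rho2 : rho / 2 <= rho. Proof. by rewrite ler_pdivrMr // mulr_natr mulr2n lerDl ltW. Qed.
Let M0 : 0 <= M.
Proof.
apply: le_trans (hM (z := ofr 0) _); first exact: nc_ge0.
by apply: tube_real => //; apply/andP; split; lra.
Qed.
Let kap0 : 0 < kap. Proof. by rewrite sqrtr_gt0 divr_gt0. Qed.
Let B10 : 0 < B1.
Proof. by rewrite /B1 /K ltr_wpDl // !addr_ge0 // ltW // divr_gt0. Qed.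
Let d4 : 0 < d / 4. Proof. by rewrite divr_gt0. Qed.

Lemma pot_re z : tube rho z -> re (pot z) <= - (3 / 4 * d).
Proof.
move=> /hd; rewrite ler_norml => /andP[a b].
rewrite /pot reM re_i im_i imD imN mul0r sub0r mul1r; move: (im (f z)) (im lam) a b lamd => u v a b c; lra.
Qed.

Lemma pot_nc z : tube rho z -> nc (pot z) <= M + B.
Proof.
move=> /hM hz; rewrite /pot ncM nc_i mul1r.
by apply: le_trans (ncB _ _) _; exact: lerD.
Qed.

Lemma pot_hol : hol pot (tube rho).
Proof.
move=> z /hf[D hD]; exists ('i%C * (D - 0)); apply: hasdZ.
by apply: hasdB => //; exact: hasd_cst.
Qed.

Lemma wkb_csq n z : re (wkb_W n z) <= - (d / 2) -> nc (wkb_W n z) <= K ->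
  (exists E, hasd id (wkb_W n) z E) ->
  nc (wkb_P n z) <= B1 /\ exists E, hasd id (wkb_P n) z E.
Proof.
move=> h1 h2 [E hE]; split.
  by rewrite wkb_PE; apply: (csq_bound (d := d / 2)) => //; rewrite divr_gt0.
have h3 : re (wkb_W n z) <= - (2 * (d / 4)) by apply: le_trans h1 _; have d0x := d0; lra.
exists ((2%:R * csq (wkb_W n z))^-1 * E).
apply: (@hasd_near _ _ _ (fun z => csq (wkb_W n z)) _ _ _ _ ltr01).
  by move=> y _; rewrite wkb_PE.
exact: (hasd_comp hE (hasd_csq d4 h3)).
Qed.

Lemma wkb_P0 z : tube rho z -> [/\ re (wkb_W 0 z) <= - (d / 2),
  nc (wkb_P 0 z) <= B1 & exists E, hasd id (wkb_P 0) z E].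
Proof.
move=> hz.
have W0 y : wkb_W 0 y = pot y by rewrite /wkb_W addr0.
have r0 : re (wkb_W 0 z) <= - (d / 2).
  by rewrite W0; apply: le_trans (pot_re hz) _; have d0x := d0; lra.
have [||? ?] := @wkb_csq 0 z r0.
- by rewrite W0; apply: le_trans (pot_nc hz) _; rewrite /K lerDl ltW.
- have [E hE] := pot_hol hz; exists E.
  by apply: (@hasd_near _ _ _ pot _ _ _ _ ltr01) hE => y _; rewrite W0.
by split.
Qed.

(** The real part of V is at most -3/4 d; by Cauchy's estimate on the previous tube and [small1] the
    correction changes it by at most d / 4, so the radicand never leaves the half-plane where the
    root is holomorphic. *)
Lemma wkb_P_in n z : tube (s n) z -> [/\ re (wkb_W n z) <= - (d / 2),
  nc (wkb_P n z) <= B1 & exists E, hasd id (wkb_P n) z E].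
Proof.
elim: n z => [|n IH] z hz.
  by apply: wkb_P0; apply: sub_tube hz; apply: le_trans (s_rho _) rho2.
have hzr : tube rho z by apply: sub_tube hz; apply: le_trans (s_rho _) rho2.
have hP : hol (wkb_P n) (tube (s n.+1 + h)) by rewrite -sS => w /IH[].
have bP w : tube (s n.+1 + h) w -> nc (wkb_P n w) <= B1 by rewrite -sS => /IH[].
have e1 := cder_est h0 hP bP hz.
have e2 : nc (ofr eps * cder (wkb_P n) z) <= d / 4.
  rewrite ncM nc_ofr gtr0_norm // -(ler_pM2r h0).
  apply: le_trans small1; rewrite -mulrA ler_wpM2l // ltW //.
have r0 : re (wkb_W n.+1 z) <= - (d / 2).
  rewrite /wkb_W reD; have := pot_re hzr.
  have := le_trans (le_trans (ler_norm _) (re_le_nc _)) e2.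
  set A := re (ofr eps * _); set C := re (pot z) => a1 a2; have d0x := d0; lra.
have [||? ?] := @wkb_csq n.+1 z r0.
- by apply: le_trans (ncD _ _) _; apply: lerD e2; exact: pot_nc.
- have [E hE] := pot_hol hzr; have [F hF] := cder_hol h0 hP hz.
  exists (E + ofr eps * F); apply: hasdD => //; exact: hasdZ.
by split.
Qed.

(** The zeroth iterate is holomorphic on the full tube, so its derivative is estimated with the
    fixed width rho / 2 instead of [h]. The first correction, and with it the distance of all
    iterates from the root of V, is therefore of order eps. *)
Lemma wkb_diff0 z : tube (rho / 2) z -> nc (ofr eps * cder (wkb_P 0) z) <= E0 * (2 * kap).
Proof.
move=> hz; have r2 : 0 < rho / 2 by rewrite divr_gt0.
have rr : rho = rho / 2 + rho / 2 by exact: splitr.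
have h1 : hol (wkb_P 0) (tube (rho / 2 + rho / 2)) by rewrite -rr => w /wkb_P0[].
have := cder_est (M := B1) r2 h1 _ hz; rewrite -rr => H.
have {}H : nc (cder (wkb_P 0) z) <= 2 * B1 / rho.
  have := H (fun w hw => let: And3 _ b _ := wkb_P0 hw in b).
  by rewrite -ler_pdivlMr // invf_div mulrA [B1 * _]mulrC.
rewrite ncM nc_ofr gtr0_norm // /E0 divfK ?mulf_neq0 ?gt_eqF //.
by rewrite ler_wpM2l // ltW.
Qed.

Lemma wkb_lip n m z : re (wkb_W n z) <= - (d / 2) -> re (wkb_W m z) <= - (d / 2) ->
  nc (wkb_P n z - wkb_P m z) * (2 * kap) <= nc (wkb_W n z - wkb_W m z).
Proof.
move=> h1 h2; rewrite !wkb_PE; apply: csq_lip => //.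
  by apply: le_trans h1 _; have d0x := d0; lra.
by apply: le_trans h2 _; have d0x := d0; lra.
Qed.

(** Consecutive radicands differ by eps times the derivative of the previous difference. Cauchy's
    estimate divides by [h] and the Lipschitz bound of the root by 2 kap; by [small2] the factor eps
    / (2 kap h) is at most 1 / 2. *)
Lemma wkb_diff n z : tube (s n.+1) z -> nc (wkb_P n.+1 z - wkb_P n z) <= E0 / 2 ^+ n.
Proof.
elim: n z => [|n IH] z hz.
  have [w1 _ _] := wkb_P_in hz.
  have hz2 : tube (rho / 2) z by exact: sub_tube (s_rho _) _ hz.
  have [w0 _ _] := wkb_P0 (sub_tube rho2 hz2).
  have := wkb_lip w1 w0; rewrite expr0 divr1.
  have -> : wkb_W 1 z - wkb_W 0 z = ofr eps * cder (wkb_P 0) z by rewrite /wkb_W; ring.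
  move=> H; have := le_trans H (wkb_diff0 hz2).
  by rewrite ler_pM2r // mulr_gt0.
have hz1 : tube (s n.+1) z by apply: sub_tube hz; exact: s_mono.
have [w2 _ _] := wkb_P_in hz; have [w1 _ _] := wkb_P_in hz1.
have H := wkb_lip w2 w1.
pose D w := wkb_P n.+1 w - wkb_P n w.
have hD : hol D (tube (s n.+2 + h)).
  rewrite -sS => w hw; have [_ _ [E hE]] := wkb_P_in hw.
  have [_ _ [F hF]] := wkb_P_in (sub_tube (s_mono (leqnSn n)) hw).
  by exists (E - F); exact: hasdB.
have bD w : tube (s n.+2 + h) w -> nc (D w) <= E0 / 2 ^+ n by rewrite -sS => /IH.
have est := cder_est h0 hD bD hz.
(* [cder] picks some derivative, so its additivity rests on uniqueness, shown with a small real
   increment. *)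
have dD : cder D z = cder (wkb_P n.+1) z - cder (wkb_P n) z.
  have [E hE] : exists E, hasd id D z E.
    by apply: hD; apply: tube_cball hz _ _; exact: cball0.
  have h2 : hasd id D z (cder (wkb_P n.+1) z - cder (wkb_P n) z).
    apply: hasdB; apply: cderP.
      by have [] := wkb_P_in hz1.
    by have [] := wkb_P_in (sub_tube (s_mono (leqnSn n)) hz1).
  have uniq F1 F2 : hasd id D z F1 -> hasd id D z F2 -> F1 = F2.
    move=> k1 k2; apply/eqP; rewrite -subr_eq0 -nc_eq0; apply/eqP/le_anti.
    rewrite nc_ge0 andbT; apply/ler_addgt0Pl => e e0; rewrite addr0.
    have e2 : 0 < e / 2 by rewrite divr_gt0.
    have [r1 r10 {}k1] := k1 _ e2; have [r2 r20 {}k2] := k2 _ e2.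
    pose r := Num.min r1 r2 / 2; have r0 : 0 < r by rewrite divr_gt0 // lt_min r10.
    have rm : r < Num.min r1 r2 by rewrite ltr_pdivrMr // ltr_pMr ?ltr1n // lt_min r10.
    have nr : nc (ofr r : R[i]) = r by rewrite nc_ofr gtr0_norm.
    have zr : z + ofr r - z = ofr r by ring.
    move: rm; rewrite lt_min => /andP[q1 q2].
    have := k1 (z + ofr r); rewrite /id zr nr => /(_ q1) {}k1.
    have := k2 (z + ofr r); rewrite /id zr nr => /(_ q2) {}k2.
    rewrite -(ler_pM2r r0) -{1}nr -ncM.
    have -> : (F1 - F2) * ofr r = (D (z + ofr r) - D z - F2 * ofr r) - (D (z + ofr r) - D z - F1 * ofr r) by ring.
    by apply: le_trans (ncB _ _) _; rewrite [e]splitr mulrDl lerD.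
  exact: uniq (cderP (ex_intro _ E hE)) h2.
rewrite dD in est.
have WW : wkb_W n.+2 z - wkb_W n.+1 z = ofr eps * (cder (wkb_P n.+1) z - cder (wkb_P n) z).
  by rewrite /wkb_W; ring.
rewrite WW ncM nc_ofr gtr0_norm // in H.
set X := nc (cder _ _ - _) in est H; set Y := nc _ in H *.
have X0 : 0 <= X by exact: nc_ge0.
have {}H : Y * (2 * kap) <= kap * (E0 / 2 ^+ n).
  apply: le_trans H _; apply: le_trans (ler_wpM2r X0 small2) _.
  by rewrite -mulrA ler_wpM2l ?(ltW kap0) // mulrC.
have -> : E0 / 2 ^+ n.+1 = E0 / 2 ^+ n / 2 by rewrite exprS; field; rewrite expf_neq0 // pnatr_eq0.
rewrite ler_pdivlMr // -(ler_pM2l kap0).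
by rewrite (_ : kap * (Y * 2) = Y * (2 * kap)) //; ring.
Qed.

Lemma wkb_close n z : (n <= N)%N -> tube (s N) z -> nc (wkb_P n z - wkb_P 0 z) <= E0 * (2 - 2 / 2 ^+ n).
Proof.
move=> + hz; elim: n => [|n IH] nN.
  by rewrite subrr nc0 expr0 divr1 subrr mulr0.
have -> : wkb_P n.+1 z - wkb_P 0 z = (wkb_P n.+1 z - wkb_P n z) + (wkb_P n z - wkb_P 0 z) by ring.
apply: le_trans (ncD _ _) _.
have h1 := @wkb_diff n z (sub_tube (s_mono nN) hz); have h2 := IH (ltnW nN).
have -> : E0 * (2 - 2 / 2 ^+ n.+1) = E0 / 2 ^+ n + E0 * (2 - 2 / 2 ^+ n).
  by rewrite exprS; field; rewrite expf_neq0 // pnatr_eq0.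
exact: lerD.
Qed.

Lemma E0_ge0 : 0 <= E0.
Proof. by apply: ltW; rewrite /E0; apply: divr_gt0; apply: mulr_gt0 => //; apply: divr_gt0 => //; apply: mulr_gt0. Qed.

(** The square of the last iterate is V plus eps times the derivative of the iterate before it. The
    residual is thus eps times the derivative of the last difference, and on the interval the
    remaining width rho / 4 serves to estimate it. *)
Lemma wkb_approx : exists p dp : R[i] -> R[i], forall x : R, -1 <= x <= 1 ->
  [/\ hasd id p (ofr x) (dp (ofr x)), ccont id dp (ofr x),
      nc (p (ofr x)) <= B1, nc (p (ofr x) - csq (pot (ofr x))) <= 2 * E0 &
      nc (p (ofr x) * p (ofr x) - ofr eps * dp (ofr x) - pot (ofr x)) <=
        eps * (E0 * (8 / rho)) / 2 ^+ N].
Proof.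
exists (wkb_P N), (cder (wkb_P N)) => x hx.
have r4 : 0 < rho / 4 by rewrite divr_gt0.
have hz : tube (s N) (ofr x) by rewrite sN; exact: tube_real.
have holN : hol (wkb_P N) (tube (s N)) by move=> w /wkb_P_in[].
have rr : rho / 4 = rho / 8 + rho / 8 by field.
have r8 : 0 < rho / 8 by rewrite divr_gt0.
have [wN bN dN] := wkb_P_in hz.
split=> //.
- exact: cderP.
- have [||E hE] := @cder_hol (wkb_P N) (rho / 8) (rho / 8) (ofr x) r8.
  + by rewrite -rr -sN.
  + by apply: tube_real.
  exact: hasd_cont hE.
- have -> : csq (pot (ofr x)) = wkb_P 0 (ofr x) by rewrite /= addr0.
  apply: le_trans (wkb_close (leqnn N) hz) _.
  rewrite mulrC ler_wpM2r ?E0_ge0 // gerBl divr_ge0 // exprn_ge0 //.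
case: (N) N0 holN hz wN (sN) => // n _ holN hz wN sNE.
have hzn : tube (s n) (ofr x) by apply: sub_tube hz; exact: s_mono.
have [w1 _ _] := csq_spec (ltac:(by rewrite divr_gt0) : 0 < d / 2) wN.
rewrite wkb_PE w1 {1}/wkb_W.
pose D w := wkb_P n.+1 w - wkb_P n w.
have hDs w : tube (s n.+1) w -> hasd id D w (cder (wkb_P n.+1) w - cder (wkb_P n) w).
  move=> hw; apply: hasdB; apply: cderP; first exact: holN.
  by have [] := wkb_P_in (sub_tube (s_mono (leqnSn n)) hw).
have := @cauchy_est _ D (ofr x) (rho / 4) (cder (wkb_P n.+1) (ofr x) - cder (wkb_P n) (ofr x)) (E0 / 2 ^+ n) r4.
have sub : cball (ofr x) (rho / 4) `<=` tube (s n.+1).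
  by rewrite sNE => w hw; exists x.
move=> H; have {}H : nc (cder (wkb_P n.+1) (ofr x) - cder (wkb_P n) (ofr x)) * (rho / 4) <= E0 / 2 ^+ n.
  apply: H; [by move=> w /sub hw; eexists; exact: hDs|exact: hDs|].
  by move=> w /sub; exact: wkb_diff.
have -> : pot (ofr x) + ofr eps * cder (wkb_P n) (ofr x) - ofr eps * cder (wkb_P n.+1) (ofr x) - pot (ofr x)
   = - (ofr eps * (cder (wkb_P n.+1) (ofr x) - cder (wkb_P n) (ofr x))) by ring.
rewrite ncN ncM nc_ofr gtr0_norm // -mulrA ler_wpM2l ?(ltW eps0) //.
rewrite -(ler_pM2r r4); apply: le_trans H _.
rewrite le_eqVlt; apply/orP; left; apply/eqP; rewrite exprS.
by field; rewrite expf_neq0 ?pnatr_eq0 // gt_eqF.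
Qed.
End WKB.

(** * The operator on twice continuously differentiable functions *)

Section OperatorDomain.
Context {R : realType}.
Implicit Types (u v w z g : R -> R[i]) (x : R) (lam : R[i]).

Definition ic u := icont (-1) 1 u.
Definition Int u : R[i] := cI (-1) 1 u.
Definition n2 u : R := re (Int (fun x => u x * (u x)^*%C)).

Lemma lemm11 : (-1 : R) <= 1. Proof. by lra. Qed.

Lemma n2E u : n2 u = Rintegral mu `[-1, 1] (fun x => normsq (u x)).
Proof.
rewrite /n2 /Int re_cI; apply: eq_Rintegral => x _.
by rewrite normsq_nc mul_conj re_ofr.
Qed.

Lemma L2normE u : L2norm u = Num.sqrt (n2 u).
Proof. by rewrite n2E. Qed.

Lemma ic_measurable u : ic u ->
  measurable_fun (`[-1, 1] : set R) (fun x => re (u x)) /\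
  measurable_fun (`[-1, 1] : set R) (fun x => im (u x)).
Proof.
move=> /icont_integrable[/integrableP[m1 _] /integrableP[m2 _]].
by split; apply/measurable_EFinP.
Qed.

Lemma ic_L2fun u : ic u -> L2fun u.
Proof.
move=> hu; have [m1 m2] := ic_measurable hu.
split=> //.
have [i1 _] := icont_integrable (icontM hu (icont_conj hu)).
rewrite (_ : (fun x => normsq (u x)) = fun x => re (u x * (u x)^*%C)) //.
by apply/funext => x; rewrite normsq_nc mul_conj re_ofr.
Qed.

(* [hasd ofr] is two-sided at -1 and 1 as well, and [ic] is continuity in R at
   each point of [-1, 1]; nothing is required away from [-1, 1]. *)
Record dom w w1 w2 : Prop := Dom {
  dom_d1 : forall x, -1 <= x <= 1 -> hasd ofr w x (w1 x);
  dom_d2 : forall x, -1 <= x <= 1 -> hasd ofr w1 x (w2 x);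
  dom_c2 : ic w2;
  dom_l : w (-1) = 0;
  dom_r : w 1 = 0 }.

Lemma dom_c0 w w1 w2 : dom w w1 w2 -> ic w.
Proof. by move=> h x hx; exact: hasd_cont (dom_d1 h hx). Qed.
Lemma dom_c1 w w1 w2 : dom w w1 w2 -> ic w1.
Proof. by move=> h x hx; exact: hasd_cont (dom_d2 h hx). Qed.

Variables (q : R -> R) (qf : R -> R[i]) (eps : R).
Hypotheses (qfc : ic qf) (qfE : forall x, -1 <= x <= 1 -> qf x = ofr (q x)) (eps0 : 0 < eps).

(* (L - lam) w, where w2 stands for w'' *)
Definition Lop lam w w2 x : R[i] := 'i%C * ofr (eps ^+ 2) * w2 x + (qf x - lam) * w x.

Lemma Lop_ic lam w w1 w2 : dom w w1 w2 -> ic (Lop lam w w2).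
Proof.
move=> h; apply: icontD; first exact: icontZ (dom_c2 h).
apply: icontM; last exact: dom_c0 h.
by apply: icontB => //; exact: icont_cst.
Qed.

Lemma dom_op_shift lam w w1 w2 g : dom w w1 w2 -> L2fun (fun x => g x + lam * w x) ->
  (forall x, -1 <= x <= 1 -> g x = Lop lam w w2 x) -> op_shift q eps lam w g.
Proof.
move=> h hg gE; split; [exact: dom_l h|exact: dom_r h|exact: hg|].
exists w2.
  split; first by apply: ic_L2fun; exact: dom_c2 h.
  exists w1 => x /andP[x1 x2].
  have sub (u : R -> R[i]) : ic u -> icont (-1) x u.
    by move=> hu y /andP[y1 y2]; apply: hu; rewrite y1 (le_trans y2).
  split.
    rewrite -[cintegral _ _]/(cI (-1) x w2) (@cI_FTC _ (-1) x w1) //.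
    - by rewrite addrC subrK.
    - by move=> y /andP[y1 y2]; apply: (dom_d2 h); rewrite y1 (le_trans y2).
    - exact: sub (dom_c2 h).
  rewrite -[cintegral _ _]/(cI (-1) x w1) (@cI_FTC _ (-1) x w) //.
  - by rewrite addrC subrK.
  - by move=> y /andP[y1 y2]; apply: (dom_d1 h); rewrite y1 (le_trans y2).
  - exact: sub (dom_c1 h).
apply/aeW => x hx; rewrite gE // /Lop -qfE //; ring.
Qed.

Lemma within_clamp (g : R -> R) (a b : R) : a <= b -> {within `[a, b], continuous g} ->
  forall x, {for x, continuous (fun y => g (clamp a b y))}.
Proof.
move=> ab hg x; apply/contP => e e0.
have cx : `[a, b]%classic (clamp a b x) by rewrite /= in_itv /= clamp_in.
have := (subspace_continuousP _ _).1 hg _ cx.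
move=> /cvgrPdist_le /(_ e e0) [d /= d0 Hd].
exists d => // y yd; rewrite distrC; apply: Hd.
  by rewrite /ball /= distrC; apply: le_lt_trans (clamp_lip _ _ _ _) yd.
by rewrite /= in_itv /= clamp_in.
Qed.

Lemma L2_integrable u : L2fun u ->
  mu.-integrable `[-1, 1] (EFin \o (fun x => re (u x))) /\
  mu.-integrable `[-1, 1] (EFin \o (fun x => im (u x))).
Proof.
move=> [m1 m2 i].
have ione : mu.-integrable `[-1, 1] (EFin \o (fun=> 1 : R)).
  apply: continuous_compact_integrable; first exact: segment_compact.
  by apply: continuous_in_subspaceT => x _; exact: cst_continuous.
have i1 : mu.-integrable `[-1, 1]
    (fun x => (1%:E + (normsq (u x))%:E)%E) by exact: (integrableD _ ione i).
have bnd (a b : R) : `|a| <= `|1 + (a ^+ 2 + b ^+ 2)|.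
  have s0 : 0 <= 1 + (a ^+ 2 + b ^+ 2) by rewrite !addr_ge0 ?sqr_ge0.
  rewrite [leRHS]ger0_norm // ler_norml; apply/andP; split; nra.
split.
  apply: (le_integrable _ _ _ i1) => //; first exact/measurable_EFinP.
  by move=> x _ /=; rewrite lee_fin /normsq; exact: bnd.
apply: (le_integrable _ _ _ i1) => //; first exact/measurable_EFinP.
by move=> x _ /=; rewrite lee_fin /normsq [X in 1 + X]addrC; exact: bnd.
Qed.

Lemma cint_within (u z1 : R -> R[i]) :
  mu.-integrable `[-1, 1] (EFin \o (fun x => re (u x))) ->
  mu.-integrable `[-1, 1] (EFin \o (fun x => im (u x))) ->
  (forall x, -1 <= x <= 1 -> z1 x = z1 (-1) + cintegral `[-1, x] u) ->
  {within `[-1, 1], continuous (fun x => re (z1 x))} /\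
  {within `[-1, 1], continuous (fun x => im (z1 x))}.
Proof.
move=> i1 i2 H.
have aux (g F : R -> R) : mu.-integrable `[-1, 1] (EFin \o g) ->
    (forall x, -1 <= x <= 1 -> F x = F (-1) + Rintegral mu `[-1, x] g) ->
    {within `[-1, 1], continuous F}.
  move=> ig HF; apply: (@subspace_eq_continuous _ _ _ (fun x => F (-1) + Rintegral mu `[-1, x] g)).
    by move=> x; rewrite inE /= in_itv /= => hx; exact: (esym (HF x hx)).
  move=> x; apply: cvgD; first exact: cvg_cst.
  exact: (parameterized_integral_continuous lemm11 ig).
split.
  by apply: (aux (fun x => re (u x))) => // x hx; rewrite {1}H // reD.
by apply: (aux (fun x => im (u x))) => // x hx; rewrite {1}H // imD.
Qed.

(** Regularity: [z] is continuous as an iterated integral, so the equation identifies its second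
    derivative almost everywhere with a continuous function [Z]; integrating [Z] twice gives a
    classical solution. *)
Lemma eigen_dom lam z : op_shift q eps lam z (fun=> 0) ->
  exists v v1 v2, [/\ dom v v1 v2, forall x, -1 <= x <= 1 -> z x = v x &
    forall x, -1 <= x <= 1 -> Lop lam v v2 x = 0].
Proof.
move=> [z0 zr _ [z2 [hz2 [z1 hz]] hae]].
have [i1 i2] := L2_integrable hz2.
have [c1 c2] := cint_within i1 i2 (fun x hx => (hz x hx).1).
have j1 := continuous_compact_integrable (@segment_compact R (-1) 1) c1.
have j2 := continuous_compact_integrable (@segment_compact R (-1) 1) c2.
have [e1 e2] := cint_within j1 j2 (fun x hx => (hz x hx).2).
(* The values of [z] outside [-1, 1] are arbitrary. *)
pose zc x := z (clamp (-1) 1 x).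
have zcc x : ccont ofr zc x.
  by apply/ccontP; split; [exact: (within_clamp lemm11 e1)|exact: (within_clamp lemm11 e2)].
pose k : R[i] := ('i%C * ofr (eps ^+ 2))^-1.
have k0 : 'i%C * ofr (eps ^+ 2) != 0 :> R[i].
  by rewrite mulf_neq0 ?neq0i // ofr_eq0 expf_neq0 // gt_eqF.
pose Z x := k * ((lam - qf (clamp (-1) 1 x)) * zc x).
have Zc x : ccont ofr Z x.
  apply: ccontM; first exact: ccont_cst.
  apply: ccontM; last exact: zcc.
  by apply: ccontB; [exact: ccont_cst|exact: clamp_cont lemm11 qfc].
have [P P0 HP] := primitive (-1) Zc.
pose v1 x := z1 (-1) + P x.
have hv1 x : -1 <= x <= 1 -> hasd ofr v1 x (Z x).
  move=> /andP[x1 x2]; rewrite -[Z x]add0r; apply: hasdD; first exact: hasd_cst.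
  by apply: HP; lra.
have z1E x : -1 <= x <= 1 -> z1 x = v1 x.
  move=> hx; have /andP[x1 x2] := hx; rewrite (hz x hx).1 /v1; congr (_ + _).
  have icZ : icont (-1) x Z by move=> y _; exact: Zc.
  have := @cI_FTC _ (-1) x P Z x1 _ icZ; rewrite P0 subr0 => <-; last first.
    by move=> y /andP[y1 _]; apply: HP; lra.
  have subi (g : R -> R) : mu.-integrable `[-1, 1] (EFin \o g) -> mu.-integrable `[-1, x] (EFin \o g).
    by apply: integrableS => // y /=; rewrite !in_itv /= => /andP[-> y2]; exact: le_trans x2.
  have ae1 : {ae mu, forall y, `[-1, x]%classic y -> z2 y = Z y}.
    move: hae; apply: filterS; first exact: (ae_filter_ringOfSetsType mu). 
    move=> y H; rewrite /= in_itv /= => /andP[y1 y2].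
    have hy : -1 <= y <= 1 by rewrite y1 (le_trans y2).
    have := H hy; rewrite add0r => E; apply: (mulfI k0).
    rewrite /Z /zc clamp_id // /k mulVKf // qfE // mulrBl E; ring.
  have [n1 n2'] := icont_integrable icZ.
  apply: complex_ext.
    rewrite /= /Rintegral; congr fine; apply: ae_eq_integral => //.
    - by have /integrableP[] := subi _ i1.
    - by have /integrableP[] := n1.
    - by move: ae1; apply: filterS; [exact: (ae_filter_ringOfSetsType mu)|move=> y H /H /= ->].
  rewrite /= /Rintegral; congr fine; apply: ae_eq_integral => //.
  - by have /integrableP[] := subi _ i2.
  - by have /integrableP[] := n2'.
  - by move: ae1; apply: filterS; [exact: (ae_filter_ringOfSetsType mu)|move=> y H /H /= ->].
have v1c x : ccont ofr (fun y => v1 (clamp (-1) 1 y)) x.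
  by apply: clamp_cont lemm11 _ => y hy; exact: hasd_cont (hv1 y hy).
have [Q Q0 HQ] := primitive (-1) v1c.
have hQ x : -1 <= x <= 1 -> hasd ofr Q x (v1 x).
  by move=> hx; have := HQ x; rewrite clamp_id //; apply; case/andP: hx; lra.
have zE x : -1 <= x <= 1 -> z x = Q x.
  move=> hx; have /andP[x1 x2] := hx; rewrite (hz x hx).2 z0 add0r.
  rewrite -[cintegral _ _]/(cI (-1) x z1) (@eq_cI _ _ _ _ v1).
    rewrite (@cI_FTC _ (-1) x Q) ?Q0 ?subr0 //.
      by move=> y /andP[y1 y2]; apply: hQ; rewrite y1 (le_trans y2).
    by move=> y /andP[y1 y2]; apply: hasd_cont (hv1 _ _); rewrite y1 (le_trans y2).
  by move=> y /andP[y1 y2]; apply: z1E; rewrite y1 (le_trans y2).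
exists Q, v1, Z; split=> //.
- by split=> //; rewrite -(zE 1) ?lexx ?lemm11 ?zr.
- move=> x hx; rewrite /Lop /Z /zc clamp_id // zE // /k.
  rewrite mulVKf //; ring.
Qed.
End OperatorDomain.

(** * Quasi-modes *)

Section Quasimode.
Context {R : realType}.
Implicit Types (lam : R[i]) (eps x : R).

(** exp y is the square of exp (y / 2) >= y / 2. Quadratic decay is enough to compare the small
    exponentials with powers of eps. *)
Lemma expRN_le (y : R) : 0 < y -> expR (- y) <= 4 / y ^+ 2.
Proof.
move=> y0; rewrite expRN -[leRHS]invrK lef_pV2 ?posrE ?expR_gt0 ?invr_gt0 ?divr_gt0 ?exprn_gt0 //.
rewrite invf_div.
have -> : expR y = expR (y / 2) * expR (y / 2) by rewrite -expRD -splitr.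
have := expR_ge1Dx (y / 2).
have y2 : 0 < y / 2 by rewrite divr_gt0.
set t := expR _ => h.
have ht : y / 2 <= t by apply: le_trans h; rewrite lerDr.
have -> : y ^+ 2 / 4 = (y / 2) * (y / 2) by field.
by apply: ler_pM => //; exact: ltW.
Qed.

Lemma n2_lower (w : R -> R[i]) (a b k : R) : ic w -> -1 <= a -> a <= b -> b <= 1 -> 0 <= k ->
  (forall x, a <= x <= b -> k <= nc (w x)) -> k ^+ 2 * (b - a) <= n2 w.
Proof.
move=> hw ha hab hb k0 H; rewrite /n2 /Int.
have hi : ic (fun x => w x * (w x)^*%C) by apply: icontM => //; exact: icont_conj.
have pos (s t : R) : -1 <= s -> t <= 1 -> 0 <= re (cI s t (fun x => w x * (w x)^*%C)).
  move=> hs ht; have -> : 0 = re (cI s t (fun=> 0)).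
    by rewrite re_cI /= Rintegral_cst //= mul0r.
  apply: le_re_cI; first exact: icont_cst.
    by move=> y /andP[y1 y2]; apply: hi; rewrite (le_trans hs) // (le_trans y2).
  by move=> y _; rewrite mul_conj re_ofr sqr_ge0.
rewrite (@cI_split _ (-1) 1 a) //; last exact: le_trans hab hb.
rewrite (@cI_split _ a 1 b) //; last by move=> y /andP[y1 y2]; apply: hi; rewrite (le_trans ha).
rewrite !reD; apply: le_trans (_ : _ <= re (cI a b (fun x => w x * (w x)^*%C))) _.
  have -> : k ^+ 2 * (b - a) = re (cI a b (fun=> ofr (k ^+ 2))) by rewrite cI_cst // re_ofrM.
  apply: le_re_cI; first exact: icont_cst.
    by move=> y /andP[y1 y2]; apply: hi; rewrite (le_trans ha) // (le_trans y2).
  by move=> y hy; rewrite mul_conj !re_ofr lerXn2r ?nnegrE ?nc_ge0 // H.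
have p1 := pos (-1) a (lexx _) (le_trans hab hb).
have p2 := pos b 1 (le_trans ha hab) (lexx _).
by rewrite addrCA lerDl addr_ge0.
Qed.

Lemma n2_upper (w : R -> R[i]) (k : R) : ic w ->
  (forall x, -1 <= x <= 1 -> nc (w x) <= k) -> n2 w <= k ^+ 2 * 2.
Proof.
move=> hw H; rewrite /n2 /Int.
have hi : ic (fun x => w x * (w x)^*%C) by apply: icontM => //; exact: icont_conj.
have -> : k ^+ 2 * 2 = re (cI (-1) 1 (fun=> ofr (k ^+ 2))).
  by rewrite cI_cst ?lemm11 // re_ofrM re_ofr; congr (_ * _); ring.
apply: le_re_cI => //; first exact: icont_cst.
move=> y hy; rewrite mul_conj !re_ofr; have := H y hy; have := nc_ge0 (w y); nra.
Qed.

Definition qf (f : R[i] -> R[i]) x : R[i] := f (ofr x).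
Lemma qf_ic q G f : AM_ext q G f -> ic (qf f).
Proof.
move=> hq x hx; apply: (ccont_comp (f := ofr)); first exact: ccont_j.
have [D hD] := derivable_hasd (AM_holo hq (AM_interval hq hx)); exact: hasd_cont hD.
Qed.
Lemma qf_q q G f : AM_ext q G f -> forall x, -1 <= x <= 1 -> qf f x = ofr (q x).
Proof. exact: AM_extends. Qed.

Lemma wkb_uniform q G f (hq : AM_ext q G f) (d B : R) : 0 < d -> exists e0 c C : R, [/\ 0 < e0, 0 < c, 1 <= C &
  forall lam eps, im lam <= - d -> nc lam <= B -> 0 < eps < e0 ->
  exists p dp : R -> R[i], forall x, -1 <= x <= 1 ->
  [/\ hasd ofr p x (dp x), ccont ofr dp x, nc (p x) <= C,
      nc (p x - csq ('i%C * (qf f x - lam))) <= C * eps &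
      nc (p x * p x - ofr eps * dp x - 'i%C * (qf f x - lam)) <= C * expR (- (c / eps)) ]].
Proof.
move=> d0; have d4 : 0 < d / 4 by rewrite divr_gt0.
have [rho [M [rho0 hf hM him]]] := AM_tube hq d4.
have M0 : 0 <= M.
  apply: le_trans (hM (ofr 0) _); first exact: nc_ge0.
  by apply: tube_real => //; apply/andP; split; lra.
pose B' := Num.max B 0; have B0 : 0 <= B' by rewrite le_max lexx orbT.
pose B1 := M + B' + d / 4 + 1.
have B11 : 1 <= B1 by rewrite /B1 lerDr !addr_ge0 // ltW.
have B10 : 0 < B1 by exact: lt_le_trans B11.
pose kap := Num.sqrt (d / 4); have kap0 : 0 < kap by rewrite sqrtr_gt0.
(* The largest value of N eps that both smallness conditions of the iteration admit. *)
pose c2 := Num.min (d * rho / (16 * B1)) (kap * rho / 4).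
have c20 : 0 < c2 by rewrite lt_min !divr_gt0 // !mulr_gt0.
have c2a : c2 * (16 * B1) <= d * rho.
  by rewrite -ler_pdivlMr ?mulr_gt0 // ge_min lexx.
have c2b : c2 * 4 <= kap * rho by rewrite -ler_pdivlMr // ge_min lexx orbT.
pose E := (2 * B1 / rho) / (2 * kap).
have E0 : 0 < E by rewrite !divr_gt0 // !mulr_gt0.
have E0' := ltW E0.
have X0 : 0 <= E * (8 / rho) by rewrite mulr_ge0 // divr_ge0 // ltW.
pose X := E * (8 / rho); rewrite -/X in X0.
pose C := B1 + 2 * E + 2 * X.
have C1 : 1 <= C by rewrite /C; lra_on E0' X0 B11.
have ln20 : 0 < ln 2 :> R by rewrite ln_gt0 // ltr1n.
exists (Num.min c2 1), (c2 * ln 2), C; split=> //.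
- by rewrite lt_min c20 ltr01.
- by rewrite mulr_gt0.
move=> lam eps lamd lamB /andP[eps0]; rewrite lt_min => /andP[epsc eps1].
have xc : 1 <= c2 / eps by rewrite ler_pdivlMr // mul1r ltW.
have /andP[N1 N2] := truncn_itv (le_trans ler01 xc).
(* The number of steps is the integral part of c2 / eps; since N > c2 / eps - 1, 2^-N is at most 2
   exp (- c2 ln 2 / eps). *)
set N := Num.trunc _ in N1 N2.
have Npos : (0 < N)%N.
  rewrite lt0n; apply/negP => /eqP N0; move: N2.
  by rewrite N0 (_ : 1%:R = 1) // ltNge xc.
have NR : (0 : R) < N%:R by rewrite ltr0n.
have Neps : N%:R * eps <= c2 by rewrite -ler_pdivlMr.
have small1 : eps * B1 <= d / 4 * (rho / (4 * N%:R)).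
  rewrite mulrA ler_pdivlMr ?mulr_gt0 //.
  have : N%:R * eps * (16 * B1) <= d * rho.
    by apply: le_trans c2a; rewrite ler_wpM2r // mulr_ge0 // ltW.
  move=> H; rewrite (_ : eps * B1 * (4 * N%:R) = N%:R * eps * (16 * B1) / 4); last by field.
  by rewrite (_ : d / 4 * rho = d * rho / 4) ?ler_wpM2r // ?invr_ge0 //; ring.
have small2 : eps <= kap * (rho / (4 * N%:R)).
  rewrite mulrA ler_pdivlMr ?mulr_gt0 // (_ : eps * (4 * N%:R) = N%:R * eps * 4); last by ring.
  by apply: le_trans c2b; rewrite ler_wpM2r.
have lamB' : nc lam <= B' by rewrite le_max lamB.
have [p [dp H]] := @wkb_approx R f rho M d B' lam eps N rho0 d0 B0 eps0 Npos hf hM him lamd lamB' small1 small2.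
exists (fun x => p (ofr x)), (fun x => dp (ofr x)) => x hx.
have [H1 H2 H3 H4 H5] := H x hx; split.
- by rewrite -[dp _]mulr1; apply: (hasd_comp (f := ofr)) H1; exact: hasd_j.
- by apply: (ccont_comp (f := ofr)) H2; exact: ccont_j.
- by apply: le_trans H3 _; rewrite -/B1 /C; lra_on E0' X0 B11.
- apply: le_trans H4 _; rewrite -/B1 -/kap -mulrA -/E mulrCA [C * _]mulrC ler_wpM2l ?(ltW eps0) //.
  by rewrite /C; lra_on E0' X0 B11.
apply: le_trans H5 _; rewrite -/B1 -/kap -[eps * _ / (2 * kap)]mulrA -/E.
have half : (2 ^+ N)^-1 <= 2 * expR (- (c2 * ln 2 / eps)).
  have -> : (2 : R) ^+ N = expR (N%:R * ln 2).
    by rewrite expRM_natl lnK // posrE.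
  have -> : 2 * expR (- (c2 * ln 2 / eps)) = expR (- ((c2 / eps - 1) * ln 2)).
    rewrite mulrBl mul1r opprB expRD lnK ?posrE // mulrAC //.
  rewrite -expRN ler_expR lerN2 ler_wpM2r ?(ltW ln20) //.
  by rewrite lerBlDr natr1 ltW.
have eps0' := ltW eps0.
have e1 : eps * (eps * E * (8 / rho)) <= X.
  rewrite -[eps * E * _]mulrA mulrA ler_piMl // mulr_ile1 ?ltW //.
apply: le_trans (_ : _ <= X * (2 * expR (- (c2 * ln 2 / eps)))) _.
  apply: ler_pM => //; first by rewrite -[eps * E * _]mulrA -/X; apply: mulr_ge0 => //; apply: mulr_ge0.
rewrite [X * _]mulrCA mulrA ler_wpM2r ?expR_ge0 //.
by rewrite /C; lra_on E0' X0 B11.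
Qed.

Lemma quasimode q G f (hq : AM_ext q G f) (d B : R) : 0 < d -> exists tau e0 : R, [/\ 0 < tau, 0 < e0 &
  forall lam eps, q (-1) + d <= re lam <= q 1 - d -> im lam <= - d -> nc lam <= B ->
  0 < eps < e0 -> exists w w1 w2, [/\ dom w w1 w2, 0 < n2 w &
    expR (2 * tau / eps) * n2 (Lop (qf f) eps lam w w2) <= n2 w]].
Proof.
move=> d0; have [e0 [c [C [e00 c0 C1 H]]]] := wkb_uniform hq B d0.
have C0 : 0 < C by exact: lt_le_trans C1.
have d2 : 0 < d / 2 by rewrite divr_gt0.
(* At distance at most [r] from an end, q differs from its end value by at most d / 2, which fixes
   the sign of q - Re lam and a lower bound d / 2 for its size. *)
have [r [r0 r1 qL qR]] : exists r, [/\ 0 < r, r <= 1,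
    forall x, -1 <= x <= -1 + r -> q x <= q (-1) + d / 2 &
    forall x, 1 - r <= x <= 1 -> q 1 - d / 2 <= q x].
  have hm : -1 <= (-1 : R) <= 1 by rewrite lexx lemm11.
  have hp : -1 <= (1 : R) <= 1 by rewrite lexx lemm11.
  have [s1 s10 S1] := qf_ic hq hm d2; have [s2 s20 S2] := qf_ic hq hp d2.
  pose r := Num.min 1 (Num.min (s1 / 2) (s2 / 2)).
  have r0 : 0 < r by rewrite !lt_min ltr01 !divr_gt0.
  have r1 : r <= 1 by rewrite ge_min lexx.
  have rs1 : r < s1.
    apply: (@le_lt_trans _ _ (s1 / 2)); first by rewrite !ge_min lexx orbT.
    by rewrite ltr_pdivrMr // ltr_pMr // ltr1n.
  have rs2 : r < s2.
    apply: (@le_lt_trans _ _ (s2 / 2)); first by rewrite !ge_min lexx !orbT.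
    by rewrite ltr_pdivrMr // ltr_pMr // ltr1n.
  clearbody r; exists r; split=> // x /andP[x1 x2].
    have hx : -1 <= x <= 1 by apply/andP; split; lra.
    have := S1 x; rewrite nc_ofrB !(qf_q hq) // nc_ofrB => h.
    have /h : `|x - -1| < s1 by apply: le_lt_trans rs1; rewrite ger0_norm; lra.
    by rewrite ler_norml => /andP[_]; lra.
  have hx : -1 <= x <= 1 by apply/andP; split; lra.
  have := S2 x; rewrite nc_ofrB !(qf_q hq) // nc_ofrB => h.
  have /h : `|x - 1| < s2 by apply: le_lt_trans rs2; rewrite ler0_norm; lra.
  by rewrite ler_norml => /andP[+ _]; lra.
(* The real part of the root is Im V / (2 Im csq V). Near the ends Im V has size at least d / 2 and
   Im csq V <= 2 C, which gives [k0]; half of it is given up to the error of [p]. *)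
pose k0 := d / (8 * C); have k00 : 0 < k0 by rewrite divr_gt0 // mulr_gt0.
pose k1 := k0 / 2 * r; have k10 : 0 < k1 by rewrite mulr_gt0 // divr_gt0.
(* The residual of [p] contributes C, and the linear correction, of size 2 del, is multiplied by q -
   lam, of size at most 4 C^2. *)
pose C3 := C + 8 * C ^+ 2; have C30 : 0 < C3 by rewrite addr_gt0 // mulr_gt0 // exprn_gt0.
have [c3 [c30 c3c c3k]] : exists c3, [/\ 0 < c3, c3 <= c & c3 <= k1].
  by exists (Num.min c k1); rewrite lt_min c0 k10 !ge_min !lexx orbT.
pose e1 : R := expR (-1); have e10 : 0 < e1 by exact: expR_gt0.
(* Thresholds for eps: the range of the approximation, an error of [p] of at most k0 / 2, the final
   comparison with [n2 w], and end values of [u] small against its maximum. *)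
pose E := Num.min (Num.min e0 1) (Num.min (k0 / (2 * C)) (Num.min (e1 ^+ 2 * c3 ^+ 2 / (32 * C * C3 ^+ 2)) (Num.min 1 (k1 ^+ 2 * e1 / 16)))).
have t1 : 0 < k0 / (2 * C) by apply: divr_gt0 => //; apply: mulr_gt0.
have t2 : 0 < e1 ^+ 2 * c3 ^+ 2 / (32 * C * C3 ^+ 2).
  by apply: divr_gt0; rewrite ?mulr_gt0 ?exprn_gt0.
have t3 : 0 < k1 ^+ 2 * e1 / 16 by apply: divr_gt0 => //; rewrite mulr_gt0 ?exprn_gt0.
have E0 : 0 < E by rewrite /E !lt_min e00 ltr01 t1 t2 t3.
(* The squared norm of the image decays like exp (- 2 c3 / eps). Only one factor exp (c3 / eps) is
   claimed; the other beats the factor eps in the lower bound of [n2 w]. *)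
exists (c3 / 2), E; split=> //; first by rewrite divr_gt0.
move=> lam eps /andP[la lb] lamd lamB /andP[eps0].
rewrite /E !lt_min => /andP[/andP[ee0 ee1] /andP[ee2 /andP[ee3 /andP[_ ee4]]]].
have [p [dp Hp]] := H lam eps lamd lamB (introT andP (conj eps0 ee0)).
have {}ee2 : C * eps <= k0 / 2.
  move: ee2; rewrite ltr_pdivlMr ?mulr_gt0 // => ee2; rewrite ler_pdivlMr //; lra_on ee2.
pose V x : R[i] := 'i%C * (qf f x - lam).
have reV x : -1 <= x <= 1 -> re (V x) <= - d.
  by move=> hx; rewrite /V (qf_q hq) // reM re_i im_i imD imN im_ofr mul0r sub0r mul1r sub0r opprK.
have imV x : -1 <= x <= 1 -> im (V x) = q x - re lam.
  by move=> hx; rewrite /V (qf_q hq) // imM re_i im_i reD reN re_ofr mul0r add0r mul1r.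
have csq2 x : -1 <= x <= 1 -> nc (csq (V x)) <= 2 * C.
  move=> hx; have [_ _ h3 h4 _] := Hp x hx.
  have -> : csq (V x) = p x - (p x - csq (V x)) by ring.
  apply: le_trans (ncB _ _) _; rewrite mulr_natl mulr2n; apply: lerD => //.
  by apply: le_trans h4 _; rewrite ler_piMr ?ltW.
have ncVb x : -1 <= x <= 1 -> nc (qf f x - lam) <= 4 * C ^+ 2.
  move=> hx; have [<- _ _ _] := csq_spec d0 (reV x hx) : _ => //.
  have : nc (V x) = nc (qf f x - lam) by rewrite ncM nc_i mul1r.
  move=> <-; have [<- _ _ _] := csq_spec d0 (reV x hx).
  have a1 := csq2 x hx; have a2 := nc_ge0 (csq (V x)); rewrite ncM; nra_on a1 a2.
have rep x k : -1 <= x <= 1 -> im (V x) <= - (d / 2) -> re (p x) <= - (k0 / 2).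
  move=> hx hV; have [_ _ h3 h4 _] := Hp x hx.
  have [_ _ s3 s4] := csq_spec d0 (reV x hx).
  have s5 := le_trans (ler_norm _) (le_trans (im_le_nc _) (csq2 x hx)).
  have rc : re (csq (V x)) <= - k0.
    rewrite leNgt; apply/negP => h; rewrite -s4 in hV.
    have kE : - k0 * (4 * C) = - (d / 2) by rewrite /k0; field; rewrite gt_eqF.
    by nra_on hV h kE s3 s5 k00 C0.
  have a1 := le_trans (ler_norm _) (le_trans (re_le_nc _) h4); rewrite reD reN in a1; lra_on a1 rc ee2.
have repR x : -1 <= x <= 1 -> d / 2 <= im (V x) -> k0 / 2 <= re (p x).
  move=> hx hV; have [_ _ h3 h4 _] := Hp x hx.
  have [_ _ s3 s4] := csq_spec d0 (reV x hx).
  have s5 := le_trans (ler_norm _) (le_trans (im_le_nc _) (csq2 x hx)).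
  have rc : k0 <= re (csq (V x)).
    rewrite leNgt; apply/negP => h; rewrite -s4 in hV.
    have kE : k0 * (4 * C) = d / 2 by rewrite /k0; field; rewrite gt_eqF.
    by nra_on hV h kE s3 s5 k00 C0.
  have := le_trans (re_le_nc _) h4; rewrite reD reN ler_norml => /andP[a1 _]; lra_on a1 rc ee2.
have pic : ic p by move=> x hx; have [h _ _ _ _] := Hp x hx; exact: hasd_cont h.
have [P P0 HP] := @primitive R (-1) (fun x => p (clamp (-1) 1 x)) (fun x => clamp_cont x lemm11 pic).
have hP x : -1 <= x <= 1 -> hasd ofr P x (p x).
  by move=> hx; have := HP x; rewrite clamp_id //; apply; case/andP: hx => a1 _; lra_on a1.
have P_FTC a b : -1 <= a -> a <= b -> b <= 1 -> re (P b) - re (P a) = re (cI a b p).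
  move=> ha hab hb; rewrite (@cI_FTC _ a b P p hab) ?reD ?reN //.
    by move=> x /andP[x1 x2]; apply: hP; rewrite (le_trans ha) // (le_trans x2).
  by move=> x /andP[x1 x2]; apply: pic; rewrite (le_trans ha) // (le_trans x2).
have upP a b k : -1 <= a -> a <= b -> b <= 1 -> (forall x, a <= x <= b -> re (p x) <= k) ->
    re (P b) - re (P a) <= k * (b - a).
  move=> ha hab hb hk; rewrite P_FTC //.
  have -> : k * (b - a) = re (cI a b (fun=> ofr k)) by rewrite cI_cst // re_ofrM.
  apply: le_re_cI => //; last exact: icont_cst.
  by move=> x /andP[x1 x2]; apply: pic; rewrite (le_trans ha) // (le_trans x2).
have loP a b k : -1 <= a -> a <= b -> b <= 1 -> (forall x, a <= x <= b -> k <= re (p x)) ->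
    k * (b - a) <= re (P b) - re (P a).
  move=> ha hab hb hk; rewrite P_FTC //.
  have -> : k * (b - a) = re (cI a b (fun=> ofr k)) by rewrite cI_cst // re_ofrM.
  apply: le_re_cI => //; first exact: icont_cst.
  by move=> x /andP[x1 x2]; apply: pic; rewrite (le_trans ha) // (le_trans x2).
have PL : re (P (-1 + r)) - re (P (-1)) <= - k1.
  have -> : - k1 = - (k0 / 2) * (-1 + r - -1) by rewrite /k1; ring.
  apply: upP; [by []|lra_on r0|lra_on r1|].
  move=> x hx; have hx' : -1 <= x <= 1 by case/andP: hx => a1 a2; apply/andP; split; lra_on a1 a2 r1.
  by apply: rep => //; rewrite imV //; have a1 := qL x hx; lra_on a1 la.
have PR : k1 <= re (P 1) - re (P (1 - r)).
  have -> : k1 = k0 / 2 * (1 - (1 - r)) by rewrite /k1; ring.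
  apply: loP; [lra_on r1|lra_on r0|by []|].
  move=> x hx; have hx' : -1 <= x <= 1 by case/andP: hx => a1 a2; apply/andP; split; lra_on a1 a2 r1.
  by apply: repR => //; rewrite imV //; have a1 := qR x hx; lra_on a1 lb.
have icP : ic P by move=> x hx; exact: hasd_cont (hP x hx).
(* The sign of Re p is known only near the ends; wherever the minimum of Re P lies, it is below both
   end values by at least [k1]. *)
have [xs xsI xsmin] := EVT_min lemm11 (proj1 (ccont_within icP)).
rewrite in_itv /= in xsI.
pose m := re (P xs).
have mmin x : -1 <= x <= 1 -> m <= re (P x) by move=> hx; apply: xsmin; rewrite in_itv.
have mL : k1 <= re (P (-1)) - m.
  have a1 : m <= re (P (-1 + r)) by apply: mmin; apply/andP; split; lra_on r0 r1.
  by lra_on a1 PL.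
have mR : k1 <= re (P 1) - m.
  have a1 : m <= re (P (1 - r)) by apply: mmin; apply/andP; split; lra_on r0 r1.
  by lra_on a1 PR.
pose ie : R[i] := ofr eps^-1.
have ieE : ofr eps * ie = 1 by rewrite /ie -rmorphM divff ?rmorph1 // gt_eqF.
(* Subtracting the minimum of Re P makes 1 the maximum of the modulus of [u]. *)
pose u x : R[i] := cexp (- ie * (P x - ofr m)).
have ncu x : nc (u x) = expR (- ((re (P x) - m) / eps)).
  rewrite nc_cexp reM reN reD reN re_ofr imN /ie im_ofr re_ofr oppr0 mul0r subr0.
  by congr expR; rewrite mulNr mulrC.
pose u1 x : R[i] := - (p x * ie * u x).
pose u2 x : R[i] := - (dp x * ie * u x + p x * ie * u1 x).
have hu x : -1 <= x <= 1 -> hasd ofr u x (u1 x).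
  move=> hx; have -> : u1 x = u x * (- ie * (p x - 0)) by rewrite /u1 subr0; ring.
  apply: (hasd_comp (f := fun x => - ie * (P x - ofr m))); last exact: hasd_cexp.
  by apply: hasdZ; apply: hasdB; [exact: hP|exact: hasd_cst].
have hu1 x : -1 <= x <= 1 -> hasd ofr u1 x (u2 x).
  move=> hx; have [h1 _ _ _ _] := Hp x hx.
  apply: hasdN; apply: hasdM; last exact: hu.
  by have := hasdM h1 (hasd_cst ofr ie x); rewrite mulr0 addr0.
have icu : ic u by move=> x hx; exact: hasd_cont (hu x hx).
have icu1 : ic u1 by move=> x hx; exact: hasd_cont (hu1 x hx).
have icu2 : ic u2.
  apply: icontN; apply: icontD; apply: icontM => //; apply: icontM => //; try exact: icont_cst.
  by move=> x hx; have [_ h2 _ _ _] := Hp x hx.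
pose del := expR (- (k1 / eps)).
have dL : nc (u (-1)) <= del.
  by rewrite ncu ler_expR lerN2 ler_wpM2r // invr_ge0 ltW.
have dR : nc (u 1) <= del.
  by rewrite ncu ler_expR lerN2 ler_wpM2r // invr_ge0 ltW.
pose l0 := (u 1 + u (-1)) / 2%:R; pose l1 := (u 1 - u (-1)) / 2%:R.
have n2c : nc (2%:R : R[i]) = 2.
  by rewrite -[X in nc X](rmorph_nat (real_complex R)) nc_ofr ger0_norm.
have l0b : nc l0 <= del.
  rewrite ncM ncV n2c ler_pdivrMr // mulr_natr mulr2n.
  by apply: le_trans (ncD _ _) (lerD dR dL).
have l1b : nc l1 <= del.
  rewrite ncM ncV n2c ler_pdivrMr // mulr_natr mulr2n.
  by apply: le_trans (ncB _ _) (lerD dR dL).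
pose ell (x : R) := l0 + l1 * ofr x.
have ellb x : -1 <= x <= 1 -> nc (ell x) <= 2 * del.
  move=> hx; apply: le_trans (ncD _ _) _; rewrite mulr_natl mulr2n; apply: lerD => //.
  rewrite ncM nc_ofr; apply: le_trans l1b; rewrite ler_piMr ?nc_ge0 //.
  by rewrite ler_norml.
have hell x : hasd ofr ell x l1.
  rewrite -[l1]add0r; apply: hasdD; first exact: hasd_cst.
  by rewrite -[X in hasd _ _ _ X]mulr1; apply: hasdZ; exact: hasd_j.
have n2' : (2%:R : R[i]) != 0 by rewrite pnatr_eq0.
pose w x := u x - ell x; pose w1 x := u1 x - l1.
have hdom : dom w w1 u2.
  split=> //.
  - by move=> x hx; apply: hasdB; [exact: hu|exact: hell].
  - by move=> x hx; rewrite -[u2 x]subr0; apply: hasdB; [exact: hu1|exact: hasd_cst].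
  - by rewrite /w /ell /l0 /l1 rmorphN1; field.
  - by rewrite /w /ell /l0 /l1 rmorph1; field.
have icw : ic w by exact: dom_c0 hdom.
have ub x : -1 <= x <= 1 -> nc (u x) <= 1.
  move=> hx; rewrite ncu -expR0 ler_expR oppr_le0 divr_ge0 ?(ltW eps0) // subr_ge0; exact: mmin.
have gb x : -1 <= x <= 1 -> nc (Lop (qf f) eps lam w u2 x) <= C3 * expR (- (c3 / eps)).
  move=> hx; have [_ _ _ _ h5] := Hp x hx.
  have -> : Lop (qf f) eps lam w u2 x = 'i%C * (p x * p x - ofr eps * dp x - V x) * u x - (qf f x - lam) * ell x.
    rewrite /Lop /w /u2 /u1 rmorphXn /= /V.
    have -> : 'i%C * ofr eps ^+ 2 * - (dp x * ie * u x + p x * ie * - (p x * ie * u x)) =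
       'i%C * ((ofr eps * ie) ^+ 2 * (p x * p x) - (ofr eps * ie) * ofr eps * dp x) * u x by ring.
    rewrite ieE expr1n !mul1r.
    have -> : 'i%C * (p x * p x - ofr eps * dp x - 'i%C * (qf f x - lam)) * u x =
      'i%C * (p x * p x - ofr eps * dp x) * u x - ('i%C * 'i%C) * (qf f x - lam) * u x by ring.
    by rewrite mulii; ring.
  apply: le_trans (ncB _ _) _; rewrite (ncM _ (u x)) (ncM 'i%C) nc_i mul1r (ncM (qf f x - lam)).
  have b1 : nc (p x * p x - ofr eps * dp x - V x) * nc (u x) <= C * expR (- (c3 / eps)).
    rewrite -[leRHS]mulr1; apply: ler_pM; rewrite ?nc_ge0 ?ub //.
    by apply: le_trans h5 _; rewrite ler_wpM2l ?(ltW C0) // ler_expR lerN2 ler_wpM2r ?invr_ge0 ?(ltW eps0) //.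
  have b2 : nc (qf f x - lam) * nc (ell x) <= 4 * C ^+ 2 * (2 * expR (- (c3 / eps))).
    apply: ler_pM; rewrite ?nc_ge0 ?ncVb //.
    by apply: le_trans (ellb x hx) _; rewrite ler_wpM2l // ler_expR lerN2 ler_wpM2r ?invr_ge0 ?(ltW eps0).
  apply: le_trans (lerD b1 b2) _; rewrite le_eqVlt; apply/orP; left; apply/eqP.
  by rewrite /C3; ring.
have n2g := n2_upper (@Lop_ic _ (qf f) eps (qf_ic hq) lam _ _ _ hdom) gb.
have delb : 2 * del <= e1 / 2.
  have h := expRN_le (divr_gt0 k10 eps0).
  have : del <= 4 * eps ^+ 2 / k1 ^+ 2.
    by apply: le_trans h _; rewrite le_eqVlt; apply/orP; left; apply/eqP; field; rewrite !gt_eqF.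
  move=> h2; apply: le_trans (ler_wpM2l (ltW (ltr0Sn _ 1)) h2) _.
  have eps2 : eps ^+ 2 <= k1 ^+ 2 * e1 / 16.
    apply: le_trans (ltW ee4); rewrite expr2 ler_piMr ?ltW //.
  have k12 : 0 < k1 ^+ 2 by rewrite exprn_gt0.
  rewrite mulrA ler_pdivrMr //; lra_on eps2 k12.
(* Re P has slope at most C, so within eps / C of [xs] it exceeds its minimum by at most eps, and
   [u] has modulus at least exp (-1) there. *)
have wlow (x : R) : -1 <= x <= 1 -> `|x - xs| <= eps / C -> e1 / 2 <= nc (w x).
  move=> hx xxs.
  have Pb : re (P x) - m <= eps.
    have step a b : -1 <= a -> a <= b -> b <= 1 -> `|re (P b) - re (P a)| <= C * (b - a).
      move=> ha hab hb; rewrite P_FTC //; apply: le_trans (re_le_nc _) _.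
      apply: nc_cI_bound => //.
        by move=> y /andP[y1 y2]; apply: pic; rewrite (le_trans ha) // (le_trans y2).
      by move=> y /andP[y1 y2]; have [] := Hp y; rewrite ?(le_trans ha) // (le_trans y2).
    apply: le_trans (ler_norm _) _.
    case/andP: hx => hx1 hx2; case/andP: xsI => hs1 hs2.
    have Cx : C * `|x - xs| <= eps by rewrite -ler_pdivlMl // mulrC.
    apply: le_trans Cx; rewrite /m; case: (leP xs x) => hxx.
      by rewrite [X in _ <= _ * X]ger0_norm ?subr_ge0 //; exact: step.
    rewrite distrC [X in _ <= _ * X]distrC [X in _ <= _ * X]ger0_norm ?subr_ge0 ?(ltW hxx) //.
    by apply: step => //; exact: ltW.
  have : e1 <= nc (u x).
    by rewrite ncu ler_expR lerN2 ler_pdivrMr // mul1r.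
  have a1 := nc_sub_le (u x) (ell x); have a2 := ellb x hx; rewrite -/(w x) in a1 => a3; lra_on a1 a2 a3 delb.
have Ceps : eps / C <= 1 by rewrite ler_pdivrMr // mul1r (le_trans (ltW ee1)).
have Ceps0 : 0 < eps / C by rewrite divr_gt0.
have n2w : (e1 / 2) ^+ 2 * (eps / C) <= n2 w.
  have e12 : 0 <= e1 / 2 by rewrite divr_ge0 // ltW.
  case/andP: (xsI) => hs1 hs2.
  (* The interval of length eps / C beside [xs] points towards 0, so that it stays in [-1, 1]. *)
  case: (leP xs 0) => hs.
    have -> : eps / C = xs + eps / C - xs by rewrite addrAC subrr add0r.
    apply: n2_lower => //; [by rewrite lerDl ltW|lra_on hs Ceps|].
    move=> x /andP[x1 x2]; apply: wlow.
      by apply/andP; split; lra_on hs1 x1 x2 hs Ceps.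
    by rewrite ger0_norm; lra_on x1 x2.
  have -> : eps / C = xs - (xs - eps / C) by rewrite opprB addrC subrK.
  apply: n2_lower => //; [lra_on hs Ceps|by rewrite gerBl ltW|].
  move=> x /andP[x1 x2]; apply: wlow.
    by apply/andP; split; lra_on hs2 x1 x2 hs Ceps.
  by rewrite ler0_norm; lra_on x1 x2.
exists w, w1, u2; split=> //.
  by apply: lt_le_trans n2w; rewrite mulr_gt0 // exprn_gt0 // divr_gt0.
apply: le_trans n2w.
apply: le_trans (ler_wpM2l (expR_ge0 _) n2g) _.
have -> : expR (2 * (c3 / 2) / eps) * ((C3 * expR (- (c3 / eps))) ^+ 2 * 2) = 2 * C3 ^+ 2 * expR (- (c3 / eps)).
  have -> : 2 * (c3 / 2) / eps = c3 / eps by field; rewrite gt_eqF.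
  have EE : expR (c3 / eps) * expR (- (c3 / eps)) = 1 by rewrite -expRD subrr expR0.
  transitivity (2 * C3 ^+ 2 * expR (- (c3 / eps)) * (expR (c3 / eps) * expR (- (c3 / eps)))); first by ring.
  by rewrite EE mulr1.
have h := expRN_le (divr_gt0 c30 eps0).
apply: le_trans (ler_wpM2l _ h) _; first by rewrite mulr_ge0 // exprn_ge0 // ltW.
move: ee3; rewrite ltr_pdivlMr ?mulr_gt0 ?exprn_gt0 // => ee3.
have -> : 2 * C3 ^+ 2 * (4 / (c3 / eps) ^+ 2) = (eps * (32 * C * C3 ^+ 2)) * (eps / (4 * C * c3 ^+ 2)).
  by field; rewrite !gt_eqF.
have -> : (e1 / 2) ^+ 2 * (eps / C) = (e1 ^+ 2 * c3 ^+ 2) * (eps / (4 * C * c3 ^+ 2)).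
  by field; rewrite !gt_eqF.
apply: ler_wpM2r (ltW ee3); apply: divr_ge0 (ltW eps0) _.
by apply: mulr_ge0; [apply: mulr_ge0 => //; exact: ltW|exact/exprn_ge0/ltW].
Qed.
End Quasimode.

(** * From quasi-modes to lower bounds for the resolvent *)

Section ResolventBound.
Context {R : realType}.
Variables (q : R -> R) (qf : R -> R[i]) (eps : R).
Hypotheses (qfc : ic qf) (qfE : forall x, -1 <= x <= 1 -> qf x = ofr (q x)) (eps0 : 0 < eps).
Implicit Types (w u : R -> R[i]).

Lemma dom_scale c w w1 w2 : dom w w1 w2 ->
  dom (fun x => c * w x) (fun x => c * w1 x) (fun x => c * w2 x).
Proof.
move=> h; split.
- by move=> x hx; apply: hasdZ; exact: (dom_d1 h).
- by move=> x hx; apply: hasdZ; exact: (dom_d2 h).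
- exact: icontZ (dom_c2 h).
- by rewrite (dom_l h) mulr0.
- by rewrite (dom_r h) mulr0.
Qed.

Lemma Lop_scale lam c w w2 x :
  Lop qf eps lam (fun x => c * w x) (fun x => c * w2 x) x = c * Lop qf eps lam w w2 x.
Proof. by rewrite /Lop; ring. Qed.

Lemma n2_scale c u : ic u -> n2 (fun x => c * u x) = nc c ^+ 2 * n2 u.
Proof.
move=> hu; have hi : ic (fun x => u x * (u x)^*%C) by apply: icontM => //; exact: icont_conj.
rewrite /n2 /Int (_ : cI _ _ _ = ofr (nc c ^+ 2) * cI (-1) 1 (fun x => u x * (u x)^*%C)).
  by rewrite reM im_ofr mul0r subr0.
rewrite -cIZ //; apply: eq_cI => x _.
by rewrite -mul_conj rmorphM; ring.
Qed.

Lemma n2_ge0 u : ic u -> 0 <= n2 u.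
Proof.
move=> hu; rewrite n2E; apply: Rintegral_ge0 => x _.
by rewrite normsq_nc sqr_ge0.
Qed.

Lemma resolvent_lower lam w w1 w2 (A : R) : 0 <= A -> dom w w1 w2 -> 0 < n2 w ->
  A ^+ 2 * n2 (Lop qf eps lam w w2) <= n2 w -> (A%:E <= resolvent_norm q eps lam)%E.
Proof.
move=> A0 h w0 H; rewrite /resolvent_norm; case: asboolP => [_|_]; last exact: leey.
apply: ereal_sup_ubound.
have icw := dom_c0 h; have icg := Lop_ic eps qfc lam h.
have s0 : 0 < Num.sqrt (n2 w) by rewrite sqrtr_gt0.
(* With this factor, t w has norm A and its image under L - lam has norm at most 1. *)
pose t := A / Num.sqrt (n2 w); have t0 : 0 <= t by rewrite divr_ge0 // ltW.
have nt : nc (ofr t : R[i]) = t by rewrite nc_ofr ger0_norm.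
exists (Lop qf eps lam (fun x => ofr t * w x) (fun x => ofr t * w2 x)), (fun x => ofr t * w x).
have h' := dom_scale (ofr t) h.
have icg' := Lop_ic eps qfc lam h'.
split.
- split; first exact: ic_L2fun.
  apply: (dom_op_shift qfE h') => //.
  by apply: ic_L2fun; apply: icontD => //; apply: icontZ; exact: dom_c0 h'.
- rewrite L2normE -[leRHS]sqrtr1 ler_sqrt //.
  have -> : n2 (Lop qf eps lam (fun x => ofr t * w x) (fun x => ofr t * w2 x)) =
     n2 (fun x => ofr t * Lop qf eps lam w w2 x).
    by congr n2; apply/funext => x; rewrite Lop_scale.
  rewrite n2_scale // nt /t expr_div_n sqr_sqrtr ?(ltW w0) //.
  by rewrite mulrAC ler_pdivrMr // mul1r.
- rewrite L2normE n2_scale // nt sqrtrM ?sqr_ge0 // sqrtr_sqr ger0_norm //.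
  by rewrite /t divfK // gt_eqF.
Qed.
End ResolventBound.

(** * The position of the domain in the semistrip *)

Section Strip.
Context {R : realType}.
Variables (q : R -> R).

Lemma nbhs_cball_intro (z : R[i]) (e : R) : 0 < e -> nbhs z (cball z e).
Proof.
move=> e0; apply/nbhs_ballP; exists (ofr e); first by rewrite /= ltcE /= eqxx.
move=> w; rewrite /ball /= distrC normr_nc ltcR => h; exact: h.
Qed.

Lemma compact_strip (K : set R[i]) : compact K -> K `<=` semistrip q ->
  exists d B : R, [/\ 0 < d & forall lam, K lam ->
    [/\ q (-1) + d <= re lam <= q 1 - d, im lam <= - d & nc lam <= B]].
Proof.
rewrite compact_near_coveringP => cK KP.
have step : forall lam, K lam -> \forall l \near lam & i \near 0^'+, 0 < i ->
  [/\ q (-1) + i <= re l <= q 1 - i, im l <= - i & nc l <= i^-1].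
  move=> lam /KP [/andP[l1 l2] l3].
  pose m := Num.min (re lam - q (-1)) (Num.min (q 1 - re lam) (- im lam)) / 2.
  have m0 : 0 < m by rewrite divr_gt0 // !lt_min !subr_gt0 l1 l2 oppr_gt0.
  have m2 : m * 2 = Num.min (re lam - q (-1)) (Num.min (q 1 - re lam) (- im lam)) by rewrite divfK // pnatr_eq0.
  have m1 : m * 2 <= re lam - q (-1) by rewrite m2 ge_min lexx.
  have m3 : m * 2 <= q 1 - re lam by rewrite m2 !ge_min lexx orbT.
  have m4 : m * 2 <= - im lam by rewrite m2 !ge_min lexx !orbT.
  clearbody m; clear m2.
  have B0 : 0 < nc lam + m by rewrite ltr_wpDl ?nc_ge0.
  pose r := Num.min m (nc lam + m)^-1.
  have r0 : 0 < r by rewrite lt_min m0 invr_gt0.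
  exists (cball lam m, [set i : R | i < r]) => /=.
    split; first exact: nbhs_cball_intro.
    exists r => // i /=; rewrite sub0r normrN => ir i0.
    by apply: le_lt_trans ir; exact: ler_norm.
  move=> [l i] /= [lr]; rewrite lt_min => /andP[im_ iB] i0.
  have lr' : nc (l - lam) < m by exact: lr.
  have := le_lt_trans (re_le_nc _) lr'; rewrite reD reN ltr_norml => /andP[a1 a2].
  have := le_lt_trans (im_le_nc _) lr'; rewrite imD imN ltr_norml => /andP[a3 a4].
  split; [apply/andP; split; lra|lra|].
  have : nc l <= nc lam + m.
    have -> : l = lam + (l - lam) by ring.
    by apply: le_trans (ncD _ _) _; rewrite lerD2l ltW.
  move=> h; apply: le_trans h _.
  by rewrite -[leLHS]invrK lef_pV2 ?posrE ?invr_gt0 // ltW.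
have [e /= e0 He] := cK R (0^'+) (fun i (lam : R[i]) => 0 < i ->
  [/\ q (-1) + i <= re lam <= q 1 - i, im lam <= - i & nc lam <= i^-1]) _ step.
have e2 : 0 < e / 2 by rewrite divr_gt0.
exists (e / 2), (e / 2)^-1; split=> // lam Kl.
apply: (He (e / 2)) => //=.
by rewrite sub0r normrN ger0_norm ?ltr_pdivrMr ?ltr_pMr ?ltr1n // ltW.
Qed.

Lemma ray_unbounded (z v : R[i]) (A : set R[i]) : nc v = 1 ->
  (forall t : R, 0 <= t -> A (z + v * ofr t)) -> ~ bounded_set (connected_component A z).
Proof.
move=> v1 hA [M [Mr HM]].
pose g (t : R) := z + v * ofr t.
have gc : {within `[0, +oo[, continuous g}.
  apply: continuous_subspaceT => t; apply/cvgrPdist_le => e /ltc_ofr[e' e0 ->].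
  near=> s; rewrite distrC normr_nc lecR.
  have -> : g s - g t = v * (ofr s - ofr t) by rewrite /g; ring.
  rewrite ncM v1 mul1r nc_ofrB distrC; near: s.
  by apply: cvgr_dist_le => //.
have cg : connected (g @` `[0, +oo[).
  apply: connected_continuous_connected gc.
  by apply/connected_intervalP; exact: interval_is_interval.
have sub : g @` `[0, +oo[ `<=` connected_component A z.
  apply: connected_component_max => //.
    by exists 0; rewrite /g ?rmorph0 ?mulr0 ?addr0 //= in_itv /= lexx.
  by move=> _ [t + <-]; rewrite /= in_itv /= andbT => t0; exact: hA.
have M1 : M < M + 1 by rewrite ltrDl.
(* The bound [M] of a bounded set is a complex number here; a norm below it is real, hence at most
   [N]. *)
pose N := nc (M + 1).
pose t := N + nc z + 1.
have N0 : 0 <= N by exact: nc_ge0.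
have t0 : 0 <= t by rewrite !addr_ge0 ?nc_ge0.
have gt_in : connected_component A z (g t).
  by apply: sub; exists t => //=; rewrite in_itv /= andbT.
have := HM _ M1 _ gt_in; rewrite /= normr_nc => H.
have H2 : nc (g t) <= N.
  move: H; rewrite lecE /= => /andP[_ h]; apply: le_trans h _.
  by apply: le_trans (ler_norm _) (re_le_nc _).
have := nc_sub_le (v * ofr t) (- z); rewrite opprK ncN ncM v1 mul1r nc_ofr ger0_norm //.
rewrite [v * _ + _]addrC -/(g t) /t; lra.
Unshelve. all: by end_near.
Qed.

(** [J] lies in the semistrip together with its upper side. The upward ray from a point above the
    real axis avoids this set, and so does the horizontal ray leading away from the strip from any
    other point outside it. *)
Lemma domain_in_strip (gp gm : set R[i]) :
  gp `<=` semistrip q `|` real_segment (q (-1)) (q 1) ->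
  gm `<=` semistrip q `|` real_segment (q (-1)) (q 1) ->
  domain_bounded_by (gp `|` gm `|` real_segment (q (-1)) (q 1)) `<=` semistrip q.
Proof.
move=> hp hm z [nJ bJ]; apply: contrapT => nP.
set S := real_segment _ _ in hp hm nJ bJ *.
set J := _ `|` S in nJ bJ.
have JS : J `<=` semistrip q `|` S.
  by move=> w [[/hp|/hm]|] //; right.
have nS : ~ S z by move=> h; apply: nJ; right.
have SP w : S w -> im w = 0 /\ q (-1) <= re w <= q 1.
  by move=> [t /= + <-]; rewrite in_itv.
have out w : (0 < im w \/ re w <= q (-1) \/ q 1 <= re w) -> ~ semistrip q w.
  by move=> [h|[h|h]] [/andP[a b] c];
    [move: (lt_trans h c)|move: (le_lt_trans h a)|move: (lt_le_trans b h)]; rewrite ltxx.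
have [iz|iz|iz] := ltgtP 0 (im z).
- apply: (@ray_unbounded z 'i%C) bJ; first exact: nc_i.
  move=> t t0 /JS; have E : im (z + 'i%C * ofr t) = im z + t.
    by rewrite imD imM re_i im_i im_ofr mulr0 add0r mul1r.
  move=> [|/SP[+ _]]; first by apply: out; left; rewrite E ltr_wpDr.
  by rewrite E => h; have := ltr_wpDr t0 iz; rewrite h ltxx.
- have nP' : re z <= q (-1) \/ q 1 <= re z.
    have [|h1] := leP (re z) (q (-1)); first by left.
    have [|h2] := leP (q 1) (re z); first by right.
    by case: nP; split => //; rewrite h1.
  have E s t : im (z + ofr s * ofr t) = im z.
    by rewrite imD imM !im_ofr mul0r mulr0 !addr0.
  have F s t : re (z + ofr s * ofr t) = re z + s * t.
    by rewrite reD reM !im_ofr !re_ofr mul0r subr0.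
  case: nP' => h.
    apply: (@ray_unbounded z (ofr (-1))) bJ; first by rewrite nc_ofr normrN1.
    move=> t t0 /JS [|/SP[+ _]]; last by rewrite E => e; rewrite e ltxx in iz.
    by apply: out; right; left; rewrite F mulN1r; lra.
  apply: (@ray_unbounded z (ofr 1)) bJ; first by rewrite nc_ofr normr1.
  move=> t t0 /JS [|/SP[+ _]]; last by rewrite E => e; rewrite e ltxx in iz.
  by apply: out; right; right; rewrite F mul1r; lra.
- have nP' : re z < q (-1) \/ q 1 < re z.
    have [h1|] := leP (q (-1)) (re z); last by left.
    have [h2|] := leP (re z) (q 1); last by right.
    case: nS; exists (re z); first by rewrite /= in_itv /= h1.
    by apply: complex_ext; rewrite ?re_ofr ?im_ofr.
  have F s t : re (z + ofr s * ofr t) = re z + s * t.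
    by rewrite reD reM !im_ofr !re_ofr mul0r subr0.
  case: nP' => h.
    apply: (@ray_unbounded z (ofr (-1))) bJ; first by rewrite nc_ofr normrN1.
    move=> t t0 /JS [|/SP[_ /andP[+ _]]]; last by rewrite F mulN1r; lra.
    by apply: out; right; left; rewrite F mulN1r; lra.
  apply: (@ray_unbounded z (ofr 1)) bJ; first by rewrite nc_ofr normr1.
  move=> t t0 /JS [|/SP[_ /andP[_ +]]]; last by rewrite F mul1r; lra.
  by apply: out; right; right; rewrite F mul1r; lra.
Qed.

Lemma connecting_in_strip G f (e : R[i]) x (y : R) A : q (-1) <= y <= q 1 ->
  connecting_part (critical_curve q G f e) x (ofr y) A ->
  A `<=` semistrip q `|` real_segment (q (-1)) (q 1).
Proof.
move=> hy [p [_ _ [p0 p1] pS ->]] w [t]; rewrite /= in_itv /= => /andP[t0].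
rewrite le_eqVlt => /predU1P[-> <-|t1 <-].
  by right; rewrite p1; exists y => //=; rewrite in_itv.
by left; apply: (proj1 (pS _ _)); exists t => //=; rewrite in_itv /= t0.
Qed.
End Strip.

Section PartOne.
Context {R : realType}.

Lemma resolvent_exponential (q : R -> R) (G : set R[i]) (f : R[i] -> R[i]) (K : set R[i]) :
  AM_ext q G f -> compact K -> K `<=` semistrip q ->
  exists tau eps0 : R, [/\ 0 < tau, 0 < eps0 &
       forall (lam : R[i]) (eps : R), K lam -> 0 < eps < eps0 ->
         ((expR (tau / eps))%:E <= resolvent_norm q eps lam)%E].
Proof.
move=> hq cK KP; have [d [B [d0 H]]] := compact_strip cK KP.
have [tau [e0 [t0 e00 Hq]]] := quasimode hq B d0.
exists tau, e0; split=> // lam eps /H[h1 h2 h3] he.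
have [w [w1 [w2 [hw w0 hg]]]] := Hq lam eps h1 h2 h3 he.
have eps0 : 0 < eps by case/andP: he.
apply: (resolvent_lower (qf_ic hq) (qf_q hq) (expR_ge0 _) hw w0).
apply: le_trans hg; rewrite -expRM_natl.
by rewrite le_eqVlt; apply/orP; left; apply/eqP; congr (expR _ * _); rewrite -mulr_natl mulrA.
Qed.
End PartOne.

(** * Energy estimates *)

Section Bilinear.
Context {R : realType}.
Implicit Types (u v w : R -> R[i]) (x : R).

(** Bilinear, without conjugation: with respect to this form L - lam is symmetric for every complex
    lam. The scalar product is [bil u (cj v)]. *)
Definition bil u v : R[i] := Int (fun x => u x * v x).
Definition cj u x : R[i] := (u x)^*%C.

Lemma cj_ic u : ic u -> ic (cj u). Proof. exact: icont_conj. Qed.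
Lemma n2_bil u : n2 u = re (bil u (cj u)). Proof. by []. Qed.
Lemma bil_cj u : ic u -> bil u (cj u) = ofr (n2 u).
Proof.
move=> hu; apply: complex_ext; rewrite ?re_ofr ?im_ofr //.
rewrite /bil /Int im_cI (@eq_Rintegral _ _ _ mu _ (fun=> 0)).
  by rewrite Rintegral_cst //= mul0r.
by move=> x _; rewrite /cj mul_conj im_ofr.
Qed.
Lemma bilC u v : bil u v = bil v u.
Proof. by apply: eq_cI => x _; rewrite mulrC. Qed.
Lemma eq_bil u v u' v' : (forall x, -1 <= x <= 1 -> u x = u' x) ->
  (forall x, -1 <= x <= 1 -> v x = v' x) -> bil u v = bil u' v'.
Proof. by move=> h1 h2; apply: eq_cI => x hx; rewrite h1 // h2. Qed.
Lemma eq_n2 u u' : (forall x, -1 <= x <= 1 -> u x = u' x) -> n2 u = n2 u'.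
Proof. by move=> h; congr re; apply: eq_cI => x hx; rewrite h. Qed.
Lemma bilDl u u' v : ic u -> ic u' -> ic v ->
  bil (fun x => u x + u' x) v = bil u v + bil u' v.
Proof.
move=> h h' hv; rewrite /bil /Int -cID; try exact: icontM.
by apply: eq_cI => x _; rewrite mulrDl.
Qed.
Lemma bilZl c u v : ic u -> ic v -> bil (fun x => c * u x) v = c * bil u v.
Proof.
move=> h hv; rewrite /bil /Int -cIZ; last exact: icontM.
by apply: eq_cI => x _; rewrite mulrA.
Qed.
Lemma bilBl u u' v : ic u -> ic u' -> ic v ->
  bil (fun x => u x - u' x) v = bil u v - bil u' v.
Proof.
move=> h h' hv; rewrite /bil /Int -cIB; try exact: icontM.
by apply: eq_cI => x _; rewrite mulrBl.
Qed.
Lemma bilBr u v v' : ic u -> ic v -> ic v' ->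
  bil u (fun x => v x - v' x) = bil u v - bil u v'.
Proof. by move=> *; rewrite bilC bilBl // !(bilC u). Qed.
Lemma bilZr c u v : ic u -> ic v -> bil u (fun x => c * v x) = c * bil u v.
Proof. by move=> *; rewrite bilC bilZl // bilC. Qed.
Lemma bil_conj u v : ic u -> ic v -> bil (cj u) (cj v) = ((bil u v)^*)%C.
Proof.
move=> hu hv; rewrite /bil /Int -cI_conj; last exact: icontM.
by apply: eq_cI => x _; rewrite /cj rmorphM.
Qed.
Lemma cjK u x : cj (cj u) x = u x. Proof. exact: conjcK. Qed.
Lemma n2_cj u : n2 (cj u) = n2 u.
Proof. by congr re; apply: eq_cI => x _; rewrite -/(cj _ x) cjK mulrC. Qed.

Lemma ic_sum n (v : nat -> R -> R[i]) (c : nat -> R[i]) : (forall k, (k < n)%N -> ic (v k)) ->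
  ic (fun x => \sum_(k < n) c k * v k x).
Proof.
elim: n => [|n IH] h.
  move=> x _; apply: (@ccont_near _ _ _ (fun=> 0) _ _ _ ltr01); last exact: ccont_cst.
  by move=> y _; rewrite big_ord0.
move=> x hx; apply: (@ccont_near _ _ _ (fun x => \sum_(k < n) c k * v k x + c n * v n x) _ _ 1 ltr01).
  by move=> y _; rewrite big_ord_recr.
apply: ccontD; first by apply: IH => // k kn; apply: h; exact: ltnW.
by apply: ccontM; [exact: ccont_cst|exact: h].
Qed.

Lemma bil_sum n (v : nat -> R -> R[i]) (c : nat -> R[i]) w : (forall k, (k < n)%N -> ic (v k)) ->
  ic w -> bil (fun x => \sum_(k < n) c k * v k x) w = \sum_(k < n) c k * bil (v k) w.
Proof.
move=> + hw; elim: n => [|n IH] h.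
  rewrite big_ord0 -[RHS](mul0r (bil w w)) -bilZl //.
  by apply: eq_bil => // x _; rewrite big_ord0 mul0r.
have h' k : (k < n)%N -> ic (v k) by move=> kn; apply: h; exact: ltnW.
have hn : ic (v n) by exact: h.
rewrite big_ord_recr /= -(IH h') -(bilZl (c n) hn hw).
rewrite -(bilDl (ic_sum c h') (icontZ (c n) hn) hw).
by apply: eq_bil => // x _; rewrite big_ord_recr.
Qed.

(** [cj v] is subtracted, so that the mixed term is the bilinear form of [u] and [v]. *)
Lemma n2_sub_expand (a b : R[i]) u v : ic u -> ic v ->
  n2 (fun x => a * u x - b * cj v x) =
  nc a ^+ 2 * n2 u - 2 * re (a * (b^*)%C * bil u v) + nc b ^+ 2 * n2 v.
Proof.
move=> hu hv; have hcv := cj_ic hv; have hcu := cj_ic hu.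
have E : bil (fun x => a * u x - b * cj v x) (cj (fun x => a * u x - b * cj v x)) =
   ofr (nc a ^+ 2 * n2 u) - a * (b^*)%C * bil u v - (a * (b^*)%C * bil u v)^*%C + ofr (nc b ^+ 2 * n2 v).
  rewrite (@eq_bil _ _ (fun x => a * u x - b * cj v x) (fun x => (a^*)%C * cj u x - (b^*)%C * v x)) //; last first.
    by move=> x _; rewrite /cj rmorphB !rmorphM /= conjcK.
  have i1 := icontZ a hu; have i2 := icontZ b hcv.
  have i3 := icontZ ((a^*)%C) hcu; have i4 := icontZ ((b^*)%C) hv.
  rewrite bilBl ?bilBr ?bilZl ?bilZr //; last exact: icontB.
  rewrite bil_cj // bil_conj // (bilC (cj v)) (_ : bil v (cj v) = ofr (n2 v)) ?bil_cj //.
  have M (c : R[i]) (k : R) : ofr (nc c ^+ 2 * k) = c * (c^*)%C * ofr k.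
    by rewrite [LHS]rmorphM mul_conj.
  have J : (a * (b^*)%C * bil u v)^*%C = (a^*)%C * b * (bil u v)^*%C.
    by rewrite !rmorphM; congr (_ * _ * _); exact: conjcK.
  rewrite !M J (bilC v u); ring.
rewrite n2_bil E !(reD, reN) re_conj !re_ofr; ring.
Qed.

Lemma n2_pos0 u x : ic u -> -1 <= x <= 1 -> u x != 0 -> 0 < n2 u.
Proof.
move=> hu hx ux.
have k0 : 0 < nc (u x) / 2 by rewrite divr_gt0 // nc_gt0.
have [d d0 Hd] := hu x hx _ k0.
pose r := Num.min (d / 2) 1.
have r0 : 0 < r by rewrite lt_min ltr01 divr_gt0.
have r1 : r <= 1 by rewrite ge_min lexx orbT.
have rd : r < d.
  apply: (@le_lt_trans _ _ (d / 2)); first by rewrite ge_min lexx.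
  by rewrite ltr_pdivrMr // ltr_pMr // ltr1n.
clearbody r.
have H y : `|y - x| <= r -> nc (u x) / 2 <= nc (u y).
  move=> hy; have := Hd y; rewrite nc_ofrB => /(_ (le_lt_trans hy rd)) h.
  have := nc_sub_le (u x) (u y); rewrite ncBC => h2; lra_on h h2.
have rr : 0 < (nc (u x) / 2) ^+ 2 * r by rewrite mulr_gt0 // exprn_gt0.
case/andP: hx => x1 x2; apply: lt_le_trans rr _.
case: (leP x 0) => hs.
  have -> : r = x + r - x by rewrite addrAC subrr add0r.
  apply: n2_lower => //; [by rewrite lerDl ltW|lra_on hs r1|exact: ltW|].
  move=> y /andP[y1 y2]; apply: H.
  by rewrite ger0_norm; lra_on y1 y2.
have -> : r = x - (x - r) by rewrite opprB addrC subrK.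
apply: n2_lower => //; [lra_on hs r1|by rewrite gerBl ltW|exact: ltW|].
move=> y /andP[y1 y2]; apply: H.
by rewrite ler0_norm; lra_on y1 y2.
Qed.

Lemma n2_eq0 u x : ic u -> n2 u = 0 -> -1 <= x <= 1 -> u x = 0.
Proof.
move=> hu u0 hx; apply/eqP; apply: contraTT isT => /(n2_pos0 hu hx).
by rewrite u0 ltxx.
Qed.

Lemma cauchy_schwarz u v : ic u -> ic v -> nc (bil u v) ^+ 2 <= n2 u * n2 v.
Proof.
move=> hu hv; have hcv := cj_ic hv.
have [v0|v0] := eqVneq (n2 v) 0.
  have -> : bil u v = bil u (fun x => 0 * v x).
    by apply: eq_bil => // x hx; rewrite (n2_eq0 hv v0 hx) mulr0.
  by rewrite bilZr // mul0r nc0 expr0n v0 mulr0.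
have vp : 0 < n2 v by rewrite lt_def v0 n2_ge0.
have := n2_sub_expand (ofr (n2 v)) (bil u v) hu hv.
have := @n2_ge0 _ (fun x => ofr (n2 v) * u x - bil u v * cj v x).
move=> /(_ (icontB (icontZ _ hu) (icontZ _ hcv))) h0 E; rewrite {}E in h0.
rewrite nc_ofr ger0_norm ?(ltW vp) // in h0.
have E : re (ofr (n2 v) * ((bil u v)^*)%C * bil u v) = n2 v * nc (bil u v) ^+ 2.
  by rewrite -mulrA [_^*%C * _]mulrC mul_conj -rmorphM re_ofr.
rewrite E in h0.
rewrite -(ler_pM2l vp).
set b := nc (bil u v) ^+ 2 in h0 *; set A := n2 u in h0 *; set D := n2 v in h0 *.
rewrite expr2 in h0; lra_on h0.
Qed.

Lemma cauchy_schwarz_sqrt u v : ic u -> ic v ->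
  nc (bil u v) <= Num.sqrt (n2 u) * Num.sqrt (n2 v).
Proof.
move=> hu hv; rewrite -sqrtrM ?n2_ge0 // -[leLHS]ger0_norm ?nc_ge0 // -sqrtr_sqr.
by apply: ler_wsqrtr; exact: cauchy_schwarz.
Qed.
End Bilinear.

Section EnergyAux.
Context {R : realType}.
Implicit Types (A t B : R) (lam : R[i]).
Lemma im_energy A t B lam :
  im (- 'i%C * ofr A + ofr t - lam * ofr B) = - (A + im lam * B).
Proof.
by rewrite !imD !imN !im_ofrM !imN im_i im_ofr; ring.
Qed.
Lemma re_energy A t B lam :
  re (- 'i%C * ofr A + ofr t - lam * ofr B) = t - re lam * B.
Proof.
by rewrite !reD !reN !re_ofrM !reN re_i re_ofr; ring.
Qed.
End EnergyAux.

Section Energy.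
Context {R : realType}.
Implicit Types (u v w : R -> R[i]) (x : R) (lam : R[i]).

Lemma hasd_conj u x D : hasd ofr u x D -> hasd ofr (cj u) x (D^*)%C.
Proof.
move=> h e /h[d d0 H]; exists d => // y /H.
rewrite /cj; have -> : (u y)^*%C - (u x)^*%C - (D^*)%C * (ofr y - ofr x) =
   ((u y - u x - D * (ofr y - ofr x))^*)%C.
  have K : ((ofr y - ofr x)^*)%C = ofr y - ofr x :> R[i] by rewrite ofrB conjc_real.
  by rewrite rmorphB rmorphB rmorphM; congr (_ - _ * _).
by rewrite nc_conj.
Qed.

Lemma dom_cj w w1 w2 : dom w w1 w2 -> dom (cj w) (cj w1) (cj w2).
Proof.
move=> h; split.
- by move=> x hx; apply: hasd_conj; exact: (dom_d1 h).
- by move=> x hx; apply: hasd_conj; exact: (dom_d2 h).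
- exact: cj_ic (dom_c2 h).
- by rewrite /cj (dom_l h) conjc0.
- by rewrite /cj (dom_r h) conjc0.
Qed.

Lemma dom_sum n (v v1 v2 : nat -> R -> R[i]) (c : nat -> R[i]) :
  (forall k, (k < n)%N -> dom (v k) (v1 k) (v2 k)) ->
  dom (fun x => \sum_(k < n) c k * v k x) (fun x => \sum_(k < n) c k * v1 k x)
    (fun x => \sum_(k < n) c k * v2 k x).
Proof.
move=> h; split.
- move=> x hx; elim: n h => [|n IH] h.
    rewrite big_ord0; apply: (@hasd_near _ _ _ (fun=> 0) _ _ _ _ ltr01); last exact: hasd_cst.
    by move=> y _; rewrite big_ord0.
  rewrite big_ord_recr /=.
  apply: (@hasd_near _ _ _ (fun x => \sum_(k < n) c k * v k x + c n * v n x) _ _ _ 1 ltr01).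
    by move=> y _; rewrite big_ord_recr.
  apply: hasdD; first by apply: IH => k kn; apply: h; exact: ltnW.
  by apply: hasdZ; exact: (dom_d1 (h n (ltnSn n))).
- move=> x hx; elim: n h => [|n IH] h.
    rewrite big_ord0; apply: (@hasd_near _ _ _ (fun=> 0) _ _ _ _ ltr01); last exact: hasd_cst.
    by move=> y _; rewrite big_ord0.
  rewrite big_ord_recr /=.
  apply: (@hasd_near _ _ _ (fun x => \sum_(k < n) c k * v1 k x + c n * v1 n x) _ _ _ 1 ltr01).
    by move=> y _; rewrite big_ord_recr.
  apply: hasdD; first by apply: IH => k kn; apply: h; exact: ltnW.
  by apply: hasdZ; exact: (dom_d2 (h n (ltnSn n))).
- by apply: ic_sum => k /h/dom_c2.
- by rewrite big1 // => k _; rewrite (dom_l (h k (ltn_ord k))) mulr0.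
- by rewrite big1 // => k _; rewrite (dom_r (h k (ltn_ord k))) mulr0.
Qed.

Lemma green w w1 w2 v v1 v2 : dom w w1 w2 -> dom v v1 v2 -> bil w2 v = bil w v2.
Proof.
move=> h k; apply/eqP; rewrite -subr_eq0; apply/eqP.
have [hw hv] := (dom_c0 h, dom_c0 k); have [hw2 hv2] := (dom_c2 h, dom_c2 k).
rewrite /bil /Int -cIB; try exact: icontM.
rewrite (@cI_FTC _ (-1) 1 (fun x => w1 x * v x - w x * v1 x)) ?lemm11 //.
- by rewrite (dom_l h) (dom_l k) (dom_r h) (dom_r k) !mulr0 !mul0r !subrr.
- move=> x hx; have -> : w2 x * v x - w x * v2 x = (w2 x * v x + w1 x * v1 x) - (w1 x * v1 x + w x * v2 x) by ring.
  apply: hasdB; apply: hasdM.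
  + exact: (dom_d2 h).
  + exact: (dom_d1 k).
  + exact: (dom_d1 h).
  + exact: (dom_d2 k).
- by apply: icontB; exact: icontM.
Qed.

Lemma green_energy w w1 w2 : dom w w1 w2 -> bil w2 (cj w) = - ofr (n2 w1).
Proof.
move=> h; have hc := dom_cj h.
apply/eqP; rewrite -subr_eq0 opprK -bil_cj; last exact: dom_c1 h.
have [hw hw1] := (dom_c0 h, dom_c1 h); have hw2 := dom_c2 h.
have [cw cw1] := (dom_c0 hc, dom_c1 hc).
rewrite /bil /Int -cID; try exact: icontM.
rewrite (@cI_FTC _ (-1) 1 (fun x => w1 x * cj w x)) ?lemm11 //.
- by rewrite (dom_l hc) (dom_r hc) !mulr0 subrr.
- by move=> x hx; apply: hasdM; [exact: (dom_d2 h)|exact: (dom_d1 hc)].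
- by apply: icontD; exact: icontM.
Qed.

Variables (q : R -> R) (qf : R -> R[i]) (eps : R).
Hypotheses (qfc : ic qf) (qfE : forall x, -1 <= x <= 1 -> qf x = ofr (q x)) (eps0 : 0 < eps).
Local Notation Lp := (Lop qf eps).

Lemma bil_Lop lam w w1 w2 v : dom w w1 w2 -> ic v ->
  bil (Lp lam w w2) v = 'i%C * ofr (eps ^+ 2) * bil w2 v + bil (fun x => (qf x - lam) * w x) v.
Proof.
move=> h hv; rewrite /Lop bilDl ?bilZl //.
- exact: dom_c2 h.
- exact: icontZ (dom_c2 h).
- by apply: icontM; [apply: icontB => //; exact: icont_cst|exact: dom_c0 h].
Qed.

Lemma Lop_sym lam w w1 w2 v v1 v2 : dom w w1 w2 -> dom v v1 v2 ->
  bil (Lp lam w w2) v = bil w (Lp lam v v2).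
Proof.
move=> h k; rewrite (bil_Lop _ h (dom_c0 k)) [RHS]bilC (bil_Lop _ k (dom_c0 h)).
rewrite (green h k) (bilC w); congr (_ + _).
by apply: eq_cI => x _; rewrite -!mulrA [w x * _]mulrC.
Qed.

(** Integration by parts against the conjugate of [w]; [t] is the integral of q |w|^2, real because
    q is. The imaginary part of the identity controls w and w' for im lam > 0, the real part
    controls w where |re lam| exceeds the bound of q. *)
Lemma energy lam w w1 w2 : dom w w1 w2 -> exists t : R,
  bil (Lp lam w w2) (cj w) = - 'i%C * ofr (eps ^+ 2 * n2 w1) + ofr t - lam * ofr (n2 w) /\
  forall Q, (forall x, -1 <= x <= 1 -> `|q x| <= Q) -> `|t| <= Q * n2 w.
Proof.
move=> h; have hw := dom_c0 h; have hcw := cj_ic hw.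
pose s := bil (fun x => qf x * w x) (cj w).
have icq : ic (fun x => qf x * w x) by exact: icontM.
have sE : im s = 0.
  rewrite /s /bil /Int im_cI (@eq_Rintegral _ _ _ mu _ (fun=> 0)).
    by rewrite Rintegral_cst //= mul0r.
  move=> x; rewrite inE /= in_itv /= => hx.
  by rewrite -mulrA /cj mul_conj qfE // -rmorphM im_ofr.
exists (re s); split.
  rewrite (bil_Lop _ h hcw) (green_energy h).
  have -> : bil (fun x => (qf x - lam) * w x) (cj w) = s - lam * bil w (cj w).
    rewrite -bilZl // -bilBl //; last exact: icontZ.
    by apply: eq_bil => // x _; rewrite mulrBl.
  rewrite bil_cj // (_ : ofr (re s) = s); last by apply: complex_ext; rewrite ?re_ofr ?im_ofr.
  rewrite rmorphM; ring.
move=> Q HQ; have -> : Q * n2 w = re (cI (-1) 1 (fun x => ofr Q * (w x * cj w x))).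
  rewrite cIZ; last exact: icontM.
  by rewrite reM im_ofr mul0r subr0.
apply: le_trans (re_le_nc _) _; apply: le_trans (nc_cI_le _) _; first exact: icontM.
apply: le_re_cI.
- by apply: icont_nc; exact: icontM.
- by apply: icontZ; exact: icontM.
move=> x hx; rewrite /cj -mulrA mul_conj qfE // -!rmorphM !re_ofr nc_ofr normrM.
by rewrite [X in _ * X]ger0_norm ?sqr_ge0 // ler_wpM2r ?sqr_ge0 // HQ.
Qed.

Lemma energy_top lam w w1 w2 : dom w w1 w2 -> 0 <= im lam ->
  eps ^+ 2 * n2 w1 + im lam * n2 w <= Num.sqrt (n2 (Lp lam w w2)) * Num.sqrt (n2 w).
Proof.
move=> h l0; have [t [E _]] := energy lam h.
have hL := Lop_ic eps qfc lam h; have hw := dom_c0 h; have hcw := cj_ic hw.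
have := cauchy_schwarz_sqrt hL hcw; rewrite n2_cj E => CS.
apply: le_trans (le_trans (ler_norm _) _) CS.
apply: le_trans (im_le_nc _).
by rewrite im_energy normrN.
Qed.

Lemma energy_side lam w w1 w2 (Q T : R) : dom w w1 w2 -> (forall x, -1 <= x <= 1 -> `|q x| <= Q) ->
  Q + T <= `|re lam| -> T * n2 w <= Num.sqrt (n2 (Lp lam w w2)) * Num.sqrt (n2 w).
Proof.
move=> h HQ HT; have [t [E Ht]] := energy lam h.
have hL := Lop_ic eps qfc lam h; have hw := dom_c0 h; have hcw := cj_ic hw.
have := cauchy_schwarz_sqrt hL hcw; rewrite n2_cj E => CS.
apply: le_trans CS; apply: le_trans (re_le_nc _).
rewrite re_energy.
have n0 := n2_ge0 hw.
have : (Q + T) * n2 w <= `|re lam| * n2 w by rewrite ler_wpM2r.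
have := Ht Q HQ; have := lerB_dist (re lam * n2 w) t.
rewrite distrC normrM (ger0_norm n0) => a b c.
by lra.
Qed.
End Energy.

(** * Schur's inequality *)

Section Herm.
Context {R : realType}.
Implicit Types (u v w : R -> R[i]) (x : R).

Lemma bil_swap u v : ic u -> ic v -> bil u (cj v) = ((bil v (cj u))^*)%C.
Proof.
move=> hu hv; rewrite -bil_conj //; last exact: cj_ic.
by rewrite bilC; apply: eq_bil => // x _; rewrite cjK.
Qed.

Lemma sum_n2_le n (w : nat -> R -> R[i]) K : (forall k, (k < n)%N -> ic (w k)) ->
  (forall x, -1 <= x <= 1 -> \sum_(k < n) nc (w k x) ^+ 2 <= K) ->
  \sum_(k < n) n2 (w k) <= 2 * K.
Proof.
move=> hw hK.
have icS m : (m <= n)%N -> ic (fun x => \sum_(k < m) w k x * cj (w k) x).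
  elim: m => [|m IH] mn.
    by move=> x hx; apply: (@ccont_near _ _ _ (fun=> 0) _ _ _ ltr01);
      [by move=> y _; rewrite big_ord0|exact: ccont_cst].
  move=> x hx; apply: (@ccont_near _ _ _ (fun x => \sum_(k < m) w k x * cj (w k) x + w m x * cj (w m) x) _ _ 1 ltr01).
    by move=> y _; rewrite big_ord_recr.
  have hm : ic (w m) by exact: hw.
  by apply: ccontD; [apply: IH => //; exact: ltnW|apply: ccontM; [exact: hm|exact: (cj_ic hm)]].
have E m : (m <= n)%N -> \sum_(k < m) n2 (w k) = re (Int (fun x => \sum_(k < m) w k x * cj (w k) x)).
  elim: m => [|m IH] mn.
    rewrite big_ord0 /Int (@eq_cI _ _ _ _ (fun=> 0)); last by move=> x _; rewrite big_ord0.
    by rewrite re_cI /= Rintegral_cst //= mul0r.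
  have hm : ic (w m) by exact: hw.
  rewrite big_ord_recr /= IH; last exact: ltnW.
  rewrite -reD -cID; last 2 first.
  - by apply: icS; exact: ltnW.
  - by apply: icontM => //; exact: cj_ic.
  rewrite -[RHS]/(re (Int (fun x => \sum_(k < m.+1) w k x * cj (w k) x))).
  by congr re; apply: eq_cI => x _; rewrite big_ord_recr.
rewrite E //.
have -> : 2 * K = re (cI (-1) 1 (fun=> ofr K)).
  by rewrite cI_cst ?lemm11 // re_ofrM re_ofr opprK mulrC.
apply: le_re_cI => //; [exact: icS|exact: icont_cst|].
move=> x hx; rewrite re_ofr; apply: le_trans (hK x hx).
rewrite (_ : \sum_(k < n) w k x * cj (w k) x = ofr (\sum_(k < n) nc (w k x) ^+ 2)) //.
by rewrite rmorph_sum /=; apply: eq_bigr => k _; rewrite /cj mul_conj.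
Qed.
End Herm.

Section Eigen.
Context {R : realType}.
Variables (q : R -> R) (qf : R -> R[i]) (eps : R).
Hypotheses (qfc : ic qf) (qfE : forall x, -1 <= x <= 1 -> qf x = ofr (q x)) (eps0 : 0 < eps).
Local Notation Lp := (Lop qf eps).
Variables (v v1 v2 : nat -> R -> R[i]) (l : nat -> R[i]).
Hypotheses (hv : forall k, dom (v k) (v1 k) (v2 k)) (hn : forall k, n2 (v k) = 1)
  (hL : forall k x, -1 <= x <= 1 -> Lp (l k) (v k) (v2 k) x = 0) (linj : injective l).
Implicit Types (c : nat -> R[i]) (lam : R[i]) (n : nat).

Definition comb n c x := \sum_(k < n) c k * v k x.
Definition comb1 n c x := \sum_(k < n) c k * v1 k x.
Definition comb2 n c x := \sum_(k < n) c k * v2 k x.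

Lemma hvc k : ic (v k). Proof. exact: dom_c0 (hv k). Qed.

Lemma comb_dom n c : dom (comb n c) (comb1 n c) (comb2 n c).
Proof. by apply: dom_sum => k _. Qed.
Lemma comb_ic n c : ic (comb n c). Proof. exact: dom_c0 (comb_dom n c). Qed.

Lemma Lop_eigen lam k x : -1 <= x <= 1 -> Lp lam (v k) (v2 k) x = (l k - lam) * v k x.
Proof.
move=> hx; have := hL k hx; rewrite /Lop => h.
have -> : 'i%C * ofr (eps ^+ 2) * v2 k x = - ((qf x - l k) * v k x).
  by apply/eqP; rewrite -addr_eq0 h.
ring.
Qed.

Lemma Lop_comb lam n c x : -1 <= x <= 1 ->
  Lp lam (comb n c) (comb2 n c) x = comb n (fun k => c k * (l k - lam)) x.
Proof.
move=> hx; rewrite /Lop /comb /comb2 !mulr_sumr -big_split /=.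
apply: eq_bigr => k _; rewrite -[RHS]mulrA -(Lop_eigen lam k hx) /Lop; ring.
Qed.

(** L - l n removes the last term. That the image of a vanishing combination vanishes follows from
    symmetry, by pairing with the conjugate of the image, without differentiating. *)
Lemma lin_indep n c : (forall x, -1 <= x <= 1 -> comb n c x = 0) ->
  forall k, (k < n)%N -> c k = 0.
Proof.
elim: n c => // n IH c h.
have h2 : forall x, -1 <= x <= 1 -> comb n (fun k => c k * (l k - l n)) x = 0.
  set c' := fun k => c k * (l k - l n).
  have E x : -1 <= x <= 1 -> Lp (l n) (comb n.+1 c) (comb2 n.+1 c) x = comb n c' x.
    by move=> hx; rewrite Lop_comb // /comb big_ord_recr /= subrr mulr0 mul0r addr0.
  have hg := comb_dom n c'; have hgc := dom_cj hg.
  have := Lop_sym eps qfc (l n) (comb_dom n.+1 c) hgc.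
  rewrite (eq_bil E (fun x _ => erefl _)).
  rewrite (@eq_bil _ (comb n.+1 c) _ (fun x => 0 * v 0%N x) _ _ (fun x _ => erefl _)); last first.
    by move=> x hx; rewrite mul0r h.
  rewrite bilZl ?mul0r; [|exact: hvc|exact: Lop_ic hgc].
  rewrite bil_cj; last exact: comb_ic.
  move=> [h0] x hx; exact: (n2_eq0 (comb_ic n c') h0 hx).
have z k : (k < n)%N -> c k = 0.
  move=> kn; have := IH _ h2 k kn; move/eqP; rewrite mulf_eq0 subr_eq0 => /orP[/eqP //|/eqP/linj kE].
  by rewrite kE ltnn in kn.
move=> k; rewrite ltnS leq_eqVlt => /predU1P[->|]; last exact: z.
have E x : -1 <= x <= 1 -> c n * v n x = 0.
  move=> hx; rewrite -(h x hx) /comb big_ord_recr /= big1 ?add0r // => i _.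
  by rewrite z // mul0r.
have := n2_scale (c n) (hvc n); rewrite hn mulr1.
rewrite (@eq_n2 _ _ (fun x => 0 * v n x)); last by move=> x hx; rewrite mul0r E.
rewrite n2_scale ?hn; last exact: hvc.
rewrite nc0 expr0n mul0r => /esym/eqP; rewrite expf_eq0 /= nc_eq0 => /eqP //.
Qed.

(** The [v k] are not orthogonal, so the next one enters through its residual [r] after projection
    onto the previous ones. *)
Lemma projection n u : ic u -> exists c, forall k, (k < n)%N ->
  bil (fun x => u x - comb n c x) (cj (v k)) = 0.
Proof.
elim: n u => [|n IH] u hu; first by exists (fun=> 0).
have [b hb] := IH _ (hvc n); have [c hc] := IH _ hu.
pose r x := v n x - comb n b x; pose u' x := u x - comb n c x.
have icr : ic r by apply: icontB; [exact: hvc|exact: comb_ic].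
have icu' : ic u' by apply: icontB => //; exact: comb_ic.
have icj k := cj_ic (hvc k).
have ort w d : ic w -> (forall k, (k < n)%N -> bil w (cj (v k)) = 0) -> bil w (cj (comb n d)) = 0.
  move=> hw hk; rewrite bil_swap //; last exact: comb_ic.
  rewrite bil_sum; [|by move=> k _; exact: hvc|exact: cj_ic].
  rewrite big1 ?conjc0 // => k _.
  by rewrite bil_swap ?hk ?conjc0 ?mulr0 //; exact: hvc.
have rn w : ic w -> (forall k, (k < n)%N -> bil w (cj (v k)) = 0) -> bil w (cj (v n)) = bil w (cj r).
  move=> hw hk; rewrite (@eq_bil _ w (cj (v n)) w (fun x => cj r x + cj (comb n b) x)) //; last first.
    by move=> x _; rewrite /cj -rmorphD /r subrK.
  rewrite bilC bilDl; [|exact: cj_ic|exact: cj_ic (comb_ic _ _)|by []].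
  by rewrite bilC (bilC (cj (comb n b))) ort // addr0.
(* If [n2 r] is 0, then [t] is 0 by the convention for division, and this is right because [r]
   vanishes on [-1, 1]. *)
pose t := bil u' (cj r) / ofr (n2 r).
exists (fun k => if k == n then t else c k - t * b k) => k kn.
have E x : u x - comb n.+1 (fun k => if k == n then t else c k - t * b k) x = u' x - t * r x.
  rewrite /comb big_ord_recr /= eqxx /u' /r /comb.
  have -> : \sum_(i < n) (if (i : nat) == n then t else c i - t * b i) * v i x =
     \sum_(i < n) c i * v i x - t * \sum_(i < n) b i * v i x.
    rewrite mulr_sumr -sumrB; apply: eq_bigr => i _.
    by rewrite ltn_eqF // mulrBl mulrA.
  ring.
rewrite (@eq_bil _ _ (cj (v k)) (fun x => u' x - t * r x) (cj (v k))) //.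
rewrite bilBl //; last exact: icontZ.
rewrite bilZl //.
move: kn; rewrite ltnS leq_eqVlt => /predU1P[->|kn]; last by rewrite hc // hb // mulr0 subr0.
rewrite (rn u') // (rn r) // bil_cj //.
have [r0|r0] := eqVneq (n2 r) 0.
  rewrite r0 mulr0 subr0 (@eq_bil _ u' (cj r) u' (fun x => 0 * u' x)) ?bilZr ?mul0r //.
  by move=> x hx; rewrite /cj (n2_eq0 icr r0 hx) conjc0 mul0r.
by rewrite /t divfK ?subrr // ofr_eq0.
Qed.

Lemma gram_schmidt j : exists a : nat -> R[i], n2 (comb j.+1 a) = 1 /\
  forall k, (k < j)%N -> bil (comb j.+1 a) (cj (v k)) = 0.
Proof.
have [b hb] := projection j (hvc j).
pose a k := if k == j then 1 else - b k.
have E x : v j x - comb j b x = comb j.+1 a x.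
  rewrite /comb big_ord_recr /= /a eqxx mul1r addrC -sumrN; congr (_ + _).
  by apply: eq_bigr => i _; rewrite ltn_eqF // mulNr.
have icr : ic (comb j.+1 a) by exact: comb_ic.
have r0 : n2 (comb j.+1 a) != 0.
  apply/eqP => h; have := lin_indep (fun x hx => n2_eq0 icr h hx) (ltnSn j).
  by rewrite /a eqxx => /eqP; rewrite oner_eq0.
have rp : 0 < n2 (comb j.+1 a) by rewrite lt_def r0 n2_ge0.
pose s : R[i] := ofr (Num.sqrt (n2 (comb j.+1 a)))^-1.
have E2 x : comb j.+1 (fun k => s * a k) x = s * comb j.+1 a x.
  by rewrite /comb mulr_sumr; apply: eq_bigr => i _; rewrite mulrA.
exists (fun k => s * a k); split.
  rewrite (eq_n2 (fun x _ => E2 x)) n2_scale // nc_ofr ger0_norm ?invr_ge0 ?sqrtr_ge0 //.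
  by rewrite exprVn sqr_sqrtr ?mulVf // ltW.
move=> k kj; rewrite (eq_bil (fun x _ => E2 x) (fun x _ => erefl _)).
rewrite bilZl //; last exact: cj_ic (hvc k).
rewrite (_ : bil _ _ = 0) ?mulr0 // -(hb k kj).
by apply: eq_bil => // x _; rewrite E.
Qed.

(* Schur's inequality for the inverse A of L - lam0: in the orthonormalized
   system e_j the numbers 1 / (l_j - lam0) are the diagonal entries of A, and the
   Hilbert-Schmidt norm of A is controlled by its pointwise bound. *)
Lemma schur_count lam0 (K : R) n : 0 <= K -> (forall k, l k != lam0) ->
  (forall w w1 w2, dom w w1 w2 -> forall x, -1 <= x <= 1 ->
     nc (w x) ^+ 2 <= K * n2 (Lp lam0 w w2)) ->
  \sum_(j < n) (nc (l j - lam0) ^- 1) ^+ 2 <= 2 * K.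
Proof.
move=> K0 hl HK.
have [a ha] := choice gram_schmidt.
pose e j := comb j.+1 (a j).
have ice j : ic (e j) by exact: comb_ic.
pose A j := comb j.+1 (fun k => a j k / (l k - lam0)).
pose A1 j := comb1 j.+1 (fun k => a j k / (l k - lam0)).
pose A2 j := comb2 j.+1 (fun k => a j k / (l k - lam0)).
have dA j : dom (A j) (A1 j) (A2 j) by exact: comb_dom.
have icA j : ic (A j) by exact: comb_ic.
have LA j x : -1 <= x <= 1 -> Lp lam0 (A j) (A2 j) x = e j x.
  move=> hx; rewrite Lop_comb // /e /comb; apply: eq_bigr => k _.
  by rewrite divfK // subr_eq0.
have ort j k : (k < j)%N -> bil (v k) (cj (e j)) = 0.
  by move=> kj; rewrite bil_swap // ?(proj2 (ha j)) ?conjc0 //; exact: hvc.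
have ortc j m c : (m <= j)%N -> bil (comb m c) (cj (e j)) = 0.
  move=> mj; rewrite bil_sum; [|by move=> k _; exact: hvc|exact: cj_ic].
  by rewrite big1 // => k _; rewrite ort ?mulr0 // (leq_trans (ltn_ord k)).
have on i j : bil (e i) (cj (e j)) = if i == j then 1 else 0.
  case: ltngtP => ij.
  - exact: ortc.
  - by rewrite bil_swap // ortc ?conjc0.
  - by rewrite ij bil_cj // (proj1 (ha j)) rmorph1.
(* The inverse is triangular: [A j] is 1 / (l j - lam0) times [e j] plus a combination of the [v k]
   with k < j, to which [e j] is orthogonal. *)
have diag j : bil (A j) (cj (e j)) = (l j - lam0)^-1.
  pose c k := a j k / (l k - lam0) - a j k / (l j - lam0).
  rewrite (@eq_bil _ (A j) (cj (e j)) (fun x => (l j - lam0)^-1 * e j x + comb j c x) (cj (e j))) //.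
    rewrite bilDl; [|exact: (icontZ _ (ice j))|exact: comb_ic|exact: cj_ic (ice j)].
    rewrite ortc // addr0 bilZl //; last exact: cj_ic (ice j).
    by rewrite on eqxx mulr1.
  move=> x _; rewrite /A /e /comb !big_ord_recr /= mulrDr mulr_sumr addrAC -big_split /=.
  congr (_ + _); last by rewrite mulrA [_ * a j j]mulrC.
  by apply: eq_bigr => k _; rewrite /c; ring.
(* For fixed x the conjugates of the values A j x, taken as coefficients, give a [W] with value S at
   x and an image of squared norm S; the pointwise bound becomes S^2 <= K S. *)
have pt x : -1 <= x <= 1 -> \sum_(j < n) nc (A j x) ^+ 2 <= K.
  move=> hx; set S := \sum_(j < n) _.
  pose s j := (A j x)^*%C.
  pose W y := \sum_(j < n) s j * A j y; pose W1 y := \sum_(j < n) s j * A1 j y.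
  pose W2 y := \sum_(j < n) s j * A2 j y.
  pose u y := \sum_(j < n) s j * e j y.
  have dW : dom W W1 W2 by apply: dom_sum => k _.
  have icu : ic u by apply: ic_sum => k _.
  have LW y : -1 <= y <= 1 -> Lp lam0 W W2 y = u y.
    move=> hy; rewrite /Lop /W /W2 /u !mulr_sumr -big_split /=; apply: eq_bigr => k _.
    by rewrite -(LA _ _ hy) /Lop; ring.
  have nu : n2 u = S.
    have : bil u (cj u) = ofr S.
      rewrite {1}/u bil_sum; [|by move=> k _|exact: cj_ic].
      rewrite rmorph_sum /=; apply: eq_bigr => j _.
      have -> : bil (e j) (cj u) = A j x.
        rewrite bil_swap // bil_sum; [|by move=> k _|exact: cj_ic].
        rewrite (bigD1 j) //= on eqxx mulr1 big1 ?addr0 ?conjcK // => i ij.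
        by rewrite on ifF ?mulr0 //; apply/negbTE; apply: contra ij => /eqP h; apply/eqP/val_inj.
      by rewrite /s mulrC mul_conj.
    by rewrite bil_cj // => -[].
  have Wx : W x = ofr S.
    by rewrite rmorph_sum /=; apply: eq_bigr => j _; rewrite /s mulrC mul_conj.
  have S0 : 0 <= S by apply: sumr_ge0 => j _; exact: sqr_ge0.
  have := HK _ _ _ dW x hx; rewrite (eq_n2 LW) nu Wx nc_ofr ger0_norm // expr2.
  have [->|Sn] := eqVneq S 0; first by [].
  by rewrite ler_pM2r // lt_def Sn.
apply: le_trans (sum_n2_le (fun k _ => icA k) pt).
apply: ler_sum => j _.
have := cauchy_schwarz (icA j) (cj_ic (ice j)).
by rewrite n2_cj (proj1 (ha j)) mulr1 diag ncV.
Qed.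

(** w is the integral of w' from -1, so nc (w x)^2 <= 2 n2 w1 by the Cauchy-Schwarz inequality on an
    interval of length 2. With im lam = 1 the energy identity bounds first the norm of w and then
    eps times that of w' by the norm of the image. *)
Lemma sup_bound lam w w1 w2 x : im lam = 1 -> dom w w1 w2 -> -1 <= x <= 1 ->
  nc (w x) ^+ 2 <= 2 / eps ^+ 2 * n2 (Lp lam w w2).
Proof.
move=> l1 h /andP[x1 x2]; have hw := dom_c0 h; have hw1 := dom_c1 h.
have hg := Lop_ic eps qfc lam h.
have := energy_top eps qfc qfE h (_ : 0 <= im lam); rewrite l1 mul1r => /(_ ler01).
set a := n2 w1; set b := n2 w; set g := n2 _ => E.
have a0 : 0 <= a := n2_ge0 hw1; have b0 : 0 <= b := n2_ge0 hw; have g0 : 0 <= g := n2_ge0 hg.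
have sb : Num.sqrt b ^+ 2 = b by rewrite sqr_sqrtr.
have sg : Num.sqrt g ^+ 2 = g by rewrite sqr_sqrtr.
have sb0 := sqrtr_ge0 b; have sg0 := sqrtr_ge0 g.
have e2 : 0 < eps ^+ 2 by rewrite exprn_gt0.
have ag : eps ^+ 2 * a <= g.
  have ea : 0 <= eps ^+ 2 * a by rewrite mulr_ge0 // ltW.
  have bg : Num.sqrt b <= Num.sqrt g.
    have [->|bn] := eqVneq (Num.sqrt b) 0; first by [].
    have bp : 0 < Num.sqrt b by rewrite lt_def bn.
    rewrite -(ler_pM2r bp) -expr2 sb; apply: le_trans E; by rewrite lerDr.
  apply: le_trans (_ : _ <= Num.sqrt g * Num.sqrt b) _; first by apply: le_trans E; rewrite lerDl.
  by rewrite -[leRHS]sg expr2 ler_wpM2l.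
have wx : nc (w x) ^+ 2 <= 2 * a.
  have E1 : w x = cI (-1) x w1.
    rewrite (@cI_FTC _ (-1) x w) // ?(dom_l h) ?subr0 //.
      by move=> y /andP[y1 y2]; apply: (dom_d1 h); rewrite y1 (le_trans y2).
    by move=> y /andP[y1 y2]; apply: hw1; rewrite y1 (le_trans y2).
  have sub : icont (-1) x w1 by move=> y /andP[y1 y2]; apply: hw1; rewrite y1 (le_trans y2).
  pose nw y : R[i] := ofr (nc (w1 y)).
  have icn : ic nw by exact: icont_nc.
  have h1 : nc (w x) <= re (Int nw).
    rewrite E1; apply: le_trans (nc_cI_le sub) _.
    rewrite /Int (@cI_split _ (-1) 1 x) // reD lerDl.
    have -> : 0 = re (cI x 1 (fun=> 0)) by rewrite re_cI /= Rintegral_cst //= mul0r.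
    apply: le_re_cI; first exact: icont_cst.
      by move=> y /andP[y1 y2]; apply: icn; rewrite (le_trans x1).
    by move=> y _; exact: nc_ge0.
  have ic1 : ic (fun=> 1 : R[i]) by exact: icont_cst.
  have CS := cauchy_schwarz icn ic1.
  have B1 : bil nw (fun=> 1) = Int nw by apply: eq_cI => y _; rewrite mulr1.
  have N1 : n2 (fun=> 1 : R[i]) = 2.
    rewrite /n2 /Int (@eq_cI _ _ _ _ (fun=> 1)); last by move=> y _; rewrite conjc1 mulr1.
    by rewrite cI_cst ?lemm11 // mul1r re_ofr opprK.
  have NW : n2 nw = a.
    by congr re; apply: eq_cI => y _; rewrite /nw conjc_real -rmorphM -expr2 mul_conj.
  rewrite B1 N1 NW mulrC in CS; apply: le_trans CS.
  rewrite lerXn2r ?nnegrE ?nc_ge0 //.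
  by apply: le_trans h1 _; apply: le_trans (ler_norm _) (re_le_nc _).
apply: le_trans wx _.
rewrite mulrAC ler_pdivlMr // -mulrA ler_wpM2l // mulrC //.
Qed.
End Eigen.

(** * The initial value problem *)

Section InitialValue.
Context {R : realType}.
Implicit Types (u v w r Q : R -> R[i]) (x : R).

Lemma dyadic_limit (t : nat -> R) (D : R) : 0 <= D ->
  (forall n, `|t n.+1 - t n| <= D / 2 ^+ n) ->
  exists X, forall n, `|t n - X| <= 2 * D / 2 ^+ n.
Proof.
move=> D0 ht.
(* The left ends of the intervals of length 4 D / 2^n centred at [t n]; these are nested. *)
pose b n := t n - 2 * D / 2 ^+ n.
have D4 : 0 <= 4 * D by rewrite mulr_ge0.
have [||X [Y H]] := @nested_rect R (fun x y n => x = b n /\ y = 0) (b 0%N) 0 (4 * D) 0 D4 (lexx 0).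
- by [].
- move=> n x y [-> ->]; exists (b n.+1), 0; split=> //; last by rewrite mul0r addr0 lexx.
  have := ht n; rewrite ler_norml => /andP[h1 h2].
  have E : 2 * D / 2 ^+ n.+1 = D / 2 ^+ n by rewrite exprS; field; rewrite expf_neq0 // pnatr_eq0.
  have E4 : 4 * D / 2 ^+ n.+1 = 2 * (D / 2 ^+ n) by rewrite exprS; field; rewrite expf_neq0 // pnatr_eq0.
  rewrite /b E E4 -[2 * D / _]mulrA.
  set d := D / 2 ^+ n in h1 h2 *; clearbody d.
  by apply/andP; split; lra_on h1 h2.
exists X => n; have [x [y [[-> _] /andP[h1 h2] _]]] := H n.
rewrite /b in h1 h2; rewrite -!mulrA in h1 h2 *.
set d := D / 2 ^+ n in h1 h2 *; clearbody d.
by rewrite ler_norml; apply/andP; split; lra_on h1 h2.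
Qed.

(** Bielecki's weight, for which Picard iteration contracts on the whole interval at once. *)
Definition wt (L x : R) : R := expR (L * (x + 1)).

Lemma wt_ge1 L x : 0 <= L -> -1 <= x -> 1 <= wt L x.
Proof. by move=> L0 x1; rewrite /wt -[leLHS]expR0 ler_expR mulr_ge0 //; lra. Qed.

Lemma ic_bound u : ic u -> exists2 M, 0 <= M & forall x, -1 <= x <= 1 -> nc (u x) <= M.
Proof.
move=> hu; have [c1 _] := ccont_within (icont_nc hu).
have [c _ Hc] := EVT_max lemm11 c1.
exists (nc (u c)); first exact: nc_ge0.
by move=> x hx; apply: Hc; rewrite in_itv.
Qed.

Lemma hasd_wt L x : L != 0 -> hasd ofr (fun x => ofr (wt L x / L)) x (ofr (wt L x)).
Proof.
move=> L0; apply/hasdP; split; last exact: is_derive_cst.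
rewrite re_ofr; have -> : (fun y => re (ofr (wt L y / L))) = (fun y => expR (L * (y + 1)) / L) by [].
apply: is_derive_eq.
by rewrite /GRing.scale /=; rewrite /wt; field.
Qed.

(* The weight exp (L (x + 1)) turns integration from -1 into division by L. *)
Lemma prim_wt (P p : R -> R[i]) (A rho L : R) r : 0 < L -> 0 <= A -> 0 <= rho -> ic p -> ic r ->
  (forall x, -1 <= x <= 1 -> hasd ofr P x (p x)) -> P (-1) = 0 ->
  (forall x, -1 <= x <= 1 -> nc (p x) <= A * wt L x + nc (r x)) ->
  re (Int (fun x => ofr (nc (r x)))) <= rho ->
  forall x, -1 <= x <= 1 -> nc (P x) <= A / L * wt L x + rho.
Proof.
move=> L0 A0 rho0 hp hr hP P0 H Hr x /andP[x1 x2].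
have sub u : ic u -> icont (-1) x u by move=> h y /andP[y1 y2]; apply: h; rewrite y1 (le_trans y2).
have -> : P x = cI (-1) x p.
  rewrite (@cI_FTC _ (-1) x P) ?P0 ?subr0 //; last exact: sub.
  by move=> y /andP[y1 y2]; apply: hP; rewrite y1 (le_trans y2).
have icw : ic (fun x => ofr (wt L x)).
  move=> y _; have h := hasd_cont (hasd_wt y (lt0r_neq0 L0)).
  have := ccontM (ccont_cst ofr (ofr L) y) h; apply: (ccont_near ltr01) => z _.
  by rewrite -rmorphM mulrC divfK // gt_eqF.
have icr : ic (fun x => ofr (nc (r x))) by exact: icont_nc.
apply: le_trans (nc_cI_le (sub _ hp)) _.
apply: (@le_trans _ _ (re (cI (-1) x (fun x => ofr A * ofr (wt L x) + ofr (nc (r x)))))).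
  apply: le_re_cI.
  - exact: icont_nc (sub _ hp).
  - by apply: sub; apply: icontD => //; exact: icontZ.
  move=> y /andP[y1 y2]; rewrite -rmorphM -rmorphD !re_ofr; apply: H.
  by rewrite y1 (le_trans y2).
rewrite cID; [|exact: sub (icontZ _ icw)|exact: sub].
rewrite reD; apply: lerD.
  rewrite cIZ; last exact: sub.
  rewrite (@cI_FTC _ (-1) x (fun x => ofr (wt L x / L))) //; last exact: sub.
    rewrite reM im_ofr mul0r subr0 reD reN !re_ofr mulrBr.
    rewrite mulrA [A / L * _]mulrAC gerBl mulr_ge0 // divr_ge0 ?(ltW L0) //.
    by rewrite /wt expR_ge0.
  by move=> y _; apply: hasd_wt; rewrite gt_eqF.
apply: le_trans Hr; rewrite /Int (@cI_split _ (-1) 1 x) // reD lerDl.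
have -> : 0 = re (cI x 1 (fun=> 0)) by rewrite re_cI /= Rintegral_cst //= mul0r.
apply: le_re_cI; first exact: icont_cst.
  by move=> y /andP[y1 y2]; apply: icr; rewrite (le_trans x1).
by move=> y _; exact: nc_ge0.
Qed.

Lemma int_nc_le r : ic r -> re (Int (fun x => ofr (nc (r x)))) <= 2 * Num.sqrt (n2 r).
Proof.
move=> hr; have icr : ic (fun x => ofr (nc (r x))) by exact: icont_nc.
have ic1 : ic (fun=> 1 : R[i]) by exact: icont_cst.
have := cauchy_schwarz_sqrt icr ic1.
have -> : bil (fun x => ofr (nc (r x))) (fun=> 1) = Int (fun x => ofr (nc (r x))).
  by apply: eq_cI => y _; rewrite mulr1.
have -> : n2 (fun=> 1 : R[i]) = 2.
  rewrite /n2 /Int (@eq_cI _ _ _ _ (fun=> 1)); last by move=> y _; rewrite conjc1 mulr1.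
  by rewrite cI_cst ?lemm11 // mul1r re_ofr opprK.
have -> : n2 (fun x => ofr (nc (r x))) = n2 r.
  by congr re; apply: eq_cI => y _; rewrite conjc_real -rmorphM -expr2 mul_conj.
move=> h; apply: le_trans (le_trans (ler_norm _) (re_le_nc _)) _; apply: le_trans h _.
rewrite mulrC ler_wpM2r ?sqrtr_ge0 //.
rewrite -[leRHS]ger0_norm // -sqrtr_sqr ler_sqrt ?sqr_ge0 //.
by rewrite expr2 ler_peMr // ler1n.
Qed.

Definition sol Q r w w1 w2 : Prop :=
  [/\ forall x, -1 <= x <= 1 -> hasd ofr w x (w1 x),
      forall x, -1 <= x <= 1 -> hasd ofr w1 x (w2 x), ic w2 &
      forall x, -1 <= x <= 1 -> w2 x = Q x * w x + r x].

(** Two integrations divide the weighted norm by L^2, and L = 2 M + 2 makes M / L^2 at most 1 / 2.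
    The maximum S of the quotient of nc w by the weight thus satisfies S <= S / 2 + 2 rho. *)
Lemma sol_bound Q (M : R) : ic Q -> (forall x, -1 <= x <= 1 -> nc (Q x) <= M) ->
  exists2 K, 0 <= K & forall r w w1 w2, ic r -> sol Q r w w1 w2 -> w (-1) = 0 -> w1 (-1) = 0 ->
  forall x, -1 <= x <= 1 -> nc (w x) <= K * Num.sqrt (n2 r).
Proof.
move=> hQ HM.
have M0 : 0 <= M by apply: le_trans (HM 0 _); rewrite ?nc_ge0 //; apply/andP; split; lra.
pose L := 2 * M + 2; have L1 : 1 <= L by rewrite /L; lra_on M0.
have L0 : 0 < L by exact: lt_le_trans L1.
have ML : M / L / L <= 1 / 2.
  rewrite ler_pdivrMr // ler_pdivrMr // /L; nra_on M0.
exists (8 * wt L 1); first by rewrite mulr_ge0 // expR_ge0.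
move=> r w w1 w2 hr [h1 h2 hc hE] w0 w10.
have icw : ic w by move=> x hx; exact: hasd_cont (h1 x hx).
have icw1 : ic w1 by move=> x hx; exact: hasd_cont (h2 x hx).
pose rho := 2 * Num.sqrt (n2 r); have rho0 : 0 <= rho by rewrite mulr_ge0 // sqrtr_ge0.
have Hr := int_nc_le hr; rewrite -/rho in Hr.
pose W x : R[i] := w x * ofr (expR (- (L * (x + 1)))).
have icW : ic W.
  apply: icontM => // x _.
  have hw : ccont ofr (fun x => ofr (wt L x)) x.
    have := ccontM (ccont_cst ofr (ofr L) x) (hasd_cont (hasd_wt x (lt0r_neq0 L0))).
    by apply: (ccont_near ltr01) => z _; rewrite -rmorphM mulrC divfK // gt_eqF.
  have hi : ccont ofr (fun y => (ofr (wt L y))^-1) x.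
    by apply: ccont_inv => //; rewrite ofr_eq0 gt_eqF // expR_gt0.
  by move: hi; apply: (ccont_near ltr01) => y _; rewrite /wt expRN fmorphV.
have [c1 _] := ccont_within (icont_nc icW).
have [c cI_ Hc] := EVT_max lemm11 c1; rewrite in_itv /= in cI_.
pose S := nc (W c); have S0 : 0 <= S by exact: nc_ge0.
have wS x : -1 <= x <= 1 -> nc (w x) <= S * wt L x.
  move=> hx; have : nc (W x) <= S by apply: Hc; rewrite in_itv.
  rewrite /W ncM nc_ofr ger0_norm ?expR_ge0 // expRN.
  by rewrite ler_pdivrMr ?expR_gt0.
have MS0 : 0 <= M * S by exact: mulr_ge0.
have H1 := @prim_wt w1 w2 (M * S) rho L r L0 MS0 rho0 hc hr h2 w10.
have {}H1 : forall x, -1 <= x <= 1 -> nc (w1 x) <= M * S / L * wt L x + rho.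
  apply: H1 => // x hx; rewrite hE //; apply: le_trans (ncD _ _) _; rewrite lerD2r ncM.
  by rewrite -mulrA; apply: ler_pM; rewrite ?nc_ge0 ?HM ?wS.
have ML0 : 0 <= M * S / L by rewrite divr_ge0 // ltW.
have icrho : ic (fun=> ofr rho) by exact: icont_cst.
have H2 := @prim_wt w w1 (M * S / L) (2 * rho) L (fun=> ofr rho) L0 ML0 (mulr_ge0 (ltW (ltr0Sn _ 1)) rho0) icw1 icrho h1 w0.
have {}H2 : forall x, -1 <= x <= 1 -> nc (w x) <= M * S / L / L * wt L x + 2 * rho.
  apply: H2.
    by move=> x hx; rewrite nc_ofr (ger0_norm rho0); exact: H1.
  by rewrite /Int cI_cst ?lemm11 // nc_ofr (ger0_norm rho0) re_ofrM re_ofr opprK mulrC.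
have SB : S <= 4 * rho.
  have := H2 c cI_; have e0 : 0 < wt L c by exact: expR_gt0.
  have e1 : 1 <= wt L c by apply: wt_ge1; [exact: ltW|case/andP: cI_].
  have -> : nc (w c) = S * wt L c.
    by rewrite /S /W ncM nc_ofr ger0_norm ?expR_ge0 // expRN divfK // gt_eqF // expR_gt0.
  have -> : M * S / L / L = S * (M / L / L) by ring.
  move=> h; have h3 : S * (M / L / L) * wt L c <= S / 2 * wt L c.
    by rewrite ler_wpM2r ?(ltW e0) // ler_wpM2l // (le_trans ML) // mul1r.
  have h4 : 2 * rho <= 2 * rho * wt L c by rewrite ler_peMr // mulr_ge0.
  have h5 : S * wt L c <= 4 * rho * wt L c by lra_on h h3 h4.
  by move: h5; rewrite ler_pM2r.
move=> x hx; apply: le_trans (wS x hx) _.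
have -> : 8 * wt L 1 * Num.sqrt (n2 r) = 4 * rho * wt L 1 by rewrite /rho; ring.
apply: ler_pM => //; first exact: expR_ge0.
by rewrite /wt ler_expR ler_wpM2l ?(ltW L0) // lerD2r; case/andP: hx.
Qed.

(** Picard iteration with contraction factor 1 / 2 in the weighted norm. A step returns the twice
    integrated function with its derivatives, so that the solution and its derivatives are read off
    from the step applied to the continuous limit [uc]. *)
Lemma ivp Q r (al be : R[i]) : ic Q -> ic r -> exists w w1 w2,
  [/\ sol Q r w w1 w2, w (-1) = al & w1 (-1) = be].
Proof.
move=> hQ hr.
have [M M0 HM] := ic_bound hQ.
pose L := 2 * M + 2; have L1 : 1 <= L by rewrite /L; lra_on M0.
have L0 : 0 < L by exact: lt_le_trans L1.
have ML : M / L / L <= 1 / 2.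
  rewrite ler_pdivrMr // ler_pdivrMr // /L; nra_on M0.
have step (u : R -> R[i]) : ic u -> exists p : (R -> R[i]) * (R -> R[i]) * (R -> R[i]),
    [/\ forall x, -1 <= x <= 1 -> hasd ofr p.1.1 x (p.1.2 x),
      forall x, -1 <= x <= 1 -> hasd ofr p.1.2 x (p.2 x), ic p.2,
      forall x, -1 <= x <= 1 -> p.2 x = Q x * u x + r x & p.1.1 (-1) = al /\ p.1.2 (-1) = be].
  move=> hu; pose g x := Q x * u x + r x.
  have icg : ic g by apply: icontD => //; exact: icontM.
  have [P1 P10 HP1] := primitive (-1) (fun x => clamp_cont x lemm11 icg).
  have dP1 x : -1 <= x <= 1 -> hasd ofr (fun x => be + P1 x) x (g x).
    move=> hx; rewrite -[g x]add0r; apply: hasdD; first exact: hasd_cst.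
    by have := HP1 x; rewrite clamp_id //; apply; case/andP: hx => a1 _; lra_on a1.
  have icP1 : ic (fun x => be + P1 x) by move=> x hx; exact: hasd_cont (dP1 x hx).
  have [P P0 HP] := primitive (-1) (fun x => clamp_cont x lemm11 icP1).
  exists ((fun x => al + P x), (fun x => be + P1 x), g); split=> //=.
  - move=> x hx; rewrite -[be + _]add0r; apply: hasdD; first exact: hasd_cst.
    by have := HP x; rewrite clamp_id //; apply; case/andP: hx => a1 _; lra_on a1.
  - by rewrite P0 P10 !addr0.
(* On a function that is not continuous the value of [T] is a dummy; all iterates are continuous. *)
pose T (u : R -> R[i]) := if pselect (ic u) is left h then sval (cid (step u h)) else (u, u, u).
have HT u : ic u -> [/\ forall x, -1 <= x <= 1 -> hasd ofr (T u).1.1 x ((T u).1.2 x),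
      forall x, -1 <= x <= 1 -> hasd ofr (T u).1.2 x ((T u).2 x), ic (T u).2,
      forall x, -1 <= x <= 1 -> (T u).2 x = Q x * u x + r x & (T u).1.1 (-1) = al /\ (T u).1.2 (-1) = be].
  by move=> hu; rewrite /T; case: pselect => // h; exact: (svalP (cid (step u h))).
have icT u : ic u -> ic (T u).1.1 by move=> /HT[h _ _ _ _] x hx; exact: hasd_cont (h x hx).
have contr u u' A : ic u -> ic u' -> 0 <= A ->
    (forall x, -1 <= x <= 1 -> nc (u x - u' x) <= A * wt L x) ->
    forall x, -1 <= x <= 1 -> nc ((T u).1.1 x - (T u').1.1 x) <= A / 2 * wt L x.
  move=> hu hu' A0 HA.
  have [a1 a2 a3 a4 [a5 a6]] := HT u hu; have [b1 b2 b3 b4 [b5 b6]] := HT u' hu'.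
  have ic0 : ic (fun=> 0 : R[i]) by exact: icont_cst.
  have MA0 : 0 <= M * A by exact: mulr_ge0.
  have I0 : re (Int (fun x => ofr (nc (0 : R[i])))) <= 0.
    by rewrite nc0 /Int cI_cst ?lemm11 // rmorph0 mul0r.
  have ic1 : ic (fun x => (T u).1.2 x - (T u').1.2 x).
    by apply: icontB => x hx; [exact: hasd_cont (a2 x hx)|exact: hasd_cont (b2 x hx)].
  have H1 : forall x, -1 <= x <= 1 -> nc ((T u).1.2 x - (T u').1.2 x) <= M * A / L * wt L x + 0.
    apply: (@prim_wt (fun x => (T u).1.2 x - (T u').1.2 x) (fun x => (T u).2 x - (T u').2 x) (M * A) 0 L (fun=> 0)) => //.
    - exact: icontB.
    - by move=> x hx; apply: hasdB; [exact: a2|exact: b2].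
    - by rewrite a6 b6 subrr.
    - move=> x hx; rewrite a4 // b4 // nc0 addr0.
      have -> : Q x * u x + r x - (Q x * u' x + r x) = Q x * (u x - u' x) by ring.
      by rewrite ncM -mulrA; apply: ler_pM; rewrite ?nc_ge0 ?HM ?HA.
  have MAL : 0 <= M * A / L by rewrite divr_ge0 // ltW.
  have H2 : forall x, -1 <= x <= 1 -> nc ((T u).1.1 x - (T u').1.1 x) <= M * A / L / L * wt L x + 0.
    apply: (@prim_wt (fun x => (T u).1.1 x - (T u').1.1 x) (fun x => (T u).1.2 x - (T u').1.2 x) (M * A / L) 0 L (fun=> 0)) => //.
    - by move=> x hx; apply: hasdB; [exact: a1|exact: b1].
    - by rewrite a5 b5 subrr.
    - by move=> x hx; rewrite nc0; exact: H1.
  move=> x hx; apply: le_trans (H2 x hx) _; rewrite addr0 ler_wpM2r ?expR_ge0 //.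
  have -> : M * A / L / L = A * (M / L / L) by ring.
  by rewrite ler_wpM2l // (le_trans ML) // mul1r.
pose U := fix U n := if n is m.+1 then (T (U m)).1.1 else (fun=> 0 : R[i]).
have icU n : ic (U n) by elim: n => [|n IH]; [exact: icont_cst|exact: icT].
have [D D0 HD] := ic_bound (icontB (icU 1%N) (icU 0%N)).
have HU n : forall x, -1 <= x <= 1 -> nc (U n.+1 x - U n x) <= D / 2 ^+ n * wt L x.
  elim: n => [|n IH] x hx.
    rewrite expr0 divr1; apply: le_trans (HD x hx) _.
    by rewrite ler_peMr //; apply: wt_ge1; [exact: ltW|case/andP: hx].
  have -> : D / 2 ^+ n.+1 = D / 2 ^+ n / 2 by rewrite exprS; field; rewrite expf_neq0 // pnatr_eq0.
  by apply: (contr (U n.+1) (U n)) => //; rewrite divr_ge0 // exprn_ge0.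
pose W := D * wt L 1; have W0 : 0 <= W by rewrite mulr_ge0 // expR_ge0.
have HW n x : -1 <= x <= 1 -> nc (U n.+1 x - U n x) <= W / 2 ^+ n.
  move=> hx; apply: le_trans (HU n x hx) _.
  rewrite /W mulrAC; apply: ler_pM => //; rewrite ?divr_ge0 ?exprn_ge0 ?expR_ge0 //.
    by rewrite mulr_ge0 // expR_ge0.
  rewrite ler_wpM2l //; by rewrite /wt ler_expR ler_wpM2l ?(ltW L0) // lerD2r; case/andP: hx.
have lim x : exists X : R[i], -1 <= x <= 1 -> forall n, nc (U n x - X) <= 4 * W / 2 ^+ n.
  case: (pselect (-1 <= x <= 1)) => hx; last by exists 0.
  have [|X HX] := @dyadic_limit (fun n => re (U n x)) W W0.
    by move=> n; rewrite -reN -reD; apply: le_trans (re_le_nc _) (HW n x hx).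
  have [|Y HY] := @dyadic_limit (fun n => im (U n x)) W W0.
    by move=> n; rewrite -imN -imD; apply: le_trans (im_le_nc _) (HW n x hx).
  exists (Complex X Y) => _ n; apply: le_trans (nc_le_reim _) _.
  rewrite reD imD reN imN reC imC.
  have -> : 4 * W / 2 ^+ n = 2 * W / 2 ^+ n + 2 * W / 2 ^+ n by ring.
  by apply: lerD; [exact: HX|exact: HY].
have [u Hu] := choice lim.
have small e : 0 < e -> exists n, 4 * W / 2 ^+ n < e by move=> e0; exact: half_pow_small.
pose uc x := u (clamp (-1) 1 x).
have Huc n x : -1 <= x <= 1 -> nc (U n x - uc x) <= 4 * W / 2 ^+ n.
  by move=> hx; rewrite /uc clamp_id //; exact: Hu.
have icu : ic uc.
  move=> x hx e e0; have e4 : 0 < e / 4 by rewrite divr_gt0.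
  have [n Hn] := small _ e4.
  have [d d0 Hd] := clamp_cont x lemm11 (icU n) e4.
  exists d => // y /Hd h.
  have E : uc y - uc x = (U n (clamp (-1) 1 y) - U n (clamp (-1) 1 x)) - (U n (clamp (-1) 1 y) - uc (clamp (-1) 1 y))
     + (U n (clamp (-1) 1 x) - uc (clamp (-1) 1 x)).
    have C z : uc (clamp (-1) 1 z) = uc z by rewrite /uc (@clamp_id _ _ _ (clamp _ _ _)) // clamp_in // lemm11.
    by rewrite !C; ring.
  rewrite E; apply: le_trans (ncD _ _) _; apply: le_trans (lerD (ncB _ _) (lexx _)) _.
  have g1 := le_trans (Huc n _ (clamp_in y lemm11)) (ltW Hn).
  have g2 := le_trans (Huc n _ (clamp_in x lemm11)) (ltW Hn).
  set a := nc _ in h *; set b := nc _ in g1 *; set c := nc _ in g2 *.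
  have h' : a <= e / 4 by exact: h.
  by lra_on h' g1 g2 e0.
have [a1 a2 a3 a4 [a5 a6]] := HT uc icu.
have fixp x : -1 <= x <= 1 -> (T uc).1.1 x = uc x.
  move=> hx; apply/eqP; rewrite -subr_eq0 -nc_eq0; apply/eqP/le_anti; rewrite nc_ge0 andbT.
  apply/ler_addgt0Pl => e e0; rewrite addr0.
  have e4 : 0 < e / (2 * wt L 1) by rewrite divr_gt0 // mulr_gt0 // expR_gt0.
  have [n Hn] := small _ e4.
  pose A := 4 * W / 2 ^+ n; have A0 : 0 <= A by rewrite divr_ge0 ?exprn_ge0 // mulr_ge0.
  have h1 : nc ((T uc).1.1 x - U n.+1 x) <= A / 2 * wt L x.
    apply: (contr uc (U n)) => // y hy.
    rewrite ncBC; apply: le_trans (Huc n y hy) _.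
    by rewrite ler_peMr //; apply: wt_ge1; [exact: ltW|case/andP: hy].
  have h2 := Huc n.+1 x hx.
  have E : 4 * W / 2 ^+ n.+1 = A / 2 by rewrite /A exprS; field; rewrite expf_neq0 // pnatr_eq0.
  rewrite E in h2.
  have w1 : wt L x <= wt L 1 by rewrite /wt ler_expR ler_wpM2l ?(ltW L0) // lerD2r; case/andP: hx.
  have w2 : 1 <= wt L 1 by apply: wt_ge1; [exact: ltW|exact: lemm11].
  apply: le_trans (nc_tri _ (U n.+1 x) _) _.
  apply: le_trans (lerD h1 h2) _.
  move: Hn; rewrite -/A ltr_pdivlMr ?mulr_gt0 ?expR_gt0 // => Hn.
  have h3 : A / 2 * wt L x <= A / 2 * wt L 1 by rewrite ler_wpM2l // divr_ge0.
  have h4 : A / 2 <= A / 2 * wt L 1 by rewrite ler_peMr // divr_ge0.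
  move: Hn h3 h4; set a := A / 2 * wt L x; set b := A / 2 * wt L 1.
  have -> : A * (2 * wt L 1) = 4 * b by rewrite /b; field.
  clearbody a b; move: e0; clear=> Hn h3 h4 e0; lra.
exists (T uc).1.1, (T uc).1.2, (T uc).2; split=> //.
by split=> // x hx; rewrite a4 // fixp.
Qed.
End InitialValue.

(** * The maximum principle on a rectangle *)

Section MaximumModulus.
Context {R : realType}.
Implicit Types (a b c d : R) (p lam : R[i]).

Definition rect a b c d lam : Prop := a <= re lam <= b /\ c <= im lam <= d.

Lemma rect_max a b c d (F : R[i] -> R) : a <= b -> c <= d ->
  (forall p, rect a b c d p -> forall e, 0 < e -> exists2 r, 0 < r &
     forall lam, rect a b c d lam -> nc (lam - p) < r -> `|F lam - F p| <= e) ->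
  exists2 p, rect a b c d p & forall lam, rect a b c d lam -> F lam <= F p.
Proof.
move=> ab cd HF.
pose A : set (R * R) := `[a, b]%classic `*` `[c, d]%classic.
pose g (x : R * R) : R := F (Complex x.1 x.2).
have A0 : A !=set0 by exists (a, c); split; rewrite /= in_itv /= lexx.
have cA : compact A by apply: compact_setX; exact: segment_compact.
have cg : {within A, continuous g}.
  apply/subspace_continuousP => x [x1 x2]; rewrite /= !in_itv /= in x1 x2.
  apply/cvgrPdist_le => e e0.
  have [r r0 Hr] := HF (Complex x.1 x.2) (conj x1 x2) e e0.
  have r2 : 0 < r / 2 by rewrite divr_gt0.
  rewrite near_withinE; near=> y.
  move=> [y1 y2]; rewrite /= !in_itv /= in y1 y2.
  rewrite distrC; apply: (Hr (Complex y.1 y.2)); first by split.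
  have : ball x (r / 2) y by near: y; exact: nbhsx_ballx.
  case=> b1 b2; have {}b1 : `|x.1 - y.1| < r / 2 by [].
  have {}b2 : `|x.2 - y.2| < r / 2 by [].
  apply: le_lt_trans (nc_le_reim _) _.
  rewrite reD imD reN imN !reC !imC distrC (distrC y.2).
  by rewrite [r]splitr ltrD.
have [p pA Hp] := compact_EVT_max A0 cA cg.
move: pA; rewrite inE => -[p1 p2]; rewrite /= !in_itv /= in p1 p2.
exists (Complex p.1 p.2) => //.
move=> lam [l1 l2]; have := Hp (re lam, im lam); rewrite /g /=.
have -> : Complex (re lam) (im lam) = lam by exact: complex_ext.
by apply; rewrite inE; split; rewrite /= in_itv.
Unshelve. all: by end_near.
Qed.

(** Parseval's identity on the fourth roots of unity, where 1, w and w^2 are orthogonal. *)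
Lemma four_point (c0 c1 c2 : R[i]) (t : R) :
  let A w := c0 + c1 * (ofr t * w) + c2 * (ofr t * w) ^+ 2 in
  nc (A 1) ^+ 2 + nc (A (-1)) ^+ 2 + nc (A 'i%C) ^+ 2 + nc (A (- 'i%C)) ^+ 2 =
  4 * (nc c0 ^+ 2 + t ^+ 2 * nc c1 ^+ 2 + t ^+ 4 * nc c2 ^+ 2).
Proof.
move=> A; have E w : nc (A w) ^+ 2 =
    (re c0 + (re c1 * re w - im c1 * im w) * t +
      (re c2 * (re w ^+ 2 - im w ^+ 2) - 2 * im c2 * re w * im w) * t ^+ 2) ^+ 2 +
    (im c0 + (re c1 * im w + im c1 * re w) * t +
      (im c2 * (re w ^+ 2 - im w ^+ 2) + 2 * re c2 * re w * im w) * t ^+ 2) ^+ 2.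
  rewrite sqr_nc /A; have {A} : re (ofr t * w) = t * re w by rewrite mulrC re_ofrM mulrC.
  have : im (ofr t * w) = t * im w by rewrite mulrC im_ofrM mulrC.
  move: (ofr t * w) => z zi zr.
  rewrite reD (reD c0) reM (expr2 z) reM (reM z) (imM z) imD (imD c0) imM (imM c2) (reM z) (imM z).
  by rewrite zi zr; congr (_ ^+ 2 + _ ^+ 2); ring.
rewrite !E; clear A E; rewrite !sqr_nc.
move: (re c0) (im c0) (re c1) (im c1) (re c2) (im c2) => x0 y0 x1 y1 x2 y2.
by rewrite !reN !imN re_i im_i re1 im1; ring.
Qed.

(** A second-order expansion with cubic error at each point stands in for holomorphy; iterating the
    resolvent provides it. A small multiple [eta] of nc lam ^ 2 is added to nc (h lam) ^ 2: around
    an interior maximum of the sum, the mean over four points at distance s would give eta s^2 =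
    O(s^3). *)
Lemma maxmod a b c d (h : R[i] -> R[i]) (m : R) : a <= b -> c <= d ->
  (forall p, rect a b c d p -> exists (c0 c1 c2 : R[i]) (r E : R), 0 < r /\
    forall lam, rect a b c d lam -> nc (lam - p) < r -> exists2 e, nc e <= E &
      h lam = c0 + c1 * (lam - p) + c2 * (lam - p) ^+ 2 + (lam - p) ^+ 3 * e) ->
  (forall lam, rect a b c d lam -> [\/ re lam = a, re lam = b, im lam = c | im lam = d] ->
    nc (h lam) <= m) ->
  forall lam, rect a b c d lam -> nc (h lam) <= m.
Proof.
move=> ab cd Hh Hm.
have m0 : 0 <= m.
  apply: le_trans (nc_ge0 _) (Hm (Complex a c) _ _); first by split; rewrite lexx.
  by apply: Or41.
have sq_low (x y s M : R) : 0 <= x -> 0 <= y -> 0 <= s -> x <= M -> x - s <= y ->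
    x ^+ 2 - 2 * M * s <= y ^+ 2.
  move=> x0 y0 s0 xM xy; have h1 : x * s <= M * s by rewrite ler_wpM2r.
  have [xs|xs] := lerP x s.
    have h2 : x * x <= x * s by rewrite ler_wpM2l.
    by move: h1 h2 y0 s0 x0; clear; rewrite !expr2; nra.
  have h2 : (x - s) ^+ 2 <= y ^+ 2 by rewrite ler_pXn2r // nnegrE subr_ge0 ltW.
  by move: h1 h2 s0; clear; rewrite !expr2; nra.
pose B := `|a| + `|b| + `|c| + `|d|.
have HB lam : rect a b c d lam -> nc lam <= B.
  move=> [/andP[r1 r2] /andP[i1 i2]]; apply: le_trans (nc_le_reim _) _; rewrite /B -addrA.
  apply: lerD.
    rewrite ler_norml; move: (ler_norm b) (ler_norm (- a)) (normr_ge0 a) (normr_ge0 b).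
    by rewrite normrN; move: r1 r2; clear; move=> *; apply/andP; split; lra.
  rewrite ler_norml; move: (ler_norm d) (ler_norm (- c)) (normr_ge0 c) (normr_ge0 d).
  by rewrite normrN; move: i1 i2; clear; move=> *; apply/andP; split; lra.
have key eta : 0 < eta -> forall lam, rect a b c d lam ->
    nc (h lam) ^+ 2 <= m ^+ 2 + eta * B ^+ 2.
  move=> eta0; pose F lam := nc (h lam) ^+ 2 + eta * nc lam ^+ 2.
  have sqd (x y M e : R) : 0 <= x -> 0 <= y <= M -> `|x - y| <= e -> e <= 1 ->
      `|x ^+ 2 - y ^+ 2| <= (2 * M + 1) * e.
    move=> x0 /andP[y0 yM] xy e1; rewrite subr_sqr normrM mulrC.
    rewrite ler_pM // ger0_norm ?addr_ge0 //.
    by move: xy; rewrite ler_norml => /andP[_ xy]; move: xy yM e1; clear; lra.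
  have [|p pr Hp] := @rect_max a b c d F ab cd.
    move=> p pr e e0.
    have [c0 [c1 [c2 [r [E [r0 H]]]]]] := Hh p pr.
    have c0E : h p = c0.
      have [|e1 _ ->] := H p pr; first by rewrite subrr nc0.
      by rewrite subrr !expr0n /= mulr0 !mul0r !addr0 ?mulr0 ?addr0.
    have E0 : 0 <= E.
      have [|e1 He1 _] := H p pr; first by rewrite subrr nc0.
      exact: le_trans (nc_ge0 _) He1.
    pose M := nc c0 + nc c1 + nc c2 + E + B.
    have M0 : 0 <= M by rewrite /M !addr_ge0 ?nc_ge0.
    pose k := (2 * M + 1) * (1 + eta) * (M + 1).
    have k0 : 0 < k by rewrite /k !mulr_gt0 // ?ltr_wpDl ?mulr_ge0 // ltr_wpDr // ltW.
    exists (Num.min r (Num.min (M + 1)^-1 (e / k))).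
      by rewrite !lt_min r0 invr_gt0 ltr_wpDl // divr_gt0.
    move=> lam lr; rewrite !lt_min => /and3P[s1 s2 s3].
    set s := nc (lam - p) in s1 s2 s3; have s0 : 0 <= s by exact: nc_ge0.
    have sM : s * (M + 1) <= 1.
      by rewrite -ler_pdivlMr ?ltr_wpDl // div1r ltW.
    have s1' : s <= 1 by move: sM s0 M0; clear; nra.
    have [e1 He1 hl] := H lam lr s1.
    have hd : nc (h lam - h p) <= s * (M + 1).
      rewrite c0E hl.
      have -> : c0 + c1 * (lam - p) + c2 * (lam - p) ^+ 2 + (lam - p) ^+ 3 * e1 - c0 =
        (lam - p) * (c1 + c2 * (lam - p) + (lam - p) ^+ 2 * e1) by ring.
      rewrite ncM -/s ler_wpM2l //; apply: le_trans (ncD _ _) _.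
      apply: le_trans (lerD (ncD _ _) (lexx _)) _.
      rewrite (ncM c2) (ncM _ e1) ncX -/s.
      have h1 : nc c2 * s <= nc c2 by rewrite ler_piMr // nc_ge0.
      have h2 : s ^+ 2 * nc e1 <= E.
        by apply: le_trans He1; rewrite ler_piMl ?nc_ge0 // expr_le1.
      have B0 : 0 <= B by rewrite /B !addr_ge0.
      rewrite /M; move: h1 h2 B0 (nc_ge0 c0); clear; lra.
    have d1 : `|nc (h lam) ^+ 2 - nc (h p) ^+ 2| <= (2 * M + 1) * (s * (M + 1)).
      apply: sqd => //; first exact: nc_ge0.
        rewrite nc_ge0 c0E /M; move: (nc_ge0 c1) (nc_ge0 c2) E0 (le_trans (nc_ge0 _) (HB p pr)).
        by clear; move=> *; lra.
      exact: le_trans (nc_norm_sub _ _) hd.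
    have d2 : `|nc lam ^+ 2 - nc p ^+ 2| <= (2 * M + 1) * (s * (M + 1)).
      apply: sqd => //; first exact: nc_ge0.
        rewrite nc_ge0 (le_trans (HB p pr)) // /M.
        by rewrite lerDr !addr_ge0 ?nc_ge0.
      apply: le_trans (nc_norm_sub _ _) _; rewrite -/s.
      by rewrite ler_peMr // lerDr.
    rewrite /F.
    have -> : nc (h lam) ^+ 2 + eta * nc lam ^+ 2 - (nc (h p) ^+ 2 + eta * nc p ^+ 2) =
      (nc (h lam) ^+ 2 - nc (h p) ^+ 2) + eta * (nc lam ^+ 2 - nc p ^+ 2) by ring.
    apply: le_trans (ler_normD _ _) _; rewrite normrM (gtr0_norm eta0).
    apply: le_trans (lerD d1 (ler_wpM2l (ltW eta0) d2)) _.
    have -> : (2 * M + 1) * (s * (M + 1)) + eta * ((2 * M + 1) * (s * (M + 1))) = s * k.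
      by rewrite /k; ring.
    by rewrite -ler_pdivlMr // ltW.
  suff side : [\/ re p = a, re p = b, im p = c | im p = d].
    move=> lam lr; apply: (@le_trans _ _ (F lam)); first by rewrite lerDl mulr_ge0 ?sqr_ge0 // ltW.
    apply: le_trans (Hp lam lr) _; apply: lerD.
      by rewrite ler_pXn2r ?nnegrE ?nc_ge0 // Hm.
    rewrite ler_wpM2l ?(ltW eta0) // ler_pXn2r ?nnegrE ?nc_ge0 ?HB //.
    exact: le_trans (nc_ge0 _) (HB p pr).
  have [/andP[p1 p2] /andP[p3 p4]] := pr.
  have [e1|n1] := eqVneq (re p) a; first exact: Or41.
  have [e2|n2] := eqVneq (re p) b; first exact: Or42.
  have [e3|n3] := eqVneq (im p) c; first exact: Or43.
  have [e4|n4] := eqVneq (im p) d; first exact: Or44.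
  exfalso.
  have {p1 n1}p1 : 0 < re p - a by rewrite subr_gt0 lt_neqAle eq_sym n1.
  have {p2 n2}p2 : 0 < b - re p by rewrite subr_gt0 lt_neqAle n2.
  have {p3 n3}p3 : 0 < im p - c by rewrite subr_gt0 lt_neqAle eq_sym n3.
  have {p4 n4}p4 : 0 < d - im p by rewrite subr_gt0 lt_neqAle n4.
  have [c0 [c1 [c2 [r [E [r0 H]]]]]] := Hh p pr.
  have c0E : h p = c0.
    have [|e1 _ ->] := H p pr; first by rewrite subrr nc0.
    by rewrite subrr !expr0n /= mulr0 !mul0r !addr0 ?mulr0 ?addr0.
  have E0 : 0 <= E.
    have [|e1 He1 _] := H p pr; first by rewrite subrr nc0.
    exact: le_trans (nc_ge0 _) He1.
  pose M := nc c0 + nc c1 + nc c2; have M0 : 0 <= M by rewrite /M !addr_ge0 ?nc_ge0.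
  have ME0 : 0 < 2 * M * E + 1 by rewrite ltr_wpDl // !mulr_ge0.
  (* [s] keeps the four points in the rectangle and in the range of the expansion, and eta / (2 M E
     + 1) makes the cubic error smaller than eta s^2. *)
  pose s := Num.min (r / 2) (Num.min 1 (Num.min (eta / (2 * M * E + 1))
    (Num.min (Num.min (re p - a) (b - re p)) (Num.min (im p - c) (d - im p))))).
  have s0 : 0 < s.
    by rewrite /s !lt_min p1 p2 p3 p4 ltr01 !divr_gt0.
  have : s <= s by []. 
  rewrite {2}/s !le_min => /and4P[s1 s2 s3 /andP[/andP[s4 s5] /andP[s6 s7]]].
  clearbody s.
  pose A w := c0 + c1 * (ofr s * w) + c2 * (ofr s * w) ^+ 2.
  have pt w : nc w = 1 -> `|re w| <= 1 -> `|im w| <= 1 ->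
      nc (A w) ^+ 2 - 2 * M * (s ^+ 3 * E) + eta * nc (p + ofr s * w) ^+ 2 <= F p.
    move=> w1 rw iw; pose lam := p + ofr s * w.
    have E1 : lam - p = ofr s * w by rewrite /lam addrC addKr.
    have ns : nc (lam - p) = s by rewrite E1 ncM w1 mulr1 nc_ofr gtr0_norm.
    have b1 : `|s * re w| <= s by rewrite normrM gtr0_norm // ler_piMr // ltW.
    have b2 : `|s * im w| <= s by rewrite normrM gtr0_norm // ler_piMr // ltW.
    have lr : rect a b c d lam.
      move: b1 b2; rewrite !ler_norml => /andP[u1 u2] /andP[u3 u4].
      have r1 : re lam = re p + s * re w by rewrite /lam reD mulrC re_ofrM mulrC.
      have r2 : im lam = im p + s * im w by rewrite /lam imD mulrC im_ofrM mulrC.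
      rewrite /rect r1 r2; move: u1 u2 u3 u4 s4 s5 s6 s7; clear.
      move: (s * re w) (s * im w) (re p) (im p) => x y u v *.
      by split; apply/andP; split; lra.
    have [|e He hl] := H lam lr; first by rewrite ns; move: s1 r0; clear; lra.
    apply: le_trans (Hp lam lr); rewrite /F -/lam lerD2r.
    have AM : nc (A w) <= M.
      rewrite /A; apply: le_trans (ncD _ _) _; apply: le_trans (lerD (ncD _ _) (lexx _)) _.
      rewrite (ncM c1) (ncM c2) ncX -E1 ns /M lerD // ?lerD //; last first.
        by rewrite ler_piMr ?nc_ge0 // expr_le1 // ltW.
      by rewrite ler_piMr ?nc_ge0.
    apply: sq_low => //; rewrite ?nc_ge0 //.
      by rewrite mulr_ge0 // exprn_ge0 // ltW.
    rewrite hl E1 -/(A w) -E1.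
    rewrite lerBlDr; have -> : A w = A w + (lam - p) ^+ 3 * e - (lam - p) ^+ 3 * e by ring.
    apply: le_trans (ncB _ _) _.
    rewrite [A w + _ - _ + _]addrAC -addrA addrN addr0 lerD2l.
    by rewrite (ncM _ e) ncX ns ler_wpM2l // exprn_ge0 // ltW.
  have q1 := pt 1; have q2 := pt (-1); have q3 := pt 'i%C; have q4 := pt (- 'i%C).
  rewrite nc1 re1 im1 normr1 normr0 in q1.
  rewrite ncN nc1 reN imN re1 im1 oppr0 normrN normr1 normr0 in q2.
  rewrite nc_i re_i im_i normr1 normr0 in q3.
  rewrite ncN nc_i reN imN re_i im_i oppr0 normrN normr1 normr0 in q4.
  have {}q1 := q1 erefl (lexx _) ler01; have {}q2 := q2 erefl (lexx _) ler01.
  have {}q3 := q3 erefl ler01 (lexx _); have {}q4 := q4 erefl ler01 (lexx _).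
  have S1 : nc (A 1) ^+ 2 + nc (A (-1)) ^+ 2 + nc (A 'i%C) ^+ 2 + nc (A (- 'i%C)) ^+ 2 =
    4 * (nc c0 ^+ 2 + s ^+ 2 * nc c1 ^+ 2 + s ^+ 4 * nc c2 ^+ 2) := four_point c0 c1 c2 s.
  have S2 := four_point p 1 0 s; cbv zeta beta in S2; rewrite !mul0r !addr0 !mul1r nc1 nc0 in S2.
  have FE : F p = nc c0 ^+ 2 + eta * nc p ^+ 2 by rewrite /F c0E.
  rewrite FE in q1 q2 q3 q4.
  have t1 : 0 <= s ^+ 2 * nc c1 ^+ 2 by rewrite mulr_ge0 ?sqr_ge0.
  have t2 : 0 <= s ^+ 4 * nc c2 ^+ 2 by rewrite mulr_ge0 ?exprn_ge0 ?nc_ge0 // ltW.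
  have t3 : 4 * eta * s ^+ 2 <= 8 * M * (s ^+ 3 * E).
    have S2' : eta * nc (p + ofr s * 1) ^+ 2 + eta * nc (p + ofr s * -1) ^+ 2 +
      eta * nc (p + ofr s * 'i%C) ^+ 2 + eta * nc (p + ofr s * - 'i%C) ^+ 2 =
      4 * (eta * nc p ^+ 2) + 4 * eta * s ^+ 2.
      by rewrite -!mulrDr S2; ring.
    by move: q1 q2 q3 q4 S1 S2' t1 t2; clear; lra.
  have t4 : eta * s ^+ 2 <= 2 * M * E * s * s ^+ 2 by move: t3; clear; rewrite !exprS expr0 !mulr1; lra.
  have t5 : eta <= 2 * M * E * s by rewrite -(@ler_pM2r _ (s ^+ 2)) // exprn_gt0.
  move: s3; rewrite ler_pdivlMr // => s3.
  by move: s3 t5 s0; clear; lra.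
move=> lam lr; rewrite -(@ler_pXn2r _ 2) ?nnegrE ?nc_ge0 //.
apply/ler_addgt0Pr => e e0.
have B1 : 0 < B ^+ 2 + 1 by rewrite ltr_wpDl ?sqr_ge0.
apply: le_trans (key (e / (B ^+ 2 + 1)) _ lam lr) _; first by rewrite divr_gt0.
by rewrite lerD2l mulrAC ler_pdivrMr // ler_pM2l // lerDl.
Qed.
End MaximumModulus.

(** * The resolvent on the complement of finitely many eigenfunctions *)

Section Resolvent.
Context {R : realType}.
Variables (q : R -> R) (qf : R -> R[i]) (eps : R).
Hypotheses (qfc : ic qf) (qfE : forall x, -1 <= x <= 1 -> qf x = ofr (q x)) (eps0 : 0 < eps).
Local Notation Lp := (Lop qf eps).
Implicit Types (lam c : R[i]) (n : nat) (g w u : R -> R[i]).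

Lemma n2_sup w S : ic w -> (forall x, -1 <= x <= 1 -> nc (w x) <= S) -> n2 w <= 2 * S ^+ 2.
Proof.
move=> hw HS; have := @sum_n2_le _ 1 (fun=> w) (S ^+ 2) (fun _ _ => hw).
rewrite big_ord1; apply => x hx; rewrite big_ord1 ler_pXn2r ?nnegrE ?nc_ge0 ?HS //.
exact: le_trans (nc_ge0 _) (HS x hx).
Qed.

Definition eqn lam g w w1 w2 : Prop :=
  [/\ forall x, -1 <= x <= 1 -> hasd ofr w x (w1 x),
      forall x, -1 <= x <= 1 -> hasd ofr w1 x (w2 x), ic w2 &
      forall x, -1 <= x <= 1 -> Lp lam w w2 x = g x].

Lemma eqn_dom lam g w w1 w2 : eqn lam g w w1 w2 -> w (-1) = 0 -> w 1 = 0 -> dom w w1 w2.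
Proof. by case. Qed.

Lemma dom_eqn lam w w1 w2 : dom w w1 w2 -> eqn lam (Lp lam w w2) w w1 w2.
Proof. by case. Qed.

Lemma eqn_ic lam g w w1 w2 : eqn lam g w w1 w2 -> ic w /\ ic w1.
Proof. by case=> h1 h2 _ _; split=> x hx; [exact: hasd_cont (h1 x hx)|exact: hasd_cont (h2 x hx)]. Qed.

Lemma eqnB lam g w w1 w2 g' w' w1' w2' c : eqn lam g w w1 w2 -> eqn lam g' w' w1' w2' ->
  eqn lam (fun x => g x - c * g' x) (fun x => w x - c * w' x) (fun x => w1 x - c * w1' x)
    (fun x => w2 x - c * w2' x).
Proof.
move=> [h1 h2 h3 h4] [k1 k2 k3 k4]; split.
- by move=> x hx; apply: hasdB; [exact: h1|apply: hasdZ; exact: k1].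
- by move=> x hx; apply: hasdB; [exact: h2|apply: hasdZ; exact: k2].
- by apply: icontB => //; exact: icontZ.
- by move=> x hx; rewrite -h4 // -k4 // /Lop; ring.
Qed.

(** Divided by i eps^2, the equation (L - lam) w = g reads w'' = Qp w + ka g. *)
Let ka : R[i] := ('i%C * ofr (eps ^+ 2))^-1.
Let ka_neq0 : 'i%C * ofr (eps ^+ 2) != 0 :> R[i].
Proof. by rewrite mulf_neq0 ?neq0i // ofr_eq0 expf_neq0 // gt_eqF. Qed.
Let Qp lam x : R[i] := - (ka * (qf x - lam)).

Let Qp_ic lam : ic (Qp lam).
Proof. by apply: icontN; apply: icontZ; apply: icontB => //; exact: icont_cst. Qed.

Lemma eqn_sol lam g w w1 w2 : eqn lam g w w1 w2 <-> sol (Qp lam) (fun x => ka * g x) w w1 w2.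
Proof.
have K : 'i%C * ofr (eps ^+ 2) * ka = 1 by rewrite divff.
split=> -[h1 h2 h3 h4]; split=> // x hx.
- by rewrite -h4 // /Lop /Qp -[LHS]mul1r -K; ring.
- rewrite /Lop h4 // /Qp -[RHS]mul1r -K -[(qf x - lam) * w x in LHS]mul1r -K; ring.
Qed.

Lemma eqn_ivp lam g (al be : R[i]) : ic g -> exists w w1 w2,
  [/\ eqn lam g w w1 w2, w (-1) = al & w1 (-1) = be].
Proof.
move=> hg; have [w [w1 [w2 [h a b]]]] := ivp al be (Qp_ic lam) (icontZ ka hg).
by exists w, w1, w2; split=> //; apply/eqn_sol.
Qed.

Lemma eqn_bound lam : exists2 K, 0 <= K & forall g w w1 w2, ic g -> eqn lam g w w1 w2 ->
  w (-1) = 0 -> w1 (-1) = 0 -> forall x, -1 <= x <= 1 -> nc (w x) <= K * Num.sqrt (n2 g).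
Proof.
have [M _ HM] := ic_bound (Qp_ic lam).
have [K K0 HK] := sol_bound (Qp_ic lam) HM.
exists (K * nc ka); first by rewrite mulr_ge0 // nc_ge0.
move=> g w w1 w2 hg /eqn_sol h a b x hx.
apply: le_trans (HK _ _ _ _ (icontZ ka hg) h a b x hx) _.
by rewrite n2_scale // sqrtrM ?sqr_ge0 // sqrtr_sqr ger0_norm ?nc_ge0 // mulrA.
Qed.

Lemma eqn_uniq lam g w w1 w2 : eqn lam g w w1 w2 -> (forall x, -1 <= x <= 1 -> g x = 0) ->
  w (-1) = 0 -> w1 (-1) = 0 -> forall x, -1 <= x <= 1 -> w x = 0.
Proof.
move=> [h1 h2 h3 h4] g0 a b x hx; have [K K0 HK] := eqn_bound lam.
have hh : eqn lam (fun=> 0) w w1 w2 by split=> // y hy; rewrite h4 // g0.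
have ic0 : ic (fun=> 0 : R[i]) by exact: icont_cst.
have := HK _ _ _ _ ic0 hh a b x hx.
have -> : n2 (fun=> 0 : R[i]) = 0 by rewrite /n2 /Int cI_cst ?lemm11 // !mul0r.
by rewrite sqrtr0 mulr0 => h; apply/eqP; rewrite -nc_eq0 eq_le h nc_ge0.
Qed.

(** Green's formula with its boundary terms, for solutions that need not satisfy the boundary
    conditions. *)
Lemma wronskian lam g w w1 w2 k u u1 u2 : eqn lam g w w1 w2 -> eqn lam k u u1 u2 ->
  bil g u - bil w k = 'i%C * ofr (eps ^+ 2) *
    ((w1 1 * u 1 - w 1 * u1 1) - (w1 (-1) * u (-1) - w (-1) * u1 (-1))).
Proof.
move=> hw hu; have [cw cw1] := eqn_ic hw; have [cu cu1] := eqn_ic hu.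
case: hw hu => [h1 h2 h3 h4] [k1 k2 k3 k4].
pose D x := w2 x * u x - w x * u2 x.
have icD : ic D by apply: icontB; exact: icontM.
rewrite -(@cI_FTC _ (-1) 1 (fun x => w1 x * u x - w x * u1 x) D) ?lemm11 //; last first.
  move=> x hx; have E : D x = (w2 x * u x + w1 x * u1 x) - (w1 x * u1 x + w x * u2 x).
    by rewrite /D; ring.
  rewrite E; apply: hasdB; apply: hasdM; by [exact: h1|exact: h2|exact: k1|exact: k2].
rewrite -cIZ //.
have icL lam' z z2 : ic z -> ic z2 -> ic (Lp lam' z z2).
  move=> hz hz2; apply: icontD; first exact: icontZ.
  by apply: icontM => //; apply: icontB => //; exact: icont_cst.
rewrite (@eq_bil _ g u (Lp lam w w2) u) // => [|x hx]; last by rewrite h4.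
rewrite (@eq_bil _ w k w (Lp lam u u2)) // => [|x hx]; last by rewrite k4.
rewrite /bil /Int -cIB; try by apply: icontM => //; exact: icL.
by apply: eq_cI => x _; rewrite /Lop /D; ring.
Qed.

Variables (v v1 v2 : nat -> R -> R[i]) (l : nat -> R[i]).
Hypotheses (hv : forall k, dom (v k) (v1 k) (v2 k)) (hn : forall k, n2 (v k) = 1)
  (hL : forall k x, -1 <= x <= 1 -> Lp (l k) (v k) (v2 k) x = 0) (linj : injective l).
Hypothesis hcomplete : forall lam w w1 w2, dom w w1 w2 ->
  (forall x, -1 <= x <= 1 -> Lp lam w w2 x = 0) ->
  (exists2 x, -1 <= x <= 1 & w x != 0) -> exists k, lam = l k.
Hypothesis hassoc : forall lam z z1 z2 w w1 w2, dom z z1 z2 -> dom w w1 w2 ->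
  (forall x, -1 <= x <= 1 -> Lp lam z z2 x = 0) ->
  (forall x, -1 <= x <= 1 -> Lp lam w w2 x = z x) -> forall x, -1 <= x <= 1 -> z x = 0.

Definition bperp n g : Prop := forall k, (k < n)%N -> bil g (v k) = 0.

Lemma bperp_solution n lam g w w1 w2 : dom w w1 w2 -> ic g ->
  (forall x, -1 <= x <= 1 -> Lp lam w w2 x = g x) -> bperp n g ->
  forall k, (k < n)%N -> lam != l k -> bil w (v k) = 0.
Proof.
move=> h hg E gV k kn lk.
have := Lop_sym eps qfc lam h (hv k).
rewrite (@eq_bil _ _ (v k) g (v k)) // gV //.
rewrite (@eq_bil _ w _ w (fun x => (l k - lam) * v k x)) //; last first.
  by move=> x hx; rewrite (Lop_eigen hL).
have cw := dom_c0 h; have cv := dom_c0 (hv k).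
by rewrite bilZr // => /esym/eqP; rewrite mulf_eq0 subr_eq0 eq_sym (negbTE lk) => /eqP ->.
Qed.

(* Let p solve (L - lam) p = 0 with p (-1) = 0 and p' (-1) = 1. If p 1 != 0, then
   a multiple of p corrects the boundary value at 1. Otherwise p is proportional
   to some v k with k < n, the boundary value is right by the Wronskian identity,
   and a multiple of p corrects the orthogonality to v k: bil p p != 0, because
   there is no associated function. *)
Lemma resolvent_point n lam : (forall k, lam = l k -> (k < n)%N) ->
  (forall g, ic g -> bperp n g -> exists w w1 w2, [/\ dom w w1 w2, bperp n w &
     forall x, -1 <= x <= 1 -> Lp lam w w2 x = g x]) /\
  exists2 C, 0 <= C & forall w w1 w2, dom w w1 w2 -> bperp n w ->
    Num.sqrt (n2 w) <= C * Num.sqrt (n2 (Lp lam w w2)).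
Proof.
move=> ln.
have ic0 : ic (fun=> 0 : R[i]) by exact: icont_cst.
have [p [p1 [p2 [hp p0 p10]]]] := eqn_ivp lam 0 1 ic0.
have [cp cp1] := eqn_ic hp.
have [K K0 HK] := eqn_bound lam.
have pE x : -1 <= x <= 1 -> Lp lam p p2 x = 0 by move=> hx; case: hp => _ _ _ ->.
have [Mp Mp0 HMp] := ic_bound cp.
have mI : -1 <= (-1 : R) <= 1 by rewrite lexx lemm11.
have oI : -1 <= (1 : R) <= 1 by rewrite lexx lemm11.
(* For c = w'(-1) the function w - c p has zero initial data, so that the image controls it; only c
   remains to be estimated, from w 1 = 0 in the one case and from orthogonality to an eigenfunction
   in the other. *)
have bound A : 0 <= A -> (forall g w w1 w2 c s, 0 <= s -> dom w w1 w2 -> bperp n w ->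
      (forall x, -1 <= x <= 1 -> nc (w x - c * p x) <= s) -> nc c <= A * s) ->
    exists2 C, 0 <= C & forall w w1 w2, dom w w1 w2 -> bperp n w ->
      Num.sqrt (n2 w) <= C * Num.sqrt (n2 (Lp lam w w2)).
  move=> A0 HA.
  exists (Num.sqrt 2 * ((1 + A * Mp) * K)).
    by rewrite mulr_ge0 ?sqrtr_ge0 // mulr_ge0 // addr_ge0 // mulr_ge0.
  move=> w w1 w2 h hw; have cw := dom_c0 h.
  have hg := Lop_ic eps qfc lam h; set g := Lp lam w w2 in hg *.
  pose c := w1 (-1); pose s := K * Num.sqrt (n2 g).
  have s0 : 0 <= s by rewrite mulr_ge0 // sqrtr_ge0.
  have hs x : -1 <= x <= 1 -> nc (w x - c * p x) <= s.
    move=> hx.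
    have e1 := eqnB c (dom_eqn lam h) hp; case: (e1) => a1 a2 a3 a4.
    have e2 : eqn lam g (fun x => w x - c * p x) (fun x => w1 x - c * p1 x) (fun x => w2 x - c * p2 x).
      by split=> // y hy; rewrite a4 // mulr0 subr0.
    apply: (HK _ _ _ _ hg e2) => //; first by rewrite (dom_l h) p0 mulr0 subr0.
    by rewrite p10 mulr1 subrr.
  have cA : nc c <= A * s by apply: (HA g w w1 w2) => //.
  have sup x : -1 <= x <= 1 -> nc (w x) <= (1 + A * Mp) * s.
    move=> hx; have -> : w x = (w x - c * p x) + c * p x by rewrite subrK.
    apply: le_trans (ncD _ _) _; rewrite mulrDl mul1r; apply: lerD; first exact: hs.
    rewrite ncM [A * Mp * s]mulrAC.
    by apply: ler_pM; rewrite ?nc_ge0 ?HMp.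
  have := n2_sup cw sup => h2.
  have -> : Num.sqrt 2 * ((1 + A * Mp) * K) * Num.sqrt (n2 g) = Num.sqrt (2 * ((1 + A * Mp) * s) ^+ 2).
    rewrite sqrtrM // sqrtr_sqr ger0_norm; last by rewrite mulr_ge0 // addr_ge0 // mulr_ge0.
    by rewrite /s -!mulrA.
  exact: ler_wsqrtr.
have [pz|pnz] := eqVneq (p 1) 0; last first.
  split.
    move=> g hg gV.
    have [w [w1 [w2 [hw w0 w10]]]] := eqn_ivp lam 0 0 hg.
    pose c := w 1 / p 1.
    have e1 := eqnB c hw hp; case: (e1) => a1 a2 a3 a4.
    pose W x := w x - c * p x; pose W2 x := w2 x - c * p2 x.
    have hd : dom W (fun x => w1 x - c * p1 x) W2.
      apply: (eqn_dom e1); first by rewrite w0 p0 mulr0 subrr.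
      by rewrite /c divfK // subrr.
    have hE x : -1 <= x <= 1 -> Lp lam W W2 x = g x by move=> hx; rewrite a4 // mulr0 subr0.
    exists W, (fun x => w1 x - c * p1 x), W2; split=> // k kn.
    apply: (bperp_solution hd hg hE gV kn).
    apply/eqP => lk; move: pnz; apply/negP; rewrite negbK; apply/eqP.
    have ek : eqn lam (fun=> 0) (v k) (v1 k) (v2 k).
      by case: (dom_eqn lam (hv k)) => b1 b2 b3 _; split=> // x hx; rewrite lk hL.
    have [d1 d2 d3 d4] := eqnB (v1 k (-1)) ek hp.
    have U x : -1 <= x <= 1 -> v k x - v1 k (-1) * p x = 0.
      apply: (@eqn_uniq lam (fun=> 0) (fun x => v k x - v1 k (-1) * p x) (fun x => v1 k x - v1 k (-1) * p1 x) (fun x => v2 k x - v1 k (-1) * p2 x)).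
      - by split=> // y hy; rewrite d4 // mulr0 subr0.
      - by [].
      - by rewrite (dom_l (hv k)) p0 mulr0 subr0.
      - by rewrite p10 mulr1 subrr.
    have := U 1 oI; rewrite (dom_r (hv k)) sub0r => /eqP; rewrite oppr_eq0 mulf_eq0 => /orP[/eqP s0|/eqP //].
    have : n2 (v k) = 0.
      rewrite (@eq_n2 _ _ (fun=> 0)); first by rewrite /n2 /Int cI_cst ?lemm11 // !mul0r.
      by move=> x hx; have := U x hx; rewrite s0 mul0r subr0.
    by rewrite hn => /eqP; rewrite oner_eq0.
  apply: (bound (nc (p 1))^-1); first by rewrite invr_ge0 nc_ge0.
  move=> g w w1 w2 c s s0 h _ /(_ 1 oI).
  by rewrite (dom_r h) sub0r ncN ncM mulrC ler_pdivlMl ?nc_gt0 // => H; rewrite mulrC.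
have hdp : dom p p1 p2 by exact: eqn_dom hp p0 pz.
have pnz : exists2 x, -1 <= x <= 1 & p x != 0.
  apply: contrapT => H.
  have p_0 x : -1 <= x <= 1 -> p x = 0.
    by move=> hx; apply/eqP; apply: contrapT => /negP nx; apply: H; exists x.
  have e2 : (0 : R) < 1 / 2 by [].
  have [d d0 Hd] := dom_d1 hdp mI e2.
  pose y := Num.min (d / 2) 1; have y0 : 0 < y by rewrite lt_min ltr01 divr_gt0.
  have y1 : y <= 1 by rewrite ge_min lexx orbT.
  have yd : y <= d / 2 by rewrite ge_min lexx.
  have := Hd (-1 + y); rewrite p_0; last by apply/andP; split; [rewrite lerDl ltW|rewrite addrC lerBlDr (le_trans y1) // lerDl].
  rewrite p0 p10 subr0 sub0r mul1r ncN nc_ofrB [-1 + y]addrC addrK gtr0_norm //.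
  move=> H1; have : y <= 1 / 2 * y by by apply: H1; apply: le_lt_trans yd _; rewrite ltr_pdivrMr // ltr_pMr // ltr1n.
  by rewrite ler_pMl // div1r invf_ge1 // lern1.
have [k0 lk0] := hcomplete hdp pE pnz.
have k0n := ln k0 lk0.
have vp : exists2 c, c != 0 & forall x, -1 <= x <= 1 -> v k0 x = c * p x.
  have ek : eqn lam (fun=> 0) (v k0) (v1 k0) (v2 k0).
    by case: (dom_eqn lam (hv k0)) => b1 b2 b3 _; split=> // x hx; rewrite lk0 hL.
  have [d1 d2 d3 d4] := eqnB (v1 k0 (-1)) ek hp.
  have U x : -1 <= x <= 1 -> v k0 x = v1 k0 (-1) * p x.
    move=> hx; apply/eqP; rewrite -subr_eq0; apply/eqP; move: x hx.
    apply: (@eqn_uniq lam (fun=> 0) (fun x => v k0 x - v1 k0 (-1) * p x) (fun x => v1 k0 x - v1 k0 (-1) * p1 x) (fun x => v2 k0 x - v1 k0 (-1) * p2 x)).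
    - by split=> // y hy; rewrite d4 // mulr0 subr0.
    - by [].
    - by rewrite (dom_l (hv k0)) p0 mulr0 subr0.
    - by rewrite p10 mulr1 subrr.
  exists (v1 k0 (-1)) => //; apply/eqP => s0.
  have : n2 (v k0) = 0.
    rewrite (@eq_n2 _ _ (fun=> 0)); first by rewrite /n2 /Int cI_cst ?lemm11 // !mul0r.
    by move=> x hx; have := U x hx; rewrite s0 mul0r.
  by rewrite hn => /eqP; rewrite oner_eq0.
have [c0 c00 Hc0] := vp.
have bilv w : ic w -> bil w (v k0) = c0 * bil w p.
  move=> hw; rewrite (@eq_bil _ w (v k0) w (fun x => c0 * p x)) ?bilZr //.
(* The Wronskian of [p] and a second solution is constant; it is 1 at -1 and would be 0 at 1. *)
have p11 : p1 1 != 0.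
  have [u [u1 [u2 [hu u0 u10]]]] := eqn_ivp lam 1 0 ic0.
  apply/eqP => pp; have := wronskian hp hu.
  rewrite pz pp p0 p10 u0 u10 !mul0r mul1r !subr0 sub0r => /eqP.
  have [cu _] := eqn_ic hu.
  have -> : bil (fun=> 0 : R[i]) u = 0.
    by rewrite /bil /Int (@eq_cI _ _ _ _ (fun=> 0)) ?cI_cst ?lemm11 ?mul0r // => x _; rewrite mul0r.
  have -> : bil p (fun=> 0 : R[i]) = 0.
    by rewrite /bil /Int (@eq_cI _ _ _ _ (fun=> 0)) ?cI_cst ?lemm11 ?mul0r // => x _; rewrite mulr0.
  rewrite subrr eq_sym mulf_eq0 (negbTE ka_neq0) /= oppr_eq0 oner_eq0 //.
have end0 g w w1 w2 : eqn lam g w w1 w2 -> w (-1) = 0 -> bil g p = 0 -> w 1 = 0.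
  move=> hw w0 gp; have := wronskian hw hp.
  rewrite gp pz p0 w0 !mulr0 !mul0r.
  have -> : bil w (fun=> 0 : R[i]) = 0.
    by rewrite /bil /Int (@eq_cI _ _ _ _ (fun=> 0)) ?cI_cst ?lemm11 ?mul0r // => x _; rewrite mulr0.
  rewrite !subr0 sub0r => /esym/eqP; rewrite mulf_eq0 (negbTE ka_neq0) /= oppr_eq0 mulf_eq0.
  by rewrite (negbTE p11) orbF => /eqP.
have pp0 : bil p p != 0.
  apply/eqP => pp.
  have [w [w1 [w2 [hw w0 w10]]]] := eqn_ivp lam 0 0 cp.
  have hd := eqn_dom hw w0 (end0 _ _ _ _ hw w0 pp).
  have [_ _ _ wE] := hw.
  have [x hx] := pnz; apply/negP; rewrite negbK; apply/eqP.
  exact: (hassoc hdp hd pE wE).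
split.
  move=> g hg gV.
  have [w [w1 [w2 [hw w0 w10]]]] := eqn_ivp lam 0 0 hg.
  have [cw _] := eqn_ic hw.
  pose c := bil w p / bil p p.
  have e1 := eqnB c hw hp; case: (e1) => a1 a2 a3 a4.
  pose W x := w x - c * p x; pose W2 x := w2 x - c * p2 x.
  have gp : bil g p = 0.
    by have := gV k0 k0n; rewrite bilv // => /eqP; rewrite mulf_eq0 (negbTE c00) => /eqP.
  have hd : dom W (fun x => w1 x - c * p1 x) W2.
    apply: (eqn_dom e1); first by rewrite w0 p0 mulr0 subrr.
    by rewrite (end0 _ _ _ _ hw) // pz mulr0 subrr.
  have hE x : -1 <= x <= 1 -> Lp lam W W2 x = g x by move=> hx; rewrite a4 // mulr0 subr0.
  exists W, (fun x => w1 x - c * p1 x), W2; split=> // k kn.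
  have [E|nE] := eqVneq lam (l k); last exact: (bperp_solution hd hg hE gV kn).
  have -> : k = k0 by apply: linj; rewrite -E -lk0.
  have cW := dom_c0 hd; rewrite bilv // /W bilBl ?bilZl //; last exact: icontZ.
  by rewrite /c divfK // subrr mulr0.
have icr u : ic u -> ic (fun x => ofr (nc (u x))) by exact: icont_nc.
apply: (bound (2 * Mp / nc (bil p p))).
  by rewrite divr_ge0 ?nc_ge0 // mulr_ge0.
move=> g w w1 w2 c s s0 h hw hs; have cw := dom_c0 h.
have wp : bil w p = 0.
  by have := hw k0 k0n; rewrite bilv // => /eqP; rewrite mulf_eq0 (negbTE c00) => /eqP.
have E : bil (fun x => w x - c * p x) p = - (c * bil p p).
  by rewrite bilBl ?bilZl ?wp ?sub0r //; exact: icontZ.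
have icd : ic (fun x => w x - c * p x) by apply: icontB => //; exact: icontZ.
have : nc (bil (fun x => w x - c * p x) p) <= s * Mp * (1 - -1).
  apply: nc_cI_bound; [exact: lemm11|exact: icontM|].
  by move=> x hx; rewrite ncM; apply: ler_pM; rewrite ?nc_ge0 ?hs ?HMp.
rewrite E ncN ncM => H.
rewrite mulrAC ler_pdivlMr ?nc_gt0 //; apply: le_trans H _.
by rewrite [leRHS](_ : _ = s * Mp * (1 - -1)) //; ring.
Qed.
End Resolvent.

(** * Completeness of the eigenfunctions *)

Section Linear.
Context {R : realType}.
Implicit Types (u v w : R -> R[i]) (x : R).

Lemma n2_triangle u w : ic u -> ic w ->
  Num.sqrt (n2 (fun x => u x + w x)) <= Num.sqrt (n2 u) + Num.sqrt (n2 w).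
Proof.
move=> hu hw; have hcw := cj_ic hw.
have E : n2 (fun x => u x + w x) = n2 u + 2 * re (bil u (cj w)) + n2 w.
  rewrite (@eq_n2 _ _ (fun x => 1 * u x - (-1) * cj (cj w) x)).
    rewrite n2_sub_expand // ncN nc1 expr1n !mul1r n2_cj rmorphN1 mulN1r reN mulrN opprK.
    by [].
  by move=> x _; rewrite cjK mul1r mulN1r opprK.
have CS := cauchy_schwarz_sqrt hu hcw; rewrite n2_cj in CS.
have u0 := n2_ge0 hu; have w0 := n2_ge0 hw.
have h1 := le_trans (ler_norm _) (re_le_nc (bil u (cj w))).
rewrite -[leRHS]ger0_norm ?addr_ge0 ?sqrtr_ge0 // -sqrtr_sqr ler_wsqrtr // E.
rewrite sqrrD !sqr_sqrtr // lerD2r lerD2l mulr2n -mulr2n -mulr_natl ler_wpM2l //.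
exact: le_trans h1 CS.
Qed.

Lemma dom_addZ (c : R[i]) w w1 w2 u u1 u2 : dom w w1 w2 -> dom u u1 u2 ->
  dom (fun x => w x + c * u x) (fun x => w1 x + c * u1 x) (fun x => w2 x + c * u2 x).
Proof.
move=> h k; split.
- by move=> x hx; apply: hasdD; [exact: (dom_d1 h)|apply: hasdZ; exact: (dom_d1 k)].
- by move=> x hx; apply: hasdD; [exact: (dom_d2 h)|apply: hasdZ; exact: (dom_d2 k)].
- by apply: icontD; [exact: (dom_c2 h)|apply: icontZ; exact: (dom_c2 k)].
- by rewrite (dom_l h) (dom_l k) mulr0 addr0.
- by rewrite (dom_r h) (dom_r k) mulr0 addr0.
Qed.

Lemma hasd_trig (F f : R -> R) x : (forall y : R, is_derive y 1 F (f y)) ->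
  hasd ofr (fun y => ofr (F y)) x (ofr (f x)).
Proof. by move=> h; apply/hasdP; split; [exact: h|exact: is_derive_cst]. Qed.

(* Variation of constants for w2 + k^2 w = h with the solutions of the
   homogeneous equation vanishing at -1 and at 1, whose Wronskian is k sin 2k. *)
Lemma oscillator_bound (k : R) w w1 w2 h : 0 < k -> sin (k + k) = 1 -> dom w w1 w2 -> ic h ->
  (forall x, -1 <= x <= 1 -> w2 x + ofr (k ^+ 2) * w x = h x) ->
  forall x, -1 <= x <= 1 -> k * nc (w x) <= re (Int (fun x => ofr (nc (h x)))).
Proof.
move=> k0 sk hd hh E x /andP[x1 x2].
have hw := dom_c0 hd; have hw1 := dom_c1 hd.
pose s y := sin (k * (y + 1)); pose c y := cos (k * (y + 1)).
pose s' y := sin (k * (1 - y)); pose c' y := cos (k * (1 - y)).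
have ds y : hasd ofr (fun y => ofr (s y)) y (ofr (k * c y)).
  by apply: (hasd_trig (F := s) (f := fun y => k * c y)) => z; apply: is_derive_eq;
     rewrite /GRing.scale /= /c; ring.
have dc y : hasd ofr (fun y => ofr (c y)) y (ofr (- (k * s y))).
  by apply: (hasd_trig (F := c) (f := fun y => - (k * s y))) => z; apply: is_derive_eq;
     rewrite /GRing.scale /= /s; ring.
have ds' y : hasd ofr (fun y => ofr (s' y)) y (ofr (- (k * c' y))).
  by apply: (hasd_trig (F := s') (f := fun y => - (k * c' y))) => z; apply: is_derive_eq;
     rewrite /GRing.scale /= /c'; ring.
have dc' y : hasd ofr (fun y => ofr (c' y)) y (ofr (k * s' y)).
  by apply: (hasd_trig (F := c') (f := fun y => k * s' y)) => z; apply: is_derive_eq;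
     rewrite /GRing.scale /= /s'; ring.
have ics : ic (fun y => ofr (s y)) by move=> y _; exact: hasd_cont (ds y).
have ics' : ic (fun y => ofr (s' y)) by move=> y _; exact: hasd_cont (ds' y).
have subl u : ic u -> icont (-1) x u by move=> H y /andP[y1 y2]; apply: H; rewrite y1 (le_trans y2).
have subr u : ic u -> icont x 1 u by move=> H y /andP[y1 y2]; apply: H; rewrite y2 (le_trans x1).
have A : cI (-1) x (fun y => ofr (s y) * h y) = ofr (s x) * w1 x - ofr (k * c x) * w x.
  rewrite (@cI_FTC _ (-1) x (fun y => ofr (s y) * w1 y - ofr k * (ofr (c y) * w y))) //.
  - rewrite (dom_l hd) !mulr0 subr0 /s addNr mulr0 sin0 rmorph0 mul0r subr0 rmorphM mulrA.
    by [].
  - move=> y /andP[y1 y2]; have hy : -1 <= y <= 1 by rewrite y1 (le_trans y2).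
    have -> : ofr (s y) * h y = (ofr (k * c y) * w1 y + ofr (s y) * w2 y) -
        ofr k * (ofr (- (k * s y)) * w y + ofr (c y) * w1 y).
      by rewrite -E // rmorphN expr2 !rmorphM; ring.
    apply: hasdB; first by apply: hasdM => //; exact: (dom_d2 hd).
    by apply: hasdZ; apply: hasdM => //; exact: (dom_d1 hd).
  - by apply: subl; exact: icontM.
have B : cI x 1 (fun y => ofr (s' y) * h y) = - (ofr (s' x) * w1 x + ofr (k * c' x) * w x).
  rewrite (@cI_FTC _ x 1 (fun y => ofr (s' y) * w1 y + ofr k * (ofr (c' y) * w y))) //.
  - rewrite (dom_r hd) !mulr0 addr0 /s' subrr mulr0 sin0 rmorph0 mul0r sub0r rmorphM mulrA.
    by [].
  - move=> y /andP[y1 y2]; have hy : -1 <= y <= 1 by rewrite y2 (le_trans x1).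
    have -> : ofr (s' y) * h y = (ofr (- (k * c' y)) * w1 y + ofr (s' y) * w2 y) +
        ofr k * (ofr (k * s' y) * w y + ofr (c' y) * w1 y).
      by rewrite -E // rmorphN expr2 !rmorphM; ring.
    apply: hasdD; first by apply: hasdM => //; exact: (dom_d2 hd).
    by apply: hasdZ; apply: hasdM => //; exact: (dom_d1 hd).
  - by apply: subr; exact: icontM.
have K : ofr k * w x = - (ofr (s' x) * (ofr (s x) * w1 x - ofr (k * c x) * w x)
    + ofr (s x) * (- (ofr (s' x) * w1 x + ofr (k * c' x) * w x))).
  have S : s x * c' x + c x * s' x = 1.
    by rewrite /s /s' /c /c' -sinD -[RHS]sk; congr sin; ring.
  have S' : ofr (s x) * ofr (c' x) + ofr (c x) * ofr (s' x) = 1.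
    by rewrite -!rmorphM -rmorphD S rmorph1.
  rewrite -[LHS]mul1r -S' !rmorphM.
  ring.
rewrite -A -B in K.
have nk : k * nc (w x) = nc (ofr k * w x) by rewrite ncM nc_ofr gtr0_norm.
have small t (z : R[i]) : `|t| <= 1 -> nc (ofr t * z) <= nc z.
  by move=> ht; rewrite ncM nc_ofr ler_piMl // nc_ge0.
rewrite nk K ncN; apply: le_trans (ncD _ _) _.
have ich : ic (fun x => ofr (nc (h x))) by exact: icont_nc.
rewrite /Int (@cI_split _ (-1) 1 x) // reD.
apply: lerD.
  apply: le_trans (small _ _ (sin_max _)) _.
  apply: le_trans (nc_cI_le (subl _ (icontM ics hh))) _.
  apply: le_re_cI; [exact: icont_nc (subl _ (icontM ics hh))|exact: subl|].
  by move=> y _; rewrite !re_ofr; exact: small (sin_max _).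
apply: le_trans (small _ _ (sin_max _)) _.
apply: le_trans (nc_cI_le (subr _ (icontM ics' hh))) _.
apply: le_re_cI; [exact: icont_nc (subr _ (icontM ics' hh))|exact: subr|].
by move=> y _; rewrite !re_ofr; exact: small (sin_max _).
Qed.
End Linear.

Section Completeness.
Context {R : realType}.
Variables (q : R -> R) (qf : R -> R[i]) (eps : R).
Hypotheses (qfc : ic qf) (qfE : forall x, -1 <= x <= 1 -> qf x = ofr (q x)) (eps0 : 0 < eps).
Local Notation Lp := (Lop qf eps).
Implicit Types (lam c : R[i]) (n : nat) (g w u : R -> R[i]).

Lemma Lop_addZ lam c w w2 u u2 x :
  Lp lam (fun x => w x + c * u x) (fun x => w2 x + c * u2 x) x = Lp lam w w2 x + c * Lp lam u u2 x.
Proof. by rewrite /Lop; ring. Qed.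

Lemma Lop_shift lam (mu0 : R[i]) w w2 x : Lp lam w w2 x = Lp mu0 w w2 x - (lam - mu0) * w x.
Proof. by rewrite /Lop; ring. Qed.

(** For im lam = - eps^2 k^2 the equation reads i eps^2 (w'' + k^2 w) = g - (q - re lam) w. The
    oscillator bound gains 1 / (eps^2 k), and 8 P <= eps^2 k allows the last term to be absorbed. *)
Lemma bottom_bound lam w w1 w2 (k P : R) : 0 < k -> sin (k + k) = 1 -> dom w w1 w2 ->
  im lam = - (eps ^+ 2 * k ^+ 2) -> (forall x, -1 <= x <= 1 -> `|q x - re lam| <= P) ->
  8 * P <= eps ^+ 2 * k ->
  eps ^+ 2 * k * Num.sqrt (n2 w) <= 8 * Num.sqrt (n2 (Lp lam w w2)).
Proof.
move=> k0 sk h il HP Pk; have hw := dom_c0 h; have hw2 := dom_c2 h.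
have hg := Lop_ic eps qfc lam h; set g := Lp lam w w2 in hg *.
have e2 : 0 < eps ^+ 2 by rewrite exprn_gt0.
pose H x := w2 x + ofr (k ^+ 2) * w x.
have icH : ic H by apply: icontD => //; exact: icontZ.
have P0 : 0 <= P by apply: le_trans (HP 0 _); rewrite ?normr_ge0 //; apply/andP; split; lra.
have HE x : -1 <= x <= 1 -> 'i%C * ofr (eps ^+ 2) * H x = g x - ofr (q x - re lam) * w x.
  move=> hx; rewrite /g /Lop qfE // /H.
  have lE : lam = ofr (re lam) - 'i%C * (ofr (eps ^+ 2) * ofr (k ^+ 2)).
    rewrite -rmorphM; apply: complex_ext.
      by rewrite reD reN re_ofrM re_i mul0r oppr0 addr0.
    by rewrite imD imN im_ofrM im_i im_ofr add0r mul1r.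
  set r := re lam in lE *; rewrite lE; clearbody r; rewrite rmorphB; ring.
have Hb x : -1 <= x <= 1 -> eps ^+ 2 * nc (H x) <= nc (g x) + P * nc (w x).
  move=> hx; have -> : eps ^+ 2 * nc (H x) = nc ('i%C * ofr (eps ^+ 2) * H x).
    by rewrite ncM (ncM 'i%C) nc_i mul1r nc_ofr gtr0_norm.
  rewrite HE //; apply: le_trans (ncB _ _) _; rewrite lerD2l ncM nc_ofr.
  by rewrite ler_wpM2r ?nc_ge0 ?HP.
have icn u : ic u -> ic (fun x => ofr (nc (u x))) by exact: icont_nc.
have I1 : eps ^+ 2 * re (Int (fun x => ofr (nc (H x)))) <=
    2 * Num.sqrt (n2 g) + P * (2 * Num.sqrt (n2 w)).
  have -> : eps ^+ 2 * re (Int (fun x => ofr (nc (H x)))) =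
     re (Int (fun x => ofr (eps ^+ 2) * ofr (nc (H x)))).
    by rewrite /Int cIZ; [rewrite [in RHS]mulrC re_ofrM mulrC|exact: icn].
  apply: (@le_trans _ _ (re (Int (fun x => ofr (nc (g x)) + ofr P * ofr (nc (w x)))))).
    apply: le_re_cI; [exact: icontZ (icn _ icH)|exact: icontD (icn _ hg) (icontZ _ (icn _ hw))|].
    by move=> x hx; rewrite -!rmorphM -rmorphD !re_ofr; exact: Hb.
  rewrite /Int cID; [|exact: icn|exact: icontZ (icn _ hw)].
  rewrite cIZ; last exact: icn.
  rewrite reD lerD ?int_nc_le // mulrC re_ofrM mulrC ler_wpM2l //; exact: int_nc_le.
set G := Num.sqrt (n2 g) in I1 *; set W := Num.sqrt (n2 w) in I1 *.
have W0 : 0 <= W by exact: sqrtr_ge0.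
have sup x : -1 <= x <= 1 -> nc (w x) <= (2 * G + P * (2 * W)) / (eps ^+ 2 * k).
  move=> hx; rewrite ler_pdivlMr ?mulr_gt0 //; apply: le_trans I1.
  rewrite mulrCA [nc _ * _]mulrC ler_pM2l //.
  exact: (oscillator_bound k0 sk h icH).
have := n2_sup hw sup => h2.
have S0 : 0 <= (2 * G + P * (2 * W)) / (eps ^+ 2 * k).
  by rewrite divr_ge0 ?mulr_ge0 ?addr_ge0 ?mulr_ge0 ?sqrtr_ge0 // ltW.
have h3 : W <= 2 * ((2 * G + P * (2 * W)) / (eps ^+ 2 * k)).
  move: h2 S0; move: ((2 * G + P * (2 * W)) / (eps ^+ 2 * k)) => S h2 S0.
  have -> : 2 * S = Num.sqrt ((2 * S) ^+ 2) by rewrite sqrtr_sqr ger0_norm // mulr_ge0.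
  rewrite ler_wsqrtr //; apply: le_trans h2 _; rewrite exprMn ler_wpM2r ?sqr_ge0 //.
  by rewrite expr2 ler_peMr // ler1n.
have ek : 0 < eps ^+ 2 * k by rewrite mulr_gt0.
move: h3; rewrite mulrA ler_pdivlMr // => h3.
have h4 : 8 * P * W <= eps ^+ 2 * k * W by rewrite ler_wpM2r.
set E := eps ^+ 2 * k in h3 h4 *.
have h3' : E * W <= 4 * G + 4 * (P * W) by move: h3; rewrite mulrC => /le_trans; apply; rewrite le_eqVlt; apply/orP; left; apply/eqP; ring.
have h4' : 8 * (P * W) <= E * W by rewrite mulrA.
by clearbody E G W; move: (P * W) (E * W) h3' h4' => a b h5 h6; lra.
Qed.
End Completeness.

Lemma half_absorb (R : realType) (X s t : R) : X <= t + s -> s <= 1 / 2 * X -> X <= 2 * t.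
Proof. by lra. Qed.

(** * Smallness of the restricted resolvent and density of the combinations *)

Section Density.
Context {R : realType}.
Variables (q : R -> R) (qf : R -> R[i]) (eps : R).
Hypotheses (qfc : ic qf) (qfE : forall x, -1 <= x <= 1 -> qf x = ofr (q x)) (eps0 : 0 < eps).
Local Notation Lp := (Lop qf eps).
Implicit Types (lam c : R[i]) (n : nat) (g w u : R -> R[i]).
Variables (v v1 v2 : nat -> R -> R[i]) (l : nat -> R[i]).
Hypotheses (hv : forall k, dom (v k) (v1 k) (v2 k)) (hn : forall k, n2 (v k) = 1)
  (hL : forall k x, -1 <= x <= 1 -> Lp (l k) (v k) (v2 k) x = 0) (linj : injective l).
Hypothesis hcomplete : forall lam w w1 w2, dom w w1 w2 ->
  (forall x, -1 <= x <= 1 -> Lp lam w w2 x = 0) ->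
  (exists2 x, -1 <= x <= 1 & w x != 0) -> exists k, lam = l k.
Hypothesis hassoc : forall lam z z1 z2 w w1 w2, dom z z1 z2 -> dom w w1 w2 ->
  (forall x, -1 <= x <= 1 -> Lp lam z z2 x = 0) ->
  (forall x, -1 <= x <= 1 -> Lp lam w w2 x = z x) -> forall x, -1 <= x <= 1 -> z x = 0.

Lemma n2_zero u : (forall x, -1 <= x <= 1 -> u x = 0) -> n2 u = 0.
Proof. by move=> h; rewrite (@eq_n2 _ _ (fun=> 0)) // /n2 /Int cI_cst ?lemm11 // !mul0r. Qed.

Lemma eigen_neqi k : l k != 'i%C.
Proof.
apply/eqP => E; have i1 : im (l k) = 1 by rewrite E im_i.
have := energy_top eps qfc qfE (hv k) (_ : 0 <= im (l k)).
rewrite i1 mul1r => /(_ ler01); rewrite hn (@n2_zero (Lp (l k) (v k) (v2 k))); last exact: hL.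
rewrite sqrtr0 mul0r; apply/negP; rewrite -ltNge ltr_wpDl //.
by rewrite mulr_ge0 ?sqr_ge0 // n2_ge0 //; exact: dom_c1 (hv k).
Qed.

Lemma count_le n : \sum_(j < n) (nc (l j - 'i%C) ^- 1) ^+ 2 <= 4 / eps ^+ 2.
Proof.
have -> : 4 / eps ^+ 2 = 2 * (2 / eps ^+ 2) by rewrite mulrA -natrM.
apply: (schur_count qfc hv hn hL) => //; first by rewrite divr_ge0 ?sqr_ge0.
- exact: eigen_neqi.
- by move=> w w1 w2 h x hx; have := sup_bound qfc qfE eps0 im_i h hx.
Qed.

(** Each eigenvalue within D of i contributes at least D^-2 to the bounded sum of [count_le]. *)
Lemma finite_near (D : R) : exists n, forall k, nc (l k - 'i%C) <= D -> (k < n)%N.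
Proof.
apply: contrapT => H.
have {}H n : exists k, (n <= k)%N /\ nc (l k - 'i%C) <= D.
  apply: contrapT => H1; apply: H; exists n => k kD; rewrite ltnNge; apply/negP => nk.
  by apply: H1; exists k.
have D0 : 0 < D.
  have [k [_ kD]] := H 0%N; apply: lt_le_trans kD.
  by rewrite nc_gt0 subr_eq0 eigen_neqi.
have S m : exists N, m%:R * (D ^- 1) ^+ 2 <= \sum_(j < N) (nc (l j - 'i%C) ^- 1) ^+ 2.
  elim: m => [|m [N IH]]; first by exists 0%N; rewrite mul0r big_ord0.
  have [k [Nk kD]] := H N; exists k.+1.
  rewrite -natr1 mulrDl mul1r big_ord_recr /=; apply: lerD.
    apply: le_trans IH _; rewrite -(subnKC Nk) big_split_ord /= lerDl.
    by apply: sumr_ge0 => j _; rewrite sqr_ge0.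
  have p0 : 0 < nc (l k - 'i%C) by rewrite nc_gt0 subr_eq0 eigen_neqi.
  by rewrite ler_pXn2r ?nnegrE ?invr_ge0 ?exprn_ge0 ?nc_ge0 ?(ltW D0) // lef_pV2 ?posrE.
pose m := (Num.Def.trunc (4 / eps ^+ 2 * D ^+ 2)).+1.
have [N HN] := S m; have := le_trans HN (count_le N).
rewrite exprVn expr1 ler_pdivrMr ?exprn_gt0 // => h.
by have := lt_le_trans (truncnS_gt (4 / eps ^+ 2 * D ^+ 2)) h; rewrite ltxx.
Qed.

Lemma bperp_addZ n c w u : ic w -> ic u -> bperp v n w -> bperp v n u ->
  bperp v n (fun x => w x + c * u x).
Proof.
move=> hw hu pw pu k kn; have cv := dom_c0 (hv k).
rewrite bilDl ?bilZl ?pw ?pu // ?mulr0 ?addr0 //; exact: icontZ.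
Qed.

Lemma bperp_Lop n lam w w1 w2 : dom w w1 w2 -> bperp v n w -> bperp v n (Lp lam w w2).
Proof.
move=> h pw k kn; have cw := dom_c0 h; have cv := dom_c0 (hv k).
rewrite (Lop_sym eps qfc lam h (hv k)) (@eq_bil _ w _ w (fun x => (l k - lam) * v k x)) //; last first.
  by move=> x hx; rewrite (Lop_eigen hL).
by rewrite bilZr // pw // mulr0.
Qed.

(** Three applications of the resolvent at p yield the coefficients, and the remainder is the
    resolvent at lam applied to the last function [d]. Since (L - p) e = d + z e and C nc z <= 1 / 2
    for nc z < 1 / (2 C + 1), the norm of [e] is at most 2 C times that of [d], uniformly in lam. *)
Lemma solution_expand n p :
  (forall k, p = l k -> (k < n)%N) -> forall g s, ic g -> ic s -> bperp v n g ->
  exists (c0 c1 c2 : R[i]) (r E : R), 0 < r /\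
    forall lam w w1 w2, (forall k, lam = l k -> (k < n)%N) -> nc (lam - p) < r ->
      dom w w1 w2 -> bperp v n w -> (forall x, -1 <= x <= 1 -> Lp lam w w2 x = g x) ->
      exists2 e, nc e <= E &
        bil w s = c0 + c1 * (lam - p) + c2 * (lam - p) ^+ 2 + (lam - p) ^+ 3 * e.
Proof.
move=> hp g s hg hs pg.
have [ex [C C0 HC]] := resolvent_point qfc eps0 hv hn hL linj hcomplete hassoc hp.
have [a [a1 [a2 [da pa Ea]]]] := ex g hg pg; have ca := dom_c0 da.
have [b [b1 [b2 [db pb Eb]]]] := ex a ca pa; have cb := dom_c0 db.
have [d [d1 [d2 [dd pd Ed]]]] := ex b cb pb; have cd := dom_c0 dd.
exists (bil a s), (bil b s), (bil d s), (2 * C + 1)^-1, (2 * C * Num.sqrt (n2 d) * Num.sqrt (n2 s)).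
have C1 : 0 < 2 * C + 1 by rewrite ltr_wpDl // mulr_ge0.
split; first by rewrite invr_gt0.
move=> lam w w1 w2 hlam lp dw pw Ew; have cw := dom_c0 dw.
have [exl [Cl Cl0 HCl]] := resolvent_point qfc eps0 hv hn hL linj hcomplete hassoc hlam.
have [e [e1 [e2 [de pe Ee]]]] := exl d cd pd; have ce := dom_c0 de.
set z := lam - p in lp *.
have dW := dom_addZ (z ^+ 3) (dom_addZ (z ^+ 2) (dom_addZ z da db) dd) de.
set W := fun x => _ in dW; set W2 := fun x => _ + z ^+ 3 * e2 x in dW.
have EW x : -1 <= x <= 1 -> Lp lam W W2 x = g x.
  move=> hx; rewrite /W /W2 !Lop_addZ Ee // (Lop_shift qf eps lam p a) (Lop_shift qf eps lam p b) (Lop_shift qf eps lam p d).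
  by rewrite Ea // Eb // Ed // -/z; ring.
have pW : bperp v n W.
  apply: bperp_addZ => //; last apply: bperp_addZ => //; last apply: bperp_addZ => //.
    by apply: icontD; [apply: icontD => //|]; exact: icontZ.
  by apply: icontD => //; exact: icontZ.
have wW x : -1 <= x <= 1 -> w x = W x.
  have dD := dom_addZ (-1) dw dW.
  have pD := bperp_addZ (-1) cw (dom_c0 dW) pw pW.
  have := HCl _ _ _ dD pD; rewrite (@n2_zero (Lp lam _ _)); last first.
    by move=> y hy; rewrite Lop_addZ EW // Ew // mulN1r subrr.
  rewrite sqrtr0 mulr0 => h.
  have : Num.sqrt (n2 (fun x => w x + -1 * W x)) == 0 by rewrite eq_le h sqrtr_ge0.
  rewrite sqrtr_eq0 => h0 hx.
  have h1 : n2 (fun x => w x + -1 * W x) = 0.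
    by apply/eqP; rewrite eq_le h0 n2_ge0 //; exact: dom_c0 dD.
  have := n2_eq0 (dom_c0 dD) h1 hx; rewrite mulN1r => /eqP; rewrite subr_eq0 => /eqP //.
exists (bil e s); last first.
  rewrite (@eq_bil _ w s W s) // /W.
  have cab : ic (fun x => a x + z * b x) by apply: icontD => //; exact: icontZ.
  have cabd : ic (fun x => a x + z * b x + z ^+ 2 * d x) by apply: icontD => //; exact: icontZ.
  rewrite bilDl //; last exact: icontZ.
  rewrite bilDl //; last exact: icontZ.
  rewrite bilDl //; last exact: icontZ.
  rewrite !bilZl //; ring.
have Le x : -1 <= x <= 1 -> Lp p e e2 x = d x + z * e x.
  by move=> hx; rewrite (Lop_shift qf eps p lam) Ee // /z; ring.
have := HC _ _ _ de pe; rewrite (eq_n2 Le) => h.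
have cze : ic (fun x => z * e x) by exact: icontZ.
have := le_trans h (ler_wpM2l C0 (n2_triangle cd cze)).
rewrite n2_scale // sqrtrM ?sqr_ge0 // sqrtr_sqr ger0_norm ?nc_ge0 // => {}h.
have zC : C * nc z <= 1 / 2.
  have h1 : nc z * (2 * C + 1) <= 1 by rewrite -ler_pdivlMr // div1r ltW.
  have h2 := nc_ge0 z; rewrite ler_pdivlMr //.
  have -> : C * nc z * 2 = nc z * (2 * C + 1) - nc z by ring.
  by rewrite lerBlDr (le_trans h1) // lerDl.
have e0 : 0 <= Num.sqrt (n2 e) by exact: sqrtr_ge0.
have h2 := ler_wpM2r e0 zC.
apply: le_trans (cauchy_schwarz_sqrt ce hs) _.
rewrite ler_wpM2r ?sqrtr_ge0 //.
set X := Num.sqrt (n2 e) in e0 h h2 *; set Y := Num.sqrt (n2 d) in h *.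
rewrite mulrDr mulrA in h.
by rewrite -(mulrA 2); exact: half_absorb h h2.
Qed.

Lemma n2_le_of_prod u (T G : R) : 0 < T -> T * n2 u <= G * Num.sqrt (n2 u) -> ic u -> 0 <= G ->
  T * Num.sqrt (n2 u) <= G.
Proof.
move=> T0 h hu G0; have := n2_ge0 hu; rewrite le_eqVlt => /predU1P[<-|u0].
  by rewrite sqrtr0 mulr0.
have s0 : 0 < Num.sqrt (n2 u) by rewrite sqrtr_gt0.
by rewrite -(ler_pM2r s0) -mulrA -expr2 sqr_sqrtr // ltW.
Qed.

Lemma large_frequency (X : R) : exists k : R, [/\ 0 < k, X <= k & sin (k + k) = 1].
Proof.
pose m := (Num.Def.trunc `|X|).+1; pose k : R := pi / 4 + m%:R * pi.
have p2 : 2 <= pi :> R by exact: pi_ge2.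
have mX : `|X| < m%:R by exact: truncnS_gt.
have X0 := normr_ge0 X; have X1 := ler_norm X.
have mp : m%:R * 1 <= m%:R * pi :> R by rewrite ler_wpM2l // (le_trans _ p2) // ler1n.
exists k; split.
- by rewrite addr_gt0 ?divr_gt0 ?pi_gt0 // mulr_gt0 ?ltr0n ?pi_gt0.
- by rewrite /k; apply: (le_trans X1); apply: (le_trans (ltW mX)); rewrite mulr1 in mp; apply: (le_trans mp); rewrite lerDr divr_ge0 ?pi_ge0.
- have -> : k + k = pi / 2 + (pi *+ 2) *+ m.
    by rewrite /k -[_ *+ m]mulr_natl mulr2n; field.
  by rewrite (periodicn (@sinD2pi R)) sin_pihalf.
Qed.

Variable (Q : R).
Hypothesis HQ : forall x, -1 <= x <= 1 -> `|q x| <= Q.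

Lemma resolvent_small (be : R) : 0 < be -> exists n, forall w w1 w2, dom w w1 w2 -> bperp v n w ->
  Num.sqrt (n2 w) <= be * Num.sqrt (n2 (Lp 'i%C w w2)).
Proof.
move=> be0; have Q0 : 0 <= Q by apply: le_trans (HQ (_ : -1 <= 0 <= 1)); rewrite ?normr_ge0 //; apply/andP; split; lra.
(* T >= 1 puts i into the rectangle, and T >= 1 / be makes a bound 1 / T on its sides at most
   [be]. *)
pose T := Num.max 1 be^-1; have T1 : 1 <= T by rewrite le_max lexx.
have Tb : be^-1 <= T by rewrite le_max lexx orbT.
clearbody T.
have T0 : 0 < T by exact: lt_le_trans T1.
have e2 : 0 < eps ^+ 2 by rewrite exprn_gt0.
pose P := Q + (Q + T); have P0 : 0 <= P by rewrite /P !addr_ge0 // ltW.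
(* On the lower side 8 P lets q - re lam be absorbed, and 8 T makes the resolvent at most 1 / T. *)
have [k [k0 kX sk]] := large_frequency ((8 * P + 8 * T) / eps ^+ 2).
have {}kX : 8 * P + 8 * T <= eps ^+ 2 * k by move: kX; rewrite ler_pdivrMr // [k * _]mulrC.
pose a := - (Q + T); pose b := Q + T; pose c := - (eps ^+ 2 * k ^+ 2).
have b0 : 0 <= b by rewrite /b addr_ge0 // ltW.
have a0 : a <= 0 by rewrite oppr_le0.
have c0 : c <= 0 by rewrite oppr_le0 mulr_ge0 ?sqr_ge0.
have ab : a <= b by exact: le_trans b0.
have cT : c <= T by apply: le_trans (ltW T0).
pose D := b + (T - c + 1).
have [n Hn] := finite_near D; exists n => w w1 w2 dw pw.
have ln lam : rect a b c T lam -> forall j, lam = l j -> (j < n)%N.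
  move=> [/andP[r1 r2] /andP[i1 i2]] j E; apply: Hn; rewrite -E.
  apply: le_trans (nc_le_reim _) _; rewrite /D reD imD reN imN re_i im_i oppr0 addr0.
  apply: lerD; first by rewrite ler_norml; apply/andP; split; rewrite // /b -/a.
  rewrite ler_norml; apply/andP; split.
    rewrite lerBrDr (_ : - (T - c + 1) + 1 = c - T); last by ring.
    by apply: le_trans i1; rewrite gerDl oppr_le0 ltW.
  rewrite lerBlDr; apply: (le_trans i2); rewrite -!addrA lerDl.
  by rewrite addr_ge0 ?oppr_ge0 // addr_ge0.
have cw := dom_c0 dw; have ccw := cj_ic cw.
set g := Lp 'i%C w w2; have hg : ic g by exact: (Lop_ic eps qfc 'i%C dw).
have pg : bperp v n g by exact: (bperp_Lop 'i%C dw pw).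
have sol_ex lam : exists u : (R -> R[i]) * (R -> R[i]) * (R -> R[i]), rect a b c T lam ->
    [/\ dom u.1.1 u.1.2 u.2, bperp v n u.1.1 & forall x, -1 <= x <= 1 -> Lp lam u.1.1 u.2 x = g x].
  case: (pselect (rect a b c T lam)) => hr; last by exists (w, w1, w2).
  have [ex _] := resolvent_point qfc eps0 hv hn hL linj hcomplete hassoc (ln _ hr).
  by have [u [u1 [u2 Hu]]] := ex g hg pg; exists (u, u1, u2).
have [U HU] := choice sol_ex.
(* The value of this scalar function at i is [n2 w]; on the boundary it carries a factor sqrt (n2
   w), which cancels at the end. *)
pose h lam := bil (U lam).1.1 (cj w).
have G0 : 0 <= Num.sqrt (n2 g) by exact: sqrtr_ge0.
have side lam : rect a b c T lam -> [\/ re lam = a, re lam = b, im lam = c | im lam = T] ->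
    nc (h lam) <= be * Num.sqrt (n2 g) * Num.sqrt (n2 w).
  move=> hr hs; have [du pu Eu] := HU lam hr; have cu := dom_c0 du.
  have gE : n2 (Lp lam (U lam).1.1 (U lam).2) = n2 g by exact: eq_n2.
  have := cauchy_schwarz_sqrt cu ccw; rewrite n2_cj => /le_trans; apply.
  rewrite ler_wpM2r ?sqrtr_ge0 //.
  suff : T * Num.sqrt (n2 (U lam).1.1) <= Num.sqrt (n2 g).
    rewrite -ler_pdivlMl // => /le_trans; apply; rewrite ler_wpM2r //.
    by rewrite -[be]invrK lef_pV2 ?posrE ?invr_gt0.
  have sideT : Q + T <= `|re lam| -> T * Num.sqrt (n2 (U lam).1.1) <= Num.sqrt (n2 g).
    move=> hh; have := energy_side eps qfc qfE du HQ hh; rewrite gE => H.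
    exact: n2_le_of_prod.
  case: hs => E.
  - by apply: sideT; rewrite E /a normrN ler_norm.
  - by apply: sideT; rewrite E ler_norm.
  - have HP x : -1 <= x <= 1 -> `|q x - re lam| <= P.
      move=> hx; apply: le_trans (ler_normB _ _) _; apply: lerD; first exact: HQ.
      by case: hr => hr _; rewrite ler_norml.
    have P8 : 8 * P <= eps ^+ 2 * k by apply: le_trans kX; rewrite lerDl mulr_ge0 // ltW.
    have := bottom_bound qfc qfE eps0 k0 sk du E HP P8; rewrite gE => H.
    have T8 : 8 * T <= eps ^+ 2 * k by apply: le_trans kX; rewrite lerDr mulr_ge0.
    rewrite -(@ler_pM2l _ 8) //; apply: le_trans H; rewrite mulrA ler_wpM2r ?sqrtr_ge0 //.
  - have := energy_top eps qfc qfE du (_ : 0 <= im lam); rewrite E gE => /(_ (ltW T0)) H.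
    apply: n2_le_of_prod => //; apply: le_trans H; rewrite lerDr mulr_ge0 ?sqr_ge0 //.
    by apply: n2_ge0; exact: dom_c1 du.
have expd p : rect a b c T p -> exists (c0 c1 c2 : R[i]) (r E : R), 0 < r /\
    forall lam, rect a b c T lam -> nc (lam - p) < r -> exists2 e, nc e <= E &
      h lam = c0 + c1 * (lam - p) + c2 * (lam - p) ^+ 2 + (lam - p) ^+ 3 * e.
  move=> hr; have [x0 [x1 [x2 [r [E [r0 H]]]]]] := solution_expand (ln _ hr) hg ccw pg.
  exists x0, x1, x2, r, E; split=> // lam hlam lr; have [du pu Eu] := HU lam hlam.
  exact: H (ln _ hlam) lr du pu Eu.
have ri : rect a b c T 'i%C by rewrite /rect re_i im_i a0 b0 T1 (le_trans c0).
have := maxmod ab cT expd side ri.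
have [du pu Eu] := HU 'i%C ri; have cu := dom_c0 du.
have [_ [C _ HC]] := resolvent_point qfc eps0 hv hn hL linj hcomplete hassoc (ln _ ri).
have -> : h 'i%C = bil w (cj w).
  apply: eq_bil => // x hx.
  have dD := dom_addZ (-1) du dw.
  have := HC _ _ _ dD (bperp_addZ (-1) cu cw pu pw); rewrite (@n2_zero (Lp 'i%C _ _)); last first.
    by move=> y hy; rewrite Lop_addZ Eu // mulN1r subrr.
  rewrite sqrtr0 mulr0 => hz.
  have : Num.sqrt (n2 (fun x => (U 'i%C).1.1 x + -1 * w x)) == 0 by rewrite eq_le hz sqrtr_ge0.
  rewrite sqrtr_eq0 => h0.
  have h1 : n2 (fun x => (U 'i%C).1.1 x + -1 * w x) = 0.
    by apply/eqP; rewrite eq_le h0 n2_ge0 //; exact: dom_c0 dD.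
  by have := n2_eq0 (dom_c0 dD) h1 hx; rewrite mulN1r => /eqP; rewrite subr_eq0 => /eqP.
rewrite bil_cj // nc_ofr ger0_norm ?n2_ge0 // -[X in X <= _]mul1r => H.
have := n2_le_of_prod ltr01 H cw (mulr_ge0 (ltW be0) G0); by rewrite mul1r.
Qed.

(** Let r be the error of the orthogonal projection of y. Then [cj r] lies in the space on which the
    inverse of L - i is small. If (L - i) w = cj r, then n2 r = bil y (cj r) is the pairing of (L -
    i) y with w, at most [be] times the norms of (L - i) y and r. *)
Lemma density (be : R) (y y1 y2 : R -> R[i]) : 0 < be -> dom y y1 y2 ->
  exists n (c : nat -> R[i]),
  Num.sqrt (n2 (fun x => y x - comb v n c x)) <= be * Num.sqrt (n2 (Lp 'i%C y y2)).
Proof.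
move=> be0 dy; have cy := dom_c0 dy.
have [n Hn] := resolvent_small be0.
have [c Hc] := projection hv n cy; exists n, c.
set r := fun x => y x - comb v n c x in Hc *.
have ccomb : ic (comb v n c) := comb_ic hv n c.
have cr : ic r by exact: icontB.
have ccr := cj_ic cr.
have pr : bperp v n (cj r).
  move=> k kn; have cv := dom_c0 (hv k).
  rewrite (@eq_bil _ (cj r) (v k) (cj r) (cj (cj (v k)))) //; last by move=> x _; rewrite cjK.
  by rewrite bil_conj ?Hc ?conjc0 //; exact: cj_ic.
have ni k : 'i%C = l k -> (k < n)%N by move=> /esym/eqP; rewrite (negbTE (eigen_neqi k)).
have [ex _] := resolvent_point qfc eps0 hv hn hL linj hcomplete hassoc ni.
have [w [w1 [w2 [dw pw Ew]]]] := ex _ ccr pr; have cw := dom_c0 dw.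
have hg := Lop_ic eps qfc 'i%C dy.
have := Hn _ _ _ dw pw; rewrite (eq_n2 Ew) n2_cj => hw.
have E : bil r (cj r) = bil (Lp 'i%C y y2) w.
  rewrite (Lop_sym eps qfc 'i%C dy dw) (@eq_bil _ y (Lp 'i%C w w2) y (cj r)) //.
  rewrite [LHS]bilBl // /comb bil_sum //; last by move=> k _; exact: dom_c0 (hv k).
  rewrite big1 ?subr0 // => k _.
  by rewrite bilC pr ?mulr0.
have := cauchy_schwarz_sqrt hg cw; rewrite -E bil_cj // nc_ofr ger0_norm ?n2_ge0 // => CS.
have G0 : 0 <= Num.sqrt (n2 (Lp 'i%C y y2)) by exact: sqrtr_ge0.
rewrite -[leLHS]mul1r; apply: n2_le_of_prod => //; last by rewrite mulr_ge0 // ltW.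
rewrite mul1r; apply: (le_trans CS); rewrite -mulrA mulrCA ler_wpM2l //.
Qed.
End Density.

(** * The Riesz constant *)

Section RieszResolvent.
Context {R : realType}.
Variables (q : R -> R) (qf : R -> R[i]) (eps : R).
Hypotheses (qfc : ic qf) (qfE : forall x, -1 <= x <= 1 -> qf x = ofr (q x)) (eps0 : 0 < eps).
Local Notation Lp := (Lop qf eps).
Implicit Types (lam : R[i]) (c : nat -> R[i]) (n : nat) (g w u : R -> R[i]).
Variables (v v1 v2 : nat -> R -> R[i]) (l : nat -> R[i]).
Hypotheses (hv : forall k, dom (v k) (v1 k) (v2 k)) (hn : forall k, n2 (v k) = 1)
  (hL : forall k x, -1 <= x <= 1 -> Lp (l k) (v k) (v2 k) x = 0) (linj : injective l).
Hypothesis hcomplete : forall lam w w1 w2, dom w w1 w2 ->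
  (forall x, -1 <= x <= 1 -> Lp lam w w2 x = 0) ->
  (exists2 x, -1 <= x <= 1 & w x != 0) -> exists k, lam = l k.
Hypothesis hassoc : forall lam z z1 z2 w w1 w2, dom z z1 z2 -> dom w w1 w2 ->
  (forall x, -1 <= x <= 1 -> Lp lam z z2 x = 0) ->
  (forall x, -1 <= x <= 1 -> Lp lam w w2 x = z x) -> forall x, -1 <= x <= 1 -> z x = 0.
Variable (Q : R).
Hypothesis HQ : forall x, -1 <= x <= 1 -> `|q x| <= Q.

(** By symmetry, w pairs with a finite combination as g = (L - lam) w does with the combination
    whose coefficients are divided by l k - lam. The two Riesz inequalities bound the norm of the
    latter by N1 N2 / d times that of the former, and density extends the estimate to the pairing of
    w with its own conjugate. *)
Lemma riesz_resolvent (N1 N2 d : R) lam : 0 <= N1 -> 0 <= N2 -> 0 < d ->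
  (forall n c, n2 (comb v n c) <= N1 * \sum_(k < n) nc (c k) ^+ 2) ->
  (forall n c, \sum_(k < n) nc (c k) ^+ 2 <= N2 ^+ 2 * N1 * n2 (comb v n c)) ->
  (forall k, d <= nc (l k - lam)) ->
  forall w w1 w2, dom w w1 w2 ->
    Num.sqrt (n2 w) <= N1 * N2 / d * Num.sqrt (n2 (Lp lam w w2)).
Proof.
move=> N10 N20 d0 HA HB Hd w w1 w2 dw; have cw := dom_c0 dw; have ccw := cj_ic cw.
have hg := Lop_ic eps qfc lam dw; set g := Lp lam w w2 in hg *.
have icc n c := comb_ic hv n c.
have C0 : 0 <= N1 * N2 / d by rewrite divr_ge0 ?mulr_ge0 // ltW.
have G0 : 0 <= Num.sqrt (n2 g) by exact: sqrtr_ge0.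
have dual n c : nc (bil w (comb v n c)) <= N1 * N2 / d * Num.sqrt (n2 g) * Num.sqrt (n2 (comb v n c)).
  pose c' k := c k / (l k - lam).
  have ln k : l k - lam != 0 by rewrite -nc_gt0; exact: lt_le_trans (Hd k).
  have -> : bil w (comb v n c) = bil g (comb v n c').
    rewrite bilC [RHS]bilC /comb !bil_sum //; try by move=> k _; exact: dom_c0 (hv k).
    apply: eq_bigr => k _; have cv := dom_c0 (hv k).
    have E : bil (v k) g = (l k - lam) * bil (v k) w.
      rewrite bilC (Lop_sym eps qfc lam dw (hv k)) (@eq_bil _ w _ w (fun x => (l k - lam) * v k x)) //.
        by rewrite bilZr // bilC.
      by move=> x hx; rewrite (Lop_eigen hL).
    by rewrite E /c' mulrA divfK.
  apply: le_trans (cauchy_schwarz_sqrt hg (icc n c')) _.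
  rewrite mulrC mulrAC ler_wpM2r //.
  have S0 : 0 <= n2 (comb v n c) by exact: n2_ge0.
  have -> : N1 * N2 / d * Num.sqrt (n2 (comb v n c)) =
      Num.sqrt (N1 * (d ^- 2 * (N2 ^+ 2 * N1 * n2 (comb v n c)))).
    have -> : N1 * (d ^- 2 * (N2 ^+ 2 * N1 * n2 (comb v n c))) = (N1 * N2 / d) ^+ 2 * n2 (comb v n c).
      by field; rewrite gt_eqF.
    by rewrite sqrtrM ?sqr_ge0 // sqrtr_sqr ger0_norm.
  apply: ler_wsqrtr; apply: le_trans (HA n c') _; rewrite ler_wpM2l //.
  apply: (@le_trans _ _ (d ^- 2 * \sum_(k < n) nc (c k) ^+ 2)); last first.
    by rewrite ler_wpM2l ?HB // invr_ge0 sqr_ge0.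
  rewrite mulr_sumr; apply: ler_sum => k _; rewrite /c' ncM ncV exprMn mulrC.
  rewrite ler_wpM2r ?sqr_ge0 // exprVn lef_pV2 ?posrE ?exprn_gt0 ?nc_gt0 //.
  by rewrite ler_pXn2r ?nnegrE ?nc_ge0 ?(ltW d0) ?Hd.
have dcw := dom_cj dw.
pose X := Num.sqrt (n2 (Lp 'i%C (cj w) (cj w2))).
pose W := Num.sqrt (n2 w); pose K := N1 * N2 / d * Num.sqrt (n2 g).
have K0 : 0 <= K by rewrite mulr_ge0.
have W0 : 0 <= W by exact: sqrtr_ge0.
have X0 : 0 <= X by exact: sqrtr_ge0.
(* [X] is a fixed number for the given w, and [be] tends to 0 at the end. *)
have est be : 0 < be -> n2 w <= K * W + be * (X * (W + K)).
  move=> be0; have [n [c Hc]] := density qfc qfE eps0 hv hn hL linj hcomplete hassoc HQ be0 dcw.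
  rewrite -/X in Hc; set r := fun x => _ in Hc.
  have cr : ic r by exact: icontB ccw (icc n c).
  have E : bil w (cj w) = bil w r + bil w (comb v n c).
    by rewrite -[LHS](subrK (bil w (comb v n c))) -bilBr.
  have := ler_norm (n2 w); rewrite -nc_ofr -bil_cj // E => H.
  apply: le_trans H _; apply: le_trans (ncD _ _) _.
  have h1 : nc (bil w r) <= W * (be * X).
    by apply: le_trans (cauchy_schwarz_sqrt cw cr) _; rewrite ler_wpM2l.
  have h2 : Num.sqrt (n2 (comb v n c)) <= W + be * X.
    have h := n2_triangle ccw (icontZ (-1) cr).
    rewrite n2_cj n2_scale // ncN nc1 expr1n mul1r in h.
    rewrite (@eq_n2 _ _ (fun x => cj w x + -1 * r x)).
      by apply: le_trans h _; rewrite lerD2l.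
    by move=> x _; rewrite /r; ring.
  have h3 := le_trans (dual n c) (ler_wpM2l K0 h2).
  apply: le_trans (lerD h1 h3) _; rewrite le_eqVlt; apply/orP; left; apply/eqP; ring.
have : n2 w <= K * W.
  apply/ler_addgt0Pr => e e0.
  have Y0 : 0 < X * (W + K) + 1 by rewrite ltr_wpDl // mulr_ge0 // addr_ge0.
  apply: le_trans (est (e / (X * (W + K) + 1)) _) _; first by rewrite divr_gt0.
  by rewrite lerD2l mulrAC ler_pdivrMr // ler_pM2l // lerDl.
move=> h; rewrite -[leLHS]mul1r; apply: n2_le_of_prod => //; by rewrite mul1r.
Qed.

(* Eigenvalues close to a given one of N + 1 equally spaced points would be
   distinct, and there are only O(1 / eps^2) of them in a bounded set. *)
Lemma resolvent_gap (a D : R) : 0 < D -> (forall t : R, 0 <= t <= 1 ->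
     nc (Complex a (- (1 + t)) - 'i%C) + 1 <= D) ->
  exists2 t : R, 0 <= t <= 1 & forall k, (2 * (4 * D ^+ 2 / eps ^+ 2 + 2))^-1 <= nc (l k - Complex a (- (1 + t))).
Proof.
move=> D0 HD.
(* X terms of size D^-2 exhaust the bound 4 / eps^2 of [count_le], and N exceeds X. *)
pose X := 4 * D ^+ 2 / eps ^+ 2; pose N := (Num.Def.trunc X).+1.
have X0 : 0 <= X by apply: divr_ge0; [apply: mulr_ge0 => //|]; exact: sqr_ge0.
have XN : X < N%:R by exact: truncnS_gt.
have NX : N%:R <= X + 1 by rewrite /N -natr1 lerD2r truncn_le.
pose t (m : nat) : R := m%:R / N.+1%:R.
have N0 : 0 < N.+1%:R :> R by rewrite ltr0n.
have t01 m : (m < N.+1)%N -> 0 <= t m <= 1.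
  by move=> mN; rewrite /t divr_ge0 //= ler_pdivrMr // mul1r ler_nat ltnW.
(* Half the spacing of the points, so that one eigenvalue cannot be closer than [del] to two of
   them. *)
pose del : R := (2 * N.+1%:R)^-1.
have del0 : 0 < del by rewrite invr_gt0 mulr_gt0.
have delX : (2 * (X + 2))^-1 <= del.
  rewrite lef_pV2 ?posrE ?mulr_gt0 ?ltr_wpDl // ler_pM2l //.
  by rewrite -natr1 (_ : X + 2 = X + 1 + 1) ?lerD2r //; ring.
apply: contrapT => H.
have {}H (m : 'I_N.+1) : exists k, nc (l k - Complex a (- (1 + t m))) < del.
  apply: contrapT => H1; apply: H; exists (t m); first exact: t01.
  by move=> k; rewrite leNgt; apply/negP => h; apply: H1; exists k; apply: lt_le_trans h delX.
have [j Hj] := choice H.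
have jinj : injective j.
  move=> m m' E; apply/val_inj/eqP; apply: contrapT => /negP mm.
  have h1 := Hj m; have h2 := Hj m'; rewrite -E in h2.
  have : nc (Complex a (- (1 + t m)) - Complex a (- (1 + t m'))) < del + del.
    apply: le_lt_trans (nc_tri _ (l (j m)) _) _; rewrite ncBC; exact: ltrD.
  apply/negP; rewrite -leNgt.
  apply: (@le_trans _ _ `|t m - t m'|).
    rewrite /t -mulrBl normrM [`|_^-1|]gtr0_norm ?invr_gt0 //.
    have -> : del + del = N.+1%:R^-1 by rewrite /del; move: (N.+1%:R : R) (lt0r_neq0 N0) => y y0; field.
    rewrite ler_peMl ?invr_ge0 ?(ltW N0) //.
    rewrite /val /= in mm; case: (ltngtP m m') mm => // mm _.
      by rewrite distrC -natrB ?(ltnW mm) // ger0_norm // ler1n subn_gt0.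
    by rewrite -natrB ?(ltnW mm) // ger0_norm // ler1n subn_gt0.
  apply: le_trans (im_le_nc _); rewrite imD imN !imC.
  move: (t m) (t m') => x y; have -> : - (1 + x) - - (1 + y) = y - x by ring.
  by rewrite distrC.
pose J := (\max_(m < N.+1) j m).+1.
have jJ m : (j m < J)%N by rewrite ltnS; exact: leq_bigmax.
pose F (k : nat) : R := (nc (l k - 'i%C) ^- 1) ^+ 2.
have low m : D ^- 2 <= F (j m).
  have nj : 0 < nc (l (j m) - 'i%C) by rewrite nc_gt0 subr_eq0 (eigen_neqi qfc qfE hv hn hL).
  rewrite /F expr1 exprVn lef_pV2 ?posrE ?exprn_gt0 // ler_pXn2r ?nnegrE ?nc_ge0 ?(ltW D0) //.
  apply: le_trans (nc_tri _ (Complex a (- (1 + t m))) _) _; rewrite addrC.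
  apply: le_trans (HD (t m) (t01 _ (ltn_ord m))); rewrite lerD2l.
  apply: (le_trans (ltW (Hj m))); rewrite /del invf_le1 ?mulr_gt0 //.
  by rewrite -natrM ler1n.
have : \sum_(m < N.+1) F (j m) <= \sum_(k < J) F k.
  pose jj m := Ordinal (jJ m).
  have jji : injective jj by move=> x y /(congr1 val) /= /jinj.
  rewrite (_ : \sum_(m < N.+1) F (j m) = \sum_(k in [set jj m | m in 'I_N.+1]%SET) F k); last first.
    by rewrite big_imset //= => x y _ _; exact: jji.
  rewrite [leRHS](bigID (fun k => k \in [set jj m | m in 'I_N.+1]%SET)) /= lerDl.
  by apply: sumr_ge0 => k _; rewrite sqr_ge0.
apply/negP; rewrite -ltNge.
have CL : \sum_(k < J) F k <= 4 / eps ^+ 2 := count_le qfc qfE eps0 hv hn hL linj J.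
apply: (le_lt_trans CL).
apply: lt_le_trans (_ : N.+1%:R * D ^- 2 <= _); last first.
  rewrite -[N.+1 in leLHS]card_ord -sum1_card natr_sum mulr_suml.
  by apply: ler_sum => m _; rewrite mul1r.
rewrite ltr_pdivlMr ?exprn_gt0 //.
have -> : 4 / eps ^+ 2 * D ^+ 2 = X by rewrite /X mulrAC.
by apply: lt_trans XN _; rewrite ltr_nat.
Qed.
End RieszResolvent.

(** * Square-summable sequences *)

Section SquareSummable.
Context {R : realType}.
Implicit Types (c d : nat -> R[i]) (n m : nat).

Let ns c := series (fun k => normsq (c k)).

Lemma normsq_ge0 (x : R[i]) : 0 <= normsq x.
Proof. by rewrite normsq_nc sqr_ge0. Qed.

Lemma seriesE (a : nat -> R) n : series a n = \sum_(k < n) a k.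
Proof. by rewrite /series /= big_mkord. Qed.

Lemma normsq_nondecreasing c : nondecreasing_seq (ns c).
Proof. by apply/nondecreasing_series => k _ _; exact: normsq_ge0. Qed.

Lemma l2_bounded c (M : R) : (forall n, \sum_(k < n) nc (c k) ^+ 2 <= M) ->
  in_l2 c /\ l2norm c <= Num.sqrt M.
Proof.
move=> HM.
have hM n : ns c n <= M.
  rewrite /ns seriesE (eq_bigr (fun k : 'I_n => nc (c k) ^+ 2)); first exact: HM.
  by move=> k _; rewrite normsq_nc.
have cv : cvgn (ns c).
  apply: nondecreasing_is_cvgn; first exact: normsq_nondecreasing.
  by exists M => _ [n _ <-].
split=> //; rewrite /l2norm ler_wsqrtr //; apply: limr_le => //.
by near=> n; exact: hM.
Unshelve. all: by end_near.
Qed.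

Lemma l2_partial c n : in_l2 c -> \sum_(k < n) nc (c k) ^+ 2 <= l2norm c ^+ 2.
Proof.
move=> hc; have h := nondecreasing_cvgn_le (normsq_nondecreasing c) hc n.
have E : \sum_(k < n) nc (c k) ^+ 2 = ns c n.
  by rewrite /ns seriesE; apply: eq_bigr => k _; rewrite normsq_nc.
rewrite E /l2norm sqr_sqrtr //; apply: le_trans h.
by rewrite -E; apply: sumr_ge0 => k _; rewrite sqr_ge0.
Qed.

Lemma l2norm_ge0 c : 0 <= l2norm c. Proof. exact: sqrtr_ge0. Qed.

Lemma l2_scale (s : R) d : 0 <= s -> in_l2 d ->
  in_l2 (fun k => ofr s * d k) /\ l2norm (fun k => ofr s * d k) <= s * l2norm d.
Proof.
move=> s0 hd; have [|h1 h2] := @l2_bounded (fun k => ofr s * d k) ((s * l2norm d) ^+ 2).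
  move=> n; rewrite exprMn; apply: le_trans (ler_wpM2l (sqr_ge0 s) (l2_partial n hd)).
  rewrite mulr_sumr ler_sum // => k _.
  by rewrite ncM nc_ofr exprMn real_normK ?num_real.
by split=> //; rewrite sqrtr_sqr ger0_norm // in h2; rewrite mulr_ge0 // l2norm_ge0.
Qed.

(** On finite sequences the Gram series is eventually constant; the Riesz inequalities are obtained
    from such sequences alone. *)
Definition cut n c k : R[i] := if (k < n)%N then c k else 0.

Lemma sum_cut n c m : \sum_(k < m) nc (cut n c k) ^+ 2 <= \sum_(k < n) nc (c k) ^+ 2.
Proof.
pose F k := nc (cut n c k) ^+ 2.
have F0 k : 0 <= F k by exact: sqr_ge0.
have -> : \sum_(k < n) nc (c k) ^+ 2 = \sum_(k < n) F k.
  by apply: eq_bigr => k _; rewrite /F /cut ltn_ord.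
have Fn k : F (n + k)%N = 0 by rewrite /F /cut (_ : (n + k < n)%N = false) ?nc0 ?expr0n // ltnNge leq_addr.
have mono a b : (a <= b)%N -> \sum_(k < a) F k <= \sum_(k < b) F k.
  by move=> ab; rewrite -(subnKC ab) big_split_ord /= lerDl sumr_ge0.
apply: (le_trans (mono _ _ (leq_addl n m))).
by rewrite big_split_ord /= [X in _ + X]big1 ?addr0 // => k _; exact: Fn.
Qed.

Lemma opnorm_ge (V W : Type) (nV : V -> R) (nW : W -> R) A v w :
  A v w -> nV v <= 1 -> ((nW w)%:E <= opnorm nV nW A)%E.
Proof. by move=> h1 h2; apply: ereal_sup_ubound; exists v, w. Qed.
End SquareSummable.

(** * Riesz inequalities from the norms of the Gram operator *)

Section Gram.
Context {R : realType}.
Variables (q : R -> R) (qf : R -> R[i]) (eps : R).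
Hypotheses (qfc : ic qf) (qfE : forall x, -1 <= x <= 1 -> qf x = ofr (q x)) (eps0 : 0 < eps).
Local Notation Lp := (Lop qf eps).
Implicit Types (lam : R[i]) (c d : nat -> R[i]) (n : nat) (g w u : R -> R[i]).
Variables (z v v1 v2 : nat -> R -> R[i]) (l : nat -> R[i]).
Hypotheses (hv : forall k, dom (v k) (v1 k) (v2 k)) (hn : forall k, n2 (v k) = 1)
  (hL : forall k x, -1 <= x <= 1 -> Lp (l k) (v k) (v2 k) x = 0) (linj : injective l)
  (hz : forall k x, -1 <= x <= 1 -> z k x = v k x).

Definition conjs c k : R[i] := (c k)^*%C.
(* the image under the Gram matrix of the sequence c cut at n *)
Definition gram n c k : R[i] := bil (v k) (cj (comb v n (conjs c))).

Let cv k : ic (v k). Proof. exact: dom_c0 (hv k). Qed.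
Let cc n c : ic (comb v n c). Proof. exact: comb_ic hv n c. Qed.

Lemma gramE n c k : gram n c k = \sum_(j < n) L2dot (z k) (z j) * c j.
Proof.
rewrite /gram bilC (@eq_bil _ _ (v k) (fun x => \sum_(j < n) c j * cj (v j) x) (v k)) //; last first.
  move=> x _; rewrite /cj /comb rmorph_sum; apply: eq_bigr => j _.
  by rewrite rmorphM /conjs /= conjcK.
rewrite (@bil_sum _ n (fun j => cj (v j))) //; last by move=> j _; exact: cj_ic.
apply: eq_bigr => j _; rewrite mulrC bilC; congr (_ * _).
by apply: eq_cI => x hx; rewrite /cj !hz.
Qed.

(** Membership in [gram_graph] requires a square-summable image. By symmetry l k - i times the k-th
    entry is the pairing of [v k] with a fixed function and hence bounded in k, and the numbers 1 /
    (l k - i) are square-summable by [count_le]. *)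
Lemma gram_l2 n c : in_l2 (gram n c).
Proof.
have du := dom_cj (comb_dom hv n (conjs c)).
set u := cj (comb _ _ _) in du; set u2 := cj (comb2 _ _ _) in du.
have hg := Lop_ic eps qfc 'i%C du.
apply: (proj1 (@l2_bounded _ _ (n2 (Lp 'i%C u u2) * (4 / eps ^+ 2)) _)) => m.
apply: le_trans (ler_wpM2l (n2_ge0 hg) (count_le qfc qfE eps0 hv hn hL linj m)).
rewrite mulr_sumr; apply: ler_sum => k _; rewrite expr1 exprVn.
have nk : 0 < nc (l k - 'i%C) by rewrite nc_gt0 subr_eq0 (eigen_neqi qfc qfE hv hn hL).
rewrite ler_pdivlMr ?exprn_gt0 // -exprMn -ncM mulrC.
have -> : (l k - 'i%C) * gram n c k = bil (v k) (Lp 'i%C u u2).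
  rewrite -(Lop_sym eps qfc 'i%C (hv k) du) (@eq_bil _ _ u (fun x => (l k - 'i%C) * v k x) u) //.
    by rewrite bilZl //; exact: dom_c0 du.
  by move=> x hx; rewrite (Lop_eigen hL).
by have := cauchy_schwarz (cv k) hg; rewrite hn mul1r.
Qed.

Arguments gram_l2 : clear implicits.

Lemma gram_graph_cut n c : gram_graph z (cut n c) (gram n c).
Proof.
split; last 1 first.
- move=> k; rewrite gramE.
  apply: cvg_near_cst => //.
  exists n => // m /= nm; rewrite /series /= big_mkord -(subnKC nm) big_split_ord /=.
  rewrite [X in _ + X]big1 ?addr0; last by move=> j _; rewrite /cut ltnNge leq_addr /= mulr0.
  by apply: eq_bigr => j _; rewrite /cut ltn_ord.
- by apply: (proj1 (@l2_bounded _ _ (\sum_(k < n) nc (c k) ^+ 2) _)) => m; exact: sum_cut.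
- exact: gram_l2.
Qed.

Lemma gram_scale (s : R) n c k : gram n (fun k => ofr s * c k) k = ofr s * gram n c k.
Proof.
rewrite !gramE mulr_sumr; apply: eq_bigr => j _; by rewrite mulrCA.
Qed.

Local Notation N1 := (opnorm l2norm l2norm (gram_graph z)).
Local Notation N2 := (opnorm l2norm l2norm (fun d c => gram_graph z c d)).

Lemma gram_graph_scale (s : R) n c : 0 <= s ->
  gram_graph z (cut n (fun k => ofr s * c k)) (fun k => ofr s * gram n c k).
Proof.
move=> s0; have := gram_graph_cut n (fun k => ofr s * c k).
by rewrite (_ : gram n _ = fun k => ofr s * gram n c k) //; apply/funext => k; exact: gram_scale.
Qed.

Lemma l2norm_cut n c : l2norm (cut n c) = Num.sqrt (\sum_(k < n) nc (c k) ^+ 2).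
Proof.
have [h1 h2] := @l2_bounded _ (cut n c) _ (sum_cut n c).
apply/le_anti; rewrite h2 /=.
rewrite -[leRHS]ger0_norm ?l2norm_ge0 // -sqrtr_sqr ler_wsqrtr //.
apply: le_trans (l2_partial n h1); rewrite le_eqVlt; apply/orP; left; apply/eqP.
by apply: eq_bigr => k _; rewrite /cut ltn_ord.
Qed.

Section Finite.
Variables (M1 M2 : R).
Hypotheses (HM1 : N1 = M1%:E) (HM2 : N2 = M2%:E).

Lemma gram_le n c : l2norm (gram n c) <= M1 * l2norm (cut n c).
Proof.
have M10 : 0 <= M1.
  have [h1 h2] := l2_scale (lexx 0) (gram_l2 n c).
  have := @opnorm_ge R _ _ l2norm l2norm (gram_graph z) _ _ (gram_graph_scale n c (lexx 0)).
  rewrite HM1 lee_fin => H; apply: le_trans (H _); first exact: l2norm_ge0.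
  rewrite l2norm_cut big1 ?sqrtr0 // => k _.
  by rewrite rmorph0 mul0r nc0 expr0n.
apply/ler_addgt0Pr => e e0.
set S := l2norm (cut n c); have S0 : 0 <= S by exact: l2norm_ge0.
have [h1 h2] := @l2_bounded _ (gram n c) (l2norm (gram n c) ^+ 2) (fun m => l2_partial m (gram_l2 n c)).
(* Scaling by 1 / t brings the sequence into the unit ball; the second summand keeps t positive when
   S is 0 and costs less than [e]. *)
pose t := S + e / (M1 + 1).
have M11 : 0 < M1 + 1 by rewrite ltr_wpDl.
have t0 : 0 < t by rewrite /t ltr_wpDl // divr_gt0.
have s0 : 0 <= t^-1 by rewrite invr_ge0 ltW.
have G := gram_graph_scale n c s0.
have := @opnorm_ge R _ _ l2norm l2norm (gram_graph z) _ _ G; rewrite HM1 lee_fin.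
have -> : l2norm (cut n (fun k => ofr t^-1 * c k)) = t^-1 * S.
  rewrite /S !l2norm_cut (eq_bigr (fun k : 'I_n => t^-1 ^+ 2 * nc (c k) ^+ 2)); last first.
    by move=> k _; rewrite ncM nc_ofr exprMn real_normK ?num_real.
  by rewrite -mulr_sumr sqrtrM ?sqr_ge0 // sqrtr_sqr ger0_norm.
have tS : t^-1 * S <= 1 by rewrite ler_pdivrMl // mulr1 lerDl divr_ge0 // ltW.
move=> /(_ tS) H.
have [g1 _] := l2_scale s0 (gram_l2 n c).
have E : l2norm (gram n c) <= t * l2norm (fun k => ofr t^-1 * gram n c k).
  have [_ k2] := l2_scale (ltW t0) g1.
  apply: le_trans k2; rewrite (_ : (fun k => _) = gram n c) //.
  by apply/funext => k; rewrite mulrA -rmorphM divff ?gt_eqF // rmorph1 mul1r.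
apply: le_trans E _; apply: le_trans (ler_wpM2l (ltW t0) H) _.
rewrite /t mulrDl mulrC lerD2l mulrAC ler_pdivrMr // ler_pM2l // lerDl //.
Qed.

Lemma gram_ge n c : l2norm (cut n c) <= M2 * l2norm (gram n c).
Proof.
have M20 : 0 <= M2.
  have [h1 h2] := l2_scale (lexx 0) (gram_l2 n c).
  have := @opnorm_ge R _ _ l2norm l2norm (fun d c => gram_graph z c d) _ _ (gram_graph_scale n c (lexx 0)).
  rewrite HM2 lee_fin => H; apply: le_trans (H _); first exact: l2norm_ge0.
  by rewrite mul0r in h2; apply: le_trans h2 _.
apply/ler_addgt0Pr => e e0.
set S := l2norm (gram n c); have S0 : 0 <= S by exact: l2norm_ge0.
pose t := S + e / (M2 + 1).
have M21 : 0 < M2 + 1 by rewrite ltr_wpDl.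
have t0 : 0 < t by rewrite /t ltr_wpDl // divr_gt0.
have s0 : 0 <= t^-1 by rewrite invr_ge0 ltW.
have := @opnorm_ge R _ _ l2norm l2norm (fun d c => gram_graph z c d) _ _ (gram_graph_scale n c s0).
rewrite HM2 lee_fin.
have -> : l2norm (cut n (fun k => ofr t^-1 * c k)) = t^-1 * l2norm (cut n c).
  rewrite !l2norm_cut (eq_bigr (fun k : 'I_n => t^-1 ^+ 2 * nc (c k) ^+ 2)); last first.
    by move=> k _; rewrite ncM nc_ofr exprMn real_normK ?num_real.
  by rewrite -mulr_sumr sqrtrM ?sqr_ge0 // sqrtr_sqr ger0_norm.
have [_ g2] := l2_scale s0 (gram_l2 n c).
have tS : t^-1 * S <= 1 by rewrite ler_pdivrMl // mulr1 lerDl divr_ge0 // ltW.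
move=> /(_ (le_trans g2 tS)); rewrite ler_pdivrMl // => H.
apply: le_trans H _.
rewrite /t mulrDl mulrC lerD2l mulrAC ler_pdivrMr // ler_pM2l // lerDl //.
Qed.

Lemma conjsK c : conjs (conjs c) = c.
Proof. by apply/funext => k; rewrite /conjs conjcK. Qed.

(** The squared norm of the combination pairs c with the image, of norm at most M1 times that of c,
    of its conjugate under the Gram operator; Young's inequality with weight M1 splits the
    products. *)
Lemma riesz_upper n c : 0 < M1 -> n2 (comb v n c) <= M1 * \sum_(k < n) nc (c k) ^+ 2.
Proof.
move=> M10; pose c' := conjs c; pose d := gram n c'.
set S := \sum_(k < n) _; have S0 : 0 <= S by apply: sumr_ge0 => k _; exact: sqr_ge0.
have SE : \sum_(k < n) nc (c' k) ^+ 2 = S by apply: eq_bigr => k _; rewrite nc_conj.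
have Hd : \sum_(k < n) nc (d k) ^+ 2 <= M1 ^+ 2 * S.
  apply: le_trans (l2_partial n (gram_l2 n c')) _.
  have := gram_le n c'; rewrite l2norm_cut SE => h.
  rewrite -[S]sqr_sqrtr // -exprMn ler_pXn2r ?nnegrE ?l2norm_ge0 //.
  by rewrite mulr_ge0 ?sqrtr_ge0 // ltW.
have E : bil (comb v n c) (cj (comb v n c)) = \sum_(k < n) c k * d k.
  rewrite {1}/comb bil_sum //; last exact: cj_ic.
  by apply: eq_bigr => k _; rewrite /d /gram conjsK.
rewrite -[leLHS]ger0_norm ?n2_ge0 // -nc_ofr -bil_cj // E.
have tri m (F : nat -> R[i]) : nc (\sum_(k < m) F k) <= \sum_(k < m) nc (F k).
  elim: m => [|m IH]; first by rewrite !big_ord0 nc0.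
  by rewrite !big_ord_recr /=; apply: le_trans (ncD _ _) _; rewrite lerD2r.
apply: le_trans (tri n (fun k => c k * d k)) _.
apply: (@le_trans _ _ (\sum_(k < n) (M1 / 2 * nc (c k) ^+ 2 + (2 * M1)^-1 * nc (d k) ^+ 2))).
  apply: ler_sum => k _; rewrite ncM; move: (nc (c k)) (nc (d k)) => x y.
  rewrite -subr_ge0 (_ : _ - _ = (2 * M1)^-1 * (M1 * x - y) ^+ 2).
    by rewrite mulr_ge0 ?sqr_ge0 // invr_ge0 mulr_ge0 // ltW.
  by field; rewrite gt_eqF.
rewrite big_split /= -!mulr_sumr -/S.
have -> : M1 * S = M1 / 2 * S + (2 * M1)^-1 * (M1 ^+ 2 * S) by field; rewrite gt_eqF.
by rewrite lerD2l ler_wpM2l // invr_ge0 mulr_ge0 // ltW.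
Qed.

(** By duality the upper bound is a Bessel inequality: the pairings [d k] of the v k with the
    conjugate of u satisfy sum |d k|^2 <= M1 n2 u. As [d] is a Gram image, the inverse recovers the
    coefficients at the cost of a factor M2^2. *)
Lemma riesz_lower n c : 0 < M1 -> 0 <= M2 ->
  \sum_(k < n) nc (c k) ^+ 2 <= M2 ^+ 2 * M1 * n2 (comb v n c).
Proof.
move=> M10 M20; pose c' := conjs c; pose d := gram n c'; pose u := comb v n c.
have cu : ic u by exact: cc.
have u0 := n2_ge0 cu.
set S := \sum_(k < n) _; have S0 : 0 <= S by apply: sumr_ge0 => k _; exact: sqr_ge0.
have SE : \sum_(k < n) nc (c' k) ^+ 2 = S by apply: eq_bigr => k _; rewrite nc_conj.
have Hd m : \sum_(k < m) nc (d k) ^+ 2 <= M1 * n2 u.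
  set E := \sum_(k < m) _; have E0 : 0 <= E by apply: sumr_ge0 => k _; exact: sqr_ge0.
  have EE : bil (comb v m (conjs d)) (cj u) = ofr E.
    rewrite {1}/comb bil_sum //; last exact: cj_ic.
    rewrite /E rmorph_sum; apply: eq_bigr => k _.
    have -> : bil (v k) (cj u) = d k by rewrite /d /gram /c' conjsK.
    by rewrite /conjs mulrC mul_conj.
  have CS := cauchy_schwarz (cc m (conjs d)) (cj_ic cu).
  rewrite EE nc_ofr ger0_norm // n2_cj in CS.
  have U := riesz_upper m (conjs d) M10.
  have UE : \sum_(k < m) nc (conjs d k) ^+ 2 = E by apply: eq_bigr => k _; rewrite nc_conj.
  rewrite UE in U.
  have := le_trans CS (ler_wpM2r u0 U).
  have := E0; rewrite le_eqVlt => /predU1P[<- _|Ep]; first by rewrite mulr_ge0 // ltW.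
  by rewrite expr2 mulrAC [M1 * n2 u * E]mulrC ler_pM2l.
have [_ h] := l2_bounded Hd.
have := le_trans (gram_ge n c') (ler_wpM2l M20 h); rewrite l2norm_cut SE => H.
rewrite -[S]sqr_sqrtr // -mulrA -[M1 * _]sqr_sqrtr ?mulr_ge0 ?(ltW M10) // -exprMn.
by rewrite ler_pXn2r ?nnegrE ?sqrtr_ge0 ?mulr_ge0 ?sqrtr_ge0.
Qed.
End Finite.

(** The diagonal entries of the Gram matrix are 1. Together with [opnorm_inverse_gt0] this rules out
    a product of 0 and +oo, so that a bounded Riesz constant makes both norms finite. *)
Lemma opnorm_gram_ge1 : (1%:E <= N1)%E.
Proof.
pose c (k : nat) : R[i] := 1.
have E : gram 1 c 0%N = 1.
  rewrite /gram (@eq_bil _ _ _ (v 0%N) (cj (v 0%N))) ?bil_cj ?hn ?rmorph1 // => x _.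
  by rewrite /cj /comb big_ord1 /conjs /c conjc1 mul1r.
have H : l2norm (cut 1 c) <= 1.
  by rewrite l2norm_cut big_ord1 /c nc1 expr1n sqrtr1.
apply: le_trans (@opnorm_ge R _ _ l2norm l2norm (gram_graph z) _ _ (gram_graph_cut 1 c) H); rewrite lee_fin.
have := l2_partial 1 (gram_l2 1 c); rewrite big_ord1 E nc1 expr1n => h.
by rewrite -(@ler_pXn2r _ 2) ?nnegrE ?l2norm_ge0 // expr1n.
Qed.

Lemma opnorm_inverse_gt0 : (0 < N2)%E.
Proof.
pose c (k : nat) : R[i] := 1.
pose s := (l2norm (gram 1 c) + 1)^-1.
have p0 : 0 < l2norm (gram 1 c) + 1 by rewrite ltr_wpDl // l2norm_ge0.
have s0 : 0 <= s by rewrite invr_ge0 ltW.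
have [_ h] := l2_scale s0 (gram_l2 1 c).
have H : l2norm (fun k => ofr s * gram 1 c k) <= 1.
  by apply: le_trans h _; rewrite /s ler_pdivrMl // mulr1 lerDl.
apply: lt_le_trans (@opnorm_ge R _ _ l2norm l2norm (fun d c => gram_graph z c d) _ _ (gram_graph_scale 1 c s0) H).
rewrite lte_fin l2norm_cut big_ord1 /c mulr1 nc_ofr real_normK; last exact: num_real.
by rewrite sqrtr_sqr gtr0_norm ?invr_gt0.
Qed.
End Gram.

(** * The exponential lower bound for the Riesz constant *)

Lemma gap_scale (R : realType) (D eps : R) : 0 < eps <= 1 ->
  (2 * (4 * D ^+ 2 + 2))^-1 * eps ^+ 2 <= (2 * (4 * D ^+ 2 / eps ^+ 2 + 2))^-1.
Proof.
move=> /andP[e0 e1]; have e2 : 0 < eps ^+ 2 by rewrite exprn_gt0.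
have e21 : eps ^+ 2 <= 1 by rewrite expr_le1 // ltW.
have D0 : 0 <= 4 * D ^+ 2 by rewrite mulr_ge0 // sqr_ge0.
have p1 : 0 < 2 * (4 * D ^+ 2 + 2) by rewrite mulr_gt0 // ltr_wpDl.
have p2 : 0 < 2 * (4 * D ^+ 2 / eps ^+ 2 + 2).
  by rewrite mulr_gt0 // ltr_wpDl // divr_ge0 // ltW.
rewrite mulrC ler_pdivrMr // ler_pdivlMl //.
rewrite -[_ * _ * eps ^+ 2]mulrA ler_pM2l // mulrDl divfK ?gt_eqF // lerD2l.
by rewrite ler_piMr.
Qed.

(** The third power is one more than the distance to the spectrum, of order eps^2, takes away. *)
Lemma exp_cube_lb (R : realType) (x : R) : 0 <= x -> (x / 3) ^+ 3 <= expR x.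
Proof.
move=> x0; have -> : expR x = expR (x / 3) ^+ 3.
  by rewrite -expRM_natl; congr expR; field.
have h : x / 3 <= expR (x / 3) by apply: le_trans (expR_ge1Dx _); rewrite lerDr.
by rewrite ler_pXn2r ?nnegrE ?expR_ge0 // divr_ge0.
Qed.

Lemma ereal_mul_lt (R : realType) (x y : \bar R) (r : R) :
  (1%:E <= x)%E -> (0 < y)%E -> (x * y < r%:E)%E ->
  exists a b, [/\ x = a%:E, y = b%:E, 1 <= a, 0 < b & a * b < r].
Proof.
case: x => [a| |] //; last by move=> _ y0; rewrite gt0_mulye // ltNge leey.
case: y => [b| |] //; last by move=> a1 _; rewrite gt0_muley ?(lt_le_trans _ a1) ?lte_fin.
by rewrite lee_fin lte_fin -EFinM lte_fin => a1 b0 h; exists a, b.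
Qed.

(** The eigenfunctions are replaced by classical solutions equal to them on [-1, 1], and the two
    spectral hypotheses are restated for such solutions. *)
Lemma eigensystem_data (R : realType) (q : R -> R) (G : set R[i]) (f : R[i] -> R[i])
    (hq : AM_ext q G f) (eps : R) (z : nat -> R -> R[i]) : 0 < eps ->
  no_associated q eps -> normed_eigensystem q eps z ->
  exists (v v1 v2 : nat -> R -> R[i]) (l : nat -> R[i]),
  [/\ forall k, dom (v k) (v1 k) (v2 k), forall k, n2 (v k) = 1,
      forall k x, -1 <= x <= 1 -> Lop (qf f) eps (l k) (v k) (v2 k) x = 0, injective l &
      [/\ forall lam w w1 w2, dom w w1 w2 ->
            (forall x, -1 <= x <= 1 -> Lop (qf f) eps lam w w2 x = 0) ->
            (exists2 x, -1 <= x <= 1 & w x != 0) -> exists k, lam = l k,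
          forall lam z z1 z2 w w1 w2, dom z z1 z2 -> dom w w1 w2 ->
            (forall x, -1 <= x <= 1 -> Lop (qf f) eps lam z z2 x = 0) ->
            (forall x, -1 <= x <= 1 -> Lop (qf f) eps lam w w2 x = z x) ->
            forall x, -1 <= x <= 1 -> z x = 0 &
          forall k x, -1 <= x <= 1 -> z k x = v k x]].
Proof.
move=> eps0 na [l [linj hl hc]].
have hqc := qf_ic hq; have hqE := qf_q hq.
have ex k : exists p : (R -> R[i]) * (R -> R[i]) * (R -> R[i]),
   [/\ dom p.1.1 p.1.2 p.2, forall x, -1 <= x <= 1 -> z k x = p.1.1 x &
    forall x, -1 <= x <= 1 -> Lop (qf f) eps (l k) p.1.1 p.2 x = 0].
  have [v [v1 [v2 H]]] := eigen_dom hqc hqE eps0 (proj1 (hl k)).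
  by exists (v, v1, v2).
have [p Hp] := choice ex.
have shift0 lam w w1 w2 : dom w w1 w2 ->
    (forall x, -1 <= x <= 1 -> Lop (qf f) eps lam w w2 x = 0) -> op_shift q eps lam w (fun=> 0).
  move=> dw E; apply: (dom_op_shift hqE dw) => [|x hx]; last by rewrite E.
  apply: ic_L2fun; apply: icontD; first exact: icont_cst.
  by apply: icontZ; exact: dom_c0 dw.
exists (fun k => (p k).1.1), (fun k => (p k).1.2), (fun k => (p k).2), l; split=> //.
- by move=> k; case: (Hp k).
- move=> k; have [_ zE _] := Hp k; rewrite -(eq_n2 zE).
  have := (hl k).2; rewrite L2normE => h.
  have n0 : 0 <= n2 (z k).
    by rewrite (eq_n2 zE); apply: n2_ge0; case: (Hp k) => dv _ _; exact: dom_c0 dv.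
  by rewrite -[LHS]sqr_sqrtr // h expr1n.
- by move=> k; case: (Hp k).
split.
- move=> lam w w1 w2 dw E [x hx wx]; apply: (hc lam w (shift0 _ _ _ _ dw E)) => h.
  by move: wx; rewrite h ?eqxx.
- move=> lam y y1 y2 w w1 w2 dy dw Ey Ew; apply: (na lam y w (shift0 _ _ _ _ dy Ey)).
  apply: (dom_op_shift hqE dw) => [|x hx]; last by rewrite Ew.
  by apply: ic_L2fun; apply: icontD; [exact: dom_c0 dy|apply: icontZ; exact: dom_c0 dw].
- by move=> k; case: (Hp k).
Qed.

Lemma riesz_exponential (R : realType) (q : R -> R) (G : set R[i]) (f : R[i] -> R[i]) :
  AM_ext q G f -> exists eta eps1 : R, [/\ 0 < eta, 0 < eps1 &
  forall (eps : R) (z : nat -> R -> R[i]), 0 < eps < eps1 ->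
    no_associated q eps -> normed_eigensystem q eps z ->
    ((expR (eta / eps))%:E <= riesz_constant z)%E].
Proof.
move=> hq; have hqc := qf_ic hq; have hqE := qf_q hq; have ab := AM_nondegenerate hq.
(* The points tried are m - i (1 + t) with 0 <= t <= 1, in the middle of the semistrip; d <= 1 keeps
   them at the depth [d] that the quasi-modes require. *)
pose m := (q (-1) + q 1) / 2.
pose d := Num.min ((q 1 - q (-1)) / 2) 1.
have d0 : 0 < d by rewrite lt_min ltr01 divr_gt0 ?subr_gt0.
have d1 : d <= 1 by rewrite ge_min lexx orbT.
have dm : d <= (q 1 - q (-1)) / 2 by rewrite ge_min lexx.
have [tau [e0 [tau0 e00 Hq]]] := quasimode hq (`|m| + 2) d0.
(* The points tried are at most |m| + 3 away from i, and [resolvent_gap] asks for one more. *)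
pose D := `|m| + 4; have D0 : 0 < D by rewrite ltr_wpDl.
pose ka := (2 * (4 * D ^+ 2 + 2))^-1.
have ka0 : 0 < ka by rewrite invr_gt0 mulr_gt0 // ltr_wpDl // mulr_ge0 // sqr_ge0.
(* exp (2 tau / eps) is the fourth power of E = exp (eta / eps). The quasi-mode against the upper
   bound of the resolvent gives gap E^2 <= M1 M2 < E, hence gap E < 1, which the cubic lower bound
   of E refutes for small eps. *)
pose eta := tau / 2; have eta0 : 0 < eta by rewrite divr_gt0.
have k0 : 0 < ka * (eta / 3) ^+ 3 by rewrite mulr_gt0 // exprn_gt0 // divr_gt0.
exists eta, (Num.min e0 (Num.min 1 (ka * (eta / 3) ^+ 3))); split=> //.
  by rewrite !lt_min e00 ltr01.
move=> eps z; rewrite !lt_min => /andP[eps0 /and3P[ee0 e1 ek]] na ze.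
have [v [v1 [v2 [l [hv hn hL linj [hcomp hass hz]]]]]] := eigensystem_data hq eps0 na ze.
rewrite leNgt; apply/negP => Hlt.
have [Q _ HQ'] := ic_bound hqc.
have HQ x : -1 <= x <= 1 -> `|q x| <= Q by move=> hx; rewrite -nc_ofr -hqE //; exact: HQ'.
have g1 := opnorm_gram_ge1 hqc hqE eps0 hv hn hL linj hz.
have g2 := opnorm_inverse_gt0 hqc hqE eps0 hv hn hL linj hz.
move: Hlt; rewrite /riesz_constant.
move=> /(ereal_mul_lt g1 g2)[M1 [M2 [E1 E2 M10 M20 MM]]].
have M1p : 0 < M1 by exact: lt_le_trans M10.
have [|t /andP[t0 t1] Ht] := @resolvent_gap _ q (qf f) eps hqc hqE eps0 v v1 v2 l hv hn hL linj m D D0.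
  move=> t /andP[t0 t1]; rewrite /D (_ : `|m| + 4 = `|m| + 3 + 1) ?lerD2r; last by ring.
  apply: le_trans (nc_le_reim _) _; rewrite reD imD reN imN reC imC re_i im_i subr0 lerD2l.
  by rewrite ler_norml; apply/andP; split; lra_on t0 t1.
set gap := _^-1 in Ht; have gapl : ka * eps ^+ 2 <= gap by apply: gap_scale; rewrite eps0 ltW.
have gap0 : 0 < gap by apply: lt_le_trans gapl; rewrite mulr_gt0 // exprn_gt0.
set lam := Complex m _ in Ht.
have l1 : q (-1) + d <= re lam <= q 1 - d.
  by rewrite /lam reC; apply/andP; split; rewrite /m; lra_on dm.
have l2 : im lam <= - d by rewrite /lam imC lerN2; lra_on t0 d1.
have l3 : nc lam <= `|m| + 2.
  apply: le_trans (nc_le_reim _) _; rewrite reC imC lerD2l normrN.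
  by rewrite ler_norml; apply/andP; split; lra_on t0 t1.
have he : 0 < eps < e0 by rewrite eps0.
have [w [w1 [w2 [dw w0 Hw]]]] := Hq lam eps l1 l2 l3 he.
have HA n c := riesz_upper hqc hqE eps0 hv hn hL linj hz E1 n c M1p.
have HB n c := riesz_lower hqc hqE eps0 hv hn hL linj hz E1 E2 n c M1p (ltW M20).
have Hr := riesz_resolvent hqc hqE eps0 hv hn hL linj hcomp hass HQ (ltW M1p) (ltW M20) gap0 HA HB Ht dw.
have cg := Lop_ic eps hqc lam dw; set g := n2 (Lop _ _ _ _ _) in Hw Hr.
have gg0 : 0 <= g := n2_ge0 cg.
have C0 : 0 <= M1 * M2 / gap by rewrite divr_ge0 ?mulr_ge0 // ltW.
have Hn : n2 w <= (M1 * M2 / gap) ^+ 2 * g.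
  rewrite -[n2 w]sqr_sqrtr ?(ltW w0) // -[g]sqr_sqrtr // -exprMn.
  by rewrite ler_pXn2r ?nnegrE ?sqrtr_ge0 // mulr_ge0 // sqrtr_ge0.
have gp : 0 < g.
  move: gg0; rewrite le_eqVlt => /predU1P[g_0|//].
  by move: (lt_le_trans w0 Hn); rewrite -g_0 mulr0 ltxx.
have H1 := le_trans Hw Hn; rewrite ler_pM2r // in H1.
pose E := expR (eta / eps); have Ep : 0 < E by exact: expR_gt0.
have EE : expR (2 * tau / eps) = (E ^+ 2) ^+ 2.
  rewrite /E -!expRM_natl; congr expR; rewrite /eta; field; exact: lt0r_neq0.
rewrite EE ler_pXn2r ?nnegrE ?sqr_ge0 // ler_pdivlMr // in H1.
have H2 : gap * E < 1.
  have := le_lt_trans H1 MM; rewrite -/E expr2 -mulrA -[ltRHS]mulr1 ltr_pM2l //.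
  by rewrite mulrC.
have H3 : ka * eps ^+ 2 * (eta / eps / 3) ^+ 3 < 1.
  apply: le_lt_trans H2; apply: ler_pM => //.
  - by rewrite mulr_ge0 ?sqr_ge0 // ltW.
  - by rewrite exprn_ge0 // !divr_ge0 // ltW.
  - by apply: exp_cube_lb; rewrite divr_ge0 // ltW.
move: H3; rewrite (_ : ka * eps ^+ 2 * (eta / eps / 3) ^+ 3 = ka * (eta / 3) ^+ 3 / eps); last first.
  by field; exact: lt0r_neq0.
by rewrite ltr_pdivrMr // mul1r ltNge (ltW ek).
Qed.

Theorem theorem4 (R : realType) (q : R -> R) (G : set R[i]) (f : R[i] -> R[i])
    (hq : AM_ext q G f) :
  (forall (lam0 : R[i]) (gamma_plus gamma_minus Omega : set R[i]),
     critical_curve q G f 1 lam0 -> critical_curve q G f (-1) lam0 ->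
     connecting_part (critical_curve q G f 1) lam0 ((q 1)%:C)%C gamma_plus ->
     connecting_part (critical_curve q G f (-1)) lam0 ((q (-1))%:C)%C
       gamma_minus ->
     Omega = domain_bounded_by
       (gamma_plus `|` gamma_minus `|` real_segment (q (-1)) (q 1)) ->
     forall K : set R[i], compact K -> K `<=` Omega ->
     exists tau eps0 : R, [/\ 0 < tau, 0 < eps0 &
       forall (lam : R[i]) (eps : R), K lam -> 0 < eps < eps0 ->
         ((expR (tau / eps))%:E <= resolvent_norm q eps lam)%E])
  /\
  (exists eta eps1 : R, [/\ 0 < eta, 0 < eps1 &
     forall (eps : R) (z : nat -> R -> R[i]), 0 < eps < eps1 ->
       no_associated q eps -> normed_eigensystem q eps z ->
       ((expR (eta / eps))%:E <= riesz_constant z)%E]).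
Proof.
split; last exact: riesz_exponential hq.
move=> lam0 gp gm Omega _ _ hp hm -> K cK KO.
have ab := ltW (AM_nondegenerate hq).
apply: (resolvent_exponential hq cK); apply: (subset_trans KO).
apply: domain_in_strip; first by apply: connecting_in_strip hp; rewrite ab lexx.
by apply: connecting_in_strip hm; rewrite lexx ab.
Qed.
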